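(* Let $K_v$ be a local field of characteristic $p$ with finite residue field $\mathbb F_v$, let $A/K_v$ be an ordinary elliptic curve having supersingular reduction, and let $K'_{v'}/K_v$ be a ramified cyclic extension of degree $p$ with Galois group $G_v$. With $n_v,\lambda_v,\lambda_w,\natural_w,\flat_w,\epsilon,\underline{\mathrm b}_v,\overline{\mathrm b}_v$ as defined in the context, $$[\mathbb F_v:\mathbb F_p]\cdot\overline{\mathrm b}_v+\epsilon\ \ge\ \log_p|\mathrm H^1(G_v,A(K'_{v'}))|\ \ge\ [\mathbb F_v:\mathbb F_p]\cdot\underline{\mathrm b}_v .$$ We have $n_v\ge\underline{\mathrm b}_v\ge 0$. Moreover: (i) if $\flat_w=1$, then $\underline{\mathrm b}_v=n_v$; (ii) $\lambda_v=1$ if and only if $\overline{\mathrm b}_v=0$; (iii) if $\lambda_w\ge p\,\natural_w$, then $\overline{\mathrm b}_v=p\,n_v$.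
   Context: Supersingular reduction means good supersingular reduction. $A$ being ordinary means that the group $A_p(\bar K_v)$ of $p$-torsion geometric points has order $p$. $\mathcal O_v$ is the ring of integers of $K_v$; $\mathrm{ord}_v$ is the valuation on $\bar K_v$ with value $1$ on uniformizers of $K_v$. Let $A^{(p)}$ be the Frobenius twist of $A$ (base change along $x\mapsto x^p$), $A^{(p)}_p$ the kernel of multiplication by $p$ on $A^{(p)}$, and $\bar K_v^s$ a separable closure of $K_v$. The group $A_p^{(p)}(\bar K_v^s)$ has order $p$. Put $k_w:=K_v(A_p^{(p)}(\bar K_v^s))$ and $\Phi_w:=\mathrm{Gal}(k_w/K_v)$; the Galois action gives an embedding $c_w:\Phi_w\to\mathrm{Aut}(A_p^{(p)}(\bar K_v^s))\simeq\mathbb F_p^*$, so $k_w/K_v$ is cyclic of degree dividing $p-1$. Let $e_w$ be the ramification index of $k_w/K_v$, let $\mathrm{ord}_w$ be the valuation on $\bar K_v$ with value $1$ on uniformizers of $k_w$, and put $k'_{w'}:=k_wK'_{v'}$. Put $f_v:=\frac1{p-1}\mathrm{ord}_v\mathrm{Disc}(K'_{v'}/K_v)$, $f_w:=\frac1{p-1}\mathrm{ord}_w\mathrm{Disc}(k'_{w'}/k_w)$ (integers $\ge 2$), $\lambda_v:=f_v-1$, $\lambda_w:=f_w-1$ (one has $\lambda_w=e_w\lambda_v$). Choose a minimal Weierstrass equation for $A/K_v$ and let $P=(a,b)$ be a non-zero point of $A_p(\bar K_v)$. Put $n_v:=p(p-1)\,\mathrm{ord}_v(a/b)$ and $n_w:=e_wn_v=p(p-1)\,\mathrm{ord}_w(a/b)$;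 these are positive integers, and $p-1$ divides $n_w$. Put $\natural_w:=\frac{p\,n_w}{p-1}$ (an integer), and $$\flat_w:=\begin{cases}\lceil\natural_w-\frac{(p-1)\lambda_w}{p}\rceil,&\text{if }\lambda_w<\frac{p(\natural_w-1)}{p-1};\\ 1,&\text{otherwise,}\end{cases}\qquad \sharp_w:=\begin{cases}\lceil\natural_w+\frac{(p-1)\lambda_w}{p}\rceil,&\text{if }\lambda_w<p\natural_w;\\ p\natural_w,&\text{otherwise.}\end{cases}$$ For a natural number $m$ put $\varphi_m:=\left\lfloor\frac{m-\lceil m/p\rceil}{e_w}\right\rfloor$, $\psi_m:=\lceil m/p\rceil+\varphi_me_w\ (\le m)$, and let $\diamondsuit_m\in\{0,1\}$ be the number of integers in the interval $[\psi_m,m)$ that are congruent to $\frac{n_w}{p-1}$ modulo $e_w$. Put $\epsilon:=1$ if $\lambda_w\ge p\natural_w$ and $c_w$ is trivial (that is, $k_w=K_v$), and $\epsilon:=0$ otherwise. Finally $$\underline{\mathrm b}_v:=\varphi_{\natural_w}+\diamondsuit_{\natural_w}-\varphi_{\flat_w}-\diamondsuit_{\flat_w},\qquad \overline{\mathrm b}_v:=\varphi_{\sharp_w}+\diamondsuit_{\sharp_w}-\varphi_{\flat_w}-\diamondsuit_{\flat_w}.$$ *)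

(* Defs.v *)
From HB Require Import structures.
From mathcomp Require Import all_boot all_order all_algebra all_fingroup all_solvable all_field.
From mathcomp Require Import finmap.
From mathcomp Require Import all_classical all_reals all_analysis.
Set Implicit Arguments.
Unset Strict Implicit.
Unset Printing Implicit Defensive.
Import Order.TTheory GRing.Theory Num.Theory.

Local Open Scope classical_set_scope.
Local Open Scope ring_scope.

(** * Valuations and local fields *)

(* The value at 0, which should be +oo, is left unconstrained: every statement
   about v x below is guarded by x != 0. *)
Definition valuation (R : realDomainType) (F : fieldType) (v : F -> R) : Prop :=
  (forall x y, x != 0 -> y != 0 -> v (x * y) = v x + v y) /\
  (forall x y, x != 0 -> y != 0 -> x + y != 0 ->
     Num.min (v x) (v y) <= v (x + y)).

Definition integral_at (R : realDomainType) (F : fieldType) (v : F -> R)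
  (x : F) : Prop := x = 0 \/ 0 <= v x.

Definition close_at (F : fieldType) (v : F -> int) (N : int) (x y : F) : Prop :=
  x = y \/ N <= v (x - y).

Definition complete_at (F : fieldType) (v : F -> int) : Prop :=
  forall u : nat -> F,
    (forall N, exists n0, forall m n, (n0 <= m)%N -> (n0 <= n)%N ->
       close_at v N (u m) (u n)) ->
    exists l, forall N, exists n0, forall n, (n0 <= n)%N ->
       close_at v N (u n) l.

(* Local fields of characteristic p with finite residue field. The reduction
   map lf_red is only meaningful on the valuation ring. *)
Record localField (p : nat) := LocalField {
  lf_sort :> fieldType;
  lf_pchar : p \in [pchar lf_sort];
  lf_ord : lf_sort -> int;
  lf_valuation : valuation lf_ord;
  lf_normalized : exists2 x, x != 0 & lf_ord x = 1;
  lf_complete : complete_at lf_ord;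
  lf_res : finFieldType;
  lf_red : lf_sort -> lf_res;
  lf_red1 : lf_red 1 = 1;
  lf_redD : forall x y, integral_at lf_ord x -> integral_at lf_ord y ->
    lf_red (x + y) = lf_red x + lf_red y;
  lf_redM : forall x y, integral_at lf_ord x -> integral_at lf_ord y ->
    lf_red (x * y) = lf_red x * lf_red y;
  lf_red_ker : forall x, integral_at lf_ord x ->
    (lf_red x = 0 <-> x = 0 \/ 0 < lf_ord x);
  lf_red_surj : forall z, exists2 x, integral_at lf_ord x & lf_red x = z
}.

Lemma lf_res_pchar p (K : localField p) : p \in [pchar lf_res K].
Proof.
have [p_pr /eqP p0] := andP (lf_pchar K).
have ord1 : lf_ord (1 : K) = 0.
  have [vM _] := lf_valuation K.
  have := vM 1 1 (oner_neq0 _) (oner_neq0 _).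
  by rewrite mulr1 -{1}[lf_ord 1]addr0 => /addrI.
have int1 : integral_at (@lf_ord p K) 1 by right; rewrite ord1.
have ordn (n : nat) : integral_at (@lf_ord p K) n%:R /\
    lf_red (n%:R : K) = n%:R.
  elim: n => [|n [In IHn]].
    split; first by left.
    by apply/(lf_red_ker (or_introl erefl)); left.
  rewrite -[in (n.+1)%:R]addn1 natrD; split; last first.
    by rewrite lf_redD // IHn lf_red1 -[in RHS]addn1 natrD.
  case: (eqVneq (n%:R + 1 : K) 0) => [->|nz]; first by left.
  case: (eqVneq (n%:R : K) 0) => [->|nz']; first by rewrite add0r.
  right; have [_ vD] := lf_valuation K.
  apply: le_trans (vD _ _ nz' (oner_neq0 _) nz).
  rewrite le_min ord1 lexx andbT; case: In => // n0.
  by rewrite n0 eqxx in nz'.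
rewrite inE p_pr -(ordn p).2 p0; apply/eqP.
by apply/(lf_red_ker (or_introl erefl)); left.
Qed.

(* [F_v : F_p] *)
Definition resdeg p (K : localField p) : nat :=
  \dim {:pPrimeCharType (lf_res_pchar K)}.

Definition alg_closure (F : fieldType) (Om : closedFieldType)
  (i : {rmorphism F -> Om}) : Prop := forall x, algebraicOver i x.

Definition separable_over (F Om : fieldType) (i : {rmorphism F -> Om})
  (x : Om) : Prop :=
  exists2 q : {poly F}, separable_poly q & root (map_poly i q) x.

(** * Subfields of a valued field, ramification, discriminants *)

Section Subfields.
Variables (Om : fieldType) (v : Om -> rat).
Implicit Types M N S : set Om.

Definition is_subfield M : Prop := GRing.divring_closed (mem M).

Definition subfield_gen S : set Om := smallest is_subfield S.

Definition int_ring M : set Om := [set x | M x /\ integral_at v x].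

Definition uniformizers M : set Om :=
  [set t | [/\ M t, t != 0, 0 < v t &
            forall x, M x -> x != 0 -> 0 < v x -> v t <= v x]].

(* The rescaling of v taking the value 1 on the uniformizers of M, for M
   discretely valued. *)
Definition ord_at M (x : Om) : rat := v x / v (xget 0 (uniformizers M)).

(* The ramification index of N / M, where M is a subfield of N. *)
Definition ram_index N M : nat :=
  Num.truncn (ord_at N (xget 0 (uniformizers M))).

Definition integral_basis N M (n : nat) (b : 'I_n -> Om) : Prop :=
  (forall k, int_ring N (b k)) /\
  forall x, int_ring N x ->
    exists! c : 'rV[Om]_n,
      (forall k, int_ring M (c 0 k)) /\ x = \sum_k c 0 k * b k.

(* d = det (Tr_{N/M} (b_i b_j)) for some O_M-basis b of O_N; C i j is the
   matrix, in the basis b, of multiplication by b_i b_j. *)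
Definition discriminants N M : set Om :=
  [set d | exists (n : nat) (b : 'I_n -> Om) (C : 'I_n -> 'I_n -> 'M[Om]_n),
    [/\ integral_basis N M b,
        forall i j k l, M (C i j k l),
        forall i j k, b i * b j * b k = \sum_l C i j k l * b l &
        d = \det (\matrix_(i, j) \tr (C i j))]].

(* ord_M Disc (N / M); the generator of the discriminant ideal is determined
   up to the square of a unit. *)
Definition ord_disc N M : rat := ord_at M (xget 0 (discriminants N M)).

End Subfields.

(** * Weierstrass equations *)

Record weierstrass (F : Type) :=
  Weierstrass { wa1 : F; wa2 : F; wa3 : F; wa4 : F; wa6 : F }.

Definition mapW (F F' : Type) (f : F -> F') (W : weierstrass F) :=
  Weierstrass (f (wa1 W)) (f (wa2 W)) (f (wa3 W)) (f (wa4 W)) (f (wa6 W)).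

Section Weierstrass.
Variable F : fieldType.
Implicit Types W : weierstrass F.

Definition discW W : F :=
  let: Weierstrass a1 a2 a3 a4 a6 := W in
  let b2 := a1 ^+ 2 + 4%:R * a2 in
  let b4 := 2%:R * a4 + a1 * a3 in
  let b6 := a3 ^+ 2 + 4%:R * a6 in
  let b8 := a1 ^+ 2 * a6 + 4%:R * a2 * a6 - a1 * a3 * a4
            + a2 * a3 ^+ 2 - a4 ^+ 2 in
  - (b2 ^+ 2 * b8) - 8%:R * b4 ^+ 3 - 27%:R * b6 ^+ 2
  + 9%:R * b2 * b4 * b6.

(* W' is obtained from W by x = u^2 x' + r, y = u^3 y' + u^2 s x' + t. *)
Definition isoW W W' : Prop :=
  let: Weierstrass a1 a2 a3 a4 a6 := W in
  exists u r s t : F, u != 0 /\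
  [/\ u * wa1 W' = a1 + 2%:R * s,
      u ^+ 2 * wa2 W' = a2 - s * a1 + 3%:R * r - s ^+ 2,
      u ^+ 3 * wa3 W' = a3 + r * a1 + 2%:R * t,
      u ^+ 4 * wa4 W' = a4 - s * a3 + 2%:R * r * a2 - (t + r * s) * a1
                        + 3%:R * r ^+ 2 - 2%:R * s * t &
      u ^+ 6 * wa6 W' = a6 + r * a4 + r ^+ 2 * a2 + r ^+ 3 - t * a3
                        - t ^+ 2 - r * t * a1].

(* None is the point at infinity. *)
Definition point := option (F * F).

Definition on_curve W (P : point) : Prop :=
  if P is Some (x, y) then
    y ^+ 2 + wa1 W * x * y + wa3 W * y
    = x ^+ 3 + wa2 W * x ^+ 2 + wa4 W * x + wa6 W
  else True.

Definition oppP W (P : point) : point :=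
  if P is Some (x, y) then Some (x, - y - wa1 W * x - wa3 W) else None.

(* The chord-and-tangent law, valid in every characteristic; the line through
   the two points is y = l x + n. *)
Definition addP W (P Q : point) : point :=
  match P, Q with
  | None, _ => Q
  | _, None => P
  | Some (x1, y1), Some (x2, y2) =>
    let: Weierstrass a1 a2 a3 a4 a6 := W in
    if (x1 == x2) && (y1 + y2 + a1 * x2 + a3 == 0) then None else
    let den := 2%:R * y1 + a1 * x1 + a3 in
    let l := if x1 != x2 then (y2 - y1) / (x2 - x1)
             else (3%:R * x1 ^+ 2 + 2%:R * a2 * x1 + a4 - a1 * y1) / den in
    let n := if x1 != x2 then (y1 * x2 - y2 * x1) / (x2 - x1)
             else (- x1 ^+ 3 + a4 * x1 + 2%:R * a6 - a3 * y1) / den in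
    let x3 := l ^+ 2 + a1 * l - a2 - x1 - x2 in
    Some (x3, - (l + a1) * x3 - n - a3)
  end.

Definition mulP W (n : nat) (P : point) : point := iter n (addP W P) None.

Definition torsion W (n : nat) : set point :=
  [set P | on_curve W P /\ mulP W n P = None].

Definition elliptic W : Prop := discW W != 0.

End Weierstrass.

Definition mapP (F F' : fieldType) (f : F -> F') (P : point F) : point F' :=
  if P is Some (x, y) then Some (f x, f y) else None.

Section Reduction.
Variables (p : nat) (K : localField p).
Implicit Types A W : weierstrass K.

Definition integralW W : Prop :=
  let O := integral_at (@lf_ord p K) in
  [/\ O (wa1 W), O (wa2 W), O (wa3 W), O (wa4 W) & O (wa6 W)].

Definition minimal_equation A W : Prop :=
  [/\ isoW A W, integralW W &
      forall W', isoW A W' -> integralW W' ->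
        lf_ord (discW W) <= lf_ord (discW W')].

Definition supersingular (k : fieldType) (E : weierstrass k) : Prop :=
  forall (kbar : closedFieldType) (i : {rmorphism k -> kbar}),
    alg_closure i -> torsion (mapW i E) p = [set None].

(* Good supersingular reduction, read off a minimal equation W of A. *)
Definition supersingular_reduction A : Prop :=
  exists W, [/\ minimal_equation A W, elliptic (mapW (@lf_red p K) W) &
                supersingular (mapW (@lf_red p K) W)].

End Reduction.

Definition ordinary (p : nat) (F : fieldType) (Om : closedFieldType)
  (i : {rmorphism F -> Om}) (A : weierstrass F) : Prop :=
  (torsion (mapW i A) p #= `I_p)%card.

(** * Group cohomology: H^1(Gal(L/K), A(L)) *)

Section H1.
Variables (K : fieldType) (L : splittingFieldType K) (A : weierstrass K).

Let AL : weierstrass L := mapW (in_alg L) A.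
Let G := 'Gal({:L} / 1)%g.

(* The product x * y of gal_of is "x, then y". *)
Definition cocycle (f : gal_of {:L} -> point L) : Prop :=
  (forall x, x \in G -> on_curve AL (f x)) /\
  (forall x y, x \in G -> y \in G ->
     f (x * y)%g = addP AL (f y) (mapP y (f x))).

Definition cohomologous (f g : gal_of {:L} -> point L) : Prop :=
  exists P, on_curve AL P /\
    forall x, x \in G ->
      g x = addP AL (f x) (addP AL (mapP x P) (oppP AL P)).

(* H^1 as the set of cohomology classes of cocycles. *)
Definition H1 : set (set (gal_of {:L} -> point L)) :=
  [set c | exists2 f, cocycle f & c = [set g | cocycle g /\ cohomologous f g]].

End H1.

Arguments H1 {K} L A _.

Definition logb (R : realType) (b x : R) : R := ln x / ln b.

(** * The fields attached to A and the numerical invariants *)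

(* k_w, the field generated over K by the coordinates of the p-torsion points
   of the Frobenius twist of A that are defined over the separable closure. *)
Definition twist_torsion_field (p : nat) (K Om : fieldType)
  (iota : {rmorphism K -> Om}) (A : weierstrass K) : set Om :=
  let Ap := mapW iota (mapW (fun x => x ^+ p) A) in
  subfield_gen (range iota `|`
    [set z | exists x y, [/\ torsion Ap p (Some (x, y)),
               separable_over iota x, separable_over iota y &
               z = x \/ z = y]]).

Section Invariants.
Variables (p e : nat).

Definition ceilp (m : nat) : nat := `|Num.ceil (m%:R / p%:R : rat)|%N.

Definition phi (m : nat) : nat := ((m - ceilp m) %/ e)%N.

Definition psi (m : nat) : nat := (ceilp m + phi m * e)%N.

(* The number of i in [psi m, m) with i = c mod e. *)
Definition diamond (c m : nat) : nat :=
  count (fun i => i == c %[mod e])%N (index_iota (psi m) m).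

(* In flat and sharp, nat_w stands for the natural sign and lam for
   lambda_w. *)
Definition flat (nat_w : nat) (lam : rat) : nat :=
  if lam < p%:R * (nat_w%:R - 1) / (p%:R - 1)
  then `|Num.ceil (nat_w%:R - (p%:R - 1) * lam / p%:R)|%N
  else 1%N.

Definition sharp (nat_w : nat) (lam : rat) : nat :=
  if lam < p%:R * nat_w%:R
  then `|Num.ceil (nat_w%:R + (p%:R - 1) * lam / p%:R)|%N
  else (p * nat_w)%N.

End Invariants.

(* Main.v *)
(* Let M be the kernel of reduction in A(L), filtered by the level of z = -x/y,
   let s generate G, and let lam be the ramification break of L/K. As [p] is
   injective on A(L)/M, H^1(G, A(L)) is (ker N)/(s - 1)M, which has the order of
   M^s / N M (Herbrand quotient 1). Here N = D^(p-1) + p Q with D = s - 1 and Q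
   invertible; D adds lam to a level prime to p, and p sends level i to p^2 i if
   (p-1) i < n and to p (i + n) if (p-1) i > n, since all the p-torsion has the
   same level. Comparing the two terms shows which graded pieces of M^s consist
   of norms; for p = 2 and n = 1 they may tie, whence epsilon. *)
Require Import Defs.
From HB Require Import structures.
From mathcomp Require Import all_boot all_order all_algebra all_fingroup all_solvable all_field.
From mathcomp Require Import finmap.
From mathcomp Require Import all_classical all_reals all_analysis.
From mathcomp Require Import ring lra zify.
Set Implicit Arguments.
Unset Strict Implicit.
Unset Printing Implicit Defensive.
Import Order.TTheory GRing.Theory Num.Theory.
Local Open Scope classical_set_scope.
Local Open Scope ring_scope.

(** Two comparisons frame the argument. The theorem counts over k_w, whereas the filtration lives
    over K_v. As p = 1 modulo e_w, the substitutions i = N - e_w k and i = N + e_w k, with N the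
    natural sign, turn the counts below and above N into counts of levels k of K_v, the sets [low]
    and [mid]. Moreover the upper bound does not hold level by level: a level below lam that is not
    known to consist of norms need not lie in [low] or [mid], so an injection with a few spare
    elements compares the cardinalities. The behaviour of [p] comes from division polynomials alone.
    Supersingularity makes the denominator of [p] reduce to a non-zero constant, ordinariness makes
    its roots the abscissas of one cyclic group, and their multiplicities determine its degree. The
    formal group is replaced by one identity: in the kernel of reduction x(P - Q) has valuation -2
    v(z(P) - z(Q)), so that z transports the filtration of L although it is not additive. Levels are
    in units of 1/p of ord_v; fixed points only occupy multiples of p. *)

Local Notation cpoint := Defs.point.
Local Notation cmap := Defs.mapP.

(** * The group law *)

Section CoordinateRing.
Variables (F : fieldType) (W : weierstrass F).
Local Notation a1 := (wa1 W). Local Notation a2 := (wa2 W).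
Local Notation a3 := (wa3 W). Local Notation a4 := (wa4 W).
Local Notation a6 := (wa6 W).

(* The affine coordinate ring of W, with p + q y represented by (p, q). *)
Definition coord_ring of weierstrass F := ({poly F} * {poly F})%type.
Local Notation R := (coord_ring W).

HB.instance Definition _ := GRing.Zmodule.on R.

Definition cubicW : {poly F} := 'X^3 + a2 *: 'X^2 + a4 *: 'X + a6%:P.
Definition linW : {poly F} := a1 *: 'X + a3%:P.
Definition cr_one : R := (1, 0).
Definition cr_mul (f g : R) : R :=
  (f.1 * g.1 + f.2 * g.2 * cubicW, f.1 * g.2 + f.2 * g.1 - f.2 * g.2 * linW).

Fact cr_mulA : associative cr_mul.
Proof. by move=> [a b] [c d] [e f]; congr pair => /=; ring. Qed.
Fact cr_mulC : commutative cr_mul.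
Proof. by move=> [a b] [c d]; congr pair => /=; ring. Qed.
Fact cr_mul1 : left_id cr_one cr_mul.
Proof. by move=> [a b]; congr pair => /=; ring. Qed.
Fact cr_mulDl : left_distributive cr_mul +%R.
Proof. by move=> [a b] [c d] [e f]; congr pair => /=; ring. Qed.
Fact cr_one_neq0 : cr_one != 0.
Proof. by apply/eqP => -[] /eqP; rewrite oner_eq0. Qed.

HB.instance Definition _ := GRing.Zmodule_isComNzRing.Build R
  cr_mulA cr_mulC cr_mul1 cr_mulDl cr_one_neq0.

Definition cr_poly (p : {poly F}) : R := (p, 0).
Fact cr_poly_additive : zmod_morphism cr_poly.
Proof. by move=> p q; rewrite /cr_poly; congr pair; rewrite subr0. Qed.
Fact cr_poly_multiplicative : monoid_morphism cr_poly.
Proof.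
split=> // p q; rewrite /cr_poly; congr pair => /=; ring.
Qed.
HB.instance Definition _ := GRing.isZmodMorphism.Build {poly F} R cr_poly
  cr_poly_additive.
HB.instance Definition _ := GRing.isMonoidMorphism.Build {poly F} R cr_poly
  cr_poly_multiplicative.

Definition cst (c : F) : R := cr_poly c%:P.
HB.instance Definition _ := GRing.RMorphism.copy cst (cr_poly \o polyC).
Definition crX : R := cr_poly 'X.
Definition crY : R := (0, 1).
Lemma crP (f : R) : f = cr_poly f.1 + cr_poly f.2 * crY.
Proof.
case: f => p q /=; congr pair => /=; ring.
Qed.

Lemma crYE : crY ^+ 2 = - (cst a1 * crX + cst a3) * crY + crX ^+ 3
  + cst a2 * crX ^+ 2 + cst a4 * crX + cst a6.
Proof.
rewrite /cst /crX -!rmorphXn -!rmorphM -!rmorphD -!rmorphN /=.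
rewrite [RHS]crP expr2.
congr pair => /=; rewrite /cubicW /linW -!mul_polyC; ring.
Qed.

Definition cr_norm (f : R) : {poly F} :=
  f.1 ^+ 2 - f.1 * f.2 * linW - f.2 ^+ 2 * cubicW.
Lemma cr_normM f g : cr_norm (f * g) = cr_norm f * cr_norm g.
Proof. by case: f g => a b [c d]; rewrite /cr_norm /=; ring. Qed.

Lemma size_cubicW : size cubicW = 4.
Proof.
rewrite /cubicW -!addrA size_polyDl size_polyXn //.
rewrite -!mul_polyC (leq_ltn_trans (size_polyD _ _)) // gtn_max.
rewrite (leq_ltn_trans (size_polyMleq _ _)) ?size_polyXn ?size_polyC //=; last by case: eqP.
rewrite (leq_ltn_trans (size_polyD _ _)) // gtn_max.
rewrite (leq_ltn_trans (size_polyMleq _ _)) ?size_polyX ?size_polyC //=; by do ?case: eqP.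
Qed.

Lemma size_linW : (size linW <= 2)%N.
Proof.
rewrite /linW -!mul_polyC (leq_trans (size_polyD _ _)) // geq_max.
rewrite (leq_trans (size_polyMleq _ _)) ?size_polyX ?size_polyC //=; by do ?case: eqP.
Qed.
Lemma size_sqr (a : {poly F}) : size (a ^+ 2) = (size a).*2.-1.
Proof.
have [-> | a0] := eqVneq a 0; first by rewrite expr0n size_poly0.
by rewrite expr2 size_mul // addnn.
Qed.

(** The degrees of a^2 and of b^2 times the cubic have opposite parities, so their leading terms
    cannot cancel, and the cross term has smaller degree than the larger of the two. The degree of
    the norm is the order of the pole at infinity; it is never 1. *)
Lemma size_cr_norm f : size (cr_norm f) =
  maxn (size f.1).*2.-1 (if f.2 == 0%R then 0 else (size f.2).*2.+2)%N.
Proof.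
case: f => a b; rewrite /cr_norm /=.
have [-> | b0] := eqVneq b 0.
  by rewrite mulr0 mul0r expr0n mul0r !subr0 maxn0 size_sqr.
have bs : (0 < size b)%N by rewrite lt0n size_poly_eq0.
have sb : size (b ^+ 2 * cubicW) = (size b).*2.+2.
  rewrite size_Mmonic ?expf_neq0 //; last first.
    rewrite monicE /lead_coef size_cubicW /cubicW /=.
    by rewrite !(coefE, coefZ) /= !mulr0 !addr0.
  by rewrite size_cubicW size_sqr; lia.
have [-> | a0] := eqVneq a 0.
  by rewrite expr0n !mul0r subr0 sub0r size_polyN sb size_poly0 max0n.
have as_ : (0 < size a)%N by rewrite lt0n size_poly_eq0.
have sa := size_sqr a.
have sab : (size (a * b * linW)%R <= (size a) + (size b))%N.
  rewrite (leq_trans (size_polyMleq _ _)) // size_mul //.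
  move: as_ bs (size_linW).
 set x := size a; set y := size b; set z := size linW. lia.
have [h|h] := leqP (size a).*2.-1 (size b).*2.+2.
  rewrite [_ - b ^+ 2 * _]addrC size_polyDl size_polyN sb //.
  rewrite (leq_ltn_trans (size_polyD _ _)) // size_polyN gtn_max sa.
  by rewrite (leq_ltn_trans sab); lia.
rewrite -addrA size_polyDl ?sa //.
rewrite (leq_ltn_trans (size_polyD _ _)) // !size_polyN gtn_max sb h andbT.
by rewrite (leq_ltn_trans sab); lia.
Qed.

Lemma cr_norm_eq0 f : cr_norm f = 0 -> f = 0.
Proof.
move=> /(congr1 (size \o @polyseq F)) /=; rewrite size_cr_norm size_poly0.
case: f => a b /=; case: eqP => [->|b0] h; last by move: h; lia.
congr pair; apply/eqP; rewrite -size_poly_eq0; move: h.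
by rewrite maxn0; case: (size a) => // n; rewrite doubleS.
Qed.

Lemma cr_mulf_eq0 (f g : R) : f * g = 0 -> f = 0 \/ g = 0.
Proof.
move=> fg; have := cr_normM f g; rewrite fg.
have -> : cr_norm 0 = 0 by rewrite /cr_norm /=; ring.
by move/esym/eqP; rewrite mulf_eq0 => /orP[] /eqP /cr_norm_eq0; [left|right].
Qed.

Lemma cr_mulI (f g h : R) : f != 0 -> f * g = f * h -> g = h.
Proof.
move=> f0 /eqP; rewrite -subr_eq0 -mulrBr => /eqP /cr_mulf_eq0[/eqP|/eqP].
  by rewrite (negPf f0).
by rewrite subr_eq0 => /eqP.
Qed.
End CoordinateRing.

(** * Finitely generated ideals up to proportionality *)

Section Ideals.
Variable R : comNzRingType.
Implicit Types (l m n : seq R) (f g : R).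

Fixpoint idl l f : Prop :=
  if l is a :: l' then exists c, idl l' (f - c * a) else f = 0.

Lemma idl0 l : idl l 0.
Proof. by elim: l => //= a l IH; exists 0; rewrite mul0r subr0. Qed.
Lemma idlD l f g : idl l f -> idl l g -> idl l (f + g).
Proof.
elim: l f g => /= [f g -> ->|a l IH f g [c hc] [d hd]]; first by rewrite addr0.
by exists (c + d); rewrite mulrDl opprD addrACA; apply: IH.
Qed.
Lemma idlM l c f : idl l f -> idl l (c * f).
Proof.
elim: l f => /= [f ->|a l IH f [d hd]]; first by rewrite mulr0.
by exists (c * d); rewrite -mulrA -mulrBr; apply: IH.
Qed.

Lemma idl_mem l a : a \in l -> idl l a.
Proof.
elim: l => //= b l IH; rewrite in_cons; case/orP=> [/eqP ->|/IH h].
  by exists 1; rewrite mul1r subrr; apply: idl0.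
by exists 0; rewrite mul0r subr0.
Qed.

Record isub l m : Prop := ISub { isubP : forall x, x \in l -> idl m x }.

Lemma idl_sub l m f : isub l m -> idl l f -> idl m f.
Proof.
case=> h; elim: l f h => /= [f _ ->|a l IH f h [c hc]]; first exact: idl0.
have -> : f = (f - c * a) + c * a by rewrite subrK.
apply: idlD; first by apply: IH => // x xl; apply: h; rewrite in_cons xl orbT.
by apply/idlM/h; rewrite mem_head.
Qed.

Lemma isub_trans l m n : isub l m -> isub m n -> isub l n.
Proof. by move=> [lm] mn; split=> x /lm; apply: idl_sub. Qed.
Lemma isub_eqi l m : l =i m -> isub l m.
Proof. by move=> e; split=> x; rewrite e; apply: idl_mem. Qed.
Definition scal a l := [seq a * x | x <- l].
Definition iprod l m := [seq x * y | x <- l, y <- m].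
Lemma idl_scal a l f : idl l f -> idl (scal a l) (a * f).
Proof.
elim: l f => /= [f ->|b l IH f [c hc]]; first by rewrite mulr0.
by exists c; rewrite mulrCA -mulrBr; apply: IH.
Qed.
Lemma isub_scal a l m : isub l m -> isub (scal a l) (scal a m).
Proof. by move=> [lm]; split=> _ /mapP[x xl ->]; apply: idl_scal; apply: lm. Qed.

Lemma isub_prodl l l' m : isub l l' -> isub (iprod l m) (iprod l' m).
Proof.
move=> [ll']; split=> _ /allpairsP[[x y] /= [xl ym ->]].
have := idl_scal y (ll' _ xl); rewrite mulrC; apply: idl_sub.
split=> _ /mapP[z zl ->]; apply: idl_mem; rewrite mulrC.
by apply/allpairsP; exists (z, y).
Qed.

Lemma iprodC l m : iprod l m =i iprod m l.
Proof.
by move=> x; apply/allpairsP/allpairsP=> -[[a b] /= [? ? ->]]; exists (b, a);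
  rewrite mulrC.
Qed.

Lemma iprodA l m n : iprod l (iprod m n) =i iprod (iprod l m) n.
Proof.
move=> x; apply/allpairsP/allpairsP=> -[[a b] /= []].
  move=> al /allpairsP[[c d] /= [cm dn ->]] ->; exists (a * c, d) => /=.
  by rewrite mulrA; split=> //; apply/allpairsP; exists (a, c).
move=> /allpairsP[[c d] /= [cm dn ->]] bn ->; exists (c, d * b) => /=.
by rewrite mulrA; split=> //; apply/allpairsP; exists (d, b).
Qed.

Lemma scal_iprod a l m : scal a (iprod l m) =i iprod (scal a l) m.
Proof.
move=> x; apply/mapP/allpairsP.
  move=> [_ /allpairsP[[c d] /= [cl dm ->]] ->]; exists (a * c, d).
  by rewrite mulrA; split=> //; apply: map_f.
move=> [[c d] /= [/mapP[e el ->] dm ->]]; exists (e * d); last by rewrite mulrA.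
by apply/allpairsP; exists (e, d).
Qed.

Lemma scalM a b l : scal a (scal b l) = scal (a * b) l.
Proof. by rewrite /scal -map_comp; apply: eq_map => x /=; rewrite mulrA. Qed.

(* The ideals generated by l and m are proportional. *)
Definition iequ l m := exists a b, [/\ a != 0, b != 0,
  isub (scal a l) (scal b m) & isub (scal b m) (scal a l)].

Lemma iequ_sym l m : iequ l m -> iequ m l.
Proof. by move=> [a [b [? ? ? ?]]]; exists b, a. Qed.
Lemma iequ_eqi l m : l =i m -> iequ l m.
Proof.
move=> e; exists 1, 1; rewrite oner_neq0; split=> //; apply: isub_scal;
  exact: isub_eqi.
Qed.

Hypothesis dom : forall x y : R, x * y = 0 -> x = 0 \/ y = 0.

Lemma iequ_trans l m n : iequ l m -> iequ m n -> iequ l n.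
Proof.
move=> [a [b [a0 b0 h1 h2]]] [c [d [c0 d0 h3 h4]]].
have nz (x y : R) : x != 0 -> y != 0 -> x * y != 0.
  by move=> x0 y0; apply/eqP => /dom[]/eqP; apply/negP.
exists (c * a), (b * d); split; rewrite ?nz // -!scalM.
  refine (isub_trans (isub_scal _ h1) _).
  by rewrite scalM mulrC -scalM; apply: isub_scal.
refine (isub_trans (isub_scal _ h4) _).
by rewrite scalM mulrC -scalM; apply: isub_scal.
Qed.

Lemma iequ_prodl l l' m : iequ l l' -> iequ (iprod l m) (iprod l' m).
Proof.
move=> [a [b [a0 b0 h1 h2]]]; exists a, b; split=> //.
  refine (isub_trans (isub_eqi (scal_iprod _ _ _)) _).
  refine (isub_trans (isub_prodl _ h1) _); apply: isub_eqi => x.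
  by rewrite scal_iprod.
refine (isub_trans (isub_eqi (scal_iprod _ _ _)) _).
refine (isub_trans (isub_prodl _ h2) _); apply: isub_eqi => x.
by rewrite scal_iprod.
Qed.

Lemma iequ_prodr l m m' : iequ m m' -> iequ (iprod l m) (iprod l m').
Proof.
move=> h; apply: iequ_trans (iequ_eqi (iprodC _ _)) _.
by apply: iequ_trans (iequ_prodl _ h) (iequ_eqi (iprodC _ _)).
Qed.
Lemma iprod1 l : iprod [:: 1] l = l.
Proof. by rewrite /iprod /= cats0 -[RHS]map_id; apply: eq_map => x; rewrite mul1r. Qed.
End Ideals.

(** * The chord-and-tangent construction *)

Section AdditionFormula.
Variable F : fieldType.
Implicit Types W : weierstrass F.

Lemma eq_or_opp W x y y' :
  on_curve W (Some (x, y)) -> on_curve W (Some (x, y')) ->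
  y = y' \/ y + y' + wa1 W * x + wa3 W = 0.
Proof.
move=> /= h h'.
have : (y - y') * (y + y' + wa1 W * x + wa3 W) = 0.
  have -> : (y - y') * (y + y' + wa1 W * x + wa3 W) =
    (y ^+ 2 + wa1 W * x * y + wa3 W * y) -
    (y' ^+ 2 + wa1 W * x * y' + wa3 W * y') by ring.
  by rewrite h h' subrr.
by move/eqP; rewrite mulf_eq0 subr_eq0 => /orP[]/eqP; [left|right].
Qed.

(* The line y = l x + n meets the curve in P, Q and -(P + Q): the third root of
   x^3 + a2 x^2 + a4 x + a6 - (l x + n) ((l + a1) x + n + a3) is x(P + Q). *)
Definition collinear W l n (x1 x2 x3 : F) :=
  [/\ l ^+ 2 + wa1 W * l - wa2 W = x1 + x2 + x3,
      wa4 W - 2%:R * l * n - wa1 W * n - wa3 W * l = x1 * x2 + x1 * x3 + x2 * x3 &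
      n ^+ 2 + wa3 W * n - wa6 W = x1 * x2 * x3].

(** Chords and tangents provide the same data, a line and three abscissas subject to the Vieta
    relations [collinear], so most later arguments need no case distinction. The final disjunction
    keeps the formula for the slope for those that do. *)
Lemma addP_line W x1 y1 x2 y2 :
  on_curve W (Some (x1, y1)) -> on_curve W (Some (x2, y2)) ->
  ~~ ((x1 == x2) && (y1 + y2 + wa1 W * x2 + wa3 W == 0)) ->
  exists l n x3,
    [/\ addP W (Some (x1, y1)) (Some (x2, y2)) =
          Some (x3, - (l + wa1 W) * x3 - n - wa3 W),
        y1 = l * x1 + n /\ y2 = l * x2 + n,
        collinear W l n x1 x2 x3 &
        (x1 != x2 /\ l = (y2 - y1) / (x2 - x1)) \/
        [/\ x1 = x2, y1 = y2, 2%:R * y1 + wa1 W * x1 + wa3 W != 0 &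
            l * (2%:R * y1 + wa1 W * x1 + wa3 W) =
            3%:R * x1 ^+ 2 + 2%:R * wa2 W * x1 + wa4 W - wa1 W * y1]].
Proof.
move=> h1 h2 hno; have := eq_or_opp (x := x1) (y := y1) (y' := y2) h1.
case: W h1 h2 hno => a1 a2 a3 a4 a6 /= h1 h2 hno heq.
rewrite (negPf hno).
have [ex|nx] := eqVneq x1 x2; last first.
  have d0 : x2 - x1 != 0 by rewrite subr_eq0 eq_sym.
  set l := (y2 - y1) / (x2 - x1); set n := (y1 * x2 - y2 * x1) / (x2 - x1).
  have e1 : y1 = l * x1 + n by rewrite /l /n; field.
  have e2 : y2 = l * x2 + n by rewrite /l /n; field.
  exists l, n, (l ^+ 2 + a1 * l - a2 - x1 - x2); split=> //; last by left.
  set x3 := (_ - x2); split=> /=; first by rewrite /x3; ring.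
  - apply/eqP; rewrite -subr_eq0.
    (* Once y is eliminated by the line, [c1] times x2 - x1 is the difference of the two curve
       equations; the non-zero factor is then cancelled. *)
    set c1 := (X in X == 0).
    have : c1 * (x2 - x1) = 0; last first.
      by move/eqP; rewrite mulf_eq0 (negPf d0) orbF.
    have -> : c1 * (x2 - x1) =
      (x2 ^+ 3 + a2 * x2 ^+ 2 + a4 * x2 + a6 - (y2 ^+ 2 + a1 * x2 * y2 + a3 * y2))
      - (x1 ^+ 3 + a2 * x1 ^+ 2 + a4 * x1 + a6 - (y1 ^+ 2 + a1 * x1 * y1 + a3 * y1)).
      by rewrite e1 e2 /c1 /x3; ring.
    by rewrite h1 h2 !subrr.
  - apply/eqP; rewrite eq_sym -subr_eq0; set c0 := (X in X == 0).
    have : c0 * (x2 - x1) = 0; last first.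
      by move/eqP; rewrite mulf_eq0 (negPf d0) orbF.
    have -> : c0 * (x2 - x1) =
      - x1 * (x2 ^+ 3 + a2 * x2 ^+ 2 + a4 * x2 + a6 - (y2 ^+ 2 + a1 * x2 * y2 + a3 * y2))
      + x2 * (x1 ^+ 3 + a2 * x1 ^+ 2 + a4 * x1 + a6 - (y1 ^+ 2 + a1 * x1 * y1 + a3 * y1)).
      by rewrite e1 e2 /c0 /x3; ring.
    by rewrite h1 h2 !subrr !mulr0 addr0.
subst x2; have ey : y1 = y2.
  by case: (heq h2) => // e; move: hno; rewrite eqxx e eqxx.
subst y2; move: hno; rewrite eqxx /=.
have -> : y1 + y1 + a1 * x1 + a3 = 2%:R * y1 + a1 * x1 + a3 by ring.
move=> d0; set d := 2%:R * y1 + a1 * x1 + a3.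
set l := (X in X / d); set n := - x1 ^+ 3 + a4 * x1 + 2 * a6 - a3 * y1.
have a6E : a6 = y1 ^+ 2 + a1 * x1 * y1 + a3 * y1 - (x1 ^+ 3 + a2 * x1 ^+ 2 + a4 * x1).
  by rewrite h1; ring.
have en : n / d = y1 - l / d * x1.
  by rewrite /n a6E /l /d; field.
have el : l / d * d = l by rewrite divfK.
have a4E : a4 = l / d * d - 3%:R * x1 ^+ 2 - 2%:R * a2 * x1 + a1 * y1.
  by rewrite el /l; ring.
rewrite {}en; move: (l / d) el a4E => k el a4E.
exists k, (y1 - k * x1), (k ^+ 2 + a1 * k - a2 - x1 - x1); split=> //.
- by split; ring.
- by split=> /=; [ring | rewrite a4E /d; ring | rewrite a6E a4E /d; ring].
- by right; split.
Qed.

Lemma addP_opp W x1 y1 x2 y2 :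
  (x1 == x2) && (y1 + y2 + wa1 W * x2 + wa3 W == 0) ->
  addP W (Some (x1, y1)) (Some (x2, y2)) = None.
Proof. by case: W => * /=; rewrite ifT. Qed.

Lemma collinear_on_curve W l n x1 x2 x3 : collinear W l n x1 x2 x3 ->
  on_curve W (Some (x3, - (l + wa1 W) * x3 - n - wa3 W)).
Proof.
case: W => a1 a2 a3 a4 a6 /= [/= e2 e4 e6].
have -> : a2 = l ^+ 2 + a1 * l - (x1 + x2 + x3) by rewrite -e2; ring.
have -> : a4 = x1 * x2 + x1 * x3 + x2 * x3 + 2%:R * l * n + a1 * n + a3 * l.
  by rewrite -e4; ring.
have -> : a6 = n ^+ 2 + a3 * n - x1 * x2 * x3 by rewrite -e6; ring.
ring.
Qed.

Lemma addP_on_curve W P Q : on_curve W P -> on_curve W Q -> on_curve W (addP W P Q).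
Proof.
case: P Q => [[x1 y1]|] [[x2 y2]|] // h1 h2.
have [h|h] := boolP ((x1 == x2) && (y1 + y2 + wa1 W * x2 + wa3 W == 0)).
  by rewrite addP_opp.
have [l [n [x3 [-> _ /collinear_on_curve]]]] := addP_line h1 h2 h.
by [].
Qed.

Lemma oppP_on_curve W P : on_curve W P -> on_curve W (oppP W P).
Proof.
by case: P => [[x y]|] //= h; rewrite -h; ring.
Qed.

Lemma addPC W P Q : on_curve W P -> on_curve W Q -> addP W P Q = addP W Q P.
Proof.
case: P Q => [[x1 y1]|] [[x2 y2]|] // h1 h2.
have := eq_or_opp (x := x1) (y := y1) (y' := y2) h1.
case: W h1 h2 => a1 a2 a3 a4 a6 /= h1 h2 heq.
have [ex|nx] := eqVneq x1 x2; last first.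
  have d0 : x2 - x1 != 0 by rewrite subr_eq0 eq_sym.
  have d0' : x1 - x2 != 0 by rewrite subr_eq0.
  by rewrite /=; congr (Some (_, _)); field; rewrite d0 d0'.
subst x2; rewrite /= [y2 + y1]addrC; case: ifP => // h.
by case: (heq h2) => [->|e] //; rewrite e eqxx in h.
Qed.

Lemma addPN W P : addP W P (oppP W P) = None.
Proof.
case: P => [[x y]|] //; rewrite /oppP addP_opp // eqxx; apply/eqP; ring.
Qed.
Lemma oppPK W P : oppP W (oppP W P) = P.
Proof. by case: P => [[x y]|] //=; congr (Some (_, _)); ring. Qed.

Lemma addP_eq0 W P Q : addP W P Q = None -> Q = oppP W P.
Proof.
case: P Q => [[x1 y1]|] [[x2 y2]|] //.
case: W => a1 a2 a3 a4 a6 /=; case: ifP => // /andP[/eqP -> /eqP h] _.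
by congr (Some (_, _)); rewrite -[RHS]addr0 -h; ring.
Qed.
End AdditionFormula.

(** * Associativity through ideal classes *)

Section GroupLaw.
Variable F : fieldType.
Implicit Types W : weierstrass F.

Definition Ip W (P : cpoint F) : seq (coord_ring W) :=
  if P is Some (x, y) then [:: crX W - cst W x; crY W - cst W y] else [:: 1].
Lemma idl2 (R : comNzRingType) (a b f c d : R) : f = c * a + d * b ->
  idl [:: a; b] f.
Proof. by move=> ->; exists c, d => /=; ring. Qed.
Lemma idl4 (R : comNzRingType) (a1 a2 a3 a4 f c1 c2 c3 c4 : R) :
  f = c1 * a1 + c2 * a2 + c3 * a3 + c4 * a4 -> idl [:: a1; a2; a3; a4] f.
Proof. by move=> ->; exists c1, c2, c3, c4 => /=; ring. Qed.
Lemma isub_cons (R : comNzRingType) (a : R) l m :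
  idl m a -> isub l m -> isub (a :: l) m.
Proof.
move=> ha [hl]; split=> x; rewrite in_cons => /orP[/eqP ->|] //; exact: hl.
Qed.
Lemma isub_nil (R : comNzRingType) (m : seq R) : isub [::] m.
Proof. by split=> x; rewrite in_nil. Qed.
Lemma crlin_neq0 W (c d : F) : crY W - cst W c * crX W - cst W d != 0.
Proof.
apply/eqP => /(congr1 snd) /=; rewrite !(mul0r, mulr0, subr0, addr0, add0r, oppr0) => /eqP.
by rewrite oner_eq0.
Qed.
Lemma crXc_neq0 W (c : F) : crX W - cst W c != 0.
Proof.
apply/eqP => /(congr1 fst) /= /eqP; apply/negP.
by rewrite -[_ + _]/('X - c%:P) polyXsubC_eq0.
Qed.

(** The second factor is the conjugate of the first under y -> - y - a1 x - a3, up to sign. The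
    product is thus a cubic in x, whose roots are the abscissas of the intersection with the
    line. *)
Lemma line_norm W l n x1 x2 x3 : collinear W l n x1 x2 x3 ->
  (crY W - cst W l * crX W - cst W n) *
  (crY W + cst W (l + wa1 W) * crX W + cst W (n + wa3 W)) =
  (crX W - cst W x1) * (crX W - cst W x2) * (crX W - cst W x3).
Proof.
move=> [e2 e4 e6].
set e := _ - cst W n; set eb := _ + cst W (n + _).
have -> : e * eb = crY W ^+ 2 + (cst W (wa1 W) * crX W + cst W (wa3 W)) * crY W
  - (cst W l * crX W + cst W n) * (cst W (l + wa1 W) * crX W + cst W (n + wa3 W)).
  by rewrite /e /eb; ring.
rewrite crYE.
have -> : wa6 W = n ^+ 2 + wa3 W * n - x1 * x2 * x3 by rewrite -e6; ring.
have -> : wa4 W = x1 * x2 + x1 * x3 + x2 * x3 + 2%:R * l * n + wa1 W * n + wa3 W * l.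
  by rewrite -e4; ring.
have -> : wa2 W = l ^+ 2 + wa1 W * l - (x1 + x2 + x3) by rewrite -e2; ring.
ring.
Qed.

(** If both partial derivatives vanish, then a3, a4 and a6 are determined by a1, a2 and the point,
    and after this substitution the discriminant is identically zero. *)
Lemma nonsingular_point W x y : elliptic W -> on_curve W (Some (x, y)) ->
  2%:R * y + wa1 W * x + wa3 W != 0 \/
  3%:R * x ^+ 2 + 2%:R * wa2 W * x + wa4 W - wa1 W * y != 0.
Proof.
move=> Wd h; have [e1|] := eqVneq (2%:R * y + wa1 W * x + wa3 W) 0; last by left.
right; apply: contraNneq Wd => e2; move: h e1 e2; rewrite /discW.
case: W => a1 a2 a3 a4 a6 /= h e1 e2.
have a3E : a3 = - 2%:R * y - a1 * x.
  by rewrite -[LHS]subr0 -{1}e1; ring.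
have a4E : a4 = a1 * y - 3%:R * x ^+ 2 - 2%:R * a2 * x.
  by rewrite -[LHS]subr0 -{1}e2; ring.
have a6E : a6 = y ^+ 2 + a1 * x * y + a3 * y - (x ^+ 3 + a2 * x ^+ 2 + a4 * x).
  by rewrite h; ring.
rewrite a6E a4E a3E; apply/eqP; ring.
Qed.

(** The function X - x1 vanishes exactly at P and -P, and it generates the product ideal. Smoothness
    is what recovers X - x1 from the products of generators: one of the two partial derivatives at P
    can be inverted. *)
Lemma Ip_opp W P : elliptic W -> on_curve W P ->
  iequ (iprod (Ip W P) (Ip W (oppP W P))) [:: 1].
Proof.
move=> Wd; case: P => [[x1 y1]|] h; last first.
  by rewrite /= iprod1; apply: iequ_eqi.
set X := crX W; set Y := crY W; set c := cst W.
have c1 : c 1 = 1 by exact: rmorph1.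
have cM a b : c (a * b) = c a * c b by exact: rmorphM.
pose y2 := - y1 - wa1 W * x1 - wa3 W.
pose G := X ^+ 2 + c x1 * X + c x1 ^+ 2 + c (wa2 W) * (X + c x1) + c (wa4 W)
  - c (wa1 W) * Y.
have hG : (Y - c y1) * (Y - c y2) = (X - c x1) * G.
  have -> : (Y - c y1) * (Y - c y2) = Y ^+ 2 + c (wa1 W * x1 + wa3 W) * Y
     - c (y1 ^+ 2 + wa1 W * x1 * y1 + wa3 W * y1) by rewrite /y2; ring.
  by rewrite crYE h /G -/c -/X -/Y; ring.
exists 1, (X - c x1); split; rewrite ?oner_neq0 ?crXc_neq0 //.
  rewrite /scal /iprod /= -/X -/Y -/c -/y2 hG.
  do ![apply: isub_cons; last exact: isub_nil|apply: isub_cons].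
  - by exists (X - c x1) => /=; ring.
  - by exists (Y - c y2) => /=; ring.
  - by exists (Y - c y1) => /=; ring.
  - by exists G => /=; ring.
rewrite /scal /iprod /= -/X -/Y -/c -/y2 !mul1r mulr1.
apply: isub_cons; last exact: isub_nil.
have [h1|h1] := nonsingular_point Wd h.
  apply: (@idl4 _ _ _ _ _ _ 0 (c (2%:R * y1 + wa1 W * x1 + wa3 W)^-1)
   (- c (2%:R * y1 + wa1 W * x1 + wa3 W)^-1) 0).
  transitivity (c ((2%:R * y1 + wa1 W * x1 + wa3 W)^-1 *
    (2%:R * y1 + wa1 W * x1 + wa3 W)) * (X - c x1)); first by rewrite mulVf // c1 mul1r.
  by rewrite cM /y2; ring.
set g := _ - _ in h1.
apply: (@idl4 _ _ _ _ _ _ (- c g^-1 * (X + 2%:R * c x1 + c (wa2 W))) 0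
   (c g^-1 * c (wa1 W)) (c g^-1)).
transitivity (c (g^-1 * g) * (X - c x1)); first by rewrite mulVf // c1 mul1r.
by rewrite cM hG /G /g; ring.
Qed.

(** Let e be the equation of the line through P and Q. It vanishes at P, Q and -(P + Q), while X -
    x3 vanishes at P + Q and -(P + Q); hence the ideal of P times that of Q, times X - x3, equals e
    times the ideal of P + Q. *)
Lemma Ip_add W P Q : elliptic W -> on_curve W P -> on_curve W Q ->
  iequ (iprod (Ip W P) (Ip W Q)) (Ip W (addP W P Q)).
Proof.
move=> Wd; case: P => [[x1 y1]|] h1; last first.
  by move=> _; rewrite /= iprod1; apply: iequ_eqi.
case: Q => [[x2 y2]|] h2; last first.
  apply: iequ_trans (iequ_eqi (iprodC _ _)) _; first exact: cr_mulf_eq0.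
  by rewrite /= iprod1; apply: iequ_eqi.
have [hc|hc] := boolP ((x1 == x2) && (y1 + y2 + wa1 W * x2 + wa3 W == 0)).
  rewrite addP_opp //; have := Ip_opp Wd h1.
  have -> // : oppP W (Some (x1, y1)) = Some (x2, y2).
  by apply/esym/addP_eq0/addP_opp.
have [l [n [x3 [-> [e1 e2] hl hcase]]]] := addP_line h1 h2 hc.
set X := crX W; set Y := crY W; set c := cst W.
have c1 : c 1 = 1 by exact: rmorph1.
have cM a b : c (a * b) = c a * c b by exact: rmorphM.
set y3 := - _ * x3 - n - _.
set e := Y - c l * X - c n.
have he := line_norm hl; rewrite -/X -/Y -/c -/e in he.
exists (X - c x3), e; rewrite crXc_neq0 crlin_neq0; split=> //.
  rewrite /scal /iprod /= -/X -/Y -/c.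
  do ![apply: isub_cons; last exact: isub_nil|apply: isub_cons].
  - apply: (@idl2 _ _ _ _ (c (l + wa1 W)) 1).
    by rewrite mulrC -he /y3; ring.
  - apply: (@idl2 _ _ _ _ (X - c x1 + c l * c (l + wa1 W)) (c l)).
    transitivity ((X - c x1) * (e * (X - c x3)) +
      c l * ((X - c x1) * (X - c x2) * (X - c x3))); first by rewrite e2 /e; ring.
    by rewrite -he /y3; ring.
  - apply: (@idl2 _ _ _ _ (X - c x2 + c l * c (l + wa1 W)) (c l)).
    transitivity ((X - c x2) * (e * (X - c x3)) +
      c l * ((X - c x1) * (X - c x2) * (X - c x3))); first by rewrite e1 /e; ring.
    by rewrite -he /y3; ring.
  - apply: (@idl2 _ _ _ _ (e + c l * (X - c x1) + c l * (X - c x2)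
        + c l ^+ 2 * c (l + wa1 W)) (c l ^+ 2)).
    transitivity ((e + c l * (X - c x1) + c l * (X - c x2)) * (e * (X - c x3)) +
      c l ^+ 2 * ((X - c x1) * (X - c x2) * (X - c x3))).
      by rewrite e1 e2 /e; ring.
    by rewrite -he /y3; ring.
(* For a chord, e is a combination of the two mixed products divided by x2 - x1. For a tangent, the
   y-derivative at the point is inverted instead, and [line_norm] supplies the missing multiple of
   e. *)
have ei : idl (iprod (Ip W (Some (x1, y1))) (Ip W (Some (x2, y2)))) e.
  rewrite /iprod /= -/X -/Y -/c.
  case: hcase => [[nx _]|[ex ey n0 _]].
    apply: (@idl4 _ _ _ _ _ _ 0 (c (x2 - x1)^-1) (- c (x2 - x1)^-1) 0).
    transitivity (c ((x2 - x1)^-1 * (x2 - x1)) * e).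
      by rewrite mulVf ?subr_eq0 1?eq_sym // c1 mul1r.
    by rewrite cM e1 e2 /e; ring.
  set g := _ + wa3 W in n0.
  apply: (@idl4 _ _ _ _ _ _ (c g^-1 * (X - c x3 - c l ^+ 2 + c (2%:R * l + wa1 W) * c l))
    (c g^-1 * (2%:R * c l - c (2%:R * l + wa1 W))) 0 (- c g^-1)).
  transitivity (c g^-1 * (c g * e)).
    by rewrite mulrA -cM mulVf // c1 mul1r.
  have -> : c g * e = (X - c x1) * (X - c x1) * (X - c x3) - e ^+ 2
      - c (2%:R * l + wa1 W) * ((X - c x1) * e).
    by rewrite {2}ex -he /g e1 /e; ring.
  by rewrite -ex -ey e1 /e; ring.
have ei' := idl_scal (X - c x3) ei.
rewrite /scal /= -/X -/Y -/c.
apply: isub_cons; first by rewrite [e * _]mulrC; exact: ei'.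
apply: isub_cons; last exact: isub_nil.
have -> : e * (Y - c y3) = (X - c x3) * ((X - c x1) * (X - c x2)) +
   - c (l + wa1 W) * ((X - c x3) * e).
  by rewrite [(X - c x3) * (_ * _)]mulrC -he /y3; ring.
apply: idlD; last exact: idlM.
by apply: idl_mem; rewrite /iprod /= mem_head.
Qed.

(** A generator g of the ideal of an affine point would be a function with a simple zero at that
    point and no other zero, hence with a simple pole at infinity; norms exclude this. *)
Lemma Ip_principal W P : on_curve W P -> iequ (Ip W P) [:: 1] -> P = None.
Proof.
case: P => [[x0 y0]|] // h [a [b [a0 b0 [h1] [h2]]]].
pose ev (f : coord_ring W) := f.1.[x0] + f.2.[x0] * y0.
have evM f g : ev (f * g) = ev f * ev g.
  case: f g => f1 f2 [g1 g2]; rewrite /ev.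
  transitivity ((f1 * g1 + f2 * g2 * cubicW W).[x0]
     + (f1 * g2 + f2 * g1 - f2 * g2 * linW W).[x0] * y0); first by [].
  rewrite /cubicW /linW !hornerE /=.
  have -> : wa6 W = y0 ^+ 2 + wa1 W * x0 * y0 + wa3 W * y0 -
     (x0 ^+ 3 + wa2 W * x0 ^+ 2 + wa4 W * x0) by rewrite h; ring.
  ring.
have evD f g : ev (f + g) = ev f + ev g.
  case: f g => f1 f2 [g1 g2].
  transitivity ((f1 + g1).[x0] + (f2 + g2).[x0] * y0); first by [].
  by rewrite /ev !hornerD /=; ring.
have [g gI bE] : exists2 g, ev g = 0 & b = a * g.
  have := h2 b; rewrite /scal /= mulr1 mem_head => /(_ isT) [c [d /eqP]].
  rewrite /Ip subr_eq0 => /eqP; set x := crX W - _; set y := crY W - _ => e.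
  exists (c * x + d * y); last by rewrite -[LHS](subrK (c * (a * x))) e; ring.
  rewrite evD !evM.
  have -> : ev x = 0 by rewrite /ev /= !hornerE; ring.
  have -> : ev y = 0 by rewrite /ev /= !hornerE; ring.
  by rewrite !mulr0 addr0.
have div z : z \in Ip W (Some (x0, y0)) -> exists c, z = c * g.
  move=> zI; have /h1 : a * z \in scal a (Ip W (Some (x0, y0))) by apply: map_f.
  rewrite /= mulr1 => -[c /eqP]; rewrite subr_eq0 => /eqP e; exists c.
  by apply: (cr_mulI a0); rewrite e bE; ring.
have [c cE] := div _ (mem_head _ _).
have [d dE] : exists d, crY W - cst W y0 = d * g.
  by apply: div; rewrite !inE eqxx orbT.
(* The norm of X - x0 has degree 2, whereas a non-zero y-part would give the norm of g degree at
   least 3. Then g is a polynomial in x dividing Y - y0, so it is constant, although it vanishes at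
   P. *)
have g2 : g.2 = 0.
  have := congr1 (size \o @cr_norm _ W) cE.
  rewrite /= cr_normM.
  have -> : cr_norm (crX W - cst W x0) = ('X - x0%:P) ^+ 2.
    by rewrite /cr_norm /=; ring.
  have n0 : cr_norm c * cr_norm g != 0.
    rewrite -cr_normM -cE; apply/eqP=> /cr_norm_eq0/eqP.
    by apply/negP/crXc_neq0.
  rewrite size_exp_XsubC size_mul; try by apply: contraNneq n0 => ->; rewrite ?mul0r ?mulr0.
  have : (0 < size (cr_norm c))%N.
    by rewrite lt0n size_poly_eq0; apply: contraNneq n0 => ->; rewrite ?mul0r ?mulr0.
  rewrite [size (cr_norm g)]size_cr_norm; case: eqP => // /eqP.
  move=> g20 cp e; exfalso; move: g20 cp e; rewrite -size_poly_eq0 -lt0n.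
  by move: (size g.2) (size g.1) (size (cr_norm c)) => u1 u2 u3; lia.
have dE1 : d.2 * g.1 = 1.
  transitivity ((d * g).2); last by rewrite -dE; apply: subr0.
  transitivity (d.1 * g.2 + d.2 * g.1 - d.2 * g.2 * linW W); last by [].
  by rewrite g2; ring.
have g1c : size g.1 = 1%N.
  have gn : d.2 * g.1 != 0 by rewrite dE1 oner_eq0.
  have := congr1 (size \o @polyseq F) dE1; rewrite /= size_poly1 size_mul.
  - have : (0 < size d.2)%N.
      by rewrite lt0n size_poly_eq0; apply: contraNneq gn => ->; rewrite mul0r.
    have : (0 < size g.1)%N.
      by rewrite lt0n size_poly_eq0; apply: contraNneq gn => ->; rewrite mulr0.
    by move: (size g.1) (size d.2) => u1 u2; lia.
  - by apply: contraNneq gn => ->; rewrite mul0r.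
  - by apply: contraNneq gn => ->; rewrite mulr0.
have := gI; rewrite /ev g2 horner0 mul0r addr0 => g10.
move/eqP: g1c => /size_poly1P[k k0 gk]; move: g10; rewrite gk hornerC => /eqP.
by rewrite (negPf k0).
Qed.

(** By [Ip_add] both sums have the class of the same triple product of ideals. Their difference then
    has a principal ideal, so it is the origin by [Ip_principal]. *)
Lemma addPA W P Q S : elliptic W -> on_curve W P -> on_curve W Q -> on_curve W S ->
  addP W P (addP W Q S) = addP W (addP W P Q) S.
Proof.
move=> Wd hP hQ hS; set T1 := addP W P _; set T2 := addP W _ S.
have dom := @cr_mulf_eq0 F W.
have hT1 : on_curve W T1 by do ?apply: addP_on_curve.
have hT2 : on_curve W T2 by do ?apply: addP_on_curve.
have e12 : iequ (Ip W T1) (Ip W T2).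
  have a1 : iequ (iprod (Ip W P) (iprod (Ip W Q) (Ip W S))) (Ip W T1).
    apply: (iequ_trans dom) (iequ_prodr dom _ (Ip_add Wd hQ hS)) _.
    by apply: Ip_add => //; apply: addP_on_curve.
  have a2 : iequ (iprod (iprod (Ip W P) (Ip W Q)) (Ip W S)) (Ip W T2).
    apply: (iequ_trans dom) (iequ_prodl _ (Ip_add Wd hP hQ)) _.
    by apply: Ip_add => //; apply: addP_on_curve.
  apply: (iequ_trans dom) (iequ_sym a1) _.
  by apply: (iequ_trans dom) (iequ_eqi (iprodA _ _ _)) a2.
have hO := oppP_on_curve hT2.
have : addP W T1 (oppP W T2) = None.
  apply: (@Ip_principal W); first exact: addP_on_curve.
  apply: (iequ_trans dom) (iequ_sym (Ip_add Wd hT1 hO)) _.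
  by apply: (iequ_trans dom) (iequ_prodl _ e12) (Ip_opp Wd hT2).
by move/addP_eq0 => e; rewrite -[RHS](oppPK W) e oppPK.
Qed.
End GroupLaw.

(** The group structure on the points depends on smoothness through associativity, so ellipticity is
    bundled with the equation. *)
Record ecurve (F : fieldType) := ECurve {
  ecW :> weierstrass F; ec_elliptic : elliptic ecW }.

(** * The abelian group of points *)

Section PointGroup.
Variables (F : fieldType) (E : ecurve F).

Definition on_curveb (P : cpoint F) : bool :=
  if P is Some (x, y) then
    y ^+ 2 + wa1 E * x * y + wa3 E * y == x ^+ 3 + wa2 E * x ^+ 2 + wa4 E * x + wa6 E
  else true.
Lemma on_curveP P : reflect (on_curve E P) (on_curveb P).
Proof. by case: P => [[x y]|] /=; [apply: eqP | apply: ReflectT]. Qed.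

Record ecpoint := ECPoint { ecval :> cpoint F; _ : on_curveb ecval }.
HB.instance Definition _ := [isSub for ecval].
HB.instance Definition _ := [Choice of ecpoint by <:].

Lemma ecpP (P : ecpoint) : on_curve E (ecval P).
Proof. by case: P => P h; apply/on_curveP. Qed.
Lemma ecval_inj : injective ecval.
Proof. exact: val_inj. Qed.
Definition mkpt (P : cpoint F) (h : on_curve E P) : ecpoint :=
  ECPoint (introT (on_curveP P) h).
Definition ec_zero := @mkpt None I.
Definition ec_opp (P : ecpoint) := mkpt (oppP_on_curve (ecpP P)).
Definition ec_add (P Q : ecpoint) := mkpt (addP_on_curve (ecpP P) (ecpP Q)).

Fact ec_addA : associative ec_add.
Proof.
move=> P Q S; apply: val_inj; apply: addPA; first exact: ec_elliptic.
  all: exact: ecpP.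
Qed.
Fact ec_addC : commutative ec_add.
Proof. by move=> P Q; apply: val_inj; apply: addPC; exact: ecpP. Qed.
Fact ec_add0 : left_id ec_zero ec_add.
Proof. by move=> P; apply: val_inj. Qed.
Fact ec_addN : left_inverse ec_zero ec_opp ec_add.
Proof. by move=> P; rewrite ec_addC; apply: val_inj; apply: addPN. Qed.

HB.instance Definition _ := GRing.isZmodule.Build ecpoint ec_addA ec_addC ec_add0 ec_addN.

Lemma ecvalD P Q : ecval (P + Q) = addP E (ecval P) (ecval Q). Proof. by []. Qed.
Lemma ecvalN P : ecval (- P) = oppP E (ecval P). Proof. by []. Qed.
Lemma ecvalMn P n : ecval (P *+ n) = mulP E n (ecval P).
Proof. by elim: n => [|n IH]; rewrite ?mulr0n // mulrS ecvalD IH. Qed.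

Lemma ec_torsion n P : torsion E n (ecval P) <-> P *+ n = 0.
Proof.
split=> [[_ h]|h]; first by apply: ecval_inj; rewrite ecvalMn.
by split; [exact: ecpP | rewrite -ecvalMn h].
Qed.
End PointGroup.

(** * Division polynomials *)

Section BiquadraticForms.
Variable R : comNzRingType.
Implicit Types (W : weierstrass R) (X Z x : R).

Definition wb2 W := wa1 W ^+ 2 + 4%:R * wa2 W.
Definition wb4 W := 2%:R * wa4 W + wa1 W * wa3 W.
Definition wb6 W := wa3 W ^+ 2 + 4%:R * wa6 W.
Definition wb8 W := wa1 W ^+ 2 * wa6 W + 4%:R * wa2 W * wa6 W
  - wa1 W * wa3 W * wa4 W + wa2 W * wa3 W ^+ 2 - wa4 W ^+ 2.

(* With x1 = X / Z and x2 = x the abscissas of P and Q, the abscissas of P + Q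
   and P - Q are the roots of formA t^2 - formB t + formC. *)
Definition formA X Z x := (X - x * Z) ^+ 2.
Definition formB W X Z x := 2%:R * X ^+ 2 * x + 2%:R * X * Z * x ^+ 2
  + wb2 W * X * Z * x + wb4 W * (X * Z + Z ^+ 2 * x) + wb6 W * Z ^+ 2.
Definition formC W X Z x := X ^+ 2 * x ^+ 2 - wb4 W * X * Z * x
  - wb6 W * (X * Z + Z ^+ 2 * x) - wb8 W * Z ^+ 2.

Lemma form_sym W X Z x X' Z' :
  formA X Z x * X' ^+ 2 - formB W X Z x * X' * Z' + formC W X Z x * Z' ^+ 2 =
  formA X' Z' x * X ^+ 2 - formB W X' Z' x * X * Z + formC W X' Z' x * Z ^+ 2.
Proof. rewrite /formA /formB /formC; ring. Qed.

(* The recursion satisfied by the numerators X n and denominators Z n of the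
   abscissa of n P, where x is the abscissa of P. *)
Definition divrec W x (X Z : nat -> R) :=
  [/\ X 0 = 1, Z 0 = 0, X 1 = x, Z 1 = 1 &
    forall n, [/\ Z n.+2 * Z n = formA (X n.+1) (Z n.+1) x,
      X n.+2 * Z n + X n * Z n.+2 = formB W (X n.+1) (Z n.+1) x &
      X n.+2 * X n = formC W (X n.+1) (Z n.+1) x]].
End BiquadraticForms.

Lemma divrec_morph (R S : comNzRingType) (f : {rmorphism R -> S})
  (W : weierstrass R) x X Z :
  divrec W x X Z -> divrec (mapW f W) (f x) (f \o X) (f \o Z).
Proof.
move=> [X0 Z0 X1 Z1 rec].
split=> /=; rewrite ?(X0, Z0, X1, Z1) ?rmorph1 ?rmorph0 // => n.
have [h1 h2 h3] := rec n.
rewrite -!rmorphM -rmorphD h1 h2 h3 /formA /formB /formC /wb2 /wb4 /wb6 /wb8.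
by case: W rec h1 h2 h3 => a1 a2 a3 a4 a6 /= _ _ _ _; split; ring.
Qed.

(** * Abscissas of sums, differences and multiples *)

Section MultiplesOfPoint.
Variables (F : fieldType) (E : ecurve F).
Local Notation b2 := (wb2 E). Local Notation b4 := (wb4 E).
Local Notation b6 := (wb6 E). Local Notation b8 := (wb8 E).
Implicit Types P Q U : ecpoint E.

Definition pX (P : cpoint F) : F := if P is Some (x, _) then x else 1.
Definition pZ (P : cpoint F) : F := if P is Some _ then 1 else 0.

(* (X : Z) are homogeneous coordinates of x(P). *)
Definition xrep (P : cpoint F) (X Z : F) :=
  exists2 s, s != 0 & X = s * pX P /\ Z = s * pZ P.

Lemma formB_diag x y : on_curve E (Some (x, y)) ->
  formB E x 1 x = (2%:R * y + wa1 E * x + wa3 E) ^+ 2.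
Proof.
rewrite /formB /wb2 /wb4 /wb6; case: (ecW E) => a1 a2 a3 a4 a6 /= h.
have -> : a6 = y ^+ 2 + a1 * x * y + a3 * y - (x ^+ 3 + a2 * x ^+ 2 + a4 * x).
  by rewrite h; ring.
ring.
Qed.

Lemma formC_diag x y : on_curve E (Some (x, y)) ->
  formC E x 1 x =
    (3%:R * x ^+ 2 + 2%:R * wa2 E * x + wa4 E - wa1 E * y) ^+ 2
    + wa1 E * (3%:R * x ^+ 2 + 2%:R * wa2 E * x + wa4 E - wa1 E * y)
      * (2%:R * y + wa1 E * x + wa3 E)
    - (wa2 E + 2%:R * x) * (2%:R * y + wa1 E * x + wa3 E) ^+ 2.
Proof.
rewrite /formC /wb4 /wb6 /wb8; case: (ecW E) => a1 a2 a3 a4 a6 /= h.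
have -> : a6 = y ^+ 2 + a1 * x * y + a3 * y - (x ^+ 3 + a2 * x ^+ 2 + a4 * x).
  by rewrite h; ring.
ring.
Qed.

(** The points (X : Z) and (X' : Z') of the projective line are the two roots of A T^2 - B T + C.
    The homogeneous form with a common scalar [t] includes the cases where one of the roots is at
    infinity. *)
Definition vieta (A B C X Z X' Z' : F) := exists2 t, t != 0 &
  [/\ Z * Z' = t * A, X * Z' + X' * Z = t * B & X * X' = t * C].
Lemma vieta_swap A B C X Z X' Z' : vieta A B C X Z X' Z' -> vieta A B C X' Z' X Z.
Proof.
move=> [t t0 [h1 h2 h3]]; exists t => //.
by rewrite -h1 -h2 -h3; split; ring.
Qed.

Lemma addsub_abscissa_same x0 y0 P : ecval P = Some (x0, y0) ->
  vieta (formA x0 1 x0) (formB E x0 1 x0) (formC E x0 1 x0)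
    (pX (ecval (P + P))) (pZ (ecval (P + P))) 1 0.
Proof.
move=> eP; have hP := ecpP P; rewrite eP in hP.
have -> : formA x0 1 x0 = 0 by rewrite /formA; ring.
rewrite (formB_diag hP) (formC_diag hP) ecvalD eP.
set eta := 2%:R * y0 + _ + _; set ga := 3%:R * _ + _ + _ - _.
have etaE : y0 + y0 + wa1 E * x0 + wa3 E = eta by rewrite /eta; ring.
have [e0|n0] := eqVneq eta 0.
  rewrite addP_opp ?eqxx ?etaE ?e0 ?eqxx //=.
  have [|g0] := nonsingular_point (ec_elliptic E) hP; first by rewrite -/eta e0 eqxx.
  exists (ga ^+ 2)^-1; first by rewrite invr_eq0 expf_neq0.
  split; [ring | ring | ].
  have -> : ga ^+ 2 + wa1 E * ga * 0 - (wa2 E + 2 * x0) * 0 ^+ 2 = ga ^+ 2 by ring.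
  by rewrite mulVf ?expf_neq0 // mulr1.
have hc : ~~ ((x0 == x0) && (y0 + y0 + wa1 E * x0 + wa3 E == 0)).
  by rewrite etaE (negPf n0) andbF.
have [l [n [x3 [-> _ [h3 _ _] [[]|[_ _ _ hl]]]]]] := addP_line hP hP hc.
  by rewrite eqxx.
exists (eta ^+ 2)^-1; first by rewrite invr_eq0 expf_neq0.
rewrite -/eta -/ga in hl; split => /=; first by rewrite !mulr0.
  by rewrite mulVf ?expf_neq0 //; ring.
have -> : x3 = l ^+ 2 + wa1 E * l - wa2 E - x0 - x0 by rewrite h3; ring.
by rewrite -hl; field.
Qed.

Lemma addsub_abscissa_diff x0 y0 x1 y1 : x1 != x0 ->
  on_curve E (Some (x1, y1)) -> on_curve E (Some (x0, y0)) ->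
  let S := addP E (Some (x1, y1)) (Some (x0, y0)) in
  let D := addP E (Some (x1, y1)) (oppP E (Some (x0, y0))) in
  vieta (formA x1 1 x0) (formB E x1 1 x0) (formC E x1 1 x0) (pX S) (pZ S) (pX D) (pZ D).
Proof.
move=> nx h1 h0 S D; exists ((x1 - x0) ^+ 2)^-1.
  by rewrite invr_eq0 expf_neq0 // subr_eq0.
have d0 : x0 - x1 != 0 by rewrite subr_eq0 eq_sym.
have d1 : x1 - x0 != 0 by rewrite subr_eq0.
move: @S @D; rewrite /oppP /formA /formB /formC /wb2 /wb4 /wb6 /wb8.
case: (ecW E) h1 h0 => a1 a2 a3 a4 a6 /= h1 h0; rewrite (negPf nx) /=.
(* The two curve equations are linear in a4 and a6; once these are eliminated the claims are
   identities between rational functions. *)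
have a4E : a4 = ((y1 ^+ 2 + a1 * x1 * y1 + a3 * y1 - x1 ^+ 3 - a2 * x1 ^+ 2)
  - (y0 ^+ 2 + a1 * x0 * y0 + a3 * y0 - x0 ^+ 3 - a2 * x0 ^+ 2)) / (x1 - x0).
  by rewrite h1 h0; field.
have a6E : a6 = y0 ^+ 2 + a1 * x0 * y0 + a3 * y0 - (x0 ^+ 3 + a2 * x0 ^+ 2 + a4 * x0).
  by rewrite h0; ring.
clear h1 h0.
split.
- by field.
- by rewrite a6E a4E; field; rewrite d0 d1.
- by rewrite a6E a4E; field; rewrite d0 d1.
Qed.

Lemma addsub_abscissa x0 y0 U P : ecval P = Some (x0, y0) ->
  vieta (formA (pX (ecval U)) (pZ (ecval U)) x0)
    (formB E (pX (ecval U)) (pZ (ecval U)) x0)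
    (formC E (pX (ecval U)) (pZ (ecval U)) x0)
    (pX (ecval (U + P))) (pZ (ecval (U + P)))
    (pX (ecval (U - P))) (pZ (ecval (U - P))).
Proof.
move=> eP; have hP := ecpP P; rewrite eP in hP.
set S := U + P; set D := U - P.
case eU: (ecval U) => [[x1 y1]|]; last first.
  have U0 : U = 0 by apply: ecval_inj.
  rewrite /S /D U0 add0r sub0r ecvalN eP /=; exists 1; first exact: oner_neq0.
  by rewrite /formA /formB /formC; split; ring.
have hU := ecpP U; rewrite eU in hU.
have [ex|nx] := eqVneq x1 x0; last first.
  have := addsub_abscissa_diff nx hU hP.
  by rewrite /S /D !ecvalD ecvalN eU eP.
subst x1; have [ey|ey] := eq_or_opp hU hP.
  have UP : U = P by apply: ecval_inj; rewrite eU eP ey.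
  by rewrite /S /D UP subrr; apply: (addsub_abscissa_same eP).
have UP : U = - P.
  apply: ecval_inj; rewrite ecvalN eU eP /=; congr (Some (_, _)).
  by rewrite -[LHS]subr0 -ey; ring.
rewrite /S /D UP addNr -opprD ecvalN; apply: vieta_swap.
have pXN Q : pX (oppP E (ecval Q)) = pX (ecval Q) by case: (ecval Q) => [[]|].
have pZN Q : pZ (oppP E (ecval Q)) = pZ (ecval Q) by case: (ecval Q) => [[]|].
by rewrite pXN pZN; apply: (addsub_abscissa_same eP).
Qed.

(** The abscissas of n P and (n + 2) P are the two roots of the quadratic attached to (n + 1) P and
    P. The recursion is that of the roots, so knowing one root up to a scalar gives the other up to
    the scalar [u] below. *)
Lemma multiple_abscissa x0 y0 P (X Z : nat -> F) : ecval P = Some (x0, y0) ->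
  divrec E x0 X Z -> forall n, xrep (ecval (P *+ n)) (X n) (Z n).
Proof.
move=> eP [X0 Z0 X1 Z1 rec] n.
suff : xrep (ecval (P *+ n)) (X n) (Z n) /\ xrep (ecval (P *+ n.+1)) (X n.+1) (Z n.+1).
  by case.
elim: n => [|n [[s s0 [Xn Zn]] [s' s'0 [Xn1 Zn1]]]].
  split; exists 1; rewrite ?oner_eq0 // ?X0 ?Z0 ?X1 ?Z1 ?mulr0n ?mulr1n ?eP /=.
    by rewrite mulr1 mulr0.
  by rewrite !mul1r.
split; first by exists s'.
have [t t0] := addsub_abscissa (P *+ n.+1) eP.
rewrite -mulrSr (mulrSr P n) addrK.
set X' := pX (ecval (P *+ n.+2)); set Z' := pZ (ecval (P *+ n.+2)).
move: Xn Zn; set x := pX (ecval (P *+ n)); set z := pZ (ecval (P *+ n)) => Xn Zn.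
have hom1 : formA (X n.+1) (Z n.+1) x0 = s' ^+ 2 *
  formA (pX (ecval (P *+ n + P))) (pZ (ecval (P *+ n + P))) x0.
  by rewrite -mulrSr Xn1 Zn1 /formA; ring.
have hom2 : formB E (X n.+1) (Z n.+1) x0 = s' ^+ 2 *
  formB E (pX (ecval (P *+ n + P))) (pZ (ecval (P *+ n + P))) x0.
  by rewrite -mulrSr Xn1 Zn1 /formB; ring.
have hom3 : formC E (X n.+1) (Z n.+1) x0 = s' ^+ 2 *
  formC E (pX (ecval (P *+ n + P))) (pZ (ecval (P *+ n + P))) x0.
  by rewrite -mulrSr Xn1 Zn1 /formC; ring.
have [r1 r2 r3] := rec n; rewrite {}hom1 {}hom2 {}hom3 in r1 r2 r3.
move: (formA _ _ _) (formB _ _ _ _) (formC _ _ _ _) r1 r2 r3 => A B C.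
rewrite Xn Zn => r1 r2 r3 [e1 e2 e3].
pose u := s' ^+ 2 / (s * t).
have st0 : s * t != 0 by rewrite mulf_neq0.
have u0 : u != 0 by rewrite /u mulf_neq0 ?invr_eq0 ?expf_neq0.
have E1 : Z n.+2 * z = u * Z' * z.
  apply: (mulfI st0); rewrite -mulrA [RHS]mulrA e1.
  transitivity (t * (Z n.+2 * (s * z))); first ring.
  by rewrite r1 /u; field; rewrite t0 s0.
have E2 : X n.+2 * z + x * Z n.+2 = u * X' * z + x * (u * Z').
  apply: (mulfI st0).
  transitivity (t * (X n.+2 * (s * z) + s * x * Z n.+2)); first ring.
  transitivity (s * t * u * (X' * z + x * Z')); last ring.
  by rewrite r2 e2 /u; field; rewrite t0 s0.
have E3 : X n.+2 * x = u * X' * x.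
  apply: (mulfI st0); rewrite -[u * X' * x]mulrA [RHS]mulrA e3.
  transitivity (t * (X n.+2 * (s * x))); first ring.
  by rewrite r3 /u; field; rewrite t0 s0.
exists u => //.
(* If n P is the origin, the relation [E1] is void; then [E2] and [E3] determine the new denominator
   and numerator. *)
have : z = 1 \/ (x = 1 /\ z = 0).
  by rewrite /x /z; case: (ecval (P *+ n)) => [[]|] /=; [left|right].
case=> [z1|[x1 z0]].
  rewrite z1 !mulr1 in E1 E2; split=> //; apply: (addIr (x * Z n.+2)).
  by rewrite E2 E1.
rewrite x1 z0 !mulr1 !mulr0 !mul1r !add0r in E2 E3 *.
by split.
Qed.
End MultiplesOfPoint.

(** * Division polynomials over a field *)

Section DivisionPolynomials.
Variables (F : fieldType) (W : weierstrass F).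
Hypothesis Wd : elliptic W.
Local Notation WX := (mapW (@polyC F) W).
Implicit Types (f z : {poly F}).

Definition fA f z : {poly F} := formA f z 'X.
Definition fB f z : {poly F} := formB WX f z 'X.
Definition fC f z : {poly F} := formC WX f z 'X.
Definition omegaW : {poly F} := formB WX 'X 1 'X.
Definition kappaW : {poly F} := formC WX 'X 1 'X.

(** A Bezout identity between the denominator [omegaW] and the numerator [kappaW] of the duplication
    formula: a common root would be the abscissa of a singular point. *)
Lemma disc_certificate :
  (12%:R *: 'X^3 - wb2 W *: 'X^2 - (10%:R * wb4 W) *: 'X
     + (wb2 W * wb4 W - 27%:R * wb6 W)%:P) * omegaW
  - (48%:R *: 'X^2 + (8%:R * wb2 W) *: 'X + (32%:R * wb4 W - wb2 W ^+ 2)%:P) * kappaW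
  = (discW W)%:P.
Proof.
rewrite /kappaW /omegaW /formC /formB /wb2 /wb4 /wb6 /wb8 /discW.
by case: (W) => a1 a2 a3 a4 a6 /=; rewrite -!mul_polyC; ring.
Qed.

(** Modulo e = f - 'X z, the forms [fB] and [fC] become [omegaW] z^2 and [kappaW] z^2, so d divides
    discW z^2 + e g for some g. As d also divides e^2, it divides discW^2 z^4, and e is coprime to
    z. *)
Lemma forms_coprime f z d : coprimep f z ->
  d %| fA f z -> d %| fB f z -> d %| fC f z -> d %| 1.
Proof.
move=> cfz dA dB dC.
set e := f - 'X * z.
have [gB hB] : exists g, fB f z = omegaW * z ^+ 2 + e * g.
  exists (2%:R * (f + 'X * z) * 'X + 2%:R * z * 'X^2 + (wb2 W)%:P * z * 'X
    + (wb4 W)%:P * z).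
  rewrite /fB /omegaW /e /formB /wb2 /wb4 /wb6.
  by case: (W) => a1 a2 a3 a4 a6 /=; ring.
have [gC hC] : exists g, fC f z = kappaW * z ^+ 2 + e * g.
  exists ((f + 'X * z) * 'X^2 - (wb4 W)%:P * z * 'X - (wb6 W)%:P * z).
  rewrite /fC /kappaW /e /formC /wb4 /wb6 /wb8.
  by case: (W) => a1 a2 a3 a4 a6 /=; ring.
have [g hg] : exists g, d %| (discW W)%:P * z ^+ 2 + e * g.
  have := disc_certificate; set al := _ + _%:P; set be := (X in _ - X * _) => hD.
  exists (al * gB - be * gC).
  have -> : (discW W)%:P * z ^+ 2 + e * (al * gB - be * gC) =
    al * fB f z - be * fC f z by rewrite hC hB -hD; ring.
  by rewrite dvdp_sub // dvdp_mull.
have dz : d %| z ^+ 4.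
  have : d %| (discW W ^+ 2)%:P * z ^+ 4.
    have -> : (discW W ^+ 2)%:P * z ^+ 4 = ((discW W)%:P * z ^+ 2 + e * g) *
      ((discW W)%:P * z ^+ 2 - e * g) + g ^+ 2 * fA f z.
      by rewrite /fA /formA -/e; ring.
    by rewrite dvdp_add ?(dvdp_mulr _ hg) ?(dvdp_mull _ dA).
  by rewrite mul_polyC dvdpZr // expf_neq0.
have ce : coprimep (e ^+ 2) (z ^+ 4).
  apply/coprimep_expl/coprimep_expr; rewrite coprimep_sym.
  by rewrite /e -mulNr addrC coprimep_addl_mul coprimep_sym.
by have /coprimepP/(_ d dA dz) := ce; rewrite /eqp => /andP[].
Qed.

(** The recursion is solved by divisions by the monic numerator [f0] only, since the denominator
    [z0] may vanish (it does for n = 0). This also makes the construction work over rings. *)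
Definition dnext (s : {poly F} * {poly F} * ({poly F} * {poly F})) :=
  let: ((f0, z0), (f1, z1)) := s in
  let f2 := fC f1 z1 %/ f0 in
  ((f1, z1), (f2, (fB f1 z1 - f2 * z0) %/ f0)).

(** The last equation says that f0 / z0 is a root of the quadratic attached to (f1 : z1); together
    with coprimality it makes the divisions of [dnext] exact. *)
Definition dinv n (s : {poly F} * {poly F} * ({poly F} * {poly F})) :=
  let: ((f0, z0), (f1, z1)) := s in
  [/\ f0 \is monic, f1 \is monic, size f0 = (n ^ 2).+1 /\ size f1 = (n.+1 ^ 2).+1,
    (size z0 <= n ^ 2)%N /\ (size z1 <= n.+1 ^ 2)%N &
    [/\ coprimep f0 z0, coprimep f1 z1 &
     fA f1 z1 * f0 ^+ 2 - fB f1 z1 * f0 * z0 + fC f1 z1 * z0 ^+ 2 = 0]].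

Lemma size_fC n f z : f \is monic -> size f = n.+1 -> (size z <= n)%N ->
  size (fC f z) = (n.*2 + 3)%N /\ fC f z \is monic.
Proof.
move=> fm sf sz.
have -> : fC f z = f ^+ 2 * 'X^2 + ((- (wb4 W)%:P * 'X - (wb6 W)%:P) * (f * z)
  - ((wb6 W)%:P * 'X + (wb8 W)%:P) * z ^+ 2).
  rewrite /fC /formC /wb4 /wb6 /wb8.
  by case: (W) => a1 a2 a3 a4 a6 /=; ring.
set g := (X in _ + X).
have m2 : f ^+ 2 * 'X^2 \is monic by rewrite monicMr ?monicXn // monic_exp.
have s2 : size (f ^+ 2 * 'X^2) = (n.*2 + 3)%N.
  by rewrite size_mulXn ?monic_neq0 ?monic_exp // size_sqr sf; lia.
have sg : (size g < n.*2 + 3)%N.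
  rewrite /g (leq_ltn_trans (size_polyD _ _)) // size_polyN gtn_max; apply/andP; split.
    rewrite (leq_ltn_trans (size_polyMleq _ _)) //.
    have : (size (f * z)%R <= n.*2)%N.
      by rewrite (leq_trans (size_polyMleq _ _)) // sf; lia.
    have : (size (- (wb4 W)%:P * 'X - (wb6 W)%:P)%R <= 2)%N.
      apply/leq_sizeP => i hi; rewrite !(coefB, coefMX, coefN, coefC).
      by case: i hi => [|[|i]] //= _; rewrite ?subr0 ?oppr0.
    by move: (size _) (size _) => u1 u2; lia.
  rewrite (leq_ltn_trans (size_polyMleq _ _)) // size_sqr.
  have : (size ((wb6 W)%:P * 'X + (wb8 W)%:P)%R <= 2)%N.
    apply/leq_sizeP => i hi; rewrite !(coefD, coefMX, coefC).
    by case: i hi => [|[|i]] //= _; rewrite addr0.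
  by move: sz; move: (size z) => u2; move: (size _) => u1; lia.
split; first by rewrite size_polyDl ?s2.
by rewrite monicE lead_coefDl ?s2 // -monicE.
Qed.

Lemma dnextP n s : dinv n s ->
  let: ((f0, z0), (f1, z1)) := s in
  let: (f2, z2) := (dnext s).2 in
  dinv n.+1 (dnext s) /\ [/\ z2 * z0 = fA f1 z1, f2 * z0 + f0 * z2 = fB f1 z1
    & f2 * f0 = fC f1 z1].
Proof.
case: s => [[f0 z0] [f1 z1]] [m0 m1 [s0 s1] [sz0 sz1] [c0 c1 S3]] /=.
set f2 := fC f1 z1 %/ f0; set z2 := (_ - _) %/ f0.
have f00 := monic_neq0 m0.
have eC : f2 * f0 = fC f1 z1.
  apply: divpK; rewrite -(Gauss_dvdpl _ (coprimep_expr 2 c0)).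
  have -> : fC f1 z1 * z0 ^+ 2 = f0 * (fB f1 z1 * z0 - fA f1 z1 * f0).
    by rewrite -[LHS]subr0 -{1}S3; ring.
  by rewrite dvdp_mulr.
have S3' : fA f1 z1 * f0 = z0 * (fB f1 z1 - f2 * z0).
  apply: (mulfI f00); rewrite -[LHS]subr0 -S3 -eC; ring.
have eB : f2 * z0 + f0 * z2 = fB f1 z1.
  have h : f0 %| fB f1 z1 - f2 * z0.
    by rewrite -(Gauss_dvdpr _ c0) -S3' dvdp_mull.
  by rewrite mulrC [f0 * z2]mulrC /z2 divpK //; ring.
have eA : z2 * z0 = fA f1 z1.
  apply: (mulIf f00); rewrite S3' -eB; ring.
split; last by split.
have [sC mC] := size_fC m1 s1 sz1.
have m2 : f2 \is monic by rewrite -(monicMr _ m0) eC.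
have s2 : size f2 = (n.+2 ^ 2).+1.
  have := congr1 (size \o @polyseq F) eC; rewrite /= size_Mmonic ?monic_neq0 // sC s0.
  by move: (size f2) => u; lia.
have sz2 : (size z2 <= n.+2 ^ 2)%N.
  have e : f0 * z2 = fB f1 z1 - f2 * z0 by rewrite -eB; ring.
  have [->|z20] := eqVneq z2 0; first by rewrite size_poly0.
  have sB : (size (fB f1 z1) <= (n.+1 ^ 2).*2 + 2)%N.
    have -> : fB f1 z1 = (2%:R%:P * 'X) * f1 ^+ 2 + ((2%:R%:P * 'X^2 + (wb2 W)%:P * 'X
       + (wb4 W)%:P) * (f1 * z1) + ((wb4 W)%:P * 'X + (wb6 W)%:P) * z1 ^+ 2).
      rewrite /fB /formB /wb2 /wb4 /wb6.
      by case: (W) => a1 a2 a3 a4 a6 /=; ring.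
    rewrite (leq_trans (size_polyD _ _)) // geq_max; apply/andP; split.
      rewrite (leq_trans (size_polyMleq _ _)) // size_sqr s1.
      have : (size (2%:R%:P * 'X : {poly F})%R <= 2)%N.
        by apply/leq_sizeP => i hi; rewrite coefMX coefC; case: i hi => [|[|i]].
      by move: (size _) => u1; lia.
    rewrite (leq_trans (size_polyD _ _)) // geq_max; apply/andP; split.
      rewrite (leq_trans (size_polyMleq _ _)) //.
      have : (size (f1 * z1)%R <= (n.+1 ^ 2).*2)%N.
        by rewrite (leq_trans (size_polyMleq _ _)) // s1; lia.
      have : (size (2%:R%:P * 'X^2 + (wb2 W)%:P * 'X + (wb4 W)%:P)%R <= 3)%N.
        apply/leq_sizeP => i hi; rewrite !(coefD, coefMXn, coefMX, coefC).
        by case: i hi => [|[|[|i]]] //= _; rewrite !addr0.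
      by move: (size _) (size _) => u1 u2; lia.
    rewrite (leq_trans (size_polyMleq _ _)) // size_sqr.
    have : (size ((wb4 W)%:P * 'X + (wb6 W)%:P)%R <= 2)%N.
      apply/leq_sizeP => i hi; rewrite !(coefD, coefMX, coefC).
      by case: i hi => [|[|i]] //= _; rewrite addr0.
    by move: sz1; move: (size z1) => u2; move: (size _) => u1; lia.
  have : (size (f0 * z2)%R <= (n.+1 ^ 2).*2 + 2)%N.
    rewrite e (leq_trans (size_polyD _ _)) // size_polyN geq_max sB /=.
    by rewrite (leq_trans (size_polyMleq _ _)) // s2; lia.
  rewrite size_monicM // s0; move: (size z2) => u; lia.
split=> //; split=> //.
  apply/coprimepP => d d2 d2'; rewrite /eqp dvd1p andbT.
  apply: (forms_coprime c1); first by rewrite -eA dvdp_mulr.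
    by rewrite -eB dvdp_add // ?(dvdp_mulr _ d2) ?(dvdp_mull _ d2').
  by rewrite -eC dvdp_mulr.
(* By symmetry of the form, the equation required at the next stage says that f2 / z2 is the other
   root of the quadratic attached to (f1 : z1). *)
have := form_sym WX f1 z1 'X f2 z2; rewrite -/(fA f1 z1) -/(fB f1 z1) -/(fC f1 z1).
rewrite -/(fA f2 z2) -/(fB f2 z2) -/(fC f2 z2) => <-.
rewrite -eA -eB -eC; ring.
Qed.

Definition dstate n := iter n dnext ((1, 0), ('X, 1)).
Definition divnum n : {poly F} := (dstate n).1.1.
Definition divden n : {poly F} := (dstate n).1.2.

Lemma dstateP n : dinv n (dstate n).
Proof.
elim: n => [|n IH].
  split; rewrite ?monic1 ?monicX ?size_poly1 ?size_polyX ?size_poly0 //.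
  split; rewrite ?coprimep1 ?coprime1p //.
  by rewrite /fA /formA; ring.
have := dnextP IH; rewrite /dstate iterS -/(dstate n).
by case: (dstate n) IH => [[f0 z0] [f1 z1]] IH /= [].
Qed.

Lemma divrec_divpoly : divrec WX 'X divnum divden.
Proof.
split=> // n; have := dnextP (dstateP n).
rewrite /divnum /divden /dstate !iterS -/(dstate n).
by case: (dstate n) => [[f0 z0] [f1 z1]] /= [_ [h1 h2 h3]]; split=> //; rewrite -h2 addrC.
Qed.

Lemma divnum_monic n : divnum n \is monic.
Proof.
by have := dstateP n; rewrite /divnum; case: (dstate n) => [[f0 z0] [f1 z1]] [].
Qed.
Lemma size_divnum n : size (divnum n) = (n ^ 2).+1.
Proof.
by have := dstateP n; rewrite /divnum; case: (dstate n) => [[f0 z0] [f1 z1]] [_ _ []].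
Qed.
Lemma coprime_divpoly n : coprimep (divnum n) (divden n).
Proof.
by have := dstateP n; rewrite /divnum /divden; case: (dstate n) => [[f0 z0] [f1 z1]] [_ _ _ _ []].
Qed.

Lemma divden2 : divden 2 = omegaW.
Proof.
have [_ Z0 X1 Z1 rec] := divrec_divpoly.
have [_ + _] := rec 0; rewrite Z0 X1 Z1 mulr0 add0r /omegaW => <-.
by have [-> _ _ _ _] := divrec_divpoly; rewrite mul1r.
Qed.

(** The product of the denominators of indices n and n + 2 is the square [formA], so being a square
    propagates in steps of 2 from the value 1 at index 1. A zero denominator is impossible because
    the numerator is coprime to it and not constant. *)
Lemma divden_odd_sqr n : exists psi, divden n.*2.+1 = psi ^+ 2.
Proof.
elim: n => [|n [psi IH]].
  by exists 1; have [_ _ _ -> _] := divrec_divpoly; rewrite expr1n.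
have [_ _ _ _ /(_ n.*2.+1)[+ _ _]] := divrec_divpoly.
rewrite IH /formA; set e := _ - _ => he.
have [p0|p0] := eqVneq psi 0.
  have := size_divnum n.*2.+1; have := coprime_divpoly n.*2.+1.
  by rewrite IH p0 expr0n coprimep0 -size_poly_eq1 => /eqP ->.
have /dvdpP[g hg] : psi %| e.
  by rewrite -(@dvdp_pexp2r _ _ _ 2) // -he dvdp_mull.
exists g; apply: (mulIf (expf_neq0 2 p0)); rewrite doubleS he hg; ring.
Qed.
End DivisionPolynomials.

(** * The kernel of reduction *)

Section Valuations.
Variables (F : fieldType) (v : F -> rat).
Hypothesis v_val : valuation v.
Implicit Types (x y z : F) (r s : rat).

(* v x >= r and v x > r, with the convention v 0 = +oo. *)
Definition vge r x := (x == 0) || (r <= v x).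
Definition vgt r x := (x == 0) || (r < v x).

Lemma val_M x y : x != 0 -> y != 0 -> v (x * y) = v x + v y.
Proof. by case: v_val => h _; apply: h. Qed.
Lemma val_1 : v 1 = 0.
Proof.
have := val_M (oner_neq0 F) (oner_neq0 F).
by rewrite mulr1 -{1}[v 1]addr0 => /addrI.
Qed.
Lemma val_X x n : x != 0 -> v (x ^+ n) = n%:R * v x.
Proof.
move=> x0; elim: n => [|n IH]; first by rewrite expr0 val_1 mul0r.
by rewrite exprS val_M ?expf_neq0 // IH -[n.+1]addn1 natrD mulrDl mul1r addrC.
Qed.

Lemma val_N x : v (- x) = v x.
Proof.
have [->|x0] := eqVneq x 0; first by rewrite oppr0.
have n10 : (-1 : F) != 0 by rewrite oppr_eq0 oner_eq0.
have : v (-1) = 0.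
  have := val_M n10 n10; rewrite mulrNN mulr1 val_1; lra.
by rewrite -[- x]mulN1r (val_M n10 x0) => ->; rewrite add0r.
Qed.

Lemma val_V x : x != 0 -> v x^-1 = - v x.
Proof.
move=> x0; have := val_M x0 (invr_neq0 x0); rewrite divff // val_1; lra.
Qed.
Lemma val_div x y : x != 0 -> y != 0 -> v (x / y) = v x - v y.
Proof. by move=> x0 y0; rewrite val_M ?invr_neq0 // val_V. Qed.

Lemma vge0 r : vge r 0. Proof. by rewrite /vge eqxx. Qed.
Lemma vgt0 r : vgt r 0. Proof. by rewrite /vgt eqxx. Qed.
Lemma vge_v x : vge (v x) x. Proof. by rewrite /vge lexx orbT. Qed.
Lemma vge_nz r x : x != 0 -> vge r x = (r <= v x).
Proof. by rewrite /vge => /negPf ->. Qed.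
Lemma vgt_nz r x : x != 0 -> vgt r x = (r < v x).
Proof. by rewrite /vgt => /negPf ->. Qed.
Lemma vgtW r x : vgt r x -> vge r x.
Proof. by rewrite /vge /vgt; case: eqP => //= _ /ltW. Qed.
Lemma vge_le r s x : s <= r -> vge r x -> vge s x.
Proof. by rewrite /vge; case: eqP => //= _; apply: le_trans. Qed.
Lemma vge_gt r s x : s < r -> vge r x -> vgt s x.
Proof. by rewrite /vgt /vge; case: eqP => //= _; apply: lt_le_trans. Qed.

Lemma vgeN r x : vge r (- x) = vge r x.
Proof. by rewrite /vge oppr_eq0 val_N. Qed.
Lemma vgtN r x : vgt r (- x) = vgt r x.
Proof. by rewrite /vgt oppr_eq0 val_N. Qed.

Lemma vgeD r x y : vge r x -> vge r y -> vge r (x + y).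
Proof.
have [->|x0] := eqVneq x 0; first by rewrite add0r.
have [->|y0] := eqVneq y 0; first by rewrite addr0.
have [->|xy0] := eqVneq (x + y) 0; first by rewrite vge0.
rewrite !vge_nz // => hx hy; apply: le_trans (v_val.2 _ _ x0 y0 xy0).
by rewrite le_min hx hy.
Qed.

Lemma vgtD r x y : vgt r x -> vgt r y -> vgt r (x + y).
Proof.
have [->|x0] := eqVneq x 0; first by rewrite add0r.
have [->|y0] := eqVneq y 0; first by rewrite addr0.
have [->|xy0] := eqVneq (x + y) 0; first by rewrite vgt0.
rewrite !vgt_nz // => hx hy; apply: lt_le_trans (v_val.2 _ _ x0 y0 xy0).
by rewrite lt_min hx hy.
Qed.

Lemma vgeB r x y : vge r x -> vge r y -> vge r (x - y).
Proof. by move=> hx hy; rewrite vgeD ?vgeN. Qed.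
Lemma vgtB r x y : vgt r x -> vgt r y -> vgt r (x - y).
Proof. by move=> hx hy; rewrite vgtD ?vgtN. Qed.

Lemma vgeM r s x y : vge r x -> vge s y -> vge (r + s) (x * y).
Proof.
have [->|x0] := eqVneq x 0; first by rewrite mul0r !vge0.
have [->|y0] := eqVneq y 0; first by rewrite mulr0 !vge0.
by rewrite !vge_nz ?mulf_neq0 // val_M //; apply: lerD.
Qed.

Lemma vgtM r s x y : vgt r x -> vge s y -> vgt (r + s) (x * y).
Proof.
have [->|x0] := eqVneq x 0; first by rewrite mul0r !vgt0.
have [->|y0] := eqVneq y 0; first by rewrite mulr0 !vgt0.
by rewrite !vgt_nz ?vge_nz ?mulf_neq0 // val_M //; apply: ltr_leD.
Qed.

Lemma vgeM0 x y : vge 0 x -> vge 0 y -> vge 0 (x * y).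
Proof. by move=> hx hy; have := vgeM hx hy; rewrite addr0. Qed.
Lemma vgtM0 x y : vgt 0 x -> vge 0 y -> vgt 0 (x * y).
Proof. by move=> hx hy; have := vgtM hx hy; rewrite addr0. Qed.
Lemma vgtM0r x y : vge 0 x -> vgt 0 y -> vgt 0 (x * y).
Proof. by move=> hx hy; rewrite mulrC vgtM0. Qed.

Lemma vge01 : vge 0 1. Proof. by rewrite /vge val_1 lexx orbT. Qed.
Lemma vgeX x n : vge 0 x -> vge 0 (x ^+ n).
Proof. by move=> hx; elim: n => [|n IH]; rewrite ?expr0 ?vge01 // exprS vgeM0. Qed.
Lemma vgeMn r x n : vge r x -> vge r (x *+ n).
Proof. by move=> hx; elim: n => [|n IH]; rewrite ?mulr0n ?vge0 // mulrS vgeD. Qed.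
Lemma vge_nat n : vge 0 n%:R. Proof. by rewrite vgeMn // vge01. Qed.
Lemma vge_sum (I : Type) (s : seq I) (P : pred I) (G : I -> F) r :
  (forall i, P i -> vge r (G i)) -> vge r (\sum_(i <- s | P i) G i).
Proof. by move=> h; elim/big_ind: _ => //; [exact: vge0 | move=> *; exact: vgeD]. Qed.
Lemma vgt_sum (I : Type) (s : seq I) (P : pred I) (G : I -> F) r :
  (forall i, P i -> vgt r (G i)) -> vgt r (\sum_(i <- s | P i) G i).
Proof. by move=> h; elim/big_ind: _ => //; [exact: vgt0 | move=> *; exact: vgtD]. Qed.

Lemma val_dom x y : x != 0 -> vgt (v x) y -> x + y != 0 /\ v (x + y) = v x.
Proof.
move=> x0 hy.
have xy0 : x + y != 0.
  apply: contraTneq hy => /eqP; rewrite addrC addr_eq0 => /eqP ->.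
  by rewrite vgtN vgt_nz // ltxx.
split=> //; apply/eqP; rewrite eq_le -(vge_nz (v x) xy0) (vgeD (vge_v _) (vgtW hy)) andbT.
rewrite leNgt; apply/negP => h.
have : vgt (v x) (x + y - y) by rewrite vgtB // vgt_nz.
by rewrite addrK vgt_nz // ltxx.
Qed.

Lemma val_eq x y : x != 0 -> vgt (v x) (y - x) -> y != 0 /\ v y = v x.
Proof. by move=> x0 h; have := val_dom x0 h; rewrite addrC subrK. Qed.

Lemma val_prod (I : Type) (s : seq I) (P : pred I) (G : I -> F) :
  (forall i, P i -> G i != 0) ->
  v (\prod_(i <- s | P i) G i) = \sum_(i <- s | P i) v (G i).
Proof.
move=> h; suff : \prod_(i <- s | P i) G i != 0 /\
  v (\prod_(i <- s | P i) G i) = \sum_(i <- s | P i) v (G i) by case.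
elim/big_rec2: _ => [|i a b Pi [b0 hb]]; first by rewrite oner_neq0 val_1.
by rewrite mulf_neq0 ?h // val_M ?h // hb.
Qed.

Lemma val_uniq_min (I : finType) (G : I -> F) i : G i != 0 ->
  (forall j, j != i -> vgt (v (G i)) (G j)) ->
  \sum_j G j != 0 /\ v (\sum_j G j) = v (G i).
Proof.
move=> i0 h; rewrite (bigD1 i) //=; apply: val_dom => //.
by apply: vgt_sum => j; apply: h.
Qed.

Lemma val_sum_min (I : finType) (G : I -> F) :
  (forall i j, i != j -> G i != 0 -> G j != 0 -> v (G i) != v (G j)) ->
  forall i, vge (v (\sum_j G j)) (G i) /\ (G i != 0 -> \sum_j G j != 0).
Proof.
move=> hd i; have [i0|i0] := eqVneq (G i) 0; first by rewrite i0 vge0.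
have [k k0 kmin] := arg_minP (fun j => v (G j)) (i0 : (fun j => G j != 0) i).
have [|s0 sv] := @val_uniq_min _ G k k0.
  move=> j jk; rewrite /vgt; have [//|j0 /=] := eqVneq (G j) 0.
  by rewrite lt_neqAle kmin // andbT hd // eq_sym.
by rewrite s0 sv; split=> //; rewrite vge_nz //; exact: kmin.
Qed.

Definition cong x y := [&& vge 0 x, vge 0 y & vgt 0 (x - y)].

Lemma cong_refl x : vge 0 x -> cong x x.
Proof. by move=> h; rewrite /cong h subrr vgt0. Qed.
Lemma congC x y : cong x y = cong y x.
Proof. by rewrite /cong andbCA -[y - x]opprB vgtN. Qed.
Lemma congD x y x' y' : cong x y -> cong x' y' -> cong (x + x') (y + y').
Proof.
move=> /and3P[a b c] /and3P[a' b' c']; rewrite /cong !vgeD //.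
have -> : x + x' - (y + y') = (x - y) + (x' - y') by ring.
exact: vgtD.
Qed.
Lemma congN x y : cong x y -> cong (- x) (- y).
Proof. by move=> /and3P[a b c]; rewrite /cong !vgeN a b -opprD vgtN. Qed.
Lemma congM x y x' y' : cong x y -> cong x' y' -> cong (x * x') (y * y').
Proof.
move=> /and3P[a b c] /and3P[a' b' c']; rewrite /cong !vgeM0 //.
have -> : x * x' - y * y' = (x - y) * x' + y * (x' - y') by ring.
by rewrite /=; apply: vgtD; [exact: vgtM0 | exact: vgtM0r].
Qed.
Lemma congX x y n : cong x y -> cong (x ^+ n) (y ^+ n).
Proof.
move=> h; elim: n => [|n IH]; first by rewrite !expr0 cong_refl // vge01.
by rewrite !exprS congM.
Qed.
Lemma cong_trans x y z : cong x y -> cong y z -> cong x z.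
Proof.
move=> /and3P[a b c] /and3P[a' b' c']; rewrite /cong a b'.
by have := vgtD c c'; rewrite addrA subrK.
Qed.
Lemma cong0 x : vgt 0 x -> cong x 0.
Proof. by move=> h; rewrite /cong vge0 subr0 h (vgtW h). Qed.
Lemma cong1 : cong 1 1. Proof. exact/cong_refl/vge01. Qed.
Lemma cong_nat n : cong n%:R n%:R. Proof. exact/cong_refl/vge_nat. Qed.

Lemma cong_unit x y : cong x y -> y != 0 -> v y = 0 -> x != 0 /\ v x = 0.
Proof.
by move=> /and3P[a b c] y0 vy; rewrite -{1}vy; apply: val_eq; rewrite // vy.
Qed.

Lemma val_nat p n : p \in [pchar F] -> n%:R != 0 :> F -> v n%:R = 0.
Proof.
move=> pF n0; have p_pr := pcharf_prime pF.
have : v (n%:R ^+ p) = v n%:R.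
  by rewrite -(pFrobenius_autE pF) rmorph_nat.
rewrite val_X //; have : (1 < p%:R :> rat) by rewrite ltr1n prime_gt1.
by move=> p1 /eqP; rewrite -subr_eq0 -{2}[v _]mul1r -mulrBl mulf_eq0 subr_eq0 (gt_eqF p1) /= => /eqP.
Qed.
End Valuations.

(** * The filtration of the kernel of reduction by subgroups *)

Section KernelOfReduction.
Variables (F : fieldType) (v : F -> rat).
Hypothesis v_val : valuation v.
Variable E : ecurve F.

Definition integral_curve (W : weierstrass F) :=
  [/\ vge v 0 (wa1 W), vge v 0 (wa2 W), vge v 0 (wa3 W), vge v 0 (wa4 W)
    & vge v 0 (wa6 W)].

Hypothesis hE : integral_curve E.
Implicit Types (P Q : ecpoint E) (r : rat).

Let int1 : vge v 0 (wa1 E). Proof. by case: hE. Qed.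
Let int2 : vge v 0 (wa2 E). Proof. by case: hE. Qed.
Let int3 : vge v 0 (wa3 E). Proof. by case: hE. Qed.
Let int4 : vge v 0 (wa4 E). Proof. by case: hE. Qed.
Let int6 : vge v 0 (wa6 E). Proof. by case: hE. Qed.
Let intn n : vge v 0 n%:R. Proof. exact: vge_nat. Qed.

Lemma int_wb : [/\ vge v 0 (wb2 E), vge v 0 (wb4 E), vge v 0 (wb6 E) & vge v 0 (wb8 E)].
Proof.
rewrite /wb2 /wb4 /wb6 /wb8; split;
  by do ![exact: int1|exact: int2|exact: int3|exact: int4|exact: int6|exact: intn
    |apply: (vgeB v_val)|apply: (vgeD v_val)|apply: (vgeM0 v_val)|apply: (vgeX v_val)].
Qed.

Definition in_kernel (P : cpoint F) : bool :=
  if P is Some (x, _) then (x != 0) && (v x < 0) else true.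
(** In the kernel v(x) = - 2 v(z), so this is the condition v(z) >= r, stated on the abscissa, which
    is what the quadratic for P + Q and P - Q controls. *)
Definition level_ge r (P : cpoint F) : bool :=
  if P is Some (x, _) then (x != 0) && (v x <= - (2%:R * r)) else true.
Definition zc (P : cpoint F) : F := if P is Some (x, y) then - x / y else 0.

Lemma kernel_y x y : on_curve E (Some (x, y)) -> x != 0 -> v x < 0 ->
  y != 0 /\ 2%:R * v y = 3%:R * v x.
Proof.
move=> h x0 vx.
have [r0 rv] : x ^+ 3 + (wa2 E * x ^+ 2 + wa4 E * x + wa6 E) != 0 /\
   v (x ^+ 3 + (wa2 E * x ^+ 2 + wa4 E * x + wa6 E)) = v (x ^+ 3).
  apply: (val_dom v_val); first exact: expf_neq0.
  rewrite (val_X v_val) //.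
  apply: (vgtD v_val); first apply: (vgtD v_val).
  - apply: (@vge_gt _ _ (0 + v (x ^+ 2))); last exact: (vgeM v_val int2 (vge_v _ _)).
    rewrite (val_X v_val) //; lra.
  - apply: (@vge_gt _ _ (0 + v x)); last exact: (vgeM v_val int4 (vge_v _ _)).
    lra.
  - apply: (@vge_gt _ _ 0); last exact: int6.
    lra.
rewrite (val_X v_val) // in rv.
have e : y * (y + (wa1 E * x + wa3 E)) = x ^+ 3 + (wa2 E * x ^+ 2 + wa4 E * x + wa6 E).
  transitivity (y ^+ 2 + wa1 E * x * y + wa3 E * y); first ring.
  by rewrite h; ring.
rewrite -e in r0 rv; move: (r0); rewrite mulf_eq0 negb_or => /andP[y0 y'0].
split=> //; rewrite (val_M v_val) // in rv.
have hs : vge v (v x) (wa1 E * x + wa3 E).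
  apply: (vgeD v_val); last by apply: vge_le int3; lra.
  by have := vgeM v_val int1 (vge_v v x); rewrite add0r.
have [hlt|hle] := ltP (v y) (v x).
  have [_ hy] := val_dom v_val y0 (vge_gt hlt hs).
  rewrite hy in rv; lra.
have := vgeD v_val (vge_le hle (vge_v v y)) hs; rewrite vge_nz //.
lra.
Qed.

Lemma zc_val x y : on_curve E (Some (x, y)) -> x != 0 -> v x < 0 ->
  zc (Some (x, y)) != 0 /\ 2%:R * v (zc (Some (x, y))) = - v x.
Proof.
move=> h x0 vx; have [y0 vy] := kernel_y h x0 vx.
rewrite /= mulf_neq0 ?oppr_eq0 ?invr_neq0 //; split=> //.
rewrite (val_div v_val) ?oppr_eq0 // (val_N v_val); lra.
Qed.

Lemma level_kernel r P : 0 < r -> level_ge r (ecval P) -> in_kernel (ecval P).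
Proof.
by case: (ecval P) => [[x y]|] //= r0 /andP[-> h] /=; lra.
Qed.

Lemma level_zc r P : in_kernel (ecval P) -> level_ge r (ecval P) = vge v r (zc (ecval P)).
Proof.
have hP := ecpP P; case: (ecval P) hP => [[x y]|] hP; last by rewrite /= vge0.
move=> /andP[x0 vx]; have [z0 zv] := zc_val hP x0 vx.
by rewrite /level_ge x0 /= vge_nz //; apply/idP/idP; lra.
Qed.

Lemma level_leq r s P : s <= r -> level_ge r (ecval P) -> level_ge s (ecval P).
Proof. by case: (ecval P) => [[x y]|] //= rs /andP[-> h] /=; lra. Qed.
Lemma level_opp r P : level_ge r (ecval (- P)) = level_ge r (ecval P).
Proof. by rewrite ecvalN; case: (ecval P) => [[x y]|]. Qed.

Lemma formC_val x1 x0 : x1 != 0 -> x0 != 0 -> v x1 < 0 -> v x0 < 0 ->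
  formC E x1 1 x0 != 0 /\ v (formC E x1 1 x0) = 2%:R * v x1 + 2%:R * v x0.
Proof.
move=> n1 n0 h1 h0; have [i2 i4 i6 i8] := int_wb.
have -> : formC E x1 1 x0 = x1 ^+ 2 * x0 ^+ 2 + (- wb4 E * (x1 * x0)
  - wb6 E * (x1 + x0) - wb8 E) by rewrite /formC; ring.
have <- : v (x1 ^+ 2 * x0 ^+ 2) = 2%:R * v x1 + 2%:R * v x0.
  by rewrite (val_M v_val) ?expf_neq0 // !(val_X v_val).
apply: (val_dom v_val); first by rewrite mulf_neq0 ?expf_neq0.
rewrite (val_M v_val) ?expf_neq0 // !(val_X v_val) //.
apply: (vgtB v_val); first apply: (vgtB v_val).
- apply: (@vge_gt _ _ (0 + (v x1 + v x0))); first lra.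
  rewrite mulNr (vgeN v_val); apply: (vgeM v_val i4).
  by rewrite -(val_M v_val) //; apply: vge_v.
- apply: (@vge_gt _ _ (0 + (v x1 + v x0))); first lra.
  apply: (vgeM v_val i6); apply: (vgeD v_val); apply: vge_le (vge_v _ _); lra.
- apply: (@vge_gt _ _ 0) => //; lra.
Qed.

Lemma formB_vge x1 x0 m : x1 != 0 -> x0 != 0 -> v x1 < 0 -> v x0 < 0 ->
  m <= v x1 -> m <= v x0 -> vge v (v x1 + v x0 + m) (formB E x1 1 x0).
Proof.
move=> n1 n0 h1 h0 m1 m0; have [i2 i4 i6 i8] := int_wb.
have -> : formB E x1 1 x0 = (2%:R * (x1 + x0) + wb2 E) * (x1 * x0) +
  (wb4 E * (x1 + x0) + wb6 E) by rewrite /formB; ring.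
have hs : vge v m (x1 + x0).
  by apply: (vgeD v_val); apply: vge_le (vge_v _ _).
apply: (vgeD v_val).
  rewrite addrC; apply: (vgeM v_val); last by rewrite -(val_M v_val) //; apply: vge_v.
  apply: (vgeD v_val); last by apply: vge_le i2; lra.
  by have := vgeM v_val (intn 2) hs; rewrite add0r.
apply: (vgeD v_val); last by apply: vge_le i6; lra.
by apply: vge_le (vgeM v_val i4 hs); lra.
Qed.

(** [formC] gives the exact valuation of the product of the two abscissas, [formB] a lower bound for
    that of their sum, and [formA] controls the scalar. If v X exceeded - 2 r, then X' would
    dominate the sum, and the product divided by the sum would bound v X by - 2 r after all. *)
Lemma vieta_level x1 x0 r X Z X' Z' : x1 != 0 -> x0 != 0 ->
  0 < r -> v x1 <= - (2%:R * r) -> v x0 <= - (2%:R * r) ->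
  (Z = 0 /\ X = 1) \/ Z = 1 -> (Z' = 0 /\ X' = 1) \/ Z' = 1 ->
  vieta (formA x1 1 x0) (formB E x1 1 x0) (formC E x1 1 x0) X Z X' Z' ->
  Z = 1 -> X != 0 /\ v X <= - (2%:R * r).
Proof.
move=> n1 n0 r0 h1 h0 hZ hZ' [t t0 [eA eB eC]] Z1; rewrite {}Z1 in hZ eA eB.
have v1 : v x1 < 0 by lra.
have v0 : v x0 < 0 by lra.
have [C0 Cv] := formC_val n1 n0 v1 v0.
have XX0 : X * X' != 0 by rewrite eC mulf_neq0.
move: (XX0); rewrite mulf_eq0 negb_or => /andP[X0 X'0]; split=> //.
have vC : v X + v X' = v t + (2%:R * v x1 + 2%:R * v x0).
  by rewrite -(val_M v_val) // eC (val_M v_val) // Cv.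
pose m : rat := Num.min (v x1) (v x0).
have m1 : m <= v x1 by rewrite /m ge_min lexx.
have m0 : m <= v x0 by rewrite /m ge_min lexx orbT.
have mm : v x1 + v x0 <= m - 2%:R * r.
  by rewrite /m minEle; case: ifP => _; lra.
have hB := formB_vge n1 n0 v1 v0 m1 m0.
case: hZ' => [[Z'0 X'1]|Z'1].
  have eB1 : t * formB E x1 1 x0 = 1 by rewrite -eB Z'0 X'1; ring.
  have B0 : formB E x1 1 x0 != 0.
    by apply: contraTneq (oner_neq0 F) => e; rewrite -eB1 e mulr0 eqxx.
  have : v t + v (formB E x1 1 x0) = 0.
    by rewrite -(val_M v_val) // eB1 (val_1 v_val).
  rewrite X'1 (val_1 v_val) in vC; rewrite vge_nz // in hB; lra.
have eA1 : t * formA x1 1 x0 = 1 by rewrite -eA Z'1; ring.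
have eB1 : t * formB E x1 1 x0 = X' + X by rewrite -eB Z'1; ring.
have vt : 2%:R * m + v t <= 0.
  have A0 : formA x1 1 x0 != 0.
    by apply: contraTneq (oner_neq0 F) => e; rewrite -eA1 e mulr0 eqxx.
  have eA' : v t + v (formA x1 1 x0) = 0.
    by rewrite -(val_M v_val) // eA1 (val_1 v_val).
  have : vge v (2%:R * m) (formA x1 1 x0).
    have -> : formA x1 1 x0 = (x1 - x0) * (x1 - x0) by rewrite /formA; ring.
    have -> : 2%:R * m = m + m by ring.
    by apply: (vgeM v_val); apply: (vgeB v_val); apply: vge_le (vge_v _ _).
  rewrite vge_nz //; lra.
rewrite leNgt; apply/negP => hX.
have [hlt|hle] := ltP (v X') (v X); last lra.
have [|S0 Sv] := @val_dom _ _ v_val X' X X'0; first by rewrite vgt_nz.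
rewrite -eB1 in S0 Sv.
have B0 : formB E x1 1 x0 != 0.
  by apply: contraNneq S0 => ->; rewrite mulr0.
rewrite (val_M v_val) // in Sv; rewrite vge_nz // in hB; lra.
Qed.

Lemma level_add r P Q : 0 < r -> level_ge r (ecval P) -> level_ge r (ecval Q) ->
  level_ge r (ecval (P + Q)) && level_ge r (ecval (P - Q)).
Proof.
move=> r0; case eQ: (ecval Q) => [[x0 y0]|]; last first.
  have -> : Q = 0 by apply: ecval_inj.
  by rewrite subr0 addr0 => ->.
case eP: (ecval P) => [[x1 y1]|]; last first.
  have -> : P = 0 by apply: ecval_inj.
  by rewrite sub0r add0r level_opp eQ => _ ->.
move=> /andP[n1 h1] /andP[n0 h0].
have := addsub_abscissa P eQ; rewrite eP.
have hZ (S : ecpoint E) : (pZ (ecval S) = 0 /\ pX (ecval S) = 1) \/ pZ (ecval S) = 1.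
  by case: (ecval S) => [[]|]; [right|left].
have lv (S : ecpoint E) :
    (pZ (ecval S) = 1 -> pX (ecval S) != 0 /\ v (pX (ecval S)) <= - (2%:R * r)) ->
    level_ge r (ecval S).
  by case: (ecval S) => [[x y]|] //= /(_ erefl)[-> ->].
move=> hV; apply/andP; split; apply: lv.
  exact: (vieta_level n1 n0 r0 h1 h0 (hZ _) (hZ _) hV).
exact: (vieta_level n1 n0 r0 h1 h0 (hZ _) (hZ _) (vieta_swap hV)).
Qed.

Lemma level_addr r P Q : 0 < r -> level_ge r (ecval P) -> level_ge r (ecval Q) ->
  level_ge r (ecval (P + Q)).
Proof. by move=> r0 h1 h2; have /andP[] := level_add r0 h1 h2. Qed.
Lemma level_subr r P Q : 0 < r -> level_ge r (ecval P) -> level_ge r (ecval Q) ->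
  level_ge r (ecval (P - Q)).
Proof. by move=> r0 h1 h2; have /andP[] := level_add r0 h1 h2. Qed.
Lemma level_mulrn r P n : 0 < r -> level_ge r (ecval P) -> level_ge r (ecval (P *+ n)).
Proof. by move=> r0 h; elim: n => // n IH; rewrite mulrS level_addr. Qed.

Lemma kernel_sub P Q : in_kernel (ecval P) -> in_kernel (ecval Q) ->
  in_kernel (ecval (P - Q)).
Proof.
have ker_level (S : ecpoint E) : in_kernel (ecval S) -> exists2 r, 0 < r & level_ge r (ecval S).
  case: (ecval S) => [[x y]|] /=; last by exists 1.
  by move=> /andP[-> h]; exists (- v x / 2%:R) => /=; lra.
move=> /ker_level[r r0 hr] /ker_level[s s0 hs].
pose m : rat := Num.min r s.
have m0 : 0 < m by rewrite lt_min r0.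
apply: (level_kernel m0); apply: level_subr => //.
  by apply: level_leq hr; rewrite ge_min lexx.
by apply: level_leq hs; rewrite ge_min lexx orbT.
Qed.
End KernelOfReduction.

(* The equations in F slow [lra] down. *)
Ltac qlra := repeat match goal with
  | H : @eq ?A _ _ |- _ => tryif unify A rat then fail else clear H
  end; lra.

(** * The exact level of a difference of points *)

Section DifferenceOfPoints.
Variables (F : fieldType) (E : ecurve F).
Implicit Types (P Q : ecpoint E).

(** Two relations for the slope of the line through P and -Q, multiplied out so that both hold for
    chords and tangents alike. The right-hand sides specialize to the two partial derivatives of the
    equation when the points coincide. *)
Lemma sub_line x1 y1 x2 y2 P Q : ecval P = Some (x1, y1) -> ecval Q = Some (x2, y2) ->
  P != Q -> exists l x3 y3, [/\ ecval (P - Q) = Some (x3, y3),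
    l ^+ 2 + wa1 E * l - wa2 E = x1 + x2 + x3,
    l * (x2 - x1) = - (y1 + y2 + wa1 E * x2 + wa3 E) &
    l * (y2 - y1) = - (x1 ^+ 2 + x1 * x2 + x2 ^+ 2 + wa2 E * (x1 + x2) + wa4 E
      - wa1 E * y1)].
Proof.
move=> eP eQ PQ; have h1 := ecpP P; have h2 := ecpP Q; rewrite eP in h1; rewrite eQ in h2.
have h2' := oppP_on_curve h2; rewrite ecvalD ecvalN eP eQ.
rewrite [oppP _ _]/= in h2' *; set y2' := _ - wa3 E in h2' *.
have hc : ~~ ((x1 == x2) && (y1 + y2' + wa1 E * x2 + wa3 E == 0)).
  apply: contra PQ => /andP[/eqP ex /eqP ey]; apply/eqP/ecval_inj.
  rewrite eP eQ ex; congr (Some (_, _)); apply/eqP.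
  by rewrite -subr_eq0 -ey /y2'; apply/eqP; ring.
have [l [n [x3 [-> [e1 e2] [hs _ _] hcase]]]] := addP_line h1 h2' hc.
exists l, x3, (- (l + wa1 E) * x3 - n - wa3 E).
have hN : l * (x2 - x1) = y2' - y1 by rewrite e2 e1; ring.
split=> //; first by rewrite hN /y2'; ring.
case: hcase => [[nx _]|[ex ey n0 hl]]; last first.
  have -> : y2 - y1 = - (2%:R * y1 + wa1 E * x1 + wa3 E).
    by rewrite ey ex /y2'; ring.
  by rewrite mulrN hl -ex; ring.
apply: (mulIf (_ : x2 - x1 != 0)); first by rewrite subr_eq0 eq_sym.
rewrite mulrAC hN /y2'; move: h1 h2; rewrite /=.
case: (ecW E) => a1 a2 a3 a4 a6 /= h1 h2.
have -> : (- y2 - a1 * x2 - a3 - y1) * (y2 - y1) =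
  y1 ^+ 2 + a1 * x1 * y1 + a3 * y1 - (y2 ^+ 2 + a1 * x2 * y2 + a3 * y2)
  + a1 * y1 * (x2 - x1) by ring.
by rewrite h1 h2; ring.
Qed.

Variable v : F -> rat.
Hypotheses (v_val : valuation v) (hE : integral_curve v E).

Let int1 : vge v 0 (wa1 E). Proof. by case: hE. Qed.
Let int2 : vge v 0 (wa2 E). Proof. by case: hE. Qed.
Let int3 : vge v 0 (wa3 E). Proof. by case: hE. Qed.
Let int4 : vge v 0 (wa4 E). Proof. by case: hE. Qed.
Let int6 : vge v 0 (wa6 E). Proof. by case: hE. Qed.

(** The abscissas of P + Q and P - Q have valuations of sum 2 v x0, and their sum has valuation at
    least v x0. If the two valuations differed, the smaller would be that of the sum and less than v
    x0. *)
Lemma level_sub_diff x1 y1 x0 y0 P Q :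
  ecval P = Some (x1, y1) -> ecval Q = Some (x0, y0) ->
  x1 != 0 -> x0 != 0 -> v x1 < v x0 -> v x0 < 0 ->
  exists x y, [/\ ecval (P - Q) = Some (x, y), x != 0 & v x = v x0].
Proof.
move=> eP eQ n1 n0 h10 h0; have h1 : v x1 < 0 by lra.
have [t t0 []] := addsub_abscissa P eQ; rewrite eP.
rewrite -[pX (Some _)]/x1 -[pZ (Some _)]/(1 : F) => eA eB eC.
have [A0 Av] : x1 - x0 != 0 /\ v (x1 - x0) = v x1.
  by apply: (val_dom v_val) => //; rewrite (vgtN v_val) vgt_nz.
have AE : formA x1 1 x0 = (x1 - x0) ^+ 2 by rewrite /formA; ring.
have tA0 : t * formA x1 1 x0 != 0 by rewrite AE mulf_neq0 ?expf_neq0.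
have [C0 Cv] := formC_val v_val hE n1 n0 h1 h0.
have hB := formB_vge v_val hE n1 n0 h1 h0 (lexx _) (ltW h10).
rewrite -eA in tA0.
move: eA eB eC tA0; case: (ecval (P - Q)) => [[xd yd]|];
  case: (ecval (P + Q)) => [[xs ys]|] /= eA eB eC; rewrite ?(mulr0, mul0r) ?eqxx //.
move=> _; exists xd, yd.
have Xn : xs * xd != 0 by rewrite eC mulf_neq0.
move: (Xn); rewrite mulf_eq0 negb_or => /andP[xs0 xd0]; split=> //.
have vt : v t + 2%:R * v x1 = 0.
  rewrite -Av -(val_X v_val 2 A0) -AE -(val_M v_val) //; last by rewrite AE expf_neq0.
  by rewrite -eA mulr1 (val_1 v_val).
have vC : v xs + v xd = v t + (2%:R * v x1 + 2%:R * v x0).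
  by rewrite -(val_M v_val) // eC (val_M v_val) // Cv.
have hS : vge v (v x0) (xs + xd).
  have -> : xs + xd = t * formB E x1 1 x0 by rewrite -eB; ring.
  apply: vge_le (vgeM v_val (vge_v v t) hB); lra.
have [hlt|hlt|heq] := ltgtP (v xs) (v xd); last lra.
  have [|S0 Sv] := @val_dom _ _ v_val xs xd xs0; first by rewrite vgt_nz.
  rewrite vge_nz // in hS; lra.
have [|S0 Sv] := @val_dom _ _ v_val xd xs xd0; first by rewrite vgt_nz.
rewrite addrC vge_nz // in hS; lra.
Qed.

(** Scaled by powers of z, the curve degenerates to the cusp Y^2 = X^3, and Y = - X by definition of
    z; with X a unit only X = 1 is left. *)
Lemma kernel_cusp x y (z : F) : on_curve E (Some (x, y)) -> x != 0 -> y != 0 -> z != 0 ->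
  0 < v z -> v x = - (2%:R * v z) -> z = - x / y -> cong v (x * z ^+ 2) 1.
Proof.
  move=> h x0 y0 z0 vz0 vx ez.
  have ye : y * z = - x by rewrite ez; field.
  have Xz : x * z ^+ 2 != 0 by rewrite mulf_neq0 ?expf_neq0.
  have Xv : v (x * z ^+ 2) = 0.
    by rewrite (val_M v_val) ?expf_neq0 // (val_X v_val) //; lra.
  have Xi : vge v 0 (x * z ^+ 2) by rewrite vge_nz // Xv.
  rewrite /cong Xi (vge01 v_val) /=.
  have -> : x * z ^+ 2 - 1 = (wa1 E * z ^+ 1 * (- 1) - wa3 E * z ^+ 3 * (x * z ^+ 2)^-1
     - wa2 E * z ^+ 2 - wa4 E * z ^+ 4 * (x * z ^+ 2)^-1
     - wa6 E * z ^+ 6 * (x * z ^+ 2)^-1 * (x * z ^+ 2)^-1).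
    apply: (mulfI (expf_neq0 2 Xz)); rewrite -(mulrA (wa6 E * _)).
    transitivity ((x ^+ 3 + wa2 E * x ^+ 2 + wa4 E * x + wa6 E) * z ^+ 6 - (y * z) ^+ 2 * z ^+ 4
      - wa2 E * x ^+ 2 * z ^+ 6 - wa4 E * x * z ^+ 6 - wa6 E * z ^+ 6).
      by rewrite ye; ring.
    rewrite -h.
    transitivity (wa1 E * x * (y * z) * z ^+ 5 + wa3 E * (y * z) * z ^+ 5
      - wa2 E * x ^+ 2 * z ^+ 6 - wa4 E * x * z ^+ 6 - wa6 E * z ^+ 6); first ring.
    by rewrite ye; field; rewrite x0 z0.
  have sm c n : vge v 0 c -> vgt v 0 (c * z ^+ n.+1).
    move=> ci; apply: (vgtM0r v_val ci); rewrite vgt_nz ?expf_neq0 // (val_X v_val) //.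
    by rewrite mulr_gt0 ?ltr0n.
  have Vi : vge v 0 (x * z ^+ 2)^-1 by rewrite vge_nz ?invr_neq0 // (val_V v_val) // Xv oppr0.
  apply: (vgtB v_val); first apply: (vgtB v_val); first apply: (vgtB v_val);
    first apply: (vgtB v_val).
  - by apply: (vgtM0 v_val); [exact: sm | rewrite (vgeN v_val) (vge01 v_val)].
  - by apply: (vgtM0 v_val) => //; exact: sm.
  - exact: sm.
  - by apply: (vgtM0 v_val) => //; exact: sm.
  - by apply: (vgtM0 v_val) => //; apply: (vgtM0 v_val) => //; exact: sm.
Qed.

(** This replaces the formal group law: z is an injective coordinate on the kernel whose differences
    have the level of the differences of points. When the valuations of z(P) and z(Q) differ it
    follows from [level_sub_diff]; otherwise the slope of the line through P and -Q is compared with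
    z(P) - z(Q). *)
Lemma kernel_sub_exact P Q : in_kernel v (ecval P) -> in_kernel v (ecval Q) -> P != Q ->
  exists x y, [/\ ecval (P - Q) = Some (x, y), x != 0, zc (ecval P) != zc (ecval Q) &
    v x = - (2%:R * v (zc (ecval P) - zc (ecval Q)))].
Proof.
case eQ: (ecval Q) => [[x2 y2]|]; last first.
  have -> : Q = 0 by apply: ecval_inj.
  rewrite subr0; case eP: (ecval P) => [[x1 y1]|]; last first.
    by move=> _ _ /eqP[]; apply: ecval_inj.
  have h1 := ecpP P; rewrite eP in h1.
  move=> /andP[x0 vx] _ _; have [z0 zv] := zc_val v_val hE h1 x0 vx.
  by exists x1, y1; rewrite subr0; split=> //; qlra.
case eP: (ecval P) => [[x1 y1]|]; last first.
  have -> : P = 0 by apply: ecval_inj.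
  have h2 := ecpP Q; rewrite eQ in h2.
  move=> _ /andP[x0 vx] _; have [z0 zv] := zc_val v_val hE h2 x0 vx.
  exists x2, (- y2 - wa1 E * x2 - wa3 E); rewrite sub0r ecvalN eQ; split=> //.
    by rewrite eq_sym.
  by rewrite sub0r (val_N v_val); qlra.
have h1 := ecpP P; have h2 := ecpP Q; rewrite eP in h1; rewrite eQ in h2.
move=> /andP[n1 v1] /andP[n2 v2] PQ.
have [z10 z1v] := zc_val v_val hE h1 n1 v1.
have [z20 z2v] := zc_val v_val hE h2 n2 v2.
have [y10 y1v] := kernel_y v_val hE h1 n1 v1.
have [y20 y2v] := kernel_y v_val hE h2 n2 v2.
set z1 := zc _ in z10 z1v *; set z2 := zc _ in z20 z2v *.
have [hlt|hlt|heq] := ltgtP (v x1) (v x2).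
- have [x [y [e x0 xv]]] := level_sub_diff eP eQ n1 n2 hlt v2.
  have z20' : - z2 != 0 by rewrite oppr_eq0.
  have [|d0 dv] := @val_dom _ _ v_val (- z2) z1 z20'.
    by rewrite (val_N v_val) vgt_nz //; qlra.
  rewrite addrC in d0 dv; rewrite (val_N v_val) in dv.
  by exists x, y; split=> //; [rewrite -subr_eq0 | qlra].
- have [x [y [e x0 xv]]] := level_sub_diff eQ eP n2 n1 hlt v1.
  have [|d0 dv] := @val_dom _ _ v_val z1 (- z2) z10.
    by rewrite (vgtN v_val) vgt_nz //; qlra.
  exists x, (- y - wa1 E * x - wa3 E).
  rewrite -[P - Q]opprB ecvalN e; split=> //; first by rewrite -subr_eq0.
  qlra.
have [l [x3 [y3 [e3 hs hN hG]]]] := sub_line eP eQ PQ.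
exists x3, y3; rewrite e3.
set G := _ - wa1 E * y1 in hG.
set N := y1 + y2 + _ + _ in hN.
(* The combination of the two slope relations in which the factor z1 - z2 appears; multiplied by
   z1^6 it is integral. *)
pose H := - N * y1 + x1 * G.
have hH : l * (z1 - z2) * (y1 * y2) = H.
  transitivity (l * (x2 - x1) * y1 - x1 * (l * (y2 - y1))).
    by rewrite /z1 /z2 /zc; field; rewrite y10 y20.
  by rewrite hN hG /H; ring.
have vz n : v (z1 ^+ n) = n%:R * v z1 by rewrite (val_X v_val).
have int_scaled c n : c != 0 -> v c + n%:R * v z1 = 0 -> vge v 0 (c * z1 ^+ n).
  by move=> c0 cv; rewrite vge_nz ?mulf_neq0 ?expf_neq0 // (val_M v_val) ?expf_neq0 // vz cv.
have X1i : vge v 0 (x1 * z1 ^+ 2) by apply: int_scaled => //; qlra.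
have X2i : vge v 0 (x2 * z1 ^+ 2) by apply: int_scaled => //; qlra.
have Y1i : vge v 0 (y1 * z1 ^+ 3) by apply: int_scaled => //; qlra.
have Y2i : vge v 0 (y2 * z1 ^+ 3) by apply: int_scaled => //; qlra.
have z1gt : 0 < v z1 by qlra.
have small c n : vge v 0 c -> vgt v 0 (c * z1 ^+ n.+1).
  move=> ci; apply: (vgtM0r v_val ci); rewrite vgt_nz ?expf_neq0 // vz.
  by rewrite mulr_gt0 ?ltr0n.
pose X1 := x1 * z1 ^+ 2; pose X2 := x2 * z1 ^+ 2.
pose Y1 := y1 * z1 ^+ 3; pose Y2 := y2 * z1 ^+ 3.
pose c1 := wa1 E * z1 ^+ 1; pose c2 := wa2 E * z1 ^+ 2.
pose c3 := wa3 E * z1 ^+ 3; pose c4 := wa4 E * z1 ^+ 4.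
have HE : H * z1 ^+ 6 = - (Y1 + Y2 + c1 * X2 + c3) * Y1 +
  X1 * (X1 ^+ 2 + X1 * X2 + X2 ^+ 2 + c2 * (X1 + X2) + c4 - c1 * Y1).
  by rewrite /H /N /G /Y1 /Y2 /X1 /X2 /c1 /c2 /c3 /c4; ring.
have c1s : vgt v 0 c1 by apply: small.
have c2s : vgt v 0 c2 by apply: small.
have c3s : vgt v 0 c3 by apply: small.
have c4s : vgt v 0 c4 by apply: small.
have vlD : l * (z1 - z2) != 0 -> v (l * (z1 - z2)) = v (H * z1 ^+ 6) /\ H * z1 ^+ 6 != 0.
  have yy0 : y1 * y2 != 0 by rewrite mulf_neq0.
  have z60 : z1 ^+ 6 != 0 by rewrite expf_neq0.
  move=> m0; rewrite -hH; split; last by apply: mulf_neq0 => //; apply: mulf_neq0.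
  rewrite [RHS](val_M v_val (mulf_neq0 m0 yy0) z60) vz (val_M v_val m0 yy0).
  by rewrite (val_M v_val y10 y20); qlra.
have iz1 : vge v (v z1) (z1 - z2).
  by apply: (vgeB v_val); [exact: vge_v | rewrite vge_nz //; qlra].
have [hgt|hng] := boolP (vgt v (v z1) (z1 - z2)); last first.
  move: hng; rewrite /vgt negb_or -leNgt => /andP[d0 dle].
  have dv : v (z1 - z2) = v z1.
    by apply/eqP; rewrite eq_le dle -(vge_nz v _ d0).
  have z12 : z1 != z2 by rewrite -subr_eq0.
  rewrite dv.
  have : level_ge v (v z1) (ecval (P - Q)).
    apply: (level_subr v_val hE) => //.
      by rewrite eP /= n1 /=; qlra.
    by rewrite eQ /= n2 /=; qlra.
  rewrite e3 => /andP[x30 x3v]; split=> //.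
  apply/eqP; rewrite eq_le x3v /= leNgt; apply/negP => hlt.
  have [l0 lv] : l != 0 /\ v l < - v z1.
    rewrite ltNge.
    have [l0|l0] := eqVneq l 0; last first.
      split=> //; apply/negP => hle; move: hlt; apply/negP; rewrite -leNgt -vge_nz //.
      have -> : x3 = l * l + wa1 E * l - wa2 E - x1 - x2.
        by rewrite -[LHS](addKr (x1 + x2)) -hs; ring.
      have hl : vge v (- v z1) l by rewrite vge_nz.
      apply: (vgeB v_val); first apply: (vgeB v_val); first apply: (vgeB v_val);
        first apply: (vgeD v_val).
      - apply: vge_le (vgeM v_val hl hl); qlra.
      - apply: vge_le (vgeM v_val int1 hl); qlra.
      - apply: vge_le int2; qlra.
      - by rewrite vge_nz //; qlra.
      - by rewrite vge_nz //; qlra.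
    exfalso; move: hlt; apply/negP; rewrite -leNgt -vge_nz //.
    have -> : x3 = - wa2 E - x1 - x2.
      by rewrite -[LHS](addKr (x1 + x2)) -hs l0; ring.
    apply: (vgeB v_val); first apply: (vgeB v_val); first by rewrite (vgeN v_val); apply: vge_le int2; qlra.
      by rewrite vge_nz //; qlra.
    by rewrite vge_nz //; qlra.
  have ld0 : l * (z1 - z2) != 0 by rewrite mulf_neq0.
  have [e He] := vlD ld0.
  rewrite (val_M v_val) // dv in e.
  suff : vge v 0 (H * z1 ^+ 6) by rewrite vge_nz //; qlra.
  rewrite HE; apply: (vgeD v_val); apply: (vgeM0 v_val) => //.
    rewrite (vgeN v_val); apply: (vgeD v_val); last exact: vgtW.
    apply: (vgeD v_val); last by apply: (vgeM0 v_val) => //; apply: vgtW.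
    exact: (vgeD v_val).
  apply: (vgeB v_val); last by apply: (vgeM0 v_val) => //; apply: vgtW.
  apply: (vgeD v_val); last exact: vgtW.
  apply: (vgeD v_val); last first.
    by apply: (vgeM0 v_val); [exact: vgtW | exact: (vgeD v_val)].
  apply: (vgeD v_val); last exact: (vgeX v_val).
  by apply: (vgeD v_val); [exact: (vgeX v_val) | exact: (vgeM0 v_val)].
have v2z : v z2 = v z1 by qlra.
have X1c : cong v X1 1 by apply: (kernel_cusp h1) => //; qlra.
have X2c' : cong v (x2 * z2 ^+ 2) 1 by apply: (kernel_cusp h2) => //; qlra.
have u_c : cong v (z1 / z2) 1.
  have q0 : z1 / z2 != 0 by rewrite mulf_neq0 ?invr_neq0.
  rewrite /cong (vge01 v_val) (vge_nz _ _ q0) (val_div v_val) //.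
  rewrite v2z subrr lexx /=.
  have -> : z1 / z2 - 1 = (z1 - z2) * z2^-1 by field.
  have := vgtM v_val hgt (vge_v v z2^-1); rewrite (val_V v_val) // v2z.
  by rewrite subrr.
have X2c : cong v X2 1.
  have -> : X2 = (x2 * z2 ^+ 2) * (z1 / z2) ^+ 2 by rewrite /X2; field.
  have -> : 1 = 1 * 1 ^+ 2 :> F by ring.
  by apply: (congM v_val) => //; apply: (congX v_val).
have Y1c : cong v Y1 (- 1).
  have -> : Y1 = - X1 by rewrite /Y1 /X1 /z1 /zc; field.
  exact: (congN v_val).
have Y2c : cong v Y2 (- 1).
  have -> : Y2 = - (X2 * (z1 / z2)).
    have z2E : z2 = - x2 / y2 by [].
    by rewrite /Y2 /X2 z2E; field; rewrite ?oppr_eq0 ?n2 ?y20.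
  apply: (congN v_val); rewrite -[1]mulr1; exact: (congM v_val).
(* At X1 = X2 = 1, Y1 = Y2 = -1 and all c equal to 0 the scaled expression is - 2 + 3 = 1, a unit in
   every characteristic. The slope is thus inverse to z1 - z2 up to a unit. *)
have Hc : cong v (H * z1 ^+ 6) 1.
  have -> : 1 = - ((-1) + (-1) + 0 * 1 + 0) * (-1) +
    1 * (1 ^+ 2 + 1 * 1 + 1 ^+ 2 + 0 * (1 + 1) + 0 - 0 * (-1)) :> F by ring.
  rewrite HE.
  have c10 := cong0 c1s. have c20 := cong0 c2s. have c30 := cong0 c3s. have c40 := cong0 c4s.
  have c11 := cong1 v_val.
  by do ![assumption|apply: (congN v_val)|apply: (congD v_val)|apply: (congM v_val)|apply: (congX v_val)].
have [H0 Hv] := cong_unit v_val Hc (oner_neq0 _) (val_1 v_val).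
have lD0 : l * (z1 - z2) != 0.
  by apply: contraNneq H0 => e; rewrite -hH e !mul0r.
move: (lD0); rewrite mulf_eq0 negb_or => /andP[l0 D0].
have [eH _] := vlD lD0; rewrite (val_M v_val) // Hv in eH.
rewrite vgt_nz // in hgt.
have ll0 : l * l != 0 by rewrite mulf_neq0.
have llv : v (l * l) = - (2%:R * v (z1 - z2)) by rewrite (val_M v_val) //; qlra.
have x3E : x3 = l * l + (wa1 E * l - wa2 E - x1 - x2).
  by rewrite -[LHS](addKr (x1 + x2)) -hs; ring.
have vl : vge v (v l) l := vge_v _ _.
have [|X0 Xv] := @val_dom _ _ v_val (l * l) (wa1 E * l - wa2 E - x1 - x2) ll0.
  rewrite llv; apply: (vgtB v_val); first apply: (vgtB v_val); first apply: (vgtB v_val).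
  - by apply: vge_gt (vgeM v_val int1 vl); qlra.
  - by apply: vge_gt int2; qlra.
  - by rewrite vgt_nz //; qlra.
  - by rewrite vgt_nz //; qlra.
by split=> //; [rewrite x3E | rewrite -subr_eq0 | rewrite x3E Xv llv].
Qed.
End DifferenceOfPoints.

(** * Points with the same good reduction *)

Section GoodReductionDifference.
Variables (F : fieldType) (E : ecurve F) (v : F -> rat).
Hypotheses (v_val : valuation v) (hE : integral_curve v E).
Implicit Types (P Q : ecpoint E).

Let int1 : vge v 0 (wa1 E). Proof. by case: hE. Qed.
Let int2 : vge v 0 (wa2 E). Proof. by case: hE. Qed.
Let int3 : vge v 0 (wa3 E). Proof. by case: hE. Qed.
Let int4 : vge v 0 (wa4 E). Proof. by case: hE. Qed.
Let int6 : vge v 0 (wa6 E). Proof. by case: hE. Qed.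

(** A non-integral slope of the line through P and -Q puts P - Q into the kernel. By the relations
    of [sub_line], whose left factors are small, an integral slope would make both partial
    derivatives at P small; the reduced curve would be singular, against the unit discriminant. *)
Lemma kernel_sub_cong x1 y1 x2 y2 P Q :
  ecval P = Some (x1, y1) -> ecval Q = Some (x2, y2) -> v (discW E) = 0 ->
  cong v x1 x2 -> cong v y1 y2 -> in_kernel v (ecval (P - Q)).
Proof.
move=> eP eQ hD cx cy.
have [->|PQ] := eqVneq P Q; first by rewrite subrr.
have h1 := ecpP P; have h2 := ecpP Q; rewrite eP in h1; rewrite eQ in h2.
have [l [x3 [y3 [-> hs hN hG]]]] := sub_line eP eQ PQ.
have cc1 := cong_refl int1. have cc2 := cong_refl int2.
have cc3 := cong_refl int3. have cc4 := cong_refl int4.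
have cc6 := cong_refl int6.
have x1i : vge v 0 x1 by case/and3P: cx.
have y1i : vge v 0 y1 by case/and3P: cy.
have cxx := cong_refl x1i. have cyy := cong_refl y1i.
suff [l0 vl] : l != 0 /\ v l < 0.
  have ll0 : l * l != 0 by rewrite mulf_neq0.
  have x3E : x3 = l * l + (wa1 E * l - wa2 E - x1 - x2).
    by rewrite -[LHS](addKr (x1 + x2)) -hs; ring.
  have x2i : vge v 0 x2 by case/and3P: cx.
  have llv : v (l * l) = 2%:R * v l by rewrite (val_M v_val) //; lra.
  have [|X0 Xv] := @val_dom _ _ v_val (l * l) (wa1 E * l - wa2 E - x1 - x2) ll0.
    rewrite llv; apply: (vgtB v_val); first apply: (vgtB v_val); first apply: (vgtB v_val).
    - by apply: vge_gt (vgeM v_val int1 (vge_v v l)); lra.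
    - by apply: vge_gt int2; lra.
    - by apply: vge_gt x1i; lra.
    - by apply: vge_gt x2i; lra.
  by rewrite /in_kernel x3E X0 Xv llv /=; lra.
have unit_slope a b : l * a = b -> vgt v 0 a -> ~~ vgt v 0 b -> l != 0 /\ v l < 0.
  move=> e ha hb; have l0 : l != 0 by apply: contraNneq hb => l0; rewrite -e l0 mul0r vgt0.
  split=> //; rewrite ltNge; apply: contra hb => vl; rewrite -e.
  by apply: (vgtM0r v_val) => //; rewrite vge_nz.
have dx : vgt v 0 (x2 - x1) by case/and3P: cx => _ _; rewrite -opprB (vgtN v_val).
have dy : vgt v 0 (y2 - y1) by case/and3P: cy => _ _; rewrite -opprB (vgtN v_val).
have [hn|hn] := boolP (vgt v 0 (- (y1 + y2 + wa1 E * x2 + wa3 E))); last first.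
  exact: unit_slope hN dx hn.
have [hg|hg] := boolP (vgt v 0 (- (x1 ^+ 2 + x1 * x2 + x2 ^+ 2 + wa2 E * (x1 + x2) + wa4 E
      - wa1 E * y1))); last exact: unit_slope hG dy hg.
exfalso.
have cx' : cong v x2 x1 by rewrite (congC v_val).
have cy' : cong v y2 y1 by rewrite (congC v_val).
have cN : cong v (- (y1 + y2 + wa1 E * x2 + wa3 E)) (- (y1 + y1 + wa1 E * x1 + wa3 E)).
  by do ![assumption|apply: (congN v_val)|apply: (congD v_val)|apply: (congM v_val)|apply: (congX v_val)].
have cG : cong v (- (x1 ^+ 2 + x1 * x2 + x2 ^+ 2 + wa2 E * (x1 + x2) + wa4 E - wa1 E * y1))
    (- (x1 ^+ 2 + x1 * x1 + x1 ^+ 2 + wa2 E * (x1 + x1) + wa4 E - wa1 E * y1)).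
  by do ![assumption|apply: (congN v_val)|apply: (congD v_val)|apply: (congM v_val)|apply: (congX v_val)].
(* Subtracting [eta] from a3 and [ga] from a4 and adjusting a6 gives an equation singular at P,
   whose discriminant is identically 0, and it is congruent to E. *)
pose eta := y1 + y1 + wa1 E * x1 + wa3 E.
pose ga := x1 ^+ 2 + x1 * x1 + x1 ^+ 2 + wa2 E * (x1 + x1) + wa4 E - wa1 E * y1.
have eta0 : cong v (wa3 E) (wa3 E - eta).
  rewrite /cong int3 (vgeB v_val) //=.
    have -> : wa3 E - (wa3 E - eta) = eta by ring.
    have e0 : cong v (- eta) 0.
      by apply: (cong_trans v_val (y := - (y1 + y2 + wa1 E * x2 + wa3 E)));
        [rewrite (congC v_val) | exact: cong0].
    by case/and3P: e0 => _ _; rewrite subr0 (vgtN v_val).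
  by case/and3P: cN => _; rewrite (vgeN v_val).
have ga0 : cong v (wa4 E) (wa4 E - ga).
  rewrite /cong int4 (vgeB v_val) //=.
    have -> : wa4 E - (wa4 E - ga) = ga by ring.
    have e0 : cong v (- ga) 0.
      by apply: (cong_trans v_val _ (cong0 hg)); rewrite (congC v_val).
    by case/and3P: e0 => _ _; rewrite subr0 (vgtN v_val).
  by case/and3P: cG => _; rewrite (vgeN v_val).
have a60 : cong v (wa6 E) (y1 ^+ 2 + wa1 E * x1 * y1 + (wa3 E - eta) * y1 -
    (x1 ^+ 3 + wa2 E * x1 ^+ 2 + (wa4 E - ga) * x1)).
  have {1}-> : wa6 E = y1 ^+ 2 + wa1 E * x1 * y1 + wa3 E * y1 -
    (x1 ^+ 3 + wa2 E * x1 ^+ 2 + wa4 E * x1) by rewrite h1; ring.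
  do ![exact: cc1|exact: cc2|exact: cxx|exact: cyy|exact: eta0|exact: ga0
   |apply: (congD v_val)|apply: (congN v_val)|apply: (congM v_val)|apply: (congX v_val)].
have : cong v (discW E) 0.
  have -> : 0 = discW (Weierstrass (wa1 E) (wa2 E) (wa3 E - eta) (wa4 E - ga)
     (y1 ^+ 2 + wa1 E * x1 * y1 + (wa3 E - eta) * y1 -
    (x1 ^+ 3 + wa2 E * x1 ^+ 2 + (wa4 E - ga) * x1))).
    by rewrite /discW /eta /ga; ring.
  move: cc1 cc2 eta0 ga0 a60; rewrite /discW.
  case: (ecW E) => a1 a2 a3 a4 a6 /=.
  move: (a3 - eta) (a4 - ga) => b3 b4.
  move: (y1 ^+ 2 + a1 * x1 * y1 + b3 * y1 - _) => b6 q1 q2 q3 q4 q6.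
  do ![exact: q1|exact: q2|exact: q3|exact: q4|exact: q6|exact: (cong_nat v_val)
   |apply: (congD v_val)|apply: (congN v_val)|apply: (congM v_val)|apply: (congX v_val)].
case/and3P=> _ _; rewrite subr0 vgt_nz ?hD ?ltxx //; exact: ec_elliptic.
Qed.
End GoodReductionDifference.

(** * Conjugate elements over a complete field have the same valuation *)

Section ConjugateValuations.
Variables (K : fieldType) (vK : K -> rat).
Hypothesis vK_val : valuation vK.

Definition complete_val (F : fieldType) (w : F -> rat) := forall u : nat -> F,
  (forall k, vge w k%:R (u k.+1 - u k)) ->
  exists l, forall k, vge w k%:R (u k - l).

Hypothesis vK_complete : complete_val vK.
Variables (Om : fieldType) (v : Om -> rat) (iota : {rmorphism K -> Om}).
Hypotheses (v_val : valuation v) (v_ext : forall x, x != 0 -> v (iota x) = vK x).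

Lemma vge_ext r x : vge v r (iota x) = vge vK r x.
Proof.
rewrite /vge fmorph_eq0; have [//|x0] := eqVneq x 0; by rewrite v_ext.
Qed.

Lemma vge_all x : (forall n : nat, vge v n%:R x) -> x = 0.
Proof.
move=> h; apply/eqP; apply: contraT => x0.
have := h (Num.bound `|v x|); rewrite vge_nz // => hb.
have := archi_boundP (normr_ge0 (v x)); have := ler_norm (v x); lra.
Qed.

Definition norm_equiv (n : nat) (e : nat -> Om) := exists C : rat,
  forall c : nat -> K, forall r, vge v r (\sum_(i < n) iota (c i) * e i) ->
    forall i, (i < n)%N -> vge vK (r - C) (c i).

(** Equivalence of norms in finite dimension, by induction on n: by the induction hypothesis the
    span of the first n vectors is complete, so the last vector stays at a bounded distance from
    it. *)
Lemma norm_equiv_indep n (e : nat -> Om) :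
  (forall c : nat -> K, \sum_(i < n) iota (c i) * e i = 0 ->
     forall i, (i < n)%N -> c i = 0) -> norm_equiv n e.
Proof.
elim: n => [|n IH] hind; first by exists 0.
have [|C hC] := IH.
  move=> c hc i hi; pose c' k := if (k < n)%N then c k else 0.
  have : c' i = 0.
    apply: (hind c') (ltnW hi : (i < n.+1)%N); rewrite big_ord_recr /= /c' ltnn rmorph0 mul0r addr0.
    by rewrite -[RHS]hc; apply: eq_bigr => k _; rewrite ltn_ord.
  by rewrite /c' hi.
(* Without such a bound there are combinations approaching - e n arbitrarily fast; their
   coefficients are Cauchy sequences, and the limits give a linear relation. *)
have [B hB] : exists B : rat, forall c : nat -> K,
    ~ vge v B (e n + \sum_(i < n) iota (c i) * e i).
  apply: contrapT => hno.
  have ex (k : nat) : exists c : nat -> K,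
      vge v (k%:R + (`|C| + 1)) (e n + \sum_(i < n) iota (c i) * e i).
    apply: contrapT => hk; apply: hno; exists (k%:R + (`|C| + 1)) => c hc.
    by apply: hk; exists c.
  pose u k := proj1_sig (cid (ex k)); have hu k := proj2_sig (cid (ex k)).
  have cau i : (i < n)%N -> forall k, vge vK k%:R (u k.+1 i - u k i).
    move=> hi k.
    apply: (@vge_le _ _ (k%:R + (`|C| + 1) - C)); first by have := ler_norm C; lra.
    apply: (hC (fun i => u k.+1 i - u k i)) => //.
    have -> : \sum_(i0 < n) iota (u k.+1 i0 - u k i0) * e i0 =
      (e n + \sum_(i < n) iota (u k.+1 i) * e i) - (e n + \sum_(i < n) iota (u k i) * e i).
      rewrite opprD addrACA subrr add0r -sumrB; apply: eq_bigr => j _.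
      by rewrite rmorphB mulrBl.
    apply: (vgeB v_val); last exact: hu.
    by apply: vge_le (hu k.+1); rewrite -[k.+1]addn1 natrD; lra.
  have lim i : exists l, (i < n)%N -> forall k, vge vK k%:R (u k i - l).
    have [hi|_] := boolP (i < n)%N; last by exists 0.
    have [l hl] := vK_complete (u := fun k => u k i) (cau i hi); by exists l.
  pose l i := proj1_sig (cid (lim i)); have hl i := proj2_sig (cid (lim i)).
  pose l' k := if (k < n)%N then l k else 1.
  have := hind l'; rewrite big_ord_recr /= => /(_ _ n (ltnSn n)).
  rewrite /l' ltnn => /(_ _)/eqP; rewrite oner_eq0 => h; apply: notF; apply: h.
  rewrite rmorph1 mul1r addrC.
  have -> : \sum_(i < n) iota (if (i < n)%N then l i else 1) * e i = \sum_(i < n) iota (l i) * e i.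
    by apply: eq_bigr => i _; rewrite ltn_ord.
  have [m hm] : exists m : nat, forall i, (i < n)%N -> vge v (- m%:R) (e i).
    exists (\max_(i < n) Num.bound `|v (e i)|) => i hi.
    have [->|ei0] := eqVneq (e i) 0; first exact: vge0.
    rewrite vge_nz //.
    have h1 := @leq_bigmax _ (fun i : 'I_n => Num.bound `|v (e i)|) (Ordinal hi).
    rewrite -(ler_nat rat) /= in h1.
    have := archi_boundP (normr_ge0 (v (e i))).
    have : - v (e i) <= `|v (e i)| by rewrite -normrN ler_norm.
    lra.
  apply: vge_all => N.
  have -> : e n + \sum_(i < n) iota (l i) * e i =
     (e n + \sum_(i < n) iota (u (N + m)%N i) * e i)
     - \sum_(i < n) iota (u (N + m)%N i - l i) * e i.
    rewrite -[RHS]addrA -sumrB; congr (_ + _); apply: eq_bigr => i _.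
    by rewrite rmorphB; ring.
  apply: (vgeB v_val).
    have hm0 : 0 <= m%:R :> rat by exact: ler0n.
    by apply: vge_le (hu (N + m)%N); rewrite natrD; have := normr_ge0 C; lra.
  apply: (vge_sum v_val) => i _.
  have -> : N%:R = (N + m)%:R + - m%:R :> rat by rewrite natrD; lra.
  apply: (vgeM v_val); last exact: hm.
  by rewrite vge_ext; apply: hl.
have key (c : nat -> K) r : vge v r (\sum_(i < n.+1) iota (c i) * e i) -> vge vK (r - B) (c n).
  move=> h; rewrite /vge; have [//|cn0 /=] := eqVneq (c n) 0.
  rewrite leNgt; apply/negP => hlt; apply: (hB (fun i => (c n)^-1 * c i)).
  have -> : e n + \sum_(i < n) iota ((c n)^-1 * c i) * e i =
     iota (c n)^-1 * \sum_(i < n.+1) iota (c i) * e i.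
    rewrite big_ord_recr /= mulrDr addrC mulrA -rmorphM mulVf // rmorph1 mul1r.
    by congr (_ + _); rewrite mulr_sumr; apply: eq_bigr => i _; rewrite rmorphM mulrA.
  have hn : vge v (- vK (c n)) (iota (c n)^-1).
    by rewrite vge_ext vge_nz ?invr_neq0 // (val_V vK_val).
  by apply: vge_le (vgeM v_val hn h); lra.
have [m hm] : exists m : rat, vge v m (e n) by exists (v (e n)); apply: vge_v.
exists (`|B| + `|C| + `|B - m + C|) => c r h i.
have hcn := key c r h.
rewrite ltnS leq_eqVlt => /orP[/eqP ->|hi].
  by apply: vge_le hcn; have := ler_norm B; have := normr_ge0 C; have := normr_ge0 (B - m + C); lra.
have hs : vge v (Num.min r (r - B + m)) (\sum_(i < n) iota (c i) * e i).
  have -> : \sum_(i < n) iota (c i) * e i =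
    \sum_(i < n.+1) iota (c i) * e i - iota (c n) * e n by rewrite big_ord_recr /= addrK.
  apply: (vgeB v_val); first by apply: vge_le h; rewrite ge_min lexx.
  apply: vge_le (vgeM v_val (_ : vge v (r - B) _) hm); first by rewrite ge_min lexx orbT.
  by rewrite vge_ext.
apply: vge_le (hC _ _ hs _ hi); rewrite minEle; case: ifP => _.
  by have := ler_norm C; have := normr_ge0 B; have := normr_ge0 (B - m + C); lra.
by have := ler_norm (B - m + C); have := normr_ge0 B; have := normr_ge0 C; lra.
Qed.

Variables (g : {poly K}) (b b' : Om).
Hypotheses (g_irr : irreducible_poly g) (gb : root (map_poly iota g) b) (gb' : root (map_poly iota g) b').

Let ev (a : Om) (f : {poly K}) := (map_poly iota f).[a].
Lemma root_ev_mod a f : root (map_poly iota g) a -> ev a (f %% g) = ev a f.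
Proof.
move=> ga; rewrite {2}(divp_eq f g) /ev rmorphD rmorphM hornerD hornerM.
by rewrite (rootP ga) mulr0 add0r.
Qed.

Lemma root_ev_eq0 a f : root (map_poly iota g) a -> (ev a f == 0) = (g %| f).
Proof.
move=> ga; apply/eqP/idP => [e|/dvdpP[h ->]]; last first.
  by rewrite /ev rmorphM hornerM (rootP ga) mulr0.
apply: contraT => ngf; have := irredp_XsubC.
have : coprimep (map_poly iota g) (map_poly iota f).
  by rewrite coprimep_map irreducible_poly_coprime.
by move=> /coprimep_root/(_ ga); rewrite -/(ev a f) e eqxx.
Qed.

Let r := (size g).-1.
Lemma ev_sum a (c : nat -> K) m : \sum_(i < m) iota (c i) * a ^+ i = ev a (\poly_(i < m) c i).
Proof.
rewrite /ev poly_def rmorph_sum horner_sum; apply: eq_bigr => i _.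
by rewrite /= map_polyZ map_polyXn hornerZ hornerXn.
Qed.

Lemma conj_bound : exists C : rat, forall f s, vge v s (ev b f) -> vge v (s - C) (ev b' f).
Proof.
have gs : (1 < size g)%N := g_irr.1.
have [|C hC] := @norm_equiv_indep r (fun i => b ^+ i).
  move=> c; rewrite ev_sum => /eqP; rewrite root_ev_eq0 // => gd i hi.
  have : \poly_(i < r) c i = 0.
    apply/eqP; apply: contraT => nz; have := dvdp_leq nz gd.
    by rewrite leqNgt (leq_ltn_trans (size_poly _ _)) // /r; case: (size g) gs.
  by move=> /(congr1 (fun h : {poly K} => h`_i)); rewrite coef_poly hi coef0.
have [m hm] : exists m : rat, forall i, (i < r)%N -> vge v m (b' ^+ i).
  exists (- \sum_(i < r) `|v (b' ^+ i)|) => i hi.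
  apply: vge_le (vge_v v _).
  rewrite lerNl (bigD1 (Ordinal hi)) //=.
  have := ler_norm (- v (b' ^+ i)); rewrite normrN => h.
  have : 0 <= \sum_(k < r | k != Ordinal hi) `|v (b' ^+ k)| by apply: sumr_ge0.
  lra.
exists (C - m) => f s; rewrite -(root_ev_mod _ gb) -(root_ev_mod _ gb').
have sf : (size (f %% g)%R <= r)%N.
  by rewrite -ltnS /r prednK ?ltn_modp -?size_poly_gt0 ?(ltnW gs).
have evE a : ev a (f %% g) = \sum_(i < r) iota (f %% g)`_i * a ^+ i.
  rewrite ev_sum; congr (ev _ _); apply/polyP => i; rewrite coef_poly.
  by case: ltnP => // hi; rewrite nth_default // (leq_trans sf).
rewrite !evE => /(hC (fun i => (f %% g)`_i)) h.
apply: (vge_sum v_val) => i _.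
have -> : s - (C - m) = (s - C) + m by ring.
by apply: (vgeM v_val); [rewrite vge_ext; apply: h | apply: hm].
Qed.
End ConjugateValuations.

Section ConjugateValues.
Variables (K : fieldType) (vK : K -> rat) (Om : fieldType) (v : Om -> rat) (iota : {rmorphism K -> Om}).
Hypotheses (vK_val : valuation vK) (vK_complete : complete_val vK) (v_val : valuation v)
  (v_ext : forall x, x != 0 -> v (iota x) = vK x).
Variable g : {poly K}.
Hypothesis g_irr : irreducible_poly g.

(** [conj_bound] compares the two valuations only up to a constant C, but it applies to every power
    of f with the same C. A strict inequality in the wrong direction would be multiplied by the
    exponent and exceed C. *)
Lemma conj_val_le (b b' : Om) f :
  root (map_poly iota g) b -> root (map_poly iota g) b' ->
  (map_poly iota f).[b] != 0 ->
  v (map_poly iota f).[b] <= v (map_poly iota f).[b'].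
Proof.
move=> gb gb' nz.
have nz' : (map_poly iota f).[b'] != 0.
  by rewrite (root_ev_eq0 g_irr _ gb') -(root_ev_eq0 g_irr _ gb).
have [C hC] := conj_bound vK_val vK_complete v_val v_ext g_irr gb gb'.
rewrite leNgt; apply/negP => hlt.
set d := v (map_poly iota f).[b] - v (map_poly iota f).[b'].
have d0 : 0 < d by rewrite subr_gt0.
pose k := Num.bound `|C / d|.
have := hC (f ^+ k) (v (map_poly iota (f ^+ k)).[b]) (vge_v v _).
rewrite rmorphXn /= !horner_exp vge_nz ?expf_neq0 // !(val_X v_val) //.
have := archi_boundP (normr_ge0 (C / d)); rewrite -/k => hk.
have : C / d < k%:R by apply: le_lt_trans hk; apply: ler_norm.
rewrite ltr_pdivrMr // /d => h1 h2.
move: h1 h2; rewrite mulrBr; move: (_ * _) (_ * _) => x y; lra.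
Qed.

Lemma conj_val (b b' : Om) f :
  root (map_poly iota g) b -> root (map_poly iota g) b' ->
  v (map_poly iota f).[b] = v (map_poly iota f).[b'].
Proof.
move=> gb gb'; have [e|nz] := eqVneq (map_poly iota f).[b] 0.
  rewrite e; congr v; apply/esym/eqP.
  by rewrite (root_ev_eq0 g_irr _ gb') -(root_ev_eq0 g_irr _ gb) e.
apply/eqP; rewrite eq_le !conj_val_le //.
by rewrite (root_ev_eq0 g_irr _ gb') -(root_ev_eq0 g_irr _ gb).
Qed.
End ConjugateValues.

(** * Filtered groups *)

Section Index.
Variable M : zmodType.
Implicit Types (X Y Z : M -> Prop) (x y : M) (s t : seq M).

Definition sgrp X := X 0 /\ forall x y, X x -> X y -> X (x - y).
Definition covers X Y s := forall x, X x -> exists2 y, y \in s & Y (x - y).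
Definition separated Y s := forall x y, x \in s -> y \in s -> Y (x - y) -> x = y.
Definition idx X Y N := exists s, [/\ size s = N, uniq s, forall x, x \in s -> X x,
  separated Y s & covers X Y s].

Lemma sgrpN X x : sgrp X -> X x -> X (- x).
Proof. by move=> [X0 XB] Xx; rewrite -sub0r; apply: XB. Qed.
Lemma sgrpD X x y : sgrp X -> X x -> X y -> X (x + y).
Proof. by move=> sX Xx Xy; rewrite -[y]opprK; apply: sX.2 => //; apply: sgrpN. Qed.
Lemma sgrp_sum X (I : Type) (r : seq I) (P : pred I) (G : I -> M) : sgrp X ->
  (forall i, P i -> X (G i)) -> X (\sum_(i <- r | P i) G i).
Proof.
by move=> sX h; elim/big_ind: _ => //; [exact: sX.1 | move=> *; exact: sgrpD].
Qed.
Lemma sgrpMn X x n : sgrp X -> X x -> X (x *+ n).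
Proof.
move=> sX Xx; elim: n => [|n IH]; rewrite ?mulr0n; first exact: sX.1.
by rewrite mulrS; apply: sgrpD.
Qed.
Lemma sgrpI X Y : sgrp X -> sgrp Y -> sgrp (fun x => X x /\ Y x).
Proof. by move=> [? hX] [? hY]; split=> // x y [? ?] [? ?]; split; [apply: hX|apply: hY]. Qed.

Lemma separated_le X Y s t : sgrp Y -> uniq s -> (forall x, x \in s -> X x) ->
  separated Y s -> covers X Y t -> (size s <= size t)%N.
Proof.
move=> sY us sX sep cov.
have ex x : exists y, x \in s -> y \in t /\ Y (x - y).
  have [xs|xs] := boolP (x \in s); last by exists 0.
  by have [y yt hy] := cov x (sX x xs); exists y.
pose f x := proj1_sig (cid (ex x)).
have hf x : x \in s -> f x \in t /\ Y (x - f x) := proj2_sig (cid (ex x)).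
rewrite -(size_map f); apply: uniq_leq_size.
  rewrite map_inj_in_uniq // => x y xs ys e; apply: sep => //.
  have [_ hx] := hf x xs; have [_ hy] := hf y ys.
  by rewrite -[x](subrK (f x)) {2}e -addrA -[f y - y]opprB; apply: sY.2.
by move=> _ /mapP[x xs ->]; case: (hf x xs).
Qed.

Lemma idx_inj X Y a b : sgrp Y -> idx X Y a -> idx X Y b -> a = b.
Proof.
move=> sY [s [<- us sX sep cov]] [t [<- ut tX sep' cov']].
by apply/eqP; rewrite eqn_leq !(separated_le (X := X) (Y := Y)).
Qed.

Lemma idx_ext X Y X' Y' a : (forall x, X x <-> X' x) -> (forall x, Y x <-> Y' x) ->
  idx X Y a -> idx X' Y' a.
Proof.
move=> hX hY [s [ss us sX sep cov]]; exists s; split=> //.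
- by move=> x /sX /hX.
- by move=> x y xs ys /hY; apply: sep.
by move=> x /hX /cov[y ys /hY]; exists y.
Qed.

Lemma covers_idx X Y t : sgrp Y -> (forall x, x \in t -> X x) -> covers X Y t ->
  exists2 a, idx X Y a & (a <= size t)%N.
Proof.
move=> sY tX cov.
suff [s [us ss sep h]] : exists s, [/\ uniq s, {subset s <= t}, separated Y s &
    forall x, x \in t -> exists2 y, y \in s & Y (x - y)].
  exists (size s); last exact: uniq_leq_size.
  exists s; split=> //; first by move=> x /ss /tX.
  move=> x /cov[y /h[z zs hz] hy]; exists z => //.
  by rewrite -[x](subrK y) -addrA; apply: sgrpD.
elim: t {tX cov} => [|x t [s [us ss sep h]]]; first by exists [::].
have [[y ys hy]|hno] := pselect (exists2 y, y \in s & Y (x - y)).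
  exists s; split=> // [z /ss zt|z]; first by rewrite in_cons zt orbT.
  by rewrite in_cons => /orP[/eqP ->|/h //]; exists y.
have hx y : y \in s -> Y (x - y) -> False by move=> ys hy; apply: hno; exists y.
exists (x :: s); split=> /=.
- by rewrite us andbT; apply/negP => /hx; apply; rewrite subrr; apply: sY.1.
- by move=> z; rewrite !in_cons => /orP[->//|/ss ->]; rewrite orbT.
- move=> z1 z2; rewrite !in_cons => /orP[/eqP ->|z1s] /orP[/eqP ->|z2s] //.
  + by move/(hx _ z2s).
  + by move/(sgrpN sY); rewrite opprB => /(hx _ z1s).
  + exact: sep.
move=> z; rewrite in_cons => /orP[/eqP ->|/h[y ys hy]].
  by exists x; rewrite ?mem_head // subrr; apply: sY.1.
by exists y; rewrite // in_cons ys orbT.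
Qed.

Lemma idx_tower X Y Z a b : sgrp X -> sgrp Y -> sgrp Z ->
  (forall x, Z x -> Y x) -> (forall x, Y x -> X x) ->
  idx X Y a -> idx Y Z b -> idx X Z (a * b).
Proof.
move=> gX sY sZ ZY YX [s [<- us sX sep cov]] [t [<- ut tY sep' cov']].
exists [seq x + y | x <- s, y <- t].
have key x1 x2 y1 y2 : x1 \in s -> x2 \in s -> y1 \in t -> y2 \in t ->
    Z (x1 + y1 - (x2 + y2)) -> x1 = x2 /\ y1 = y2.
  move=> h1 h2 h3 h4; rewrite opprD addrACA => hZ.
  have e : x1 = x2.
    apply: sep => //; rewrite -[x1 - x2](addrK (y1 - y2)).
    by apply: sY.2; [exact: ZY | apply: sY.2; apply: tY].
  by rewrite e subrr add0r in hZ; split=> //; apply: sep'.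
split.
- by rewrite size_allpairs.
- apply: allpairs_uniq => // -[x1 y1] [x2 y2] /allpairsP[[? ?] /= [? ? [-> ->]]].
  move=> /allpairsP[[? ?] /= [? ? [-> ->]]] /= e.
  move: e; set u1 := _ + _; set u2 := _ + _ => e.
  have hZ : Z (u1 - u2) by rewrite e subrr; apply: sZ.1.
  by case: (key _ _ _ _ _ _ _ _ hZ) => // -> ->.
- by move=> _ /allpairsP[[x y] /= [xs yt ->]]; apply: sgrpD; [|apply: sX|apply/YX/tY].
- move=> _ _ /allpairsP[[x1 y1] /= [? ? ->]] /allpairsP[[x2 y2] /= [? ? ->]] hZ.
  by case: (key _ _ _ _ _ _ _ _ hZ) => // -> ->.
move=> x /cov[y ys hy]; have [z zt hz] := cov' _ hy.
exists (y + z); last by rewrite opprD addrA.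
by apply/allpairsP; exists (y, z).
Qed.

Lemma idx_sub X Z A c : sgrp X -> sgrp Z -> sgrp A -> (forall x, A x -> X x) ->
  idx X Z c -> exists2 a, idx A (fun x => A x /\ Z x) a & (a <= c)%N.
Proof.
move=> gX sZ sA AX [s [<- us sX sep cov]].
have ex x : exists y, A y /\ ((exists2 z, A z & Z (z - x)) -> Z (y - x)).
  have [[z zA hz]|h] := pselect (exists2 z, A z & Z (z - x)); first by exists z.
  by exists 0; split=> //; exact: sA.1.
pose f x := proj1_sig (cid (ex x)); have hf x := proj2_sig (cid (ex x)).
have [] := @covers_idx A (fun x => A x /\ Z x) (map f s).
- exact: sgrpI.
- by move=> _ /mapP[x _ ->]; case: (hf x).
- move=> x Ax; have [y ys hy] := cov x (AX x Ax).
  have [fA fZ] := hf y; exists (f y); first exact: map_f.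
  split; first exact: sA.2.
  have : Z (f y - y) by apply: fZ; exists x.
  by move=> h; rewrite -[x](subrK y) -addrA -[y - _]opprB; apply: sZ.2.
by move=> a ha; rewrite size_map => hle; exists a.
Qed.

Lemma idx_mid X Y Z c : sgrp X -> sgrp Y -> sgrp Z ->
  (forall x, Z x -> Y x) -> (forall x, Y x -> X x) -> idx X Z c ->
  exists a b, [/\ idx X Y a, idx Y Z b & c = (a * b)%N].
Proof.
move=> gX sY sZ ZY YX hc.
have [b hb _] := idx_sub gX sZ sY YX hc.
have hb' : idx Y Z b by apply: idx_ext hb => // x; split=> [[]//|h]; split=> //; apply: ZY.
have [s [_ us sX sep cov]] := hc.
have [a ha _] : exists2 a, idx X Y a & (a <= size s)%N.
  by apply: covers_idx => // x /cov[y ys /ZY]; exists y.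
exists a, b; split=> //; apply: (idx_inj sZ hc); exact: (idx_tower gX sY sZ ZY YX ha hb').
Qed.

(** Second isomorphism theorem: representatives of X modulo its part in Y serve for the sum of X and
    Y modulo Y. *)
Lemma idx_sum X Y a : sgrp X -> sgrp Y -> idx X (fun x => X x /\ Y x) a ->
  idx (fun z => exists2 x, X x & Y (z - x)) Y a.
Proof.
move=> gX sY [s [<- us sX sep cov]]; exists s; split=> //.
- by move=> x /sX Xx; exists x => //; rewrite subrr; apply: sY.1.
- by move=> x y xs ys h; apply: sep => //; split=> //; apply: gX.2; apply: sX.
move=> z [x /cov[y ys [_ hy]] hz]; exists y => //.
by rewrite -[z](subrK x) -addrA; apply: sgrpD.
Qed.
End Index.

Section IndexMorphism.
Variables (M : zmodType) (f : M -> M).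
Hypothesis fB : forall x y, f (x - y) = f x - f y.
Implicit Types (X Y : M -> Prop).

Lemma idx_image X Y a : sgrp X -> sgrp Y -> idx X (fun x => X x /\ Y (f x)) a ->
  idx (fun y => exists2 x, X x & y = f x)
      (fun y => (exists2 x, X x & y = f x) /\ Y y) a.
Proof.
move=> gX sY [s [<- us sX sep cov]]; exists (map f s); rewrite size_map; split=> //.
- rewrite map_inj_in_uniq // => x y xs ys e; apply: sep => //.
  by split; [apply: gX.2; apply: sX | rewrite fB e subrr; apply: sY.1].
- by move=> _ /mapP[x xs ->]; exists x => //; apply: sX.
- move=> _ _ /mapP[x xs ->] /mapP[y ys ->] [_ h]; congr f; apply: sep => //.
  by rewrite fB; split=> //; apply: gX.2; apply: sX.
move=> _ [x /cov[y ys [h1 h2]] ->]; exists (f y); first exact: map_f.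
by rewrite -fB; split=> //; exists (x - y).
Qed.

(** An injection between quotients with the same finite number of elements is onto. On graded
    pieces, this turns strictness of a map on levels into solvability of an equation up to the next
    level. *)
Lemma idx_inj_onto X Y X' Y' q : sgrp X -> sgrp Y -> sgrp X' -> sgrp Y' ->
  idx X Y q -> idx X' Y' q -> (forall x, X x -> X' (f x)) ->
  (forall x, X x -> Y' (f x) -> Y x) ->
  forall y, X' y -> exists2 x, X x & Y' (y - f x).
Proof.
move=> gX sY sX' sY' [s [ss us sX sep cov]] [t [st ut tX' sep' cov']] fX fY y X'y.
apply: contrapT => hno.
have hn x : x \in s -> ~ Y' (y - f x) by move=> /sX Xx h; apply: hno; exists x.
have fsep x z : x \in s -> z \in s -> Y' (f x - f z) -> x = z.
  move=> xs zs h; apply: sep => //; apply: fY; last by rewrite fB.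
  by apply: gX.2; apply: sX.
suff : (size (y :: map f s) <= size t)%N by rewrite /= size_map ss st ltnn.
apply: (@separated_le _ X' Y') => //=.
- apply/andP; split.
    apply/negP => /mapP[x xs e]; apply: (hn x xs); rewrite e subrr; exact: sY'.1.
  rewrite map_inj_in_uniq // => x z xs zs e; apply: fsep => //.
  by rewrite e subrr; apply: sY'.1.
- by move=> z; rewrite in_cons => /orP[/eqP -> //|/mapP[x xs ->]]; apply/fX/sX.
move=> z1 z2; rewrite !in_cons => /orP[/eqP ->|/mapP[x1 x1s ->]] /orP[/eqP ->|/mapP[x2 x2s ->]] //.
- by move/(hn _ x2s).
- by move/(sgrpN sY'); rewrite opprB => /(hn _ x1s).
by move/(fsep _ _ x1s x2s) => ->.
Qed.
End IndexMorphism.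

Lemma sum_pred (M : zmodType) m (G : nat -> M) : (0 < m)%N ->
  \sum_(k < m) G k = \sum_(k < m.-1) G k + G m.-1.
Proof. by case: m => // m _; rewrite big_ord_recr. Qed.
Lemma sum_predl (M : zmodType) m (G : nat -> M) : (0 < m)%N ->
  \sum_(k < m) G k = G 0%N + \sum_(k < m.-1) G k.+1.
Proof. by case: m => // m _; rewrite big_ord_recl. Qed.

(** * Norms in a complete filtered group with an action of a cyclic group of order p *)

Section FilteredGroup.
Variables (M : zmodType) (FM : nat -> M -> Prop) (sg : M -> M) (p q lam n : nat).
Hypotheses (p_pr : prime p) (lam_gt0 : (0 < lam)%N) (lam_p : ~~ (p %| lam)%N) (n_gt0 : (0 < n)%N)
 (FM_sub : forall i, sgrp (FM i)) (FM_dec : forall i x, FM i.+1 x -> FM i x) (FM_1 : forall x, FM 1 x)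
 (FM_sep : forall x, (forall i, FM i x) -> x = 0)
 (FM_complete : forall u : nat -> M, (forall k, FM k (u k)) ->
  exists x, forall k, FM k (x - \sum_(i < k) u i)) (FM_idx : forall i, (0 < i)%N -> idx (FM i) (FM i.+1) q)
 (sgB : forall x y, sg (x - y) = sg x - sg y) (sgp : forall x, iter p sg x = x)
 (sgF : forall i x, FM i x -> FM i (sg x)).

Local Notation D x := (sg x - x).
(** The two features of a totally ramified extension: D is injective on the graded pieces of level
    prime to p and raises them by the ramification break, and a level divisible by p is represented
    by fixed points, because L and K have the same residue field. *)
Hypotheses (DF : forall i x, (0 < i)%N -> FM i x -> FM (i + lam) (D x))
 (DF' : forall i x, (0 < i)%N -> ~~ (p %| i)%N -> FM i x ->
  FM (i + lam).+1 (D x) -> FM i.+1 x) (sg_fix : forall i x, (0 < i)%N -> (p %| i)%N -> FM i x ->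
  exists2 y, sg y = y & FM i y /\ FM i.+1 (x - y)).

(* Multiplication by p sends the level i to min (p^2 i) (p (i + n)). *)
Hypotheses (mulp1 : forall i x, (p.-1 * i <= n)%N -> FM i x -> FM (p ^ 2 * i) (x *+ p))
 (mulp1' : forall i x, (0 < i)%N -> (p.-1 * i < n)%N -> FM i x ->
  FM (p ^ 2 * i).+1 (x *+ p) -> FM i.+1 x)
 (mulp2 : forall i x, (n <= p.-1 * i)%N -> FM i x -> FM (p * (i + n)) (x *+ p))
 (mulp2' : forall i x, (0 < i)%N -> (n < p.-1 * i)%N -> FM i x ->
  FM (p * (i + n)).+1 (x *+ p) -> FM i.+1 x).

Let p_gt1 := prime_gt1 p_pr.
Let p_gt0 := prime_gt0 p_pr.
Lemma FM_le i j x : (i <= j)%N -> FM j x -> FM i x.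
Proof.
move=> /subnK <-; elim: (j - i)%N => // k IH; rewrite addSn => /FM_dec; exact: IH.
Qed.

Lemma sg0 : sg 0 = 0. Proof. by rewrite -[X in sg X](subrr 0) sgB subrr. Qed.
Lemma sgN x : sg (- x) = - sg x. Proof. by rewrite -sub0r sgB sg0 sub0r. Qed.
Lemma sgD x y : sg (x + y) = sg x + sg y. Proof. by rewrite -{1}[y]opprK sgB sgN opprK. Qed.
Lemma sgMn x k : sg (x *+ k) = sg x *+ k.
Proof. by elim: k => [|k IH]; rewrite ?mulr0n ?sg0 // !mulrS sgD IH. Qed.
Lemma sg_sum (I : Type) (r : seq I) (P : pred I) (G : I -> M) :
  sg (\sum_(i <- r | P i) G i) = \sum_(i <- r | P i) sg (G i).
Proof. by elim/big_rec2: _ => [|i a b _ <-]; rewrite ?sg0 ?sgD. Qed.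

Lemma DB x y : D (x - y) = D x - D y.
Proof. by rewrite sgB !opprD !opprK addrACA. Qed.
Definition Dk k x := iter k (fun x => D x) x.
Lemma DkS k x : Dk k.+1 x = D (Dk k x). Proof. by []. Qed.
Lemma Dk_FM k i x : (0 < i)%N -> FM i x -> FM (i + k * lam) (Dk k x).
Proof.
move=> i0; elim: k => [|k IH] hx; first by rewrite mul0n addn0.
by rewrite DkS mulSn [(lam + _)%N]addnC addnA; apply: DF; [lia|apply: IH].
Qed.

Lemma iter_sg_bin m x : iter m sg x = \sum_(k < m.+1) Dk k x *+ 'C(m, k).
Proof.
elim: m => [|m IH]; first by rewrite big_ord1.
rewrite iterS IH sg_sum.
have -> : \sum_(i < m.+1) sg (Dk i x *+ 'C(m, i)) =
  \sum_(i < m.+1) Dk i.+1 x *+ 'C(m, i) + \sum_(i < m.+1) Dk i x *+ 'C(m, i).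
  by rewrite -big_split; apply: eq_bigr => i _ /=; rewrite sgMn -mulrnDl subrK.
rewrite [RHS]big_ord_recl /= bin0 mulr1n.
have -> : \sum_(i < m.+1) Dk (bump 0 i) x *+ 'C(m.+1, bump 0 i) =
  \sum_(i < m.+1) Dk i.+1 x *+ 'C(m, i) + \sum_(i < m.+1) Dk i.+1 x *+ 'C(m, i.+1).
  by rewrite -big_split; apply: eq_bigr => i _; rewrite /bump /= add1n binS mulrnDr addrC.
rewrite addrCA; congr (_ + _).
rewrite big_ord_recl /= bin0 mulr1n; congr (_ + _).
by rewrite [RHS]big_ord_recr /= bin_small // mulr0n addr0.
Qed.

Definition nrm x := \sum_(k < p) iter k sg x.

Lemma sum_iter_sg m x : \sum_(k < m) iter k sg x = \sum_(k < m) Dk k x *+ 'C(m, k.+1).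
Proof.
elim: m => [|m IH]; first by rewrite !big_ord0.
rewrite big_ord_recr /= IH iter_sg_bin.
have -> : \sum_(k < m.+1) Dk k x *+ 'C(m.+1, k.+1) =
  \sum_(k < m.+1) Dk k x *+ 'C(m, k.+1) + \sum_(k < m.+1) Dk k x *+ 'C(m, k).
  by rewrite -big_split; apply: eq_bigr => i _; rewrite binS mulrnDr.
by congr (_ + _); rewrite [RHS]big_ord_recr /= bin_small // mulr0n addr0.
Qed.

Definition Qpart x := \sum_(k < p.-1) Dk k x *+ ('C(p, k.+1) %/ p).

(** The norm is ((1 + D)^p - 1) / D, and the binomial coefficients are divisible by p except the
    last one. *)
Lemma nrmE x : nrm x = Dk p.-1 x + Qpart x *+ p.
Proof.
rewrite /nrm sum_iter_sg (sum_pred (fun k => Dk k x *+ 'C(p, k.+1)) p_gt0) addrC (prednK p_gt0) binn mulr1n.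
congr (_ + _); rewrite /Qpart -sumrMnl; apply: eq_bigr => k _.
rewrite -mulrnA divnK // prime_dvd_bin //=.
by have := ltn_ord k; lia.
Qed.

Lemma Qpart_FM i x : (0 < i)%N -> FM i x -> FM i (Qpart x) /\ FM i.+1 (Qpart x - x).
Proof.
move=> i0 hx.
have e : Qpart x - x = \sum_(k < p.-2) Dk k.+1 x *+ ('C(p, k.+2) %/ p).
  rewrite /Qpart; have -> : p.-1 = p.-2.+1 by lia.
  by rewrite big_ord_recl /= bin1 divnn p_gt0 mulr1n addrC addKr.
have h : FM i.+1 (Qpart x - x).
  rewrite e; apply: sgrp_sum => // k _; apply: sgrpMn => //.
  by apply: FM_le (Dk_FM _ i0 hx); nia.
by split=> //; rewrite -[Qpart x](subrK x); apply: sgrpD => //; apply: FM_dec.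
Qed.

Lemma nrmB x y : nrm (x - y) = nrm x - nrm y.
Proof.
rewrite /nrm -sumrB; apply: eq_bigr => k _.
by elim: (k : nat) => // m IH; rewrite !iterS IH sgB.
Qed.
Lemma sg_nrm x : sg (nrm x) = nrm x.
Proof.
rewrite /nrm sg_sum (sum_pred (fun k => sg (iter k sg x)) p_gt0) (sum_predl (fun k => iter k sg x) p_gt0) addrC.
by rewrite -iterS (prednK p_gt0) sgp.
Qed.

Lemma nrmD x : nrm (D x) = 0.
Proof.
rewrite nrmB; apply/eqP; rewrite subr_eq0; apply/eqP.
rewrite -[RHS]sg_nrm /nrm sg_sum; apply: eq_bigr => k _.
by rewrite -iterSr.
Qed.

Lemma sg_FMk k i x : FM i x -> FM i (iter k sg x).
Proof. by move=> hx; elim: k => //= k; apply: sgF. Qed.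
Lemma nrm_FM i x : FM i x -> FM i (nrm x).
Proof. by move=> hx; apply: sgrp_sum => // k _; apply: sg_FMk. Qed.
Definition fixp x := sg x = x.
(** The filtration of the fixed points, renumbered: fixed points can only have levels divisible by
    p. *)
Definition KF l x := fixp x /\ FM (p * l) x.
Lemma fixp_sub : sgrp fixp.
Proof. by split; [exact: sg0 | move=> x y hx hy; rewrite /fixp sgB hx hy]. Qed.
Lemma KF_sub l : sgrp (KF l). Proof. exact: sgrpI fixp_sub (FM_sub _). Qed.

(** At a level prime to p the hypothesis [DF'] applies with D x = 0, so a fixed point climbs to the
    next multiple of p. *)
Lemma KF_step l x : fixp x -> FM (p * l).+1 x -> KF l.+1 x.
Proof.
move=> hfx hx; split=> //; rewrite mulnS addnC.
suff h k : (k.+1 <= p)%N -> FM (p * l + k.+1) x.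
  by have := h p.-1; rewrite (prednK p_gt0); apply.
elim: k => [|k IH] hk; first by rewrite addn1.
rewrite addnS; apply: DF' (IH (ltnW hk)) _ => //; first by rewrite addnS.
  by rewrite dvdn_addr ?dvdn_mulr // gtnNdvd.
by rewrite (hfx : sg x = x) subrr; apply: (FM_sub _).1.
Qed.

Lemma KF1 x : fixp x -> KF 1 x.
Proof. by move=> hfx; apply: KF_step => //; rewrite muln0; apply: FM_1. Qed.
Lemma KF_le l m x : (l <= m)%N -> KF m x -> KF l x.
Proof. by move=> h [hfx hx]; split=> //; apply: FM_le hx; rewrite leq_mul2l h orbT. Qed.

Lemma KF_idx l : (0 < l)%N -> idx (KF l) (KF l.+1) q.
Proof.
move=> l0; have pl0 : (0 < p * l)%N by rewrite muln_gt0 p_gt0.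
have [s [ss us sX sep cov]] := FM_idx pl0.
have ex x : exists y, x \in s -> KF l y /\ FM (p * l).+1 (x - y).
  have [xs|xs] := boolP (x \in s); last by exists 0.
  have [y hy [h1 h2]] := sg_fix pl0 (dvdn_mulr l (dvdnn p)) (sX x xs).
  by exists y.
pose f x := proj1_sig (cid (ex x)); have hf x := proj2_sig (cid (ex x)).
have fsep x y : x \in s -> y \in s -> FM (p * l).+1 (f x - f y) -> x = y.
  move=> xs ys h; apply: sep => //.
  have [_ hx] := hf x xs; have [_ hy] := hf y ys.
  have -> : x - y = (x - f x) + ((f x - f y) - (y - f y)).
    by rewrite opprB (addrA (f x - f y)) subrK addrA subrK.
  by apply: sgrpD => //; apply: (FM_sub _).2.
exists (map f s); rewrite size_map; split=> //.
- rewrite map_inj_in_uniq // => x y xs ys e; apply: fsep => //.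
  by rewrite e subrr; apply: (FM_sub _).1.
- by move=> _ /mapP[x xs ->]; case: (hf x xs).
- move=> _ _ /mapP[x xs ->] /mapP[y ys ->] [_ h]; congr f; apply: fsep => //.
  by apply: FM_le h; rewrite mulnS; lia.
move=> x [hfx hx]; have [y ys hy] := cov x hx; have [[fK _] hfy] := hf y ys.
exists (f y); first exact: map_f.
apply: KF_step; first exact: fixp_sub.2.
by rewrite -[x](subrK y) -addrA; apply: sgrpD.
Qed.

Lemma FM_idx_pow i k : (0 < i)%N -> idx (FM i) (FM (i + k)) (q ^ k).
Proof.
move=> i0; elim: k => [|k IH].
  rewrite addn0 expn0; exists [:: 0]; split=> //.
  - by move=> x; rewrite inE => /eqP ->; apply: (FM_sub _).1.
  - by move=> x y; rewrite !inE => /eqP -> /eqP ->.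
  by move=> x hx; exists 0; rewrite ?inE // subr0.
rewrite expnSr; apply: idx_tower (IH) _ => //.
- by move=> x; apply: FM_le; lia.
- by move=> x; apply: FM_le; lia.
by rewrite addnS; apply: FM_idx; lia.
Qed.

Lemma KF_idx_pow i k : (0 < i)%N -> idx (KF i) (KF (i + k)) (q ^ k).
Proof.
move=> i0; elim: k => [|k IH].
  rewrite addn0 expn0; exists [:: 0]; split=> //.
  - by move=> x; rewrite inE => /eqP ->; apply: (KF_sub _).1.
  - by move=> x y; rewrite !inE => /eqP -> /eqP ->.
  by move=> x hx; exists 0; rewrite ?inE // subr0.
rewrite expnSr; apply: idx_tower (IH) _; try exact: KF_sub.
- by move=> x; apply: KF_le; lia.
- by move=> x; apply: KF_le; lia.
by rewrite addnS; apply: KF_idx; lia.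
Qed.

(** With i = lam modulo p, the level before the (k + 1)-st application of D is congruent to (k + 1)
    lam. It is prime to p for k < p - 1, so all p - 1 applications are strict. *)
Lemma Dk_strict i x m : (0 < i)%N -> (m <= p.-1)%N -> i = lam %[mod p] -> FM i x ->
  FM (i + m * lam).+1 (Dk m x) -> FM i.+1 x.
Proof.
move=> i0 + hi hx; elim: m => [|m IH] hm; first by rewrite mul0n addn0.
move=> h; apply: IH; first exact: ltnW.
apply: DF' (_ : FM _ _) _; first by lia.
- rewrite /dvdn -modnDml hi modnDml -mulSn -/(dvdn _ _) Euclid_dvdM // (negPf lam_p) orbF.
  by rewrite gtnNdvd //; lia.
- exact: Dk_FM.
by move: h; rewrite DkS mulSn -addnA [(m * _ + _)%N]addnC.
Qed.

Lemma FM_all i x : FM i x -> FM 0 x. Proof. exact: FM_le. Qed.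

(** Successive approximation: the correction at stage k has level at least k - c, so the corrections
    are summable by completeness, and the remaining error lies in every level. The bound [s] records
    a level common to all corrections. *)
Lemma iterative_onto (f : M -> M) (X : nat -> M -> Prop) (rho c s : nat) :
  (forall x y, f (x - y) = f x - f y) -> (forall i x, FM i x -> FM i (f x)) ->
  (forall k y, X k y -> FM k y) -> (c <= rho)%N ->
  (forall k y, (rho <= k)%N -> X k y ->
    exists2 x, FM (k - c) x /\ FM s x & X k.+1 (y - f x)) ->
  forall y, X rho y -> exists2 x, FM s x & f x = y.
Proof.
move=> fB fF XF hc step y0 hy0.
have f0 : f 0 = 0 by rewrite -[X in f X](subrr 0) fB subrr.
have fD x y : f (x + y) = f x + f y by rewrite -{1}[y]opprK fB -[- y]sub0r fB f0 sub0r opprK.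
have f_sum k (u : nat -> M) : f (\sum_(i < k) u i) = \sum_(i < k) f (u i).
  by elim: k => [|k IH]; rewrite ?big_ord0 // !big_ord_recr /= fD IH.
have ex k y : exists x, X (rho + k)%N y ->
    [/\ FM (rho + k - c) x, FM s x & X (rho + k).+1 (y - f x)].
  have [hy|hy] := pselect (X (rho + k)%N y); last by exists 0.
  by have [x [h1 h2] h3] := step _ _ (leq_addr k rho) hy; exists x.
pose ch k y := proj1_sig (cid (ex k y)).
have hch k y := proj2_sig (cid (ex k y)).
pose ys := fix ys k := if k is k'.+1 then ys k' - f (ch k' (ys k')) else y0.
have hys k : X (rho + k)%N (ys k).
  elim: k => [|k IH]; first by rewrite addn0.
  by rewrite addnS; have [] := hch k (ys k) IH.
pose u k := ch k (ys k).
have hu k : FM k (u k) /\ FM s (u k).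
  by have [h1 h2 _] := hch k _ (hys k); split=> //; apply: FM_le h1; lia.
have [x hx] := FM_complete (fun k => (hu k).1).
have ysE k : ys k = y0 - \sum_(i < k) f (u i).
  elim: k => [|k IH]; first by rewrite big_ord0 subr0.
  by rewrite big_ord_recr /= IH opprD addrA -IH.
exists x.
  rewrite -[x](subrK (\sum_(i < s) u i)); apply: sgrpD => //.
  by apply: sgrp_sum => // i _; case: (hu i).
apply/eqP; rewrite -subr_eq0; apply/eqP; apply: FM_sep => k.
have -> : f x - y0 = f (x - \sum_(i < k) u i) - ys k.
  by rewrite fB f_sum ysE opprB addrA subrK.
apply: (FM_sub _).2; first exact: fF.
by apply: FM_le (XF _ _ (hys k)); apply: leq_addl.
Qed.

(** The two regimes of multiplication by p combine into the bound p min (p i, i + n); the two values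
    agree where (p - 1) i = n. *)
Lemma mulp_min i l x : (0 < i)%N -> (l <= p * i)%N -> (l <= i + n)%N -> FM i x ->
  FM (p * l) (x *+ p).
Proof.
move=> i0 h1 h2 hx; case: (leqP (p.-1 * i) n) => h.
  by apply: FM_le (mulp1 h hx); rewrite expnS expn1 -mulnA leq_mul2l h1 orbT.
by apply: FM_le (mulp2 (ltnW h) hx); rewrite leq_mul2l h2 orbT.
Qed.

Lemma mulpQ_min i l x : (0 < i)%N -> (l <= p * i)%N -> (l <= i + n)%N -> FM i x ->
  FM (p * l) (Qpart x *+ p).
Proof. by move=> i0 h1 h2 /(Qpart_FM i0)[+ _]; apply: mulp_min. Qed.
Lemma Qpart_inj i x : (0 < i)%N -> FM i x -> FM i.+1 (Qpart x) -> FM i.+1 x.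
Proof.
move=> i0 hx h; have [_ h'] := Qpart_FM i0 hx.
by rewrite -[x](subKr (Qpart x)); apply: (FM_sub _).2.
Qed.
Definition covered l := forall y, KF l y -> exists x, KF l.+1 (y - nrm x).

(** Here D^(p-1) dominates p Q. Since i = lam modulo p, it is strict by [Dk_strict], so the norm is
    injective from the graded piece i to the graded piece l of the fixed points, and both have q
    elements. *)
Lemma covered1 l i : (0 < l)%N -> (0 < i)%N -> (i + p.-1 * lam = p * l)%N ->
  (l < p * i)%N -> (l < i + n)%N ->
  forall y, KF l y -> exists2 x, FM i x & KF l.+1 (y - nrm x).
Proof.
move=> l0 i0 e h1 h2.
have hi : i = lam %[mod p].
  have : (i + p * lam = p * l + lam)%N by rewrite -e; have := prednK p_gt0; nia.
  by move/(congr1 (fun k => k %% p)%N); rewrite ![(p * _)%N]mulnC modnMDl addnC modnMDl.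
have h3 x : FM i x -> FM (p * l).+1 (Qpart x *+ p).
  move=> hx; apply: (@FM_le _ (p * l.+1)); first by rewrite mulnS; lia.
  exact: (mulpQ_min i0).
apply: (idx_inj_onto nrmB (FM_sub i) (FM_sub i.+1) (KF_sub l) (KF_sub l.+1) (FM_idx i0) (KF_idx l0)).
  move=> x hx; split; first exact: sg_nrm.
  rewrite nrmE; apply: sgrpD; first exact: FM_sub.
    by rewrite -e; apply: Dk_FM.
  exact/FM_dec/h3.
move=> x hx [_ hn]; apply: (Dk_strict i0 (leqnn _) hi hx).
rewrite e -[Dk _ _](addrK (Qpart x *+ p)) -nrmE; apply: (FM_sub _).2; last exact: h3.
by apply: FM_le hn; rewrite mulnS; lia.
Qed.

(** Here p Q dominates D^(p-1). Q is the identity on graded pieces, and multiplication by p is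
    strict away from (p - 1) i = n, so the same count applies. *)
Lemma covered_mulp l i : (0 < l)%N -> (0 < i)%N -> (p * l < i + p.-1 * lam)%N ->
  (l = p * i /\ p.-1 * i < n \/ l = i + n /\ n < p.-1 * i)%N -> covered l.
Proof.
move=> l0 i0 h1 h2 y hy.
have h3 x : FM i x -> FM (p * l).+1 (Dk p.-1 x).
  by move=> hx; apply: FM_le (Dk_FM _ i0 hx).
have [x _ hx] : exists2 x, FM i x & KF l.+1 (y - nrm x); last by exists x.
apply: (idx_inj_onto nrmB (FM_sub i) (FM_sub i.+1) (KF_sub l) (KF_sub l.+1) (FM_idx i0) (KF_idx l0)) => //.
  move=> x hx; split; first exact: sg_nrm.
  rewrite nrmE; apply: sgrpD; [exact: FM_sub | exact/FM_dec/h3 |].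
  by apply: (mulpQ_min i0) => //; nia.
move=> x hx [_ hn]; apply: (Qpart_inj i0 hx).
have hq : FM (p * l).+1 (Qpart x *+ p).
  rewrite -[_ *+ p](addKr (Dk p.-1 x)) -nrmE addrC; apply: (FM_sub _).2; last exact: h3.
  by apply: FM_le hn; rewrite mulnS; lia.
have [hQ _] := Qpart_FM i0 hx.
case: h2 => -[el hi]; rewrite el in hq.
  by apply: mulp1' => //; rewrite expnS expn1 -mulnA.
by apply: mulp2' hq.
Qed.

Lemma covered1_ge l : (lam <= l)%N -> (0 < p * l - p.-1 * lam)%N /\
  forall y, KF l y -> exists2 x, FM (p * l - p.-1 * lam) x & KF l.+1 (y - nrm x).
Proof.
move=> hl; have hpp := prednK p_gt0.
have e : (p * l = l + p.-1 * l)%N by rewrite -{1}hpp mulSn.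
have h1 : (p.-1 * lam <= p.-1 * l)%N by rewrite leq_mul2l hl orbT.
have h0 : (0 < p * l - p.-1 * lam)%N by lia.
split=> //; apply: covered1 => //; [lia|lia| |lia].
have : (l * 2 <= p * (p * l - p.-1 * lam))%N by rewrite mulnC leq_mul //; lia.
lia.
Qed.

(** From lam on, every level is covered through D^(p-1), and the approximations converge. Hence only
    the levels below lam contribute to the norm index. *)
Lemma nrm_onto rho y : (lam <= rho)%N -> KF rho y ->
  exists2 x, FM (p * rho - p.-1 * lam) x & nrm x = y.
Proof.
move=> hr hy; have hpp := prednK p_gt0.
apply: (@iterative_onto nrm KF rho 0%N) => //.
- exact: nrmB.
- exact: nrm_FM.
- by move=> k z [_]; apply: FM_le; rewrite leq_pmull.
move=> k z hk hz; have [h0 h] := covered1_ge (leq_trans hr hk).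
have [x hx hx'] := h z hz; exists x => //.
have e : (p * k = k + p.-1 * k)%N by rewrite -{1}hpp mulSn.
have h1 : (p.-1 * lam <= p.-1 * k)%N by rewrite leq_mul2l (leq_trans hr hk) orbT.
split; apply: FM_le hx; first by lia.
by rewrite leq_sub2r // leq_mul2l hk orbT.
Qed.

(** At a level k with k - lam prime to p, the leading term is a value of D. Otherwise k = lam modulo
    p, and D^(p-1) x = - p Q x has higher level than strictness of D^(p-1) allows, so x already lies
    in level k + 1. *)
Lemma ker_nrm_im_D i x : (lam < i)%N -> nrm x = 0 -> FM i x -> exists y, D y = x.
Proof.
move=> hi hn hx; have hpp := prednK p_gt0.
suff [y _ <-] : exists2 y, FM 1 y & D y = x by exists y.
apply: (@iterative_onto (fun x => D x) (fun k z => FM k z /\ nrm z = 0) i lam 1) (conj hx hn).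
- exact: DB.
- move=> [|k] z hz; first exact/FM_all/FM_1.
  by apply: FM_le (DF _ hz); rewrite ?leq_addr.
- by move=> k z [].
- exact: ltnW.
- move=> k z hk [hz nz]; case: (boolP (p %| k - lam)%N) => hd; last first.
    have k0 : (0 < k - lam)%N by lia.
    have sk := FM_sub (k - lam); have skl := FM_sub (k - lam + lam).
    have [u hu hu'] : exists2 u, FM (k - lam) u & FM (k - lam + lam).+1 (z - D u).
      apply: (idx_inj_onto DB (FM_sub _) (FM_sub (k - lam).+1) (FM_sub (k - lam + lam)) (FM_sub _) (FM_idx k0)).
      + by apply: FM_idx; lia.
      + by move=> u hu; apply: DF.
      + by move=> u hu; apply: DF'.
      + by rewrite subnK //; lia.
    rewrite subnK in hu'; last by lia.
    exists u; first by split=> //; apply: FM_1.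
    by split=> //; rewrite nrmB nrmD nz subr0.
  exists 0; first by split; apply: (FM_sub _).1.
  rewrite sg0 !subr0; split=> //.
  have hk0 : (0 < k)%N by lia.
  apply: (Dk_strict hk0 (leqnn _)) => //.
    by apply/eqP; rewrite eqn_mod_dvd //; lia.
  have -> : Dk p.-1 z = - (Qpart z *+ p).
    by apply/eqP; rewrite -addr_eq0 -nrmE nz.
  apply: sgrpN => //.
  have hm : (p.-1 * lam < p.-1 * k)%N by rewrite ltn_mul2l; apply/andP; split; lia.
  have [l hl hl'] : exists2 l, (k + p.-1 * lam < p * l)%N & (l <= k.+1)%N /\ (l <= p * k)%N.
    exists k; first by rewrite -{2}hpp mulSn; lia.
    by split=> //; rewrite leq_pmull.
  apply: (@FM_le _ (p * l)) => //; apply: (mulpQ_min hk0 hl'.2 _ hz).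
  by lia.
Qed.

(** Induction on the level: at a level prime to p the bound on D x raises the level of the
    difference, and at a multiple of p a fixed point is subtracted. *)
Lemma D_FM_fixp m x : FM (p * m + lam) (D x) ->
  exists2 y, fixp y & FM (p * m) (x - y).
Proof.
move=> h.
suff H j : (j < p * m)%N -> exists2 y, fixp y & FM j.+1 (x - y).
  have [e|e] := posnP (p * m).
    exists 0; first exact: fixp_sub.1.
    by rewrite e subr0; apply: FM_all (FM_1 x).
  by have := H (p * m).-1; rewrite prednK //; apply.
elim: j => [|j IH] hj; first by exists 0; [exact: fixp_sub.1 | exact: FM_1].
have [y hy hxy] := IH (ltnW hj).
have eD : D (x - y) = D x by rewrite DB (hy : sg y = y) subrr subr0.
case: (boolP (p %| j.+1)%N) => hd; last first.
  exists y => //; apply: DF' => //; rewrite eD; apply: FM_le h.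
  by lia.
have [w hw [h1 h2]] := sg_fix (ltn0Sn j) hd hxy.
by exists (y + w); [exact: sgrpD fixp_sub hy hw | rewrite opprD addrA].
Qed.

Lemma idx_all_FM k : idx (fun=> True) (FM k.+1) (q ^ k).
Proof.
apply: idx_ext (FM_idx_pow k (ltn0Sn 0)) => // x; split=> // _; exact: FM_1.
Qed.
Lemma idx_fixp_KF k : idx fixp (KF k.+1) (q ^ k).
Proof.
apply: idx_ext (KF_idx_pow k (ltn0Sn 0)) => // x; split=> [[]//|]; exact: KF1.
Qed.
Definition NM y := exists x, nrm x = y.
Definition DM y := exists x, D x = y.
Definition kerN x := nrm x = 0.

Lemma NM_sub : sgrp NM.
Proof.
split; first by exists 0; rewrite -[0 in LHS](subrr 0) nrmB subrr.
by move=> _ _ [x <-] [y <-]; exists (x - y); rewrite nrmB.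
Qed.
Lemma DM_sub : sgrp DM.
Proof.
split; first by exists 0; rewrite sg0 subrr.
by move=> _ _ [x <-] [y <-]; exists (x - y); rewrite DB.
Qed.
Lemma kerN_sub : sgrp kerN.
Proof.
split; first by rewrite /kerN -[0 in LHS](subrr 0) nrmB subrr.
by move=> x y hx hy; rewrite /kerN nrmB hx hy subrr.
Qed.
Lemma all_sub : sgrp (fun _ : M => True). Proof. by []. Qed.

(* The Herbrand quotient of M is 1: compare both indices with those of the
   levels p + lam in M and 1 + lam in the fixed points. *)
Lemma herbrand g : (0 < q)%N -> idx fixp NM g -> idx kerN DM g.
Proof.
(* The two levels correspond under the norm: p rho - (p - 1) lam = r, so the norm maps FM r onto KF
   rho. *)
move=> q0 hg; pose r := (p + lam)%N; pose rho := lam.+1.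
have er : (p * rho - p.-1 * lam = r)%N.
  by rewrite /r /rho mulnS -{2}(prednK p_gt0) mulSn; lia.
have Zsub : sgrp (fun x => True /\ FM r (D x)).
  split; first by rewrite sg0 subrr; split=> //; exact: (FM_sub _).1.
  by move=> x y [_ hx] [_ hy]; split=> //; rewrite DB; apply: (FM_sub _).2.
have hFMp : idx (fun=> True) (FM p) (q ^ p.-1).
  by have := idx_all_FM p.-1; rewrite prednK.
(* All fixed points lie in FM p, so by [D_FM_fixp] D x is in FM r only if x is in FM p. *)
have hZp : idx (fun x => True /\ FM r (D x)) (FM p) 1.
  have h0 : idx fixp (fun x => fixp x /\ FM p x) 1.
    by apply: idx_ext (idx_fixp_KF 0) => // x; rewrite /KF muln1.
  apply: idx_ext (idx_sum fixp_sub (FM_sub p) h0) => // x; split.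
    move=> [y hy hxy]; split=> //.
    have -> : D x = D (x - y) by rewrite DB (hy : sg y = y) subrr subr0.
    exact: DF.
  move=> [_ h]; have := @D_FM_fixp 1 x; rewrite muln1 => /(_ h)[y hy hxy].
  by exists y.
have [z [b [hz hb e1]]] := idx_mid all_sub Zsub (FM_sub p) (fun x (h : FM p x) =>
  conj I (DF p_gt0 h)) (fun _ _ => I) hFMp.
have b1 := idx_inj (FM_sub p) hb hZp; rewrite {}b1 muln1 in e1.
have hDr : idx DM (fun x => kerN x /\ FM r x) z.
  apply: idx_ext (idx_image DB all_sub (FM_sub r) hz).
    by move=> x; split=> [[y _ ->]|[y <-]]; exists y.
  move=> x; split=> [[[y _ ->] h]|[h1 h2]].
    by split=> //; rewrite /kerN nrmD.
  split=> //; have [|y hy] := ker_nrm_im_D _ h1 h2; first by rewrite /r; lia.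
  by exists y.
have hFMr : idx (fun=> True) (FM r) (q ^ r.-1).
  by have := idx_all_FM r.-1; rewrite prednK // /r; lia.
have Wsub : sgrp (fun x => True /\ KF rho (nrm x)).
  split; first by split=> //; rewrite (kerN_sub.1 : nrm 0 = 0); exact: (KF_sub _).1.
  by move=> x y [_ hx] [_ hy]; split=> //; rewrite nrmB; apply: (KF_sub _).2.
have hWr x : FM r x -> True /\ KF rho (nrm x).
  move=> hx; split=> //; split; first exact: sg_nrm.
  rewrite nrmE; apply: sgrpD; first exact: FM_sub.
    apply: FM_le (Dk_FM _ _ hx); last by rewrite /r; lia.
    by rewrite -er /rho; lia.
  apply: (@mulpQ_min r) => //; rewrite /r /rho; try lia; by nia.
have [a [k [ha hk e2]]] := idx_mid all_sub Wsub (FM_sub r) hWr (fun _ _ => I) hFMr.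
have hkerk : idx kerN (fun x => kerN x /\ FM r x) k.
  have [k' hk' _] := idx_sub all_sub (FM_sub r) kerN_sub (fun _ _ => I) hFMr.
  suff <- : k' = k by [].
  apply: (idx_inj (FM_sub r)) hk.
  apply: idx_ext (idx_sum kerN_sub (FM_sub r) hk') => // x; split.
    move=> [y hy hxy]; rewrite -[x](subrK y); apply: sgrpD Wsub _ _; first exact: hWr.
    by split=> //; rewrite (hy : nrm y = 0); exact: (KF_sub _).1.
  move=> [_ h]; have [|u hu eu] := nrm_onto _ h; first by rewrite /rho.
  rewrite er in hu; exists (x - u); first by rewrite /kerN nrmB eu subrr.
  by rewrite opprB addrC subrK.
have hNa : idx NM (KF rho) a.
  apply: idx_ext (idx_image nrmB all_sub (KF_sub rho) ha).
    by move=> x; split=> [[y _ ->]|[y <-]]; exists y.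
  move=> x; split=> [[]//|h]; split=> //; have [|y _ <-] := nrm_onto _ h; first by rewrite /rho.
  by exists y.
have e3 : (g * a = q ^ lam)%N.
  apply: (idx_inj (KF_sub rho)) (idx_fixp_KF lam).
  apply: idx_tower fixp_sub NM_sub (KF_sub _) _ _ hg hNa.
    by move=> x h; have [|y _ <-] := nrm_onto _ h; [rewrite /rho | exists y].
  by move=> _ [y <-]; apply: sg_nrm.
have kD x : kerN x /\ FM r x -> DM x.
  by move=> [h1 h2]; apply: ker_nrm_im_D h1 h2; rewrite /r; lia.
have Dker x : DM x -> kerN x by move=> [y <-]; apply: nrmD.
have [h [z' [hh hz' e4]]] := idx_mid kerN_sub DM_sub (sgrpI kerN_sub (FM_sub r)) kD Dker hkerk.
have := idx_inj (sgrpI kerN_sub (FM_sub r)) hz' hDr => ezz.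
(* The relations a k = q^(r-1), g a = q^lam and k = h z with z = q^(p-1) give h = g, because r - 1 =
   lam + (p - 1). *)
suff <- : h = g by [].
have a0 : (0 < a)%N by move: e3 (expn_gt0 q lam); rewrite q0 => <-; rewrite muln_gt0 => /andP[].
apply/eqP; rewrite -(eqn_pmul2r a0) e3.
have : (0 < q ^ p.-1)%N by rewrite expn_gt0 q0.
move/eqn_pmul2r <-; rewrite -expnD e1 -ezz -mulnA [(a * _)%N]mulnC mulnA -e4.
rewrite mulnC -e2; apply/eqP; congr (_ ^ _)%N; rewrite /r; lia.
Qed.

(** The sum of KF l and the norms. For l from 1 to lam it descends from all fixed points to the
    norms, so the norm index is a product of lam - 1 successive indices, each at most q: it is 1 at
    a covered level and q where no norm has exact level l. *)
Definition NK l z := exists2 x, KF l x & NM (z - x).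

Lemma NK_sub l : sgrp (NK l).
Proof.
split; first by exists 0; [exact: (KF_sub _).1 | rewrite subrr; exact: NM_sub.1].
move=> x y [a ha hxa] [b hb hyb]; exists (a - b); first exact: (KF_sub _).2.
by rewrite opprD addrACA -opprD; apply: NM_sub.2.
Qed.

Lemma NK_S l z : NK l.+1 z -> NK l z.
Proof. by move=> [x hx hz]; exists x => //; apply: KF_le hx. Qed.

Lemma NK_step l : (0 < l)%N -> exists c b, [/\ idx (NK l) (NK l.+1) c,
  idx (KF l) (fun x => KF l x /\ NK l.+1 x) c,
  idx (fun x => KF l x /\ NK l.+1 x) (KF l.+1) b & q = (c * b)%N].
Proof.
move=> l0.
have hK x : KF l.+1 x -> KF l x /\ NK l.+1 x.
  move=> h; split; first exact: KF_le h.
  by exists x => //; rewrite subrr; exact: NM_sub.1.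
have [c [b [hc hb e]]] := idx_mid (KF_sub l) (sgrpI (KF_sub l) (NK_sub l.+1)) (KF_sub l.+1)
  hK (fun x => @proj1 _ _) (KF_idx l0).
exists c, b; split=> //.
apply: idx_ext (idx_sum (KF_sub l) (NK_sub l.+1) hc) => // z; split.
  move=> [x hx [w hw hzw]]; exists (x + w); last by rewrite opprD addrA.
  by apply: sgrpD (KF_sub l) hx _; apply: KF_le hw.
by move=> [x hx hz]; exists x => //; exists 0; [exact: (KF_sub _).1 | rewrite subr0].
Qed.

Lemma idx1 (X Y : M -> Prop) : sgrp X -> (forall x, X x -> Y x) -> idx X Y 1.
Proof.
move=> sX XY; exists [:: 0]; split=> //.
- by move=> x; rewrite inE => /eqP ->; exact: sX.1.
- by move=> x y; rewrite !inE => /eqP -> /eqP ->.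
by move=> x /XY h; exists 0; rewrite ?inE // subr0.
Qed.

Lemma NK_step_le l : (0 < l)%N -> (0 < q)%N -> exists2 c, idx (NK l) (NK l.+1) c & (0 < c <= q)%N.
Proof.
move=> l0 q0; have [c [b [h1 h2 _ e]]] := NK_step l0; exists c => //.
by move: q0; rewrite e muln_gt0 => /andP[c0 b0]; rewrite c0 leq_pmulr.
Qed.

Lemma NK_step_covered l : covered l -> idx (NK l) (NK l.+1) 1.
Proof.
move=> hc; apply: idx1; first exact: NK_sub.
move=> z [x hx hz]; have [w hw] := hc x hx; exists (x - nrm w) => //.
by rewrite opprB addrCA addrC; apply: sgrpD NM_sub hz _; exists w.
Qed.

Definition lower_level l := forall x, KF l (nrm x) -> KF l.+1 (nrm x).

Lemma NK_step_lower l : (0 < l)%N -> lower_level l -> idx (NK l) (NK l.+1) q.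
Proof.
move=> l0 hl; have [c [b [h1 h2 hb e]]] := NK_step l0.
suff b1 : b = 1%N by rewrite e b1 muln1.
apply: (idx_inj (KF_sub l.+1)) hb (idx1 _ _); first exact: sgrpI (KF_sub l) (NK_sub l.+1).
move=> z [hz [x hx [w hw]]]; have hx' := hx; rewrite -[z](subrK x) -hw; apply: sgrpD (KF_sub _) _ hx.
apply: hl; rewrite hw; apply: (KF_sub _).2 => //; exact: KF_le hx'.
Qed.

(** D^(p-1) x always lies beyond p l, so only p Q x could have exact level p l. For (p - 1) i < n
    the levels of multiples of p are p^2 i, which differs from p l as l is prime to p; from (p - 1)
    i >= n on they exceed p l. *)
Lemma lower_levelP l : ~~ (p %| l)%N -> (p * l <= p.-1 * lam)%N -> (p.-1 * l < p * n)%N ->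
  lower_level l.
Proof.
move=> hd h1 h2 x [_ hx]; apply: KF_step; first exact: sg_nrm.
have hD : FM (p * l).+1 (Dk p.-1 x).
  by apply: FM_le (Dk_FM _ (ltn0Sn 0) (FM_1 x)); rewrite addnC addn1.
rewrite nrmE; apply: sgrpD => //.
have : FM (p * l) (Qpart x *+ p).
  rewrite -[_ *+ p](addKr (Dk p.-1 x)) -nrmE addrC; apply: (FM_sub _).2 => //.
  exact: FM_dec.
move: (Qpart x) => y hy.
suff H k : (k <= l)%N -> FM k.+1 y \/ FM (p * l).+1 (y *+ p).
  have [h|//] := H l (leqnn l).
  have : FM (p * l.+1) (y *+ p) by apply: (mulp_min (ltn0Sn l)) => //; [rewrite leq_pmull | lia].
  by apply: FM_le; rewrite mulnS; lia.
elim: k => [|k IH] hk; first by left; apply: FM_1.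
have [h|] := IH (ltnW hk); last by right.
case: (leqP n (p.-1 * k.+1)) => hn.
  right; apply: FM_le (mulp2 hn h).
  have : (p.-1 * l < p.-1 * (k.+1 + n))%N.
    by rewrite mulnDr; have := prednK p_gt0; nia.
  by rewrite ltn_pmul2l; [rewrite ltn_mul2l p_gt0 | lia].
have [hl|hl|hl] := ltngtP l (p * k.+1).
- by right; apply: FM_le (mulp1 (ltnW hn) h); rewrite expnS expn1 -mulnA ltn_mul2l p_gt0.
- left; apply: mulp1' => //; apply: FM_le hy.
  by rewrite expnS expn1 -mulnA ltn_mul2l p_gt0.
by rewrite hl dvdn_mulr in hd.
Qed.

Lemma NK1 z : NK 1 z <-> fixp z.
Proof.
split=> [[x [hx _] [w hw]]|hz].
  by rewrite -[z](subrK x); apply: sgrpD fixp_sub _ hx; rewrite -hw; apply: sg_nrm.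
by exists z; [exact: KF1 | rewrite subrr; exact: NM_sub.1].
Qed.

Lemma norm_index_chain rho (lo hi : nat -> nat) : (lam <= rho)%N -> (0 < q)%N ->
  (forall l, (0 < l < rho)%N -> exists2 c, idx (NK l) (NK l.+1) c & (lo l <= c <= hi l)%N) ->
  exists2 g, idx kerN DM g & (\prod_(1 <= l < rho) lo l <= g <= \prod_(1 <= l < rho) hi l)%N.
Proof.
move=> hrho q0 hstep.
suff H k : (k < rho)%N -> exists2 g, idx (NK 1) (NK k.+1) g &
    (\prod_(1 <= l < k.+1) lo l <= g <= \prod_(1 <= l < k.+1) hi l)%N.
  have r0 : (0 < rho)%N by apply: leq_trans hrho.
  have [|g hg hb] := H rho.-1; first by rewrite prednK.
  rewrite prednK // in hg hb; exists g => //; apply: herbrand => //.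
  apply: idx_ext hg; first exact: NK1.
  move=> z; split=> [[x hx hz]|hz].
    have [w _ hw] := nrm_onto hrho hx.
    by rewrite -[z](subrK x); apply: sgrpD NM_sub hz _; exists w.
  by exists 0; [exact: (KF_sub _).1 | rewrite subr0].
elim: k => [|k IH] hk.
  by exists 1%N; [apply: idx1; [exact: NK_sub|] | rewrite !big_geq].
have [g hg /andP[g1 g2]] := IH (ltnW hk).
have [c hc /andP[c1 c2]] := hstep k.+1 hk.
exists (g * c)%N; last by rewrite !(big_nat_recr k.+1) //= !leq_mul.
apply: idx_tower hg hc; try exact: NK_sub.
  by move=> x; apply: NK_S.
move=> x [y hy hxy]; exists y => //; exact: KF_le hy.
Qed.

Lemma prod_count (a : pred nat) m k : (\prod_(m <= l < k) (if a l then q else 1) =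
  q ^ count a (index_iota m k))%N.
Proof. by rewrite -big_mkcond -big_filter big_const_seq count_predT iter_muln_1 size_filter. Qed.

Theorem norm_index rho (cov low : pred nat) : (lam <= rho)%N -> (0 < q)%N ->
  (forall l, (0 < l < rho)%N -> cov l -> covered l) ->
  (forall l, (0 < l < rho)%N -> low l -> lower_level l) ->
  exists2 g, idx kerN DM g & (q ^ count low (index_iota 1 rho) <= g
    <= q ^ count (predC cov) (index_iota 1 rho))%N.
Proof.
move=> hrho q0 hcov hlow; rewrite -!prod_count; apply: norm_index_chain => // l hl.
have [l0 _] := andP hl.
have [hc|hc] := boolP (cov l).
  exists 1%N; first exact/NK_step_covered/hcov.
  rewrite /= hc; case: ifP => // /(hlow l hl)/(NK_step_lower l0) h.
  by rewrite (idx_inj (NK_sub _) h (NK_step_covered (hcov l hl hc))).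
rewrite /= hc; have [/(hlow l hl)/(NK_step_lower l0) h|_] := boolP (low l).
  by exists q; rewrite ?leqnn.
exact: NK_step_le.
Qed.

(** At level 1, where (p - 1) i = n, doubling need not be injective on the graded piece. The last
    hypothesis says that its kernel there has at most 2 elements; source and target both have q
    elements, so the cokernel has as many elements as the kernel. *)
Lemma NK_step_tie : p = 2%N -> n = 1%N -> (4 <= lam)%N -> (0 < q)%N ->
  (forall x y, FM 5 (x *+ 2) -> FM 5 (y *+ 2) -> FM 2 x \/ FM 2 y \/ FM 2 (x - y)) ->
  exists2 c, idx (NK 2) (NK 3) c & (0 < c <= 2)%N.
Proof.
move=> p2 n1 lam4 q0 tie.
have nrm2 x : nrm x = D x + x *+ 2.
  by rewrite /nrm p2 big_ord_recl big_ord1 /= mulr2n addrA subrK addrC.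
have D5 x : FM 5 (D x) by apply: FM_le (DF (ltn0Sn 0) (FM_1 x)); lia.
have N2 x : KF 2 (nrm x).
  split; first exact: sg_nrm.
  rewrite nrm2; apply: sgrpD => //; first by apply: FM_le (D5 x); rewrite p2.
  have := @mulp_min 1 2 x (ltn0Sn 0); rewrite p2 n1; apply => //.
have N3 x : KF 3 (nrm x) <-> FM 5 (x *+ 2).
  split=> [[_ h]|h].
    rewrite -[x *+ 2](addKr (D x)) -nrm2 addrC; apply: (FM_sub _).2 => //.
    by apply: FM_le h; rewrite p2.
  apply: KF_step; first exact: sg_nrm.
  by rewrite p2 nrm2; apply: sgrpD.
pose Y x := True /\ KF 3 (nrm x).
have Ysub : sgrp Y.
  split; first by split=> //; apply/N3; rewrite mul0rn; exact: (FM_sub _).1.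
  by move=> x y [_ hx] [_ hy]; split=> //; rewrite nrmB; apply: (KF_sub _).2.
have FY x : FM 2 x -> Y x.
  move=> hx; split=> //; apply/N3; apply: (@FM_le _ (p * 3)); first by rewrite p2.
  by have := @mulp_min 2 3 x (ltn0Sn 1); rewrite p2 n1; apply.
have [e [d [he hd eq]]] := idx_mid all_sub Ysub (FM_sub 2) FY (fun _ _ => I)
  (idx_ext (fun x => conj (fun _ => I) (fun _ => FM_1 x)) (fun x => conj id id) (FM_idx (ltn0Sn 0))).
have d2 : (d <= 2)%N.
  have [[x0 [_ hx0] nx0]|hno] := pselect (exists2 x, Y x & ~ FM 2 x).
    have [|||d' hd' hle] := @covers_idx _ Y (FM 2) [:: 0; x0].
    - exact: FM_sub.
    - by move=> x; rewrite !inE => /orP[] /eqP -> //; exact: Ysub.1.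
    - move=> x [_ /N3 hx]; have [h|h] := pselect (FM 2 x).
        by exists 0; rewrite ?inE ?eqxx // subr0.
      exists x0; first by rewrite !inE eqxx orbT.
      by case: (tie x x0 hx ((N3 _).1 hx0)) => [//|[//|]].
    by rewrite (idx_inj (FM_sub 2) hd hd').
  have h1 : idx Y (FM 2) 1.
    by apply: idx1 => // x hx; apply: contrapT => h; apply: hno; exists x.
  by rewrite (idx_inj (FM_sub 2) hd h1).
have [c [b [h1 _ h2 h3]]] := NK_step (ltn0Sn 1); exists c => //.
have -> : c = d.
  have hNe : idx NM (fun x => NM x /\ KF 3 x) e.
    apply: idx_ext (idx_image nrmB all_sub (KF_sub 3) he).
      by move=> x; split=> [[y _ ->]|[y <-]]; exists y.
    by move=> x; split=> [[[y _ ->] h]|[[y <-] h]]; split=> //; exists y.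
  have hKe : idx (fun x => KF 2 x /\ NK 3 x) (KF 3) e.
    apply: idx_ext (idx_sum NM_sub (KF_sub 3) hNe) => // x; split.
      move=> [y hy hxy]; split.
        rewrite -[x](subrK y); apply: sgrpD (KF_sub 2) (KF_le _ hxy) _ => //.
        by case: hy => w <-.
      by exists (x - y) => //; rewrite opprB addrC subrK.
    by move=> [_ [y hy hxy]]; exists (x - y) => //; rewrite opprB addrC subrK.
  have eb := idx_inj (KF_sub 3) h2 hKe.
  have e0 : (0 < e)%N by move: q0; rewrite eq muln_gt0 => /andP[].
  by apply/eqP; rewrite -(eqn_pmul2r e0) -{1}eb -h3 eq mulnC.
by move: q0; rewrite eq muln_gt0 d2 andbT => /andP[].
Qed.

Theorem norm_index_tie rho (cov low : pred nat) : (lam <= rho)%N -> (0 < q)%N ->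
  (forall l, (0 < l < rho)%N -> cov l -> covered l) ->
  p = 2%N -> n = 1%N -> (4 <= lam)%N -> ~~ cov 2 ->
  (forall x y, FM 5 (x *+ 2) -> FM 5 (y *+ 2) -> FM 2 x \/ FM 2 y \/ FM 2 (x - y)) ->
  forall g, idx kerN DM g ->
  (q * g <= 2 * q ^ count (predC cov) (index_iota 1 rho))%N.
Proof.
move=> hrho q0 hcov p2 n1 lam4 nc2 tie g hg.
(* Only the uncovered level 2 changes: its factor q is replaced by 2. *)
pose hi l := if (l == 2)%N then 2%N else if predC cov l then q else 1%N.
have [l hl|g' hg' /andP[_ hle]] := @norm_index_chain rho (fun=> 1%N) hi hrho q0.
  have [l0 _] := andP hl; rewrite /hi; have [->|_] := eqVneq l 2.
    have [c h /andP[h1 h2]] := NK_step_tie p2 n1 lam4 q0 tie.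
    by exists c => //; rewrite h1.
  have [hc|hc] := boolP (cov l); rewrite /= hc; first by exists 1%N; [exact/NK_step_covered/hcov|].
  exact: NK_step_le.
rewrite (idx_inj DM_sub hg hg') -prod_count.
have r2 : 2%N \in index_iota 1 rho by rewrite mem_index_iota; lia.
rewrite (bigD1_seq 2) ?iota_uniq //= nc2 mulnCA leq_mul2l; apply/orP; right.
rewrite /hi (bigD1_seq 2) ?iota_uniq //= in hle.
apply: leq_trans hle _; rewrite leq_mul2l; apply/orP; right.
by apply: leq_prod => i /negPf ->.
Qed.
End FilteredGroup.

Lemma index_iota_cat a b d : (a <= b <= d)%N -> index_iota a d = index_iota a b ++ index_iota b d.
Proof.
move=> /andP[h1 h2]; rewrite /index_iota (_ : d - a = (b - a) + (d - b))%N; last by lia.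
by rewrite iotaD subnKC.
Qed.

(** * The counting functions of the theorem *)

Section Counting.
Local Open Scope nat_scope.
Variables (p : nat).
Hypothesis p_pr : prime p.
Let p_gt1 := prime_gt1 p_pr.
Let p_gt0 := prime_gt0 p_pr.
Let pE : p = p.-1.+1. Proof. by rewrite prednK. Qed.

Lemma ceilp_eq m a : m <= a * p < m + p -> ceilp p m = a.
Proof.
rewrite /ceilp => /andP[h1 h2]; suff -> : Num.ceil (m%:R / p%:R : rat) = a by [].
have p0 : (0 < p%:R :> rat)%R by rewrite ltr0n.
apply: ceil_def; rewrite /= ltr_pdivlMr // ler_pdivrMr //.
rewrite -[a%:Z%:~R]/(a%:R : rat)%R intrB -[a%:Z%:~R]/(a%:R : rat)%R -natrM ler_nat h1 andbT.
by rewrite mulrBl mul1r ltrBlDr -natrM -natrD ltr_nat.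
Qed.

Lemma ceilp_bounds m : m <= ceilp p m * p < m + p.
Proof.
suff [a h] : exists a, m <= a * p < m + p by rewrite (ceilp_eq h).
exists ((m + p.-1) %/ p); have := divn_eq (m + p.-1) p; have := ltn_pmod (m + p.-1) p_gt0.
by set a := _ %/ p; set b := _ %% p; lia.
Qed.

Lemma ceilp_le m : ceilp p m <= m.
Proof.
have /andP[_ h] := ceilp_bounds m; rewrite leqNgt; apply/negP => hlt.
have : m.+1 * p <= ceilp p m * p by rewrite leq_mul2r hlt orbT.
by rewrite mulSn; have := leq_pmulr m p_gt0; lia.
Qed.

Variable e : nat.
Hypothesis e_dvd : e %| p.-1.
Let e_gt0 : 0 < e. Proof. by apply: dvdn_gt0 e_dvd; have := prime_gt1 p_pr; lia. Qed.
Variable c : nat.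
Local Notation P := (fun i => i == c %[mod e]).

Lemma count_window a k : count P (index_iota a (a + k * e)) = k.
Proof.
suff H b : count P (index_iota b (b + e)) = 1.
  elim: k a => [|k IH] a; first by rewrite mul0n addn0 /index_iota subnn.
  rewrite -[k.+1]addn1 mulnDl mul1n addnA.
  rewrite (@index_iota_cat a (a + k * e)) ?leq_addr //.
  by rewrite count_cat IH H.
elim: b => [|b IH].
  rewrite add0n /index_iota subn0.
  rewrite (@eq_in_count _ _ (pred1 (c %% e))).
    by rewrite count_uniq_mem ?iota_uniq // mem_iota ltn_pmod.
  by move=> i; rewrite mem_iota add0n /= => hi; rewrite modn_small.
move: IH; rewrite addSn /index_iota subSS !addKn.
have : count P (iota b e.+1) = P b + count P (iota b.+1 e) by [].
by rewrite -{1}addn1 iotaD count_cat /= addn0 modnDr addnC => /addnI ->.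
Qed.

Definition F m := phi p e m + diamond p e c m.

(** The interval from ceil(m/p) to psi m consists of phi m full periods modulo e, each with one
    element of the class; diamond counts the incomplete rest. *)
Lemma F_window m : F m = count P (index_iota (ceilp p m) m).
Proof.
have hc := ceilp_le m.
have hs : psi p e m <= m.
  by rewrite /psi /phi; have := leq_divM (m - ceilp p m) e; lia.
rewrite /F /diamond.
rewrite (@index_iota_cat (ceilp p m) (psi p e m) m) ?leq_addr //.
by rewrite count_cat count_window.
Qed.

(** The multiples of p below m are p j with j < ceil(m/p), and p j = j modulo e as e divides p - 1.
    Removing them from the class removes as many elements as the initial interval below ceil(m/p)
    contains. *)
Lemma F_count m : F m = count (fun i => ~~ (p %| i) && P i) (index_iota 0 m).
Proof.
have pe : p = 1 %[mod e] by apply/eqP; rewrite eqn_mod_dvd // subn1.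
have hm j : P (p * j) = P j by rewrite /= -modnMm pe modnMm mul1n.
have mult : count (fun i => (p %| i) && P i) (index_iota 0 m) = count P (index_iota 0 (ceilp p m)).
  elim: m => [|m IH]; first by rewrite (@ceilp_eq 0 0) ?p_gt0.
  have hS k : index_iota 0 k.+1 = index_iota 0 k ++ [:: k].
    by rewrite /index_iota !subn0 -addn1 iotaD.
  rewrite hS count_cat IH /= addn0.
  have [/dvdnP[j ->]|hd] := boolP (p %| m).
    have -> : ceilp p (j * p).+1 = j.+1 by apply: ceilp_eq; lia.
    have -> : ceilp p (j * p) = j by apply: ceilp_eq; lia.
    rewrite hS count_cat /= addn0; congr (_ + nat_of_bool _).
    by rewrite mulnC hm.
  rewrite addn0; congr (count _ (index_iota _ _)).
  apply/esym/ceilp_eq; have /andP[h1 h2] := ceilp_bounds m.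
  have : m != ceilp p m * p by apply: contraNneq hd => ->; rewrite dvdn_mull.
  lia.
have := count_predC (fun i => p %| i) [seq i <- index_iota 0 m | P i].
rewrite !count_filter size_filter.
have -> : count (predI (fun i => p %| i) P) (index_iota 0 m) =
   count (fun i => (p %| i) && P i) (index_iota 0 m) by apply: eq_count.
rewrite mult F_window.
rewrite (@index_iota_cat 0 (ceilp p m) m) ?ceilp_le //.
by rewrite [X in _ = X -> _]count_cat => /addnI <-; apply: eq_count.
Qed.
End Counting.

Lemma leq_wmul2l c a b : (a <= b)%N -> (c * a <= c * b)%N.
Proof. by move=> h; rewrite leq_mul2l h orbT. Qed.

(** * Comparing uncovered levels with the counts of the theorem *)

Section Levels.
Local Open Scope nat_scope.
Variables (p lam n : nat).
Hypotheses (p_pr : prime p) (lam_gt0 : 0 < lam) (lam_p : ~~ (p %| lam)) (n_gt0 : 0 < n).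
Let P := p.-1.
Let p_gt1 := prime_gt1 p_pr.
Let p_gt0 := prime_gt0 p_pr.
Let pP : p = P.+1. Proof. by rewrite /P prednK. Qed.
Let P_gt0 : 0 < P. Proof. by rewrite /P; lia. Qed.

(** The three alternatives are [covered1] with i = l - (p - 1) m and [covered_mulp] with i = l / p
    and i = l - n, their inequalities being rewritten in terms of m = lam - l. *)
Definition cov l := let m := lam - l in
  [|| (p * m < l) && (P * m < n), [&& p %| l, P * l < p * n & l < p * m]
    | (p * n < P * l) && (n < P * m)].
Definition low l := [&& ~~ (p %| l), p * l <= P * lam & P * l < p * n].
(** The k for which N + e k is counted between the natural sign N and sharp; likewise [low]
    describes the N - e k counted from flat to N. *)
Definition mid k := [&& ~~ (p %| k), p * k < P * lam & k < p * n].
Definition std l := let m := lam - l in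
  [&& P * m < l, l < p * m, ~~ (p %| l) & (P * m <= n) || (P * l < p * n)].
(** The three exceptional families are boundary cases of [cov]: (p - 1) l = p n, then (p - 1) m = n,
    then l = p m, where m = lam - l. *)
Definition exA l := (P * l == p * n) && (n < P * (lam - l)).
Definition exB l := (P * (lam - l) == n) && (p * (lam - l) <= l).
Definition exC l := (l == p * (lam - l)) && (P * (lam - l) < n).

Lemma uncovered_cases l : 0 < l < lam -> ~~ cov l ->
  [|| low l, std l, exA l, exB l | exC l].
Proof.
move=> /andP[l0 hl]; rewrite /cov /low /std /exA /exB /exC.
have el : lam = l + (lam - l) by lia.
have m0 : 0 < lam - l by lia.
move: (lam - l) el m0 => m -> m0.
have pm : p * m = P * m + m by rewrite pP mulSn addnC.
have pl : p * l = P * l + l by rewrite pP mulSn addnC.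
have h2 : p * (P * m) = P * (p * m) by rewrite mulnCA.
have h3 : p * (P * m) = P * (P * m) + P * m by rewrite pP mulSn addnC.
have h4 : P * m <= n -> p * (P * m) <= p * n by exact: leq_wmul2l.
have h5 : n <= P * m -> p * n <= p * (P * m) by exact: leq_wmul2l.
have h6 : l < p * m -> P * l < P * (p * m) by move=> h; rewrite ltn_mul2l P_gt0 h.
have h7 : p * m <= l -> P * (p * m) <= P * l by exact: leq_wmul2l.
have h8 : l <= P * m -> P * l <= P * (P * m) by exact: leq_wmul2l.
rewrite !negb_or mulnDr pl !negb_and -!leqNgt.
case: (boolP (p %| l)) => hd /=; rewrite ?orbF ?andbF /=.
  by have [h1|h1] := leqP l (P * m); lia.
have [h1|h1] := leqP l (P * m); last lia.
have h9 : P * l = p * n -> n < P * m by nia.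
lia.
Qed.

(** On standard levels, adding lam gives (p + 1) (lam - l). The map is therefore injective there,
    and its image lies in a single class modulo p + 1, which leaves room for the exceptional
    levels. *)
Definition shift l := p * (lam - l) - l.

Lemma std_mid l : 0 < l < lam -> std l -> mid (shift l) && (0 < shift l < lam).
Proof.
move=> /andP[l0 hl]; rewrite /mid /std /shift.
have el : lam = l + (lam - l) by lia.
have m0 : 0 < lam - l by lia.
move: (lam - l) el m0 => m -> m0 /and4P[h1 h2 h3 h4].
have pm : p * m = P * m + m by rewrite pP mulSn addnC.
have hd : ~~ (p %| p * m - l) by rewrite dvdn_subr ?dvdn_mulr // ltnW.
rewrite hd /= mulnDr.
have k1 : p * m - l < m by lia.
have h5 : p * (P * m) = P * (p * m) by rewrite mulnCA.
have h6 : P * (P * m).+1 <= P * l by exact: leq_wmul2l.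
have h7 : p * (p * m - l) <= p * m.-1 by rewrite leq_mul2l; lia.
have h8 : p * m = p * m.-1 + p by rewrite -{1}(prednK m0) mulnS addnC.
have h9 : n <= p * n by rewrite leq_pmull.
have h10 : m <= P * m by rewrite leq_pmull.
have h11 : l <= P * l by rewrite leq_pmull.
have h12 : P * (p * m) = P * (P * m) + P * m by rewrite pm mulnDr.
have h13 : p * m <= P * (p * m) by rewrite leq_pmull.
lia.
Qed.

Lemma shiftE l : 0 < l < lam -> std l -> shift l + lam = p.+1 * (lam - l).
Proof. by move=> hl /and4P[h1 h2 _ _]; rewrite /shift mulSn; lia. Qed.

Local Notation rg := (index_iota 1 lam).
Lemma mem_rg l : (l \in rg) = (0 < l < lam). Proof. by rewrite mem_index_iota. Qed.

(* The standard uncovered levels are shifted into the set [mid]; the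
   exceptional ones are matched with elements of [mid] outside the image,
   which is contained in one residue class modulo p + 1. *)
Lemma match_extra (ex sp : seq nat) :
  (forall l, l \in rg -> [|| exA l, exB l | exC l] -> l \in ex) ->
  uniq sp -> (forall k, k \in sp -> mid k && (0 < k < lam)) ->
  (forall k l, k \in sp -> l \in rg -> std l -> shift l != k) ->
  count (predC cov) rg + size sp <= count low rg + count mid rg + size ex.
Proof.
move=> hex usp hsp hdisj.
have h1 : count (predC cov) rg <= count low rg + count std rg + size ex.
  rewrite -!size_filter -!size_cat; apply: uniq_leq_size.
    by rewrite filter_uniq // iota_uniq.
  move=> l; rewrite mem_filter => /andP[/= hc hl].
  have := uncovered_cases _ hc; rewrite -mem_rg => /(_ hl).
  rewrite !mem_cat !mem_filter hl !andbT => /orP[->//|/orP[->|h]]; first by rewrite orbT.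
  by rewrite (hex l hl h) orbT.
suff : count std rg + size sp <= count mid rg by lia.
rewrite -!size_filter -(size_map shift) -size_cat; apply: uniq_leq_size.
  rewrite cat_uniq usp andbT; apply/andP; split.
    rewrite map_inj_in_uniq ?filter_uniq ?iota_uniq // => x y.
    rewrite !mem_filter !mem_rg => /andP[sx hx] /andP[sy hy] e.
    have := shiftE hx sx; rewrite e (shiftE hy sy) => /eqP; rewrite eqn_pmul2l //; lia.
  apply/hasPn => k hk; apply/negP => /mapP[l]; rewrite mem_filter => /andP[sl hl] e.
  by move: (hdisj k l hk hl sl); rewrite e eqxx.
move=> k; rewrite mem_cat mem_filter mem_rg => /orP[/mapP[l]|/hsp //].
by rewrite mem_filter mem_rg => /andP[sl hl] ->; apply: std_mid.
Qed.

Lemma mid1 : 1 < lam -> mid 1.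
Proof.
move=> hl; rewrite /mid muln1 dvdn1; apply/and3P; split; [by rewrite gtn_eqF| |].
  have [p2|p2] := eqVneq p 2; last by nia.
  by move: lam_p; rewrite p2 /P p2 dvdn2 negbK mul1n; case: lam hl => [|[|[|m]]].
by rewrite (leq_trans p_gt1) // leq_pmulr.
Qed.

Lemma shift_mod l : l \in rg -> std l -> shift l + lam = 0 %[mod p.+1].
Proof. by rewrite mem_rg => hl hs; rewrite (shiftE hl hs) modnMr mod0n. Qed.

Lemma shift_neq (cand : seq nat) :
  forall k l, k \in [seq k <- cand | k + lam != 0 %[mod p.+1]] -> l \in rg -> std l ->
  shift l != k.
Proof.
move=> k l; rewrite mem_filter => /andP[+ _] hl hs; apply: contraNneq => <-.
by apply/eqP; apply: shift_mod.
Qed.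

(** Pairwise incongruent numbers modulo p + 1: at most one of them lies in the class that contains
    the image of [shift]. *)
Lemma filter3 x y z : x < y -> y < z -> ~~ (p.+1 %| y - x) -> ~~ (p.+1 %| z - y) ->
  ~~ (p.+1 %| z - x) -> 2 <= size [seq k <- [:: x; y; z] | k + lam != 0 %[mod p.+1]].
Proof.
move=> h1 h2 d1 d2 d3.
have hne a b : a < b -> ~~ (p.+1 %| b - a) -> a + lam == 0 %[mod p.+1] -> b + lam == 0 %[mod p.+1] -> false.
  move=> hab hb /eqP ha /eqP hb'; have : b + lam == a + lam %[mod p.+1] by rewrite ha hb'.
  by rewrite eqn_modDr eqn_mod_dvd ?(ltnW hab) // (negPf hb).
have hxy := hne x y h1 d1; have hyz := hne y z h2 d2.
have hz := hne x z (ltn_trans h1 h2) d3.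
move: hxy hyz hz; rewrite /=.
case: (x + _ == _ %[mod _]); case: (y + _ == _ %[mod _]); case: (z + _ == _ %[mod _]) => //= a b d.
- by have := a isT isT.
- by have := a isT isT.
- by have := d isT isT.
- by have := b isT isT.
Qed.

Lemma exA_t la : exA la -> exists2 t, n = P * t & la = p * t /\ t < lam - la.
Proof.
move=> /andP[/eqP e1 h2].
have hco : coprime P p by rewrite pP coprimenS.
have /dvdnP[t et] : P %| n by rewrite -(Gauss_dvdr _ hco) -e1 dvdn_mulr.
rewrite mulnC in et; exists t => //; split.
  by apply/eqP; rewrite -(eqn_pmul2l P_gt0) e1 et mulnCA.
by move: h2; rewrite et ltn_pmul2l.
Qed.

(** There are at most two exceptional levels, and exactly as many elements of [mid] have to be found
    outside the image of [shift]. The excluded case is the one where [mid] is too small for this. *)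
Lemma uncovered_le : ~~ [&& p == 2, n == 1 & 4 <= lam] ->
  count (predC cov) rg <= count low rg + count mid rg.
Proof.
move=> hexc.
have [/hasP[la hla /exA_t[t et [ela ht]]]|hA] := boolP (has exA rg).
  rewrite mem_rg in hla.
  have t0 : 0 < t by move: n_gt0; rewrite et muln_gt0 => /andP[].
  have pt : p * t = P * t + t by rewrite pP mulSn addnC.
  have hlam : p * t + t < lam by lia.
  (* Besides [la] only lam - t can be exceptional: [exB] means (p - 1) (lam - l) = n = (p - 1) t,
     and [exC] would give lam < (p + 1) t. *)
  have hex l : l \in rg -> [|| exA l, exB l | exC l] -> l \in [:: la; lam - t].
    rewrite mem_rg => hl; rewrite !inE => /or3P[/exA_t[t' et' [-> _]]|/andP[/eqP h1 _]|/andP[/eqP h1 h2]].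
    - suff -> : t' = t by rewrite ela eqxx.
      by apply/eqP; rewrite -(eqn_pmul2l P_gt0) -et -et'.
    - suff -> : l = lam - t by rewrite eqxx orbT.
      have : lam - l = t by apply/eqP; rewrite -(eqn_pmul2l P_gt0) h1 et.
      lia.
    have hm : lam - l < t by move: h2; rewrite et ltn_pmul2l.
    have : p * (lam - l) <= p * t by rewrite leq_mul2l ltnW ?orbT.
    lia.
  (* If a standard level exists, the spare elements must avoid the image of [shift]; but then t >= 2
     p, and three pairwise incongruent small candidates belong to [mid]. Without standard levels two
     small elements of [mid] suffice. *)
  have [/hasP[l hl hs]|hstd] := boolP (has std rg).
    have ht2 : 2 * p <= t.
      rewrite mem_rg in hl; move: hs; rewrite /std => /and4P[h1 h2 _ h3].
      have el : lam = l + (lam - l) by lia.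
      move: (lam - l) el h1 h2 h3 => m el h1 h2 h3.
      have hl2 : l < p * t.
        case/orP: h3 => h3.
          have hmt : m <= t by move: h3; rewrite et leq_pmul2l.
          have : p * m <= p * t by exact: leq_wmul2l.
          lia.
        by move: h3; rewrite et mulnCA ltn_pmul2l.
      have : P * (t + 2) <= P * m by rewrite leq_mul2l; lia.
      by rewrite mulnDr; lia.
    pose cand := if p == 2 then [:: 1; 3; 5] else [:: 1; 2; p.+1].
    pose sp := [seq k <- cand | k + lam != 0 %[mod p.+1]].
    have hsize : 2 <= size sp.
      rewrite /sp /cand; case: eqP => p2; apply: filter3 => //; rewrite ?p2 //; try (by rewrite gtnNdvd //; lia); by lia.
    have := @match_extra [:: la; lam - t] sp hex _ _ (shift_neq (cand := cand)).
    rewrite -/sp /=; set a := count _ _; set b := count _ _; set d := count _ _ => H.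
    suff : a + size sp <= b + d + 2 by lia.
    apply: H.
      apply: filter_uniq; rewrite /cand; case: eqP => [//|p2] /=.
      by rewrite !inE !negb_or /= andbT; apply/andP; split; [lia|lia].
    have hn : t <= n by rewrite et leq_pmull.
    move=> k; rewrite mem_filter => /andP[_].
    rewrite /cand /mid; case: eqP => p2; rewrite !inE => /or3P[] /eqP ->; rewrite ?dvdn1.
    + by rewrite /P p2; lia.
    + by rewrite /P p2; lia.
    + by rewrite /P p2; lia.
    + by rewrite gtn_eqF //; nia.
    + by rewrite gtnNdvd //; [nia|lia].
    rewrite -addn1 dvdn_addr // dvdn1 gtn_eqF //=.
    have : p * (2 * p) <= p * n by rewrite leq_mul2l (leq_trans ht2 hn) orbT.
    have : P * (p * (2 * p)) <= P * lam by rewrite leq_mul2l; apply/orP; right; apply: leq_trans (ltnW hlam); rewrite (leq_trans _ (leq_addr _ _)) // leq_mul2l ht2 orbT.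
    have : p * (2 * p) <= P * (p * (2 * p)) by rewrite leq_pmull.
    have : p * 2 <= p * p by rewrite leq_mul2l p_gt1 orbT.
    have : p * p <= p * t by rewrite leq_mul2l; lia.
    rewrite mulnDr muln1 mulnCA; lia.
  pose sp := if p == 2 then [:: 1; 3] else [:: 1; 2].
  have := @match_extra [:: la; lam - t] sp hex _ _ _.
  have -> : size sp = 2 by rewrite /sp; case: eqP.
  rewrite leq_add2r; apply.
  - by rewrite /sp; case: eqP.
  - have hlam1 : 1 < lam by lia.
    move=> k; rewrite /sp; case: eqP => p2; rewrite !inE => /orP[] /eqP ->; rewrite ?mid1 //=.
      (* For t = 1 and p = 2, that is n = 1 and lam > 3, the candidate 3 is not in [mid]: this is
         the excluded case. *)
      have t2 : t != 1.
        apply: contra hexc => /eqP t1; rewrite et /P p2 t1 /=; move: hlam; rewrite p2 t1; lia.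
      by rewrite /mid et /P p2 /=; lia.
    rewrite /mid gtnNdvd //=; last by lia.
    have : P * (p + 2) <= P * lam by rewrite leq_mul2l; nia.
    have : p * 1 <= p * n by rewrite leq_mul2l n_gt0 orbT.
    by rewrite mulnDr; nia.
  by move=> k l _ hl hs; move: hstd => /hasPn/(_ l hl); rewrite hs.
(* If [exB] held with l > p (lam - l), then p (lam - l) would satisfy [exA], which has been
   excluded. *)
have key l : l \in rg -> exB l || exC l -> l = p * (lam - l).
  rewrite mem_rg => hl /orP[/andP[/eqP h1 h2]|/andP[/eqP //]].
  apply/eqP; rewrite eqn_leq h2 andbT leqNgt; apply/negP => hlt.
  move/hasPn: hA => /(_ (p * (lam - l))); rewrite mem_rg /exA mulnCA h1 eqxx /=.
  have hm : 0 < p * (lam - l) < lam by rewrite muln_gt0 p_gt0; lia.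
  move=> /(_ hm) /negP; apply; rewrite -[X in X < _]h1 ltn_mul2l P_gt0; lia.
have [/hasP[l0 hl0 hl0']|hB] := boolP (has (fun l => exB l || exC l) rg).
  have e0 := key l0 hl0 hl0'; rewrite mem_rg in hl0.
  (* This makes the exceptional level unique, and it puts the image of [shift] into the multiples of
     p + 1, so that 1 is a spare element of [mid]. *)
  have elam : lam = p.+1 * (lam - l0) by rewrite mulSn -e0; lia.
  have := @match_extra [:: l0] [:: 1] _ _ _ _; rewrite leq_add2r; apply => //.
  - move=> l hl; case/orP => [hAl|hl']; first by move/hasPn: hA => /(_ l hl); rewrite hAl.
    have e1 := key l hl hl'; rewrite mem_rg in hl.
    have : p.+1 * (lam - l) = p.+1 * (lam - l0) by rewrite -elam mulSn -e1; lia.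
    move/eqP; rewrite eqn_pmul2l // inE; lia.
  - have hlam1 : 1 < lam by lia.
    by move=> k; rewrite inE => /eqP ->; rewrite mid1.
  move=> k l; rewrite inE => /eqP -> hl hs; apply/eqP => e1.
  have := shift_mod hl hs; rewrite e1 elam [_ * _]mulnC addnC modnMDl.
  by rewrite mod0n modn_small.
have := @match_extra [::] [::] _ _ _ _; rewrite leq_add2r; apply => //.
move=> l hl; case/orP => [hAl|hl']; first by move/hasPn: hA => /(_ l hl); rewrite hAl.
by move/hasPn: hB => /(_ l hl); rewrite hl'.
Qed.

Lemma uncovered_le_tie : p = 2 -> n = 1 -> 4 <= lam ->
  count (predC cov) rg <= (count low rg + count mid rg).+1 /\ ~~ cov 2.
Proof.
move=> p2 n1 hl; split; last by rewrite /cov /P p2 n1; lia.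
have := @match_extra [:: 2; lam - 1] [:: 1] _ _ _ _; rewrite /= !addn1 addn2 ltnS; apply => //.
- move=> l; rewrite mem_rg !inE /exA /exB /exC /P p2 n1; lia.
- by move=> k; rewrite inE => /eqP ->; rewrite mid1 //=; lia.
move=> k l _; rewrite mem_rg /std /P p2 n1; lia.
Qed.

Lemma count_supp (a : pred nat) x x' y y' : (forall k, a k -> (x <= k < y) = (x' <= k < y')) ->
  count a (index_iota x y) = count a (index_iota x' y').
Proof.
move=> h; rewrite -!size_filter; apply: perm_size; apply: uniq_perm.
- by rewrite filter_uniq ?iota_uniq.
- by rewrite filter_uniq ?iota_uniq.
by move=> k; rewrite !mem_filter !mem_index_iota; case: (boolP (a k)) => //= /h.
Qed.

Lemma count_ndvd m : count (fun i => ~~ (p %| i)) (index_iota 0 m) = m - ceilp p m.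
Proof.
have := F_count p_pr (dvd1n P) 0 m; rewrite (F_window p_pr (dvd1n P)).
have -> : count (fun i => ~~ (p %| i)) (index_iota 0 m) =
   count (fun i => ~~ (p %| i) && (i == 0 %[mod 1])) (index_iota 0 m).
  by apply: eq_count => i; rewrite !modn1 eqxx andbT.
move=> <-; rewrite (@eq_count _ _ predT) ?count_predT ?size_iota //.
by move=> i; rewrite /= !modn1.
Qed.

(** With s = ceil(n / (p - 1)) the condition becomes k < n + s, and s of these n + s numbers are
    multiples of p. *)
Lemma count_base : count (fun k => ~~ (p %| k) && (P * k < p * n)) (index_iota 0 (p * n)) = n.
Proof.
have [s /andP[s1 s2]] : exists s, P * s < n + P <= P * s + P.
  exists ((n + P.-1) %/ P); have := divn_eq (n + P.-1) P; have := ltn_pmod (n + P.-1) P_gt0.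
  set a := _ %/ _; set b := _ %% _ => h1 h2; have : P * a = a * P by rewrite mulnC.
  by lia.
have ps : p * s = P * s + s by rewrite pP mulSn addnC.
have pn : p * n = P * n + n by rewrite pP mulSn addnC.
have e : n + s - ceilp p (n + s) = n.
  by rewrite (@ceilp_eq p p_pr _ s) ?addnK // mulnC; lia.
have hk k : (P * k < p * n) = (k < n + s).
  rewrite pn; apply/idP/idP => h.
    rewrite ltnNge; apply/negP => h'.
    have : P * (n + s) <= P * k by exact: leq_wmul2l.
    by rewrite mulnDr; lia.
  have : P * k.+1 <= P * (n + s) by exact: leq_wmul2l.
  by rewrite mulnDr mulnS; lia.
rewrite -[RHS]e -count_ndvd -[in RHS](@eq_in_count _ (fun k => ~~ (p %| k) && (P * k < p * n))); last first.
  by move=> k; rewrite mem_index_iota /= hk => ->; rewrite andbT.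
apply: count_supp => k /andP[_ h']; have h := h'; rewrite hk in h; rewrite h /=.
by rewrite (leq_ltn_trans _ h') // leq_pmull.
Qed.

Lemma count_low_le : count low rg <= n.
Proof.
rewrite -[X in _ <= X]count_base; apply: (@leq_trans (count low (index_iota 0 (p * n)))).
  apply: eq_leq; apply: count_supp => k /and3P[h1 h2 h3].
  have k0 : 0 < k by case: (k) h1; rewrite ?dvdn0.
  have : k <= P * k by rewrite leq_pmull.
  have : p * k = P * k + k by rewrite pP mulSn addnC.
  have : lam <= k -> P * lam <= P * k by exact: leq_wmul2l.
  lia.
by apply: sub_count => k /and3P[h1 _ h3]; rewrite h1.
Qed.

Lemma count_low_eq : (forall k, P * k < p * n -> p * k <= P * lam) -> count low rg = n.
Proof.
move=> h; rewrite -[RHS]count_base.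
have -> : count (fun k => ~~ (p %| k) && (P * k < p * n)) (index_iota 0 (p * n)) =
    count low (index_iota 0 (p * n)).
  by apply: eq_count => k /=; rewrite /low; have := h k; case: (P * k < p * n) => [->|_]; rewrite ?andbF.
apply: count_supp => k /and3P[h1 h2 h3].
have k0 : 0 < k by case: (k) h1; rewrite ?dvdn0.
have : k <= P * k by rewrite leq_pmull.
have : p * k = P * k + k by rewrite pP mulSn addnC.
have : lam <= k -> P * lam <= P * k by exact: leq_wmul2l.
lia.
Qed.

Lemma count_mid_eq : p * (p * n) <= P * lam -> count mid rg = p * n - n.
Proof.
move=> h.
have ec : ceilp p (p * n) = n by apply: ceilp_eq => //; rewrite mulnC leqnn /=; lia.
have := count_ndvd (p * n); rewrite ec => <-.
have -> : count (fun i => ~~ (p %| i)) (index_iota 0 (p * n)) = count mid (index_iota 0 (p * n)).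
  apply: eq_in_count => k; rewrite mem_index_iota /= /mid => hk; rewrite hk andbT.
  have : p * k < p * (p * n) by rewrite ltn_pmul2l.
  by move=> hk2; rewrite (leq_trans hk2 h) andbT.
apply: count_supp => k /and3P[h1 h2 h3].
have k0 : 0 < k by case: (k) h1; rewrite ?dvdn0.
have : P * k <= p * k by rewrite leq_mul2r leq_pred orbT.
have : lam <= k -> P * lam <= P * k by exact: leq_wmul2l.
lia.
Qed.

Lemma count_low_mid_eq0 : (count low rg + count mid rg == 0) = (lam == 1).
Proof.
have [->|l1] := eqVneq lam 1; first by [].
apply/eqP => h; have l2 : 1 < lam by lia.
have : 0 < count mid rg.
  by rewrite -has_count; apply/hasP; exists 1; [rewrite mem_rg | apply: mid1].
lia.
Qed.
End Levels.

(** * Flat, sharp and the translation from k_w to levels of K_v *)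

Section Numerics.
Variables (p e lam n c : nat).
Hypotheses (p_pr : prime p) (e_dvd : (e %| p.-1)%N) (lam_gt0 : (0 < lam)%N) (lam_p : ~~ (p %| lam)%N)
 (n_gt0 : (0 < n)%N) (c_def : (c * p.-1 = e * n)%N).
Let p_gt1 := prime_gt1 p_pr.
Let p_gt0 := prime_gt0 p_pr.
Let e_gt0 : (0 < e)%N. Proof. by apply: dvdn_gt0 e_dvd; lia. Qed.
Let P_gt0 : (0 < p.-1)%N. Proof. by lia. Qed.
Let c_gt0 : (0 < c)%N.
Proof. by rewrite -(ltn_pmul2r P_gt0) c_def mul0n muln_gt0 e_gt0. Qed.
Let N := (p * c)%N.
Let lamw : rat := (e * lam)%:R.
Let ec : (p.-1 * N = p * (e * n))%N. Proof. by rewrite /N mulnCA [(p.-1 * c)%N]mulnC c_def. Qed.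
Let PR : (p%:R - 1 : rat) = p.-1%:R. Proof. by rewrite -subn1 natrB. Qed.

(** Both branches of [flat] amount to the same integral inequality on the positive i up to N, which
    avoids rounding in the counts. *)
Lemma flat_le i : (0 < i <= N)%N -> (flat p N lamw <= i)%N = (p * (N - i) <= p.-1 * (e * lam))%N.
Proof.
move=> /andP[i0 hi]; rewrite /flat PR.
have P0 : 0 < p.-1%:R :> rat by rewrite ltr0n.
have p0 : 0 < p%:R :> rat by rewrite ltr0n.
have N0 : (0 < N)%N by rewrite muln_gt0 p_gt0.
have e1 : (N%:R - 1 : rat) = N.-1%:R by rewrite -subn1 natrB.
case: ifP => hlt; last first.
  rewrite i0; apply/esym/idP.
  move/negbT: hlt; rewrite -leNgt e1 ler_pdivrMr // -!natrM ler_nat mulnC => h.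
  by rewrite [(p.-1 * _)%N]mulnC; apply: leq_trans h; rewrite mulnC leq_mul2r; lia.
move: hlt; rewrite e1 ltr_pdivlMr // -!natrM ltr_nat => hlt.
set x := N%:R - _.
have x0 : 0 <= x.
  rewrite /x subr_ge0 ler_pdivrMr // -!natrM ler_nat mulnC.
  by apply: ltnW; apply: leq_trans hlt _; rewrite mulnC leq_mul2r; lia.
have -> : (`|Num.ceil x| <= i)%N = (x <= i%:R).
  have cx : (0 : int) <= Num.ceil x by rewrite ceil_ge0 (lt_le_trans (ltrN10 _) x0).
  by rewrite -lez_nat gez0_abs // ceil_le_int.
rewrite /x lerBlDr -lerBlDl -natrB // ler_pdivlMr // -!natrM ler_nat.
by rewrite mulnC.
Qed.

Lemma lt_sharp i : (N <= i)%N -> (i < sharp p N lamw)%N = (p * (i - N) < p.-1 * (e * lam))%N && (i < p * N)%N.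
Proof.
move=> hi; rewrite /sharp PR.
have P0 : 0 < p.-1%:R :> rat by rewrite ltr0n.
have p0 : 0 < p%:R :> rat by rewrite ltr0n.
rewrite -natrM ltr_nat; have [hlt|hlt] := ltnP (e * lam)%N (p * N)%N.
  set x := N%:R + _.
  have x0 : 0 <= x by rewrite addr_ge0 ?divr_ge0 ?mulr_ge0 ?ler0n.
  have -> : (i < `|Num.ceil x|)%N = (i%:R < x).
    have cx : (0 : int) <= Num.ceil x by rewrite ceil_ge0 (lt_le_trans (ltrN10 _) x0).
    by rewrite -ltz_nat gez0_abs // ceil_gt_int.
  rewrite /x -ltrBlDl -natrB // ltr_pdivlMr // -!natrM ltr_nat mulnC.
  case: ltnP => //= h; apply/esym; rewrite ltnNge; apply/negP => h'.
  have : (p * (p.-1 * N) <= p * (i - N))%N.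
    by rewrite leq_mul2l; apply/orP; right; have := prednK p_gt0; nia.
  have : (p.-1 * (e * lam) < p.-1 * (p * N))%N by rewrite ltn_pmul2l.
  by rewrite mulnCA; lia.
case: ltnP => h; last by rewrite andbF.
rewrite andbT; apply/esym.
have : (p * (i - N) < p * (p.-1 * N))%N.
  by rewrite ltn_pmul2l //; have := prednK p_gt0; nia.
have : (p.-1 * (p * N) <= p.-1 * (e * lam))%N by rewrite leq_pmul2l.
by rewrite mulnCA; lia.
Qed.

Local Notation Q := (fun i => ~~ (p %| i)%N && (i == c %[mod e])%N).
Local Notation rg := (index_iota 1 lam).

Lemma F_diff a b : (a <= b)%N -> (F p e c b)%:Z - (F p e c a)%:Z = (count Q (index_iota a b))%:Z.
Proof.
move=> h; rewrite !(F_count p_pr e_dvd) (@index_iota_cat 0 a b) // count_cat PoszD addrAC subrr add0r.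
by [].
Qed.
Lemma N_mod i : (i == c %[mod e])%N = (i == N %[mod e])%N.
Proof.
have pe : (p = 1 %[mod e])%N by apply/eqP; rewrite eqn_mod_dvd // subn1.
by rewrite /N -(modnMml p c) pe modnMml mul1n.
Qed.
Lemma pe_coprime : coprime p e.
Proof.
by rewrite prime_coprime // gtnNdvd //; have := dvdn_leq P_gt0 e_dvd; lia.
Qed.

(** The bijection is k -> N - e k. The class of c modulo e is that of N = p c, and as p divides N
    and is prime to e, it divides N - e k exactly when it divides k. Positivity of N - e k is the
    bound (p - 1) k < p n. *)
Lemma count_below : count Q (index_iota (flat p N lamw) N) = count (low p lam n) rg.
Proof.
have fl1 : (0 < flat p N lamw)%N.
  rewrite ltnNge; apply/negP => h; move: h; rewrite leqn0 => /eqP e0.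
  move: e0; rewrite /flat; case: ifP => // hlt /eqP; rewrite absz_eq0 => /eqP hc.
  have := ceil_ge (N%:R - (p%:R - 1) * lamw / p%:R); rewrite hc PR subr_le0 ler_pdivlMr ?ltr0n // -!natrM ler_nat => h.
  move: hlt; rewrite PR ltr_pdivlMr ?ltr0n // => hlt.
  have : (p.-1 * (e * lam))%:R < (N * p)%:R :> rat.
    apply: (@lt_le_trans _ _ (p%:R * (N%:R - 1))); first by rewrite natrM mulrC.
    by rewrite natrM mulrC ler_wpM2r // lerBlDr lerDl.
  by rewrite ltr_nat ltnNge h.
rewrite -!size_filter -[RHS](size_map (fun k => N - e * k)%N); apply: perm_size; apply: uniq_perm.
- by rewrite filter_uniq ?iota_uniq.
- rewrite map_inj_in_uniq ?filter_uniq ?iota_uniq // => x y.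
  rewrite !mem_filter => /andP[/and3P[_ _ hx] _] /andP[/and3P[_ _ hy] _] h.
  have hle z : (p.-1 * z < p * n -> e * z < N)%N.
    by move=> hz; rewrite -(ltn_pmul2l P_gt0) ec mulnCA [(p * (e * n))%N]mulnCA ltn_pmul2l.
  apply/eqP; rewrite -(eqn_pmul2l e_gt0); apply/eqP; have := hle _ hx; have := hle _ hy; lia.
move=> i; rewrite mem_filter mem_index_iota; apply/idP/mapP.
  move=> /andP[/andP[hd hmod] /andP[h1 h2]].
  have i0 : (0 < i)%N by apply: leq_trans h1.
  rewrite N_mod eq_sym eqn_mod_dvd ?(ltnW h2) // in hmod.
  have /dvdnP[k ek] := hmod; rewrite mulnC in ek.
  have ei : i = (N - e * k)%N by rewrite -ek; lia.
  exists k => //; rewrite flat_le ?i0 ?(ltnW h2) // ek mulnCA in h1.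
  have h1' : (p * k <= p.-1 * lam)%N by rewrite -(leq_pmul2l e_gt0) (leq_trans h1) // mulnCA.
  have k0 : (0 < k)%N by case: (k) ek => [|//]; rewrite muln0; lia.
  rewrite mem_filter mem_index_iota k0 /= /low h1'; apply/andP; split; last first.
    rewrite ltnNge; apply/negP => hk; have : (p.-1 * lam <= p.-1 * k)%N by exact: leq_wmul2l.
    have : (p.-1 * k < p * k)%N by rewrite ltn_pmul2r //; lia.
    lia.
  apply/andP; split.
    by apply: contra hd => hk; rewrite ei /N; apply: dvdn_sub; [exact: dvdn_mulr|exact: dvdn_mull].
  rewrite -(ltn_pmul2l e_gt0) [(e * (p * n))%N]mulnCA -ec mulnCA -ek ltn_pmul2l //; lia.
move=> [k]; rewrite mem_filter mem_index_iota => /andP[/and3P[hd h1 h2] /andP[k0 _]] ->.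
have hk : (e * k < N)%N.
  by rewrite -(ltn_pmul2l P_gt0) ec mulnCA [(p * (e * n))%N]mulnCA ltn_pmul2l.
have ek0 : (0 < e * k)%N by rewrite muln_gt0 e_gt0.
rewrite flat_le; last by lia.
rewrite subKn ?(ltnW hk) // mulnCA [(_.-1 * (e * _))%N]mulnCA leq_pmul2l // h1.
rewrite N_mod eq_sym eqn_mod_dvd ?leq_subr // subKn ?(ltnW hk) // dvdn_mulr //= andbT.
have pN : (p %| N)%N by rewrite /N dvdn_mulr.
rewrite (dvdn_subr (ltnW hk) pN) Gauss_dvdr ?pe_coprime // hd /=.
by lia.
Qed.

(** The bijection is k -> N + e k, with the same congruences; the bound p N becomes k < p n because
    (p - 1) N = p e n. *)
Lemma count_above : count Q (index_iota N (sharp p N lamw)) = count (mid p lam n) rg.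
Proof.
have hpN k : (e * k < p.-1 * N)%N = (k < p * n)%N by rewrite ec mulnCA ltn_pmul2l.
have epN : (p * N = N + p.-1 * N)%N by rewrite -{1}(prednK p_gt0) mulSn.
rewrite -!size_filter -[RHS](size_map (fun k => N + e * k)%N); apply: perm_size; apply: uniq_perm.
- by rewrite filter_uniq ?iota_uniq.
- rewrite map_inj_in_uniq ?filter_uniq ?iota_uniq // => x y _ _ /addnI/eqP.
  by rewrite eqn_pmul2l // => /eqP.
move=> i; rewrite mem_filter mem_index_iota; apply/idP/mapP.
  move=> /andP[/andP[hd hmod] /andP[h1]]; rewrite lt_sharp // => /andP[h2 h3].
  rewrite N_mod eqn_mod_dvd // in hmod.
  have /dvdnP[k ek] := hmod; rewrite mulnC in ek.
  have ei : i = (N + e * k)%N by rewrite -ek; lia.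
  exists k => //; rewrite ek mulnCA [(_.-1 * (e * _))%N]mulnCA ltn_pmul2l // in h2.
  have k0 : (0 < k)%N by case: (k) ei hd => [|//]; rewrite muln0 addn0 => ->; rewrite dvdn_mulr.
  have hdk : ~~ (p %| k)%N.
    by apply: contra hd => hk; rewrite ei /N; apply: dvdn_add; [exact: dvdn_mulr|exact: dvdn_mull].
  rewrite mem_filter mem_index_iota k0 /= /mid h2 hdk /= -hpN; apply/andP; split; first by lia.
  rewrite ltnNge; apply/negP => hk; have : (p.-1 * lam <= p.-1 * k)%N by exact: leq_wmul2l.
  have : (p.-1 * k < p * k)%N by rewrite ltn_pmul2r //; lia.
  lia.
move=> [k]; rewrite mem_filter mem_index_iota => /andP[/and3P[hd h1 h2] /andP[k0 _]] ->.
have hlt : (N + e * k < p * N)%N by rewrite epN ltn_add2l hpN.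
rewrite lt_sharp ?leq_addr // addKn mulnCA [(_.-1 * (e * _))%N]mulnCA ltn_pmul2l // h1 hlt.
rewrite N_mod eqn_mod_dvd ?leq_addr // addKn dvdn_mulr // !andbT.
have pN : (p %| N)%N by rewrite /N dvdn_mulr.
by rewrite (dvdn_addr _ pN) Gauss_dvdr ?pe_coprime.
Qed.

Lemma flat_leN : (flat p N lamw <= N)%N.
Proof. by rewrite flat_le ?subnn ?muln0 // leqnn andbT muln_gt0 p_gt0. Qed.

Lemma leN_sharp : (N <= sharp p N lamw)%N.
Proof.
have N0 : (0 < N)%N by rewrite muln_gt0 p_gt0.
apply: ltnW; rewrite lt_sharp // subnn muln0 !muln_gt0 P_gt0 e_gt0 lam_gt0 /=.
by rewrite -{1}[N]mul1n ltn_pmul2r.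
Qed.

Theorem b_lowE : (F p e c N)%:Z - (F p e c (flat p N lamw))%:Z = (count (low p lam n) rg)%:Z.
Proof. by rewrite F_diff ?flat_leN // count_below. Qed.

Theorem b_upE : (F p e c (sharp p N lamw))%:Z - (F p e c (flat p N lamw))%:Z =
  (count (low p lam n) rg + count (mid p lam n) rg)%:Z.
Proof.
rewrite F_diff; last exact: leq_trans flat_leN leN_sharp.
by rewrite (@index_iota_cat _ N) ?flat_leN ?leN_sharp // count_cat count_below count_above.
Qed.

Lemma flat1 : flat p N lamw = 1%N -> count (low p lam n) rg = n.
Proof.
move=> h1; apply: (count_low_eq p_pr lam_gt0 lam_p n_gt0) => k hk.
have hkN : (e * k < N)%N.
  by rewrite -(ltn_pmul2l P_gt0) ec mulnCA [(p * (e * n))%N]mulnCA ltn_pmul2l.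
have N0 : (0 < N)%N by rewrite muln_gt0 p_gt0.
have := flat_le (i := 1); rewrite h1 leqnn => /(_ N0)/esym h.
rewrite -(leq_pmul2l e_gt0) mulnCA [(e * (_ * lam))%N]mulnCA (leq_trans _ h) // leq_mul2l.
by apply/orP; right; lia.
Qed.

Lemma big_lam : (p * N <= e * lam)%N ->
  (count (low p lam n) rg + count (mid p lam n) rg = p * n)%N.
Proof.
move=> h.
have h' : (p * (p * n) <= p.-1 * lam)%N.
  have : (p.-1 * (p * N) <= p.-1 * (e * lam))%N by exact: leq_wmul2l.
  by rewrite mulnCA ec [(p * (e * n))%N]mulnCA mulnCA [(_.-1 * (e * _))%N]mulnCA leq_pmul2l.
rewrite (count_mid_eq p_pr lam_gt0 lam_p n_gt0 h') count_low_eq //.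
  by rewrite subnKC // leq_pmull.
move=> k hk; apply: leq_trans h'; rewrite leq_mul2l; apply/orP; right.
by apply: leq_trans (ltnW hk); rewrite leq_pmull.
Qed.
End Numerics.

(** * Supersingular reduction *)

Lemma mapW_comp (A B C : Type) (f : B -> C) (g : A -> B) W :
  mapW f (mapW g W) = mapW (f \o g) W.
Proof. by case: W. Qed.
Lemma eq_mapW (A B : Type) (f g : A -> B) W : f =1 g -> mapW f W = mapW g W.
Proof. by move=> h; rewrite /mapW !h. Qed.
Lemma discW_map (F F' : fieldType) (f : {rmorphism F -> F'}) W :
  discW (mapW f W) = f (discW W).
Proof. by case: W => a1 a2 a3 a4 a6; rewrite /discW /=; ring. Qed.
Lemma elliptic_map (F F' : fieldType) (f : {rmorphism F -> F'}) W :
  elliptic (mapW f W) = elliptic W.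
Proof. by rewrite /elliptic discW_map fmorph_eq0. Qed.
Lemma mapW_polyC (A B : comNzRingType) (f : {rmorphism A -> B}) W :
  mapW (map_poly f) (mapW polyC W) = mapW polyC (mapW f W).
Proof. by rewrite /mapW /= !map_polyC. Qed.

Lemma divrec_inj (R S : comNzRingType) (f : {rmorphism R -> S}) W x X Z :
  injective f -> divrec (mapW f W) (f x) (f \o X) (f \o Z) -> divrec W x X Z.
Proof.
move=> fI [/= X0 Z0 X1 Z1 rec].
split; try (by apply: fI; rewrite ?rmorph1 ?rmorph0).
move=> n.
have [h1 h2 h3] := rec n.
split; apply: fI; rewrite ?(rmorphM, rmorphD) /= ?h1 ?h2 ?h3 /formA /formB /formC /wb2 /wb4 /wb6 /wb8;
  by case: W {rec h1 h2 h3} => a1 a2 a3 a4 a6 /=; ring.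
Qed.

(** * Integrality of division polynomials *)

Section IntegralDivisionPolynomials.
Variables (O : comNzRingType) (F : fieldType) (h : {rmorphism O -> F}).
Hypothesis h_inj : injective h.

Let map_h_inj : injective (map_poly h).
Proof. exact: map_inj_poly h_inj (rmorph0 h). Qed.

Lemma monic_quotient_lift (D C : {poly O}) (Q : {poly F}) : D \is monic ->
  map_poly h C = map_poly h D * Q -> exists Q', map_poly h Q' = Q.
Proof.
move=> Dm e; exists (Pdiv.Ring.rdivp C D).
have e2 := congr1 (map_poly h) (Pdiv.RingMonic.rdivp_eq Dm C).
rewrite rmorphD rmorphM /= e in e2.
have : map_poly h (Pdiv.Ring.rmodp C D) = map_poly h D * (Q - map_poly h (Pdiv.Ring.rdivp C D)).
  by rewrite mulrBr e2; ring.
have [/eqP|nz] := eqVneq (Q - map_poly h (Pdiv.Ring.rdivp C D)) 0.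
  by rewrite subr_eq0 => /eqP ->.
move/(congr1 (fun q : {poly F} => size q)); rewrite size_monicM ?map_monic_eq0 //; last first.
  by rewrite monic_map.
move=> es; have := Pdiv.Ring.ltn_rmodpN0 C (monic_neq0 Dm).
have := size_poly_gt0 (Q - map_poly h (Pdiv.Ring.rdivp C D)); rewrite nz.
move=> a0; rewrite ltnNge => /negP[].
have e1 := size_map_inj_poly h_inj (rmorph0 h) (Pdiv.Ring.rmodp C D).
rewrite -(etrans (esym es) e1) (size_map_inj_poly h_inj (rmorph0 h)).
by case: (size (Q - _)) a0 => // m _; rewrite addnS leq_addr.
Qed.

Variable W : weierstrass O.
Hypothesis Wd : elliptic (mapW h W).

(** The recursion divides by monic numerators only, and a quotient by a monic polynomial over O has
    coefficients in O. The lifted recursion can then be mapped to the residue field. *)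
Lemma divpoly_lift : exists X Z : nat -> {poly O},
  [/\ divrec (mapW polyC W) 'X X Z, forall n, map_poly h (X n) = divnum (mapW h W) n &
   forall n, map_poly h (Z n) = divden (mapW h W) n].
Proof.
have rec := divrec_divpoly Wd.
have [X0 Z0 X1 Z1 recn] := rec.
have monic_lift (f : {poly O}) n : map_poly h f = divnum (mapW h W) n -> f \is monic.
  move=> e; apply/eqP/h_inj; rewrite rmorph1 -(lead_coef_map_inj h_inj (rmorph0 h)) e.
  exact/monicP/divnum_monic.
have ex n : exists f z, map_poly h f = divnum (mapW h W) n /\ map_poly h z = divden (mapW h W) n.
  suff [] : (exists f z, map_poly h f = divnum (mapW h W) n /\ map_poly h z = divden (mapW h W) n)
    /\ (exists f z, map_poly h f = divnum (mapW h W) n.+1 /\ map_poly h z = divden (mapW h W) n.+1) by [].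
  elim: n => [|n [[f0 [z0 [ef0 ez0]]] [f1 [z1 [ef1 ez1]]]]].
    split; first by exists 1, 0; rewrite X0 Z0 rmorph1 rmorph0.
    by exists 'X, 1; rewrite X1 Z1 rmorph1 map_polyX.
  split; first by exists f1, z1.
  have [r1 r2 r3] := recn n; rewrite -ef0 -ez0 -ef1 -ez1 in r1 r2 r3.
  have mC : map_poly h (formC (mapW polyC W) f1 z1 'X) =
      formC (mapW polyC (mapW h W)) (map_poly h f1) (map_poly h z1) 'X.
    rewrite -mapW_polyC /formC /wb4 /wb6 /wb8 -[in RHS](map_polyX h).
    by case: (W) => a1 a2 a3 a4 a6 /=; ring.
  have mB : map_poly h (formB (mapW polyC W) f1 z1 'X) =
      formB (mapW polyC (mapW h W)) (map_poly h f1) (map_poly h z1) 'X.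
    rewrite -mapW_polyC /formB /wb2 /wb4 /wb6 -[in RHS](map_polyX h).
    by case: (W) => a1 a2 a3 a4 a6 /=; ring.
  have [f2 ef2] : exists f2, map_poly h f2 = divnum (mapW h W) n.+2.
    apply: (@monic_quotient_lift f0 (formC (mapW polyC W) f1 z1 'X)).
      exact: (monic_lift _ n).
    by rewrite mC -r3 mulrC.
  have [z2 ez2] : exists z2, map_poly h z2 = divden (mapW h W) n.+2.
    apply: (@monic_quotient_lift f0 (formB (mapW polyC W) f1 z1 'X - f2 * z0)).
      exact: (monic_lift _ n).
    by rewrite rmorphB rmorphM /= mB -r2 ef2 addrAC subrr add0r.
  by exists f2, z2.
pose X n := proj1_sig (cid (ex n)).
have hX n : exists z, map_poly h (X n) = divnum (mapW h W) n /\ map_poly h z = divden (mapW h W) n.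
  exact: (proj2_sig (cid (ex n))).
pose Z n := proj1_sig (cid (hX n)).
have hZ n : map_poly h (X n) = divnum (mapW h W) n /\ map_poly h (Z n) = divden (mapW h W) n.
  exact: (proj2_sig (cid (hX n))).
exists X, Z; split; [|by move=> n; case: (hZ n)|by move=> n; case: (hZ n)].
apply: (divrec_inj (f := map_poly h)) => //.
rewrite mapW_polyC /= map_polyX; split=> /=; rewrite ?(hZ _).1 ?(hZ _).2 // => n.
by rewrite !(hZ _).1 !(hZ _).2.
Qed.
End IntegralDivisionPolynomials.

(** * The ring of integers and reduction of division polynomials *)

Section RingOfIntegers.
Variables (p : nat) (K : localField p).

Definition oint : {pred K} := fun x => (x == 0) || (0 <= lf_ord x).
Lemma ointP x : reflect (integral_at (@lf_ord p K) x) (x \in oint).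
Proof.
apply: (iffP orP); first by move=> [/eqP|]; [left|right].
by move=> [->|]; [left|right].
Qed.
Definition vK (x : K) : rat := (lf_ord x)%:~R.
Lemma vK_val : valuation vK.
Proof.
have [h1 h2] := lf_valuation K; split=> x y x0 y0; first by rewrite /vK h1 // intrD.
by move=> xy; have := h2 x y x0 y0 xy; rewrite !ge_min /vK !ler_int.
Qed.
Lemma oint_vge x : (x \in oint) = vge vK 0 x.
Proof. by rewrite /vge /vK ler0z. Qed.

Lemma oint_subring : subring_closed oint.
Proof.
split=> [|x y|x y]; rewrite !oint_vge; first exact: (vge01 vK_val).
  exact: (vgeB vK_val).
exact: (vgeM0 vK_val).
Qed.
HB.instance Definition _ := GRing.isSubringClosed.Build K oint oint_subring.

Record oring := ORing { oval :> K; oring_proof : oval \in oint }.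
HB.instance Definition _ := [isSub for oval].
HB.instance Definition _ := [Choice of oring by <:].
HB.instance Definition _ := [SubChoice_isSubComNzRing of oring by <:].

Fact oval_zmod : zmod_morphism oval. Proof. by []. Qed.
Fact oval_monoid : monoid_morphism oval. Proof. by []. Qed.
HB.instance Definition _ := GRing.isZmodMorphism.Build oring K oval oval_zmod.
HB.instance Definition _ := GRing.isMonoidMorphism.Build oring K oval oval_monoid.

Definition ored (x : oring) : lf_res K := lf_red (oval x).
Lemma ored_int (x : oring) : integral_at (@lf_ord p K) (oval x).
Proof. by apply/ointP; case: x. Qed.
Lemma oredB : zmod_morphism ored.
Proof.
move=> x y; apply/eqP; rewrite -subr_eq addrC opprK eq_sym -subr_eq0 addrC; apply/eqP.
have e : ored x = ored (x - y) + ored y by rewrite /ored -lf_redD ?subrK //; apply: ored_int.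
by rewrite e; ring.
Qed.
Lemma oredM : monoid_morphism ored.
Proof.
split; first exact: lf_red1.
by move=> x y; rewrite /ored lf_redM //; apply: ored_int.
Qed.
HB.instance Definition _ := GRing.isZmodMorphism.Build oring (lf_res K) ored oredB.
HB.instance Definition _ := GRing.isMonoidMorphism.Build oring (lf_res K) ored oredM.

Lemma ored_eq0 (x : oring) : (ored x == 0) = vgt vK 0 (oval x).
Proof.
rewrite /vgt /vK ltr0z; apply/eqP/orP => [/(lf_red_ker (ored_int x))[->|]|h].
- by left.
- by right.
by apply/(lf_red_ker (ored_int x)); case: h => [/eqP|]; [left|right].
Qed.

Lemma oval_inj : injective oval. Proof. exact: val_inj. Qed.
Lemma integralW_lift (W : weierstrass K) : integralW W -> exists W0, mapW oval W0 = W.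
Proof.
case: W => a1 a2 a3 a4 a6 [/ointP h1 /ointP h2 /ointP h3 /ointP h4 /ointP h6].
by exists (Weierstrass (ORing h1) (ORing h2) (ORing h3) (ORing h4) (ORing h6)).
Qed.

Lemma divpoly_integral (W : weierstrass K) n i : integralW W -> elliptic W ->
  vge vK 0 (divnum W n)`_i /\ vge vK 0 (divden W n)`_i.
Proof.
move=> /integralW_lift[W0 <-] Wd.
have [X [Z [_ hX hZ]]] := divpoly_lift (h := oval) oval_inj Wd.
by rewrite -hX -hZ !coef_map -!oint_vge !(valP (_ : oring)).
Qed.

Lemma curve_point (Om : closedFieldType) (W : weierstrass Om) x : exists y, on_curve W (Some (x, y)).
Proof.
have [|y /eqP] := @closed_rootP Om ('X^2 + ((wa1 W * x + wa3 W) *: 'X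
   - (x ^+ 3 + wa2 W * x ^+ 2 + wa4 W * x + wa6 W)%:P)) _.
  rewrite size_polyDl size_polyXn // ltnS.
  rewrite (leq_trans (size_polyD _ _)) // geq_max size_polyN.
  by rewrite (leq_trans (size_scale_leq _ _)) ?size_polyX // (leq_trans (size_polyC_leq1 _)).
rewrite !(hornerD, hornerN, hornerZ, hornerXn, hornerX, hornerC) => h; exists y; rewrite /=; apply/eqP; rewrite -subr_eq0; apply/eqP.
by rewrite -[RHS]h; ring.
Qed.

(** A root of the reduced denominator would be the abscissa of a p-torsion point of the reduced
    curve. There is none, so the reduced denominator has no root in an algebraic closure and is a
    non-zero constant. *)
Lemma supersingular_divden (W : weierstrass K) : integralW W -> elliptic W ->
  elliptic (mapW (@lf_red p K) W) -> supersingular p (mapW (@lf_red p K) W) ->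
  [/\ (divden W p)`_0 != 0, vK (divden W p)`_0 = 0 & forall i, (0 < i)%N -> vgt vK 0 (divden W p)`_i].
Proof.
move=> /integralW_lift[W0 <-] Wd rWd; rewrite mapW_comp => ss.
have [X [Z [rec hX hZ]]] := divpoly_lift (h := oval) oval_inj Wd.
have [kbar [i ik]] := countable_algebraic_closure (lf_res K).
have {}ss := ss kbar i (fun x => (integral_algebraic i x).2 (ik x)).
pose f : {rmorphism oring -> kbar} := i \o ored.
have Ed : elliptic (mapW f W0).
  by rewrite (_ : mapW f W0 = mapW i (mapW (@lf_red p K) (mapW oval W0))) ?elliptic_map // !mapW_comp.
pose E := ECurve Ed.
have Zroot x : (map_poly f (Z p)).[x] != 0.
  apply/eqP => e; have [y hy] := curve_point (mapW f W0) x.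
  pose P : ecpoint E := mkpt (hy : on_curve E _).
  have recx : divrec E x (fun n => (map_poly f (X n)).[x]) (fun n => (map_poly f (Z n)).[x]).
    have := divrec_morph (horner_eval x \o map_poly f) rec.
    have -> : mapW (horner_eval x \o map_poly f) (mapW polyC W0) = E.
      by rewrite mapW_comp; apply: eq_mapW => a /=; rewrite map_polyC /= /horner_eval hornerC.
    by rewrite /= /horner_eval map_polyX hornerX.
  have [s s0 [_]] := multiple_abscissa (erefl : ecval P = Some (x, y)) recx p.
  rewrite e => /esym/eqP; rewrite mulf_eq0 (negPf s0) /= => hz.
  have : torsion E p (ecval P).
    by apply/ec_torsion; apply: ecval_inj; case: (ecval _) hz => [[]|] //=; rewrite oner_eq0.
  rewrite /E /= (_ : mapW f W0 = mapW i (mapW (@lf_red p K \o oval) W0)); last by rewrite mapW_comp.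
  by rewrite ss.
have sZ : size (map_poly f (Z p)) == 1%N.
  apply: contraT => hs; have [x] := @closed_rootP kbar (map_poly f (Z p)) hs.
  by rewrite /root => h; have := Zroot x; rewrite h.
have fE j : (f (Z p)`_j == 0) = vgt vK 0 (divden (mapW oval W0) p)`_j.
  by rewrite -hZ coef_map /f /= fmorph_eq0 ored_eq0.
have c0 : f (Z p)`_0 != 0.
  by move: sZ; rewrite -coef_map size_poly_eq1 => h; have := Zroot 0; rewrite horner_coef0.
have int0 := (divpoly_integral p 0 _ Wd).2.
have [n0 v0] : (divden (mapW oval W0) p)`_0 != 0 /\ vK (divden (mapW oval W0) p)`_0 = 0.
  move: c0; rewrite fE /vgt negb_or -leNgt => /andP[h1 h2]; split=> //.
  apply/eqP; rewrite eq_le h2 /= -vge_nz // -hZ coef_map -oint_vge; exact: (valP (_ : oring)).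
split=> // j j0; rewrite -fE -coef_map nth_default ?eqxx //.
by rewrite (eqP sZ).
Qed.
End RingOfIntegers.

(** * Multiplication by p on abscissas *)

Section MultiplicationByP.
Variables (F : fieldType) (v : F -> rat).
Hypothesis v_val : valuation v.
Variables (E : ecurve F) (p : nat) (Phi Psi : {poly F}).
Hypotheses (hE : integral_curve v E) (Phi_monic : Phi \is monic) (Phi_size : size Phi = (p ^ 2).+1)
 (Phi_int : forall i, vge v 0 Phi`_i) (Psi0 : Psi`_0 != 0) (vPsi0 : v Psi`_0 = 0)
 (Psi_int : forall i, (0 < i)%N -> vgt v 0 Psi`_i)
 (mulE : forall (P : ecpoint E) x y, ecval P = Some (x, y) ->
  xrep (ecval (P *+ p)) Phi.[x] Psi.[x]).

Lemma num_val x : x != 0 -> v x < 0 -> Phi.[x] != 0 /\ v Phi.[x] = (p ^ 2)%:R * v x.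
Proof.
move=> x0 vx; have xp0 : x ^+ (p ^ 2) != 0 by rewrite expf_neq0.
have [|h1 h2] := @val_eq _ _ v_val (x ^+ (p ^ 2)) Phi.[x] xp0; last by rewrite h1 h2 (val_X v_val).
have -> : Phi.[x] - x ^+ (p ^ 2) = \sum_(i < p ^ 2) Phi`_i * x ^+ i.
  rewrite horner_coef Phi_size big_ord_recr /=.
  have -> : Phi`_(p ^ 2) = 1 by rewrite -(monicP Phi_monic) /lead_coef Phi_size.
  by rewrite mul1r addrK.
apply: (vgt_sum v_val) => i _; rewrite (val_X v_val) //.
have h : vge v (0 + i%:R * v x) (Phi`_i * x ^+ i).
  by apply: (vgeM v_val); [exact: Phi_int | rewrite -(val_X v_val) // vge_v].
apply: vge_gt h; rewrite add0r ltr_nM2r // ltr_nat; exact: ltn_ord.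
Qed.

Lemma num_int x : vge v 0 x -> vge v 0 Phi.[x].
Proof.
move=> hx; rewrite horner_coef; apply: (vge_sum v_val) => i _.
by apply: (vgeM0 v_val); [exact: Phi_int | exact: (vgeX v_val)].
Qed.

Lemma den_unit x : vge v 0 x -> Psi.[x] != 0 /\ v Psi.[x] = 0.
Proof.
move=> hx; have [|h1 h2] := @val_eq _ _ v_val Psi`_0 Psi.[x] Psi0; last by rewrite h1 h2.
have s0 : (0 < size Psi)%N by rewrite size_poly_gt0; apply: contraNneq Psi0 => ->; rewrite coef0.
rewrite horner_coef -(prednK s0) big_ord_recl /= expr0 mulr1 addrAC subrr add0r vPsi0.
apply: (vgt_sum v_val) => i _; apply: (vgtM0 v_val); first exact: Psi_int.
exact: (vgeX v_val).
Qed.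

(** At an integral abscissa the denominator is a unit and the numerator is integral, so p P has
    integral abscissa as well: [p] is injective on the reduced points. *)
Lemma kernel_mulp (P : ecpoint E) : in_kernel v (ecval (P *+ p)) -> in_kernel v (ecval P).
Proof.
case eP: (ecval P) => [[x y]|] //= h; have := mulE eP.
have [hx|hx] := boolP (vge v 0 x); last first.
  by move: hx; rewrite /vge negb_or -ltNge.
have [d0 vd] := den_unit hx; have hn := num_int hx.
move=> [s s0 [e1 e2]]; move: h e1 e2; case: (ecval _) => [[x' y']|] /=; last first.
  by rewrite mulr0 => _ _ e2; rewrite e2 eqxx in d0.
move=> /andP[x'0 vx'] e1 e2; rewrite mulr1 in e2.
move: hn; rewrite e1 /vge mulf_eq0 (negPf s0) (negPf x'0) /= (val_M v_val) // -e2 vd add0r.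
by rewrite leNgt vx'.
Qed.

Lemma mulp_abscissa (P : ecpoint E) x y : ecval P = Some (x, y) -> Psi.[x] != 0 ->
  exists y', ecval (P *+ p) = Some (Phi.[x] / Psi.[x], y').
Proof.
move=> eP d0; have [s s0 []] := mulE eP.
case: (ecval _) => [[x' y']|] /=; last by rewrite mulr0 => _ e2; rewrite e2 eqxx in d0.
by rewrite mulr1 => -> ->; exists y'; rewrite mulrC mulKf.
Qed.

Lemma mulp_eq0 (P : ecpoint E) x y : ecval P = Some (x, y) -> (P *+ p == 0) = (Psi.[x] == 0).
Proof.
move=> eP; have [s s0 [_ ->]] := mulE eP; rewrite mulf_eq0 (negPf s0) /=.
apply/eqP/eqP => [->//|]; case e: (ecval _) => [[]|] /=; first by move/eqP; rewrite oner_eq0.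
by move=> _; apply: ecval_inj.
Qed.
End MultiplicationByP.

Lemma mulrn_coprime (V : zmodType) (P : V) i j : coprime i j -> P *+ i = 0 -> P *+ j = 0 -> P = 0.
Proof.
move=> + hi hj; have [-> |i0] := posnP i.
  by rewrite /coprime gcd0n => /eqP e; rewrite e in hj.
move=> /(coprimeP _ i0)[[a b] /= e].
have e2 : (a * i = b * j + 1)%N by lia.
have : P *+ (a * i) = 0 by rewrite mulnC mulrnA hi mul0rn.
by rewrite e2 mulrnDr [(b * j)%N]mulnC mulrnA hj mul0rn add0r.
Qed.

(** * The cyclic group of p-torsion points *)

Section TorsionGroup.
Variables (F : fieldType) (E : ecurve F) (p : nat).
Hypothesis p_pr : prime p.
Lemma torsion_neq0 (P : ecpoint E) i : P != 0 -> P *+ p = 0 -> (0 < i < p)%N -> P *+ i != 0.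
Proof.
move=> P0 hp /andP[i0 ip]; apply: contra_neq P0 => hi; apply: mulrn_coprime hi hp.
by rewrite coprime_sym prime_coprime // gtnNdvd.
Qed.

Lemma torsion_inj (P : ecpoint E) i j : P != 0 -> P *+ p = 0 -> (i < p)%N -> (j < p)%N ->
  P *+ i = P *+ j -> i = j.
Proof.
move=> P0 hp; wlog le_ij : i j / (i <= j)%N.
  by move=> h hi hj e; case: (leqP i j) => [/h->|/ltnW/h<-].
move=> hi hj e; apply/eqP; rewrite eqn_leq le_ij leqNgt; apply/negP => lt_ij.
have := @torsion_neq0 P (j - i) P0 hp; rewrite mulrnBr // e subrr eqxx => h.
by suff : false by []; apply: h; lia.
Qed.

Hypothesis tors_card : (torsion E p #= `I_p)%card.

Lemma torsion_multiple (P Q : ecpoint E) : P != 0 -> P *+ p = 0 -> Q *+ p = 0 ->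
  exists2 m, (m < p)%N & Q = P *+ m.
Proof.
move=> P0 hp hq; apply: contrapT => hno.
pose s := Q :: [seq P *+ i | i <- iota 0 p].
have us : uniq s.
  rewrite /s /= map_inj_in_uniq ?iota_uniq ?andbT; last first.
    by move=> i j; rewrite !mem_iota => /andP[_ hi] /andP[_ hj]; apply: torsion_inj.
  by apply/negP => /mapP[i]; rewrite mem_iota => /andP[_ hi] e; apply: hno; exists i.
have ts R : R \in s -> torsion E p (ecval R).
  rewrite in_cons => h; apply/ec_torsion; case/orP: h => [/eqP -> //|/mapP[i _ ->]].
  by rewrite -mulrnA mulnC mulrnA hp mul0rn.
move: tors_card; rewrite card_eq_le => /andP[/pcard_leP[f] _].
have : (size [seq f (ecval R) | R <- s] <= size (iota 0 p))%N.
  apply: uniq_leq_size.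
    rewrite map_inj_in_uniq // => R R' hR hR' e; apply: ecval_inj.
    by apply: (@inj _ _ (torsion E p) f); rewrite ?inE //; apply: ts.
  by move=> _ /mapP[R /ts hR ->]; rewrite mem_iota; apply: (@funS _ _ _ _ f).
by rewrite size_map size_iota /= size_map size_iota ltnn.
Qed.
End TorsionGroup.

Lemma multiplicity_arith (P2 t k d c m f kap u1 u2 : rat) :
  u1 + u2 = 2 * c + m * (f - - k) + kap ->
  P2 * - t - u2 = P2 * - k - d * (t + - k) -> P2 * - t - u1 = P2 * - k - d * (t + - k) ->
  2 * (P2 * - k - d * (t + - k)) = 2 * (P2 * - t) - (2 * c + m * (f - - k) + kap).
Proof. lra. Qed.

(** * Level and multiplicity of the roots of the denominator of [p] *)

Section Torsion.
Variables (Om : closedFieldType) (v : Om -> rat).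
Hypothesis v_val : valuation v.
Variables (E : ecurve Om) (p : nat) (Phi Psi : {poly Om}).
Hypotheses (hE : integral_curve v E) (p_pr : prime p) (Phi_monic : Phi \is monic)
 (Phi_size : size Phi = (p ^ 2).+1) (Phi_int : forall i, vge v 0 Phi`_i) (Psi0 : Psi`_0 != 0)
 (vPsi0 : v Psi`_0 = 0) (Psi_int : forall i, (0 < i)%N -> vgt v 0 Psi`_i)
 (mulE : forall (P : ecpoint E) x y, ecval P = Some (x, y) ->
  xrep (ecval (P *+ p)) Phi.[x] Psi.[x]) (tors_card : (torsion E p #= `I_p)%card).
Variables (T : ecpoint E) (xT yT : Om).
Hypotheses (eT : ecval T = Some (xT, yT)) (T_tors : T *+ p = 0).

Let T0 : T != 0. Proof. by apply/eqP => e; move: eT; rewrite e. Qed.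
Let Psi_nz : Psi != 0. Proof. by apply: contraNneq Psi0 => ->; rewrite coef0. Qed.
Let p_gt0 := prime_gt0 p_pr.
Definition tau := - v xT / 2.

Lemma torsion_root (P : ecpoint E) x y : ecval P = Some (x, y) -> P *+ p = 0 ->
  [/\ root Psi x, x != 0 & v x < 0].
Proof.
move=> eP hp; have e : Psi.[x] = 0 by apply/eqP; rewrite -(mulp_eq0 mulE eP) hp.
split; first exact/rootP.
  by apply: contraNneq Psi0 => x0; move: e; rewrite x0 horner_coef0 => ->.
rewrite ltNge; apply/negP => hx.
have [] := @den_unit _ _ v_val Psi Psi0 vPsi0 Psi_int x _; first by rewrite /vge hx orbT.
by rewrite e eqxx.
Qed.

Lemma tau_gt0 : 0 < tau.
Proof. by have [_ _ h] := torsion_root eT T_tors; rewrite /tau; lra. Qed.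

(** Q is a multiple of P, and taking multiples does not lower the level. By symmetry all non-zero
    p-torsion points have the same level. *)
Lemma torsion_level_le (P Q : ecpoint E) x y x' y' : ecval P = Some (x, y) -> P *+ p = 0 ->
  ecval Q = Some (x', y') -> Q *+ p = 0 -> v x' <= v x.
Proof.
move=> eP hp eQ hq.
have P0 : P != 0 by apply/eqP => e; move: eP; rewrite e.
have [m _ Qm] := torsion_multiple p_pr tors_card P0 hp hq.
have [_ x0 vx] := torsion_root eP hp.
have := @level_mulrn _ _ v_val E hE (- v x / 2) P m.
rewrite -Qm eP eQ /= x0 => h; have /andP[_] : (x' != 0) && (v x' <= - (2 * (- v x / 2))).
  by apply: h; lra.
lra.
Qed.

Lemma torsion_level (P : ecpoint E) x y : ecval P = Some (x, y) -> P *+ p = 0 ->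
  v x = - (2 * tau).
Proof.
move=> eP hp; have -> : - (2 * tau) = v xT by rewrite /tau; lra.
apply/eqP; rewrite eq_le (torsion_level_le eT T_tors eP hp).
by rewrite (torsion_level_le eP hp eT T_tors).
Qed.

Lemma root_torsion r : root Psi r ->
  exists (P : ecpoint E) y, ecval P = Some (r, y) /\ P *+ p = 0.
Proof.
move=> /rootP e; have [y hy] := curve_point E r.
exists (mkpt hy), y; split=> //; apply/eqP.
by rewrite (mulp_eq0 mulE (erefl : ecval (mkpt hy) = Some (r, y))) e.
Qed.

Lemma root_level r : root Psi r -> r != 0 /\ v r = - (2 * tau).
Proof.
move=> hr; have [P [y [eP hp]]] := root_torsion hr.
by split; [case: (torsion_root eP hp) | apply: torsion_level eP hp].
Qed.

Variable rs : seq Om.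
Hypothesis rsE : Psi = lead_coef Psi *: \prod_(r <- rs) ('X - r%:P).
Local Notation d := (size rs).
Let c_nz : lead_coef Psi != 0. Proof. by rewrite lead_coef_eq0. Qed.

Let rs_root r : (r \in rs) = root Psi r.
Proof. by rewrite rsE rootZ // root_prod_XsubC. Qed.
Lemma den_prod x : Psi.[x] = lead_coef Psi * \prod_(r <- rs) (x - r).
Proof.
rewrite {1}rsE hornerZ horner_prod; congr (_ * _).
by apply: eq_bigr => r _; rewrite hornerXsubC.
Qed.
Lemma den_val_sum x : Psi.[x] != 0 -> v Psi.[x] = v (lead_coef Psi) + \sum_(r <- rs) v (x - r).
Proof.
rewrite den_prod mulf_eq0 negb_or => /andP[c0 h]; rewrite (val_M v_val) // big_seq (val_prod v_val) -?big_seq //.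
by move=> r hr; apply: contraNneq h => e; rewrite prodf_seq_eq0; apply/hasP; exists r; rewrite ?e ?eqxx.
Qed.

Lemma sum_const (s : seq Om) (f : Om -> rat) k : (forall r, r \in s -> f r = k) ->
  \sum_(r <- s) f r = (size s)%:R * k.
Proof.
move=> h; rewrite big_seq (eq_bigr (fun=> k)) // -big_seq big_const_seq count_predT.
by rewrite iter_addr_0 mulr_natl.
Qed.

(** The constant term of Psi is a unit and, up to sign, the leading coefficient times the product of
    the roots, each of valuation - 2 tau. *)
Lemma lead_den_val : v (lead_coef Psi) = d%:R * (2 * tau).
Proof.
have e : Psi.[0] = Psi`_0 by rewrite horner_coef0.
have := den_val_sum (x := 0); rewrite e => /(_ Psi0); rewrite vPsi0 (@sum_const _ _ (- (2 * tau))).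
  by move=> h; apply/eqP; rewrite -subr_eq0 -[X in X == 0]opprK; apply/eqP; lra.
by move=> r; rewrite rs_root sub0r (val_N v_val) => /root_level[].
Qed.

Lemma den_val_low x : x != 0 -> v x < - (2 * tau) -> Psi.[x] != 0 /\
  v Psi.[x] = d%:R * (2 * tau + v x).
Proof.
move=> x0 hx.
have h r : r \in rs -> x - r != 0 /\ v (x - r) = v x.
  rewrite rs_root => /root_level[r0 vr].
  by apply: (val_dom v_val) => //; rewrite vgtN // vgt_nz // vr.
have nz : Psi.[x] != 0.
  by rewrite den_prod mulf_neq0 // prodf_seq_neq0; apply/allP => r /h[-> _].
split=> //; rewrite den_val_sum // lead_den_val (@sum_const _ _ (v x)); first ring.
by move=> r /h[].
Qed.

Lemma den_val_high x : (x == 0) || (- (2 * tau) < v x) -> Psi.[x] != 0 /\ v Psi.[x] = 0.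
Proof.
move=> hx.
have h r : r \in rs -> x - r != 0 /\ v (x - r) = - (2 * tau).
  rewrite rs_root => /root_level[r0 vr].
  have rN0 : - r != 0 by rewrite oppr_eq0.
  have := @val_dom _ _ v_val (- r) x rN0; rewrite (val_N v_val) vr addrC; apply.
  by rewrite /vgt; case/orP: hx => [->//|->]; rewrite orbT.
have nz : Psi.[x] != 0.
  by rewrite den_prod mulf_neq0 // prodf_seq_neq0; apply/allP => r /h[-> _].
split=> //; rewrite den_val_sum // lead_den_val (@sum_const _ _ (- (2 * tau))); first ring.
by move=> r /h[].
Qed.

Lemma den_val_mid x : x != 0 -> v x = - (2 * tau) -> vge v 0 Psi.[x].
Proof.
move=> x0 vx; rewrite /vge; have [//|nz /=] := eqVneq Psi.[x] 0.
rewrite den_val_sum // lead_den_val.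
suff : \sum_(r <- rs) - (2 * tau) <= \sum_(r <- rs) v (x - r).
  by rewrite (@sum_const rs (fun=> - (2 * tau)) (- (2 * tau))) // => h; lra.
rewrite [X in X <= _]big_seq [X in _ <= X]big_seq; apply: ler_sum => r hr.
have xr : x - r != 0.
  apply: contraNneq nz => e; by rewrite den_prod (big_rem r) //= e mul0r mulr0.
have [r0 vr] := root_level (etrans (esym (rs_root r)) hr).
have : vge v (- (2 * tau)) (x - r) by apply: (vgeB v_val); rewrite vge_nz ?vx ?vr.
by rewrite vge_nz.
Qed.

(* The multiplicity of an abscissa r0 = x(T') as a root of Psi is found by
   comparing, for U very close to the origin, [p](T' + U), [p](T' - U) and
   [p]U. *)
Hypothesis small : exists2 t, t != 0 & v t = 1.

Lemma low_abscissa k : exists b, b != 0 /\ v b = - k%:R.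
Proof.
have [t t0 vt] := small; exists (t ^+ k)^-1; split; first by rewrite invr_eq0 expf_neq0.
by rewrite (val_V v_val) ?expf_neq0 // (val_X v_val) // vt mulr1.
Qed.

Lemma quad_val a2 a1 a0 : a2 != 0 -> exists N : nat, forall b, b != 0 -> v b < - N%:R ->
  a2 * b ^+ 2 - a1 * b + a0 != 0 /\ v (a2 * b ^+ 2 - a1 * b + a0) = v a2 + 2 * v b.
Proof.
move=> a20; exists (Num.bound (`|v a2| + `|v a1| + `|v a0|)) => b b0 hb.
have := archi_boundP (addr_ge0 (addr_ge0 (normr_ge0 (v a2)) (normr_ge0 (v a1))) (normr_ge0 (v a0))).
move: (Num.bound _) hb => N hb hN.
have e : v (a2 * b ^+ 2) = v a2 + 2 * v b.
  by rewrite (val_M v_val) ?expf_neq0 // (val_X v_val).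
have h2 := ler_norm (v a2); have h1 := ler_norm (- v a1); have h0 := ler_norm (- v a0).
rewrite !normrN in h1 h0; have h3 := normr_ge0 (v a0); have h4 := normr_ge0 (v a1).
have h5 := normr_ge0 (v a2).
have nz : a2 * b ^+ 2 != 0 by rewrite mulf_neq0 ?expf_neq0.
rewrite -addrA; have [|n1 ->] := @val_dom _ _ v_val _ (- (a1 * b) + a0) nz; last by rewrite n1 e.
apply: (vgtD v_val).
  rewrite vgtN // /vgt; have [->|a10] := eqVneq a1 0; first by rewrite mul0r eqxx.
  by rewrite e (val_M v_val a10 b0) mulf_eq0 (negPf a10) (negPf b0) /=; lra.
by rewrite /vgt e; have [//|a00 /=] := eqVneq a0 0; lra.
Qed.

Lemma lin_val a1 a0 : a1 != 0 -> exists N : nat, forall b, b != 0 -> v b < - N%:R ->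
  - (a1 * b) + a0 != 0 /\ v (- (a1 * b) + a0) = v a1 + v b.
Proof.
move=> a10; exists (Num.bound (`|v a1| + `|v a0|)) => b b0 hb.
have := archi_boundP (addr_ge0 (normr_ge0 (v a1)) (normr_ge0 (v a0))).
move: (Num.bound _) hb => N hb hN.
have e : v (- (a1 * b)) = v a1 + v b by rewrite (val_N v_val) (val_M v_val).
have h1 := ler_norm (v a1); have h0 := ler_norm (- v a0).
rewrite normrN in h0; have h4 := normr_ge0 (v a1).
have nz : - (a1 * b) != 0 by rewrite oppr_eq0 mulf_neq0.
have [|n1 ->] := @val_dom _ _ v_val _ a0 nz; last by rewrite n1 e.
by rewrite /vgt e; have [//|a00 /=] := eqVneq a0 0; lra.
Qed.

Lemma eventually_all (s : seq Om) (Q : Om -> Om -> Prop) :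
  (forall r, r \in s -> exists N : nat, forall b, b != 0 -> v b < - N%:R -> Q r b) ->
  exists N : nat, forall b, b != 0 -> v b < - N%:R -> forall r, r \in s -> Q r b.
Proof.
elim: s => [|r s IH] h; first by exists 0%N.
have [|N1 h1] := IH; first by move=> r' hr'; apply: h; rewrite in_cons hr' orbT.
have [N2 h2] := h r (mem_head _ _).
exists (N1 + N2)%N => b b0; rewrite natrD => hb r'; rewrite in_cons => /orP[/eqP ->|].
  by apply: h2 => //; have : 0 <= N1%:R :> rat := ler0n _ _; lra.
by apply: h1 => //; have : 0 <= N2%:R :> rat := ler0n _ _; lra.
Qed.

Lemma root_multiplicity r0 y0 : on_curve E (Some (r0, y0)) -> root Psi r0 ->
  formB E r0 1 r0 != 0 -> (count_mem r0 rs)%:R = 2 * ((p ^ 2)%:R - d%:R) :> rat.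
Proof.
move=> hT' hr0 om0.
have [r00 vr0] := root_level hr0.
pose T' : ecpoint E := mkpt hT'.
have eT' : ecval T' = Some (r0, y0) by [].
have T'0 : T' *+ p = 0 by apply/eqP; rewrite (mulp_eq0 mulE eT') (rootP hr0).
pose num r b := formA r 1 r0 * b ^+ 2 - formB E r 1 r0 * b + formC E r 1 r0.
pose val r (beta : rat) := if r == r0 then v (formB E r0 1 r0) - beta else 2 * v (r - r0).
have [N hN] : exists N : nat, forall b, b != 0 -> v b < - N%:R -> forall r, r \in rs ->
    num r b != 0 /\ v (num r b) = val r (v b) + 2 * v b.
  apply: eventually_all => r hr; rewrite /num /val; have [->|nr] := eqVneq r r0.
    have [N hN] := lin_val (formC E r0 1 r0) om0; exists N => b b0 hb.
    have -> : formA r0 1 r0 = 0 by rewrite /formA; ring.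
    by rewrite mul0r add0r; have [-> ->] := hN b b0 hb; split=> //; ring.
  have A0 : formA r 1 r0 != 0 by rewrite /formA mulr1 expf_neq0 // subr_eq0.
  have [N hN] := quad_val (formB E r 1 r0) (formC E r 1 r0) A0; exists N => b b0 hb.
  have [-> ->] := hN b b0 hb; split=> //.
  by rewrite /formA mulr1 (val_X v_val) ?subr_eq0.
pose M := (N + Num.bound (2 * tau) + 1)%N.
have hM k : (M <= k)%N -> - k%:R < - N%:R :> rat /\ - k%:R < - (2 * tau) :> rat.
  rewrite -(ler_nat rat) /M !natrD => hk.
  have := archi_boundP (ltW (mulr_gt0 (ltr0n _ 2 : 0 < 2 :> rat) tau_gt0)).
  have : 0 <= N%:R :> rat := ler0n _ _.
  by have := tau_gt0; split; lra.
pose kappa := \sum_(r <- rs | r != r0) 2 * v (r - r0).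
(* For U of abscissa b with v b = - k, the points U + T' and U - T' have the same multiple p U.
   Equating valuations in Phi / Psi gives a relation in k. *)
have main k : (M <= k)%N -> 2 * ((p ^ 2)%:R * - k%:R - d%:R * (2 * tau + - k%:R)) =
    2 * ((p ^ 2)%:R * - (2 * tau)) - (2 * v (lead_coef Psi)
      + (count_mem r0 rs)%:R * (v (formB E r0 1 r0) - - k%:R) + kappa) :> rat.
  move=> hk; have [hk1 hk2] := hM k hk.
  have [b [b0 vb]] := low_abscissa k.
  have [yb hb] := curve_point E b.
  pose U : ecpoint E := mkpt hb.
  have eU : ecval U = Some (b, yb) by [].
  have lt_b : v b < v r0 by rewrite vb vr0.
  have hbN : v b < - N%:R by rewrite vb.
  have hbt : v b < - (2 * tau) by rewrite vb.
  have vr0n : v r0 < 0 by rewrite vr0; have := tau_gt0; lra.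
  have [xD [yD [eD xD0 vD]]] := level_sub_diff v_val hE eU eT' b0 r00 lt_b vr0n.
  have eNT : ecval (- T') = Some (r0, - y0 - wa1 E * r0 - wa3 E) by rewrite ecvalN eT'.
  have [xS [yS [eS xS0 vS]]] := level_sub_diff v_val hE eU eNT b0 r00 lt_b vr0n.
  rewrite opprK in eS.
  have := addsub_abscissa U eT'; rewrite eU eS eD /= => -[t t0 [ht1 ht2 ht3]].
  have A0 : formA b 1 r0 != 0.
    by rewrite /formA mulr1 expf_neq0 // subr_eq0; apply: contraTneq lt_b => ->; rewrite ltxx.
  (* The quadratic with roots [xS] and [xD], evaluated at r; the symmetry of the form makes it a
     polynomial in b, whose leading term is known for b large. *)
  have prodE r : formA b 1 r0 * ((xS - r) * (xD - r)) = num r b.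
    have := form_sym E b 1 r0 r 1; rewrite !expr1n !mulr1 /num => <-.
    have eA : t * formA b 1 r0 = 1 by rewrite -ht1 mulr1.
    have eB : xS + xD = t * formB E b 1 r0 by rewrite -ht2 !mulr1.
    apply: (mulfI t0); rewrite mulrA eA mul1r.
    transitivity (t * formC E b 1 r0 - t * formB E b 1 r0 * r + (t * formA b 1 r0) * r ^+ 2); last ring.
    by rewrite eA mul1r -eB -ht3; ring.
  have vA : v (formA b 1 r0) = 2 * v b.
    rewrite /formA mulr1 (val_X v_val); last first.
      by rewrite subr_eq0; apply: contraTneq lt_b => ->; rewrite ltxx.
    have [|_ ->] // := @val_dom _ _ v_val b (- r0) b0.
    by rewrite vgtN // vgt_nz.
  have vprod r : r \in rs -> (xS - r) * (xD - r) != 0 /\ v ((xS - r) * (xD - r)) = val r (v b).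
    move=> hr; have [n0 vn] := hN b b0 hbN r hr.
    have nz : (xS - r) * (xD - r) != 0.
      by apply: contraNneq n0; rewrite -prodE => ->; rewrite mulr0.
    split=> //; have e := congr1 v (prodE r).
    rewrite vn (val_M v_val A0 nz) vA in e.
    by move: e; rewrite addrC => /addIr.
  have PSD : Psi.[xS] * Psi.[xD] = lead_coef Psi ^+ 2 * \prod_(r <- rs) ((xS - r) * (xD - r)).
    by rewrite !den_prod big_split /=; ring.
  have PS0 : Psi.[xS] != 0 /\ Psi.[xD] != 0.
    have : Psi.[xS] * Psi.[xD] != 0.
      rewrite PSD mulf_neq0 ?expf_neq0 // prodf_seq_neq0; apply/allP => r /vprod[-> _]; by [].
    by rewrite mulf_eq0 negb_or => /andP[].
  have vPSD : v Psi.[xS] + v Psi.[xD] = 2 * v (lead_coef Psi)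
      + (count_mem r0 rs)%:R * (v (formB E r0 1 r0) - v b) + kappa.
    rewrite -(val_M v_val) ?PS0.1 ?PS0.2 // PSD (val_M v_val) ?expf_neq0 //; last first.
      by rewrite prodf_seq_neq0; apply/allP => r /vprod[-> _].
    rewrite (val_X v_val) // [in X in _ + X = _]big_seq (val_prod v_val) -?big_seq; last by move=> r /vprod[].
    rewrite -addrA; congr (_ + _).
    rewrite big_seq (eq_bigr (fun r => val r (v b))); last by move=> r /vprod[].
    rewrite -big_seq (bigID (pred1 r0)) /=; congr (_ + _).
      rewrite (eq_bigr (fun=> v (formB E r0 1 r0) - v b)); last by move=> r /eqP ->; rewrite /val eqxx.
      by rewrite big_const_seq iter_addr_0 mulr_natl.
    by apply: eq_bigr => r hr; rewrite /val (negPf hr).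
  have [PU0 vPU] := den_val_low b0 hbt.
  have ePU : v b < 0 by apply: lt_trans vr0n.
  have [yU eUp] := mulp_abscissa mulE eU PU0.
  have [yS' eSp] := mulp_abscissa mulE eS PS0.1.
  have [yD' eDp] := mulp_abscissa mulE eD PS0.2.
  have eqS : Phi.[xS] / Psi.[xS] = Phi.[b] / Psi.[b].
    by move: eSp; rewrite mulrnDl T'0 addr0 eUp => -[].
  have eqD : Phi.[xD] / Psi.[xD] = Phi.[b] / Psi.[b].
    by move: eDp; rewrite mulrnBl T'0 subr0 eUp => -[].
  have NV := num_val v_val Phi_monic Phi_size Phi_int.
  have vS0 : v xS < 0 by rewrite vS.
  have vD0 : v xD < 0 by rewrite vD.
  have [nS vnS] := NV xS xS0 vS0.
  have [nD vnD] := NV xD xD0 vD0.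
  have [nU vnU] := NV b b0 ePU.
  have := congr1 v eqS; have := congr1 v eqD.
  rewrite !(val_div v_val) ?PS0.1 ?PS0.2 // vnS ?vS // vnD ?vD // vnU vPU ?vb // vr0.
  move: vPSD; rewrite vb.
  exact: multiplicity_arith.
(* The relation is affine in k, so two consecutive values isolate its slope, which contains the
   multiplicity. *)
have h1 := main M (leqnn _); have h2 := main M.+1 (leqnSn _).
rewrite -[M.+1]addn1 natrD in h2.
lra.
Qed.

Lemma opp_abscissa (P Q : ecpoint E) x y y' : ecval P = Some (x, y) -> ecval Q = Some (x, y') ->
  Q = P \/ Q = - P.
Proof.
move=> eP eQ; have hP := ecpP P; have hQ := ecpP Q; rewrite eP in hP; rewrite eQ in hQ.
have [e|e] := eq_or_opp hQ hP; first by left; apply: ecval_inj; rewrite eP eQ e.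
right; apply: ecval_inj; rewrite ecvalN eP eQ /=; congr (Some (_, _)).
by rewrite -[LHS]subr0 -e; ring.
Qed.

Lemma ecval_some (P : ecpoint E) : P != 0 -> exists x y, ecval P = Some (x, y).
Proof.
case e: (ecval P) => [[x y]|]; first by exists x, y.
by rewrite (_ : P = 0) ?eqxx //; apply: ecval_inj.
Qed.
Definition abscissa (P : ecpoint E) := pX (ecval P).

Lemma omega_neq0 r y : odd p -> on_curve E (Some (r, y)) -> root Psi r -> formB E r 1 r != 0.
Proof.
move=> p_odd h hr; apply/eqP; rewrite (formB_diag h) => /eqP; rewrite sqrf_eq0 => /eqP e.
pose P : ecpoint E := mkpt h; have eP : ecval P = Some (r, y) by [].
have hp : P *+ p = 0 by apply/eqP; rewrite (mulp_eq0 mulE eP) (rootP hr).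
have PN : - P = P.
  by apply: ecval_inj; rewrite ecvalN eP /=; congr (Some (_, _)); rewrite -[RHS]subr0 -e; ring.
have P2 : P *+ 2 = 0 by rewrite mulr2n -{1}PN addNr.
suff P0 : P = 0 by move: eP; rewrite P0.
by apply: mulrn_coprime P2 hp; rewrite coprime2n.
Qed.

(** The points P and -P share an abscissa, so there are (p - 1) / 2 distinct roots, all of
    multiplicity 2 (p^2 - d). Summing gives d = (p - 1) (p^2 - d), hence d = p^2 - p and
    multiplicity 2 p. *)
Lemma den_degree_odd : odd p ->
  [/\ d = (p ^ 2 - p)%N, forall r, r \in rs -> count_mem r rs = p.*2 &
  perm_eq (undup rs) [seq abscissa (T *+ j) | j <- iota 1 p./2]].
Proof.
move=> p_odd; have p2 : (p./2.*2.+1 = p)%N by rewrite -[RHS]odd_double_half p_odd.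
have hmul r : r \in rs -> (count_mem r rs)%:R = 2 * ((p ^ 2)%:R - d%:R) :> rat.
  rewrite rs_root => hr; have [y hy] := curve_point E r.
  exact: root_multiplicity hy hr (omega_neq0 p_odd hy hr).
have jT j : (0 < j < p)%N -> exists x y, ecval (T *+ j) = Some (x, y).
  by move=> hj; apply: ecval_some; exact: (torsion_neq0 p_pr T0 T_tors hj).
have jT0 j : T *+ j *+ p = 0 by rewrite -mulrnA mulnC mulrnA T_tors mul0rn.
have hperm : perm_eq (undup rs) [seq abscissa (T *+ j) | j <- iota 1 p./2].
  apply: uniq_perm; first exact: undup_uniq.
    rewrite map_inj_in_uniq ?iota_uniq // => i j; rewrite !mem_iota => hi hj e.
    have [x [y ei]] := jT i ltac:(clear - hi p2; lia); have [x' [y' ej]] := jT j ltac:(clear - hj p2; lia).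
    move: e; rewrite /abscissa ei ej /= => e; rewrite -e in ej.
    have [h|h] := opp_abscissa ei ej.
      by apply: (torsion_inj p_pr T0 T_tors) => //; clear - hi hj p2; lia.
    have : T *+ (i + j) = 0 by rewrite mulrnDr h subrr.
    have hij : (0 < i + j < p)%N by clear - hi hj p2; lia.
    by have := torsion_neq0 p_pr T0 T_tors hij => /eqP h1 /h1.
  move=> r; rewrite mem_undup rs_root; apply/idP/mapP.
    move=> hr; have [P [y [eP hP]]] := root_torsion hr.
    have [m hm eQ] := torsion_multiple p_pr tors_card T0 T_tors hP.
    have m0 : (0 < m)%N by case: (m) eQ => // eQ; move: eP; rewrite eQ mulr0n.
    case: (leqP m p./2) => hm2.
      by exists m; rewrite ?mem_iota ?m0 //= /abscissa -eQ eP.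
    exists (p - m)%N; first by rewrite mem_iota; clear - hm hm2 m0 p2; lia.
    by rewrite mulrnBr ?(ltnW hm) // T_tors sub0r /abscissa ecvalN -eQ eP.
  move=> [j]; rewrite mem_iota => hj ->; have [x [y ej]] := jT j ltac:(clear - hj p2; lia).
  by rewrite /abscissa ej /=; case: (torsion_root ej (jT0 j)).
have hsize : d%:R = p./2%:R * (2 * ((p ^ 2)%:R - d%:R)) :> rat.
  have -> : p./2 = size (undup rs) by rewrite (perm_size hperm) size_map size_iota.
  have hs : d%:R = \sum_(r <- undup rs) 2 * ((p ^ 2)%:R - d%:R) :> rat.
    have := perm_size (perm_count_undup rs); rewrite size_flatten /shape -map_comp sumnE big_map => {1}<-.
    rewrite natr_sum; apply: eq_big_seq => r.
    by rewrite mem_undup => hr; rewrite -(hmul r hr) /= size_nseq.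
  by rewrite [LHS]hs big_const_seq count_predT iter_addr_0 [RHS]mulr_natl.
have hd : d = (p ^ 2 - p)%N.
  have e : (d + d * (2 * p./2) = 2 * p./2 * p ^ 2)%N.
    apply/eqP; rewrite -(eqr_nat rat) !(natrD, natrM) {1}hsize; apply/eqP; ring.
  have e2 : (2 * p./2 = p.-1)%N by rewrite -{2}p2 mul2n.
  apply/eqP; rewrite -(eqn_pmul2r p_gt0); apply/eqP; move: e; rewrite e2.
  have -> : (d + d * p.-1 = d * p)%N by rewrite -{2}(prednK p_gt0) mulnS.
  have -> : (p ^ 2 - p = p.-1 * p)%N by rewrite expnS expn1 -[X in (_ - X)%N]mul1n -mulnBl subn1.
  by move=> ->; rewrite expnS expn1 mulnA.
have hp : (p <= p ^ 2)%N by rewrite expnS expn1 leq_pmulr.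
split=> // r /hmul; rewrite hd natrB //.
rewrite opprB addrCA subrr addr0 -natrM => /eqP; rewrite eqr_nat mul2n => /eqP //.
Qed.
End Torsion.

Section BaseChange.
Variables (K F : fieldType) (h : {rmorphism K -> F}) (W : weierstrass K).
Hypothesis Wd : elliptic W.

Lemma elliptic_mapW : elliptic (mapW h W). Proof. by rewrite elliptic_map. Qed.
Definition ec_map := ECurve elliptic_mapW.

Lemma multiple_abscissa_map n (P : ecpoint ec_map) x y : ecval P = Some (x, y) ->
  xrep (ecval (P *+ n)) (map_poly h (divnum W n)).[x] (map_poly h (divden W n)).[x].
Proof.
move=> eP; have := divrec_morph (horner_eval x \o map_poly h) (divrec_divpoly Wd).
have -> : mapW (horner_eval x \o map_poly h) (mapW polyC W) = ec_map.
  by rewrite mapW_comp; apply: eq_mapW => a /=; rewrite map_polyC /= /horner_eval hornerC.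
rewrite /= /horner_eval map_polyX hornerX => rec.
exact: (multiple_abscissa eP rec).
Qed.

Lemma integral_curve_map (vK : K -> rat) (v : F -> rat) :
  (forall x, x != 0 -> v (h x) = vK x) -> integral_curve vK W -> integral_curve v (mapW h W).
Proof.
move=> v_ext [h1 h2 h3 h4 h6].
by split; rewrite /mapW /= /vge fmorph_eq0; case: eqP => //= /eqP nz; rewrite v_ext //;
  move: h1 h2 h3 h4 h6; rewrite /vge ?(negPf nz).
Qed.
End BaseChange.

(** * The level of the torsion and the action of [p] on levels *)

Section SupersingularCurve.
Variables (p : nat) (K : localField p) (Om : closedFieldType) (iota : {rmorphism K -> Om}) (v : Om -> rat).
Hypotheses (v_val : valuation v) (v_ext : forall x : K, x != 0 -> v (iota x) = vK x).
Variable W : weierstrass K.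
Hypotheses (Wd : elliptic W) (W_int : integralW W) (W_good : elliptic (mapW (@lf_red p K) W))
 (W_ss : supersingular p (mapW (@lf_red p K) W)).
Local Notation E := (ec_map iota Wd).
Hypothesis tors_card : (torsion E p #= `I_p)%card.
Variables (T : ecpoint E) (xT yT : Om).
Hypotheses (eT : ecval T = Some (xT, yT)) (T_tors : T *+ p = 0).

Let p_pr : prime p. Proof. by have /andP[] := lf_pchar K. Qed.
Let p_gt0 := prime_gt0 p_pr.
Local Notation tau := (tau v xT).
Local Notation Phi := (map_poly iota (divnum W p)).
Local Notation Psi := (map_poly iota (divden W p)).
Lemma integral_curveK : integral_curve (@vK p K) W.
Proof.
by case: W_int => /ointP h1 /ointP h2 /ointP h3 /ointP h4 /ointP h6; split; rewrite -oint_vge.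
Qed.
Let hE : integral_curve v E. Proof. exact: integral_curve_map v_ext integral_curveK. Qed.
Lemma vge_iota r x : vge v r (iota x) = vge (@vK p K) r x.
Proof. by rewrite /vge fmorph_eq0; have [//|x0] := eqVneq x 0; rewrite v_ext. Qed.
Lemma vgt_iota r x : vgt v r (iota x) = vgt (@vK p K) r x.
Proof. by rewrite /vgt fmorph_eq0; have [//|x0] := eqVneq x 0; rewrite v_ext. Qed.

Lemma Phi_monic : Phi \is monic. Proof. by rewrite map_monic divnum_monic. Qed.
Lemma Phi_size : size Phi = (p ^ 2).+1. Proof. by rewrite size_map_poly size_divnum. Qed.
Lemma Phi_int i : vge v 0 Phi`_i.
Proof. by rewrite coef_map vge_iota; case: (divpoly_integral p i W_int Wd). Qed.
Lemma Psi0 : Psi`_0 != 0.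
Proof. by rewrite coef_map fmorph_eq0; case: (supersingular_divden W_int Wd W_good W_ss). Qed.
Lemma vPsi0 : v Psi`_0 = 0.
Proof. by rewrite coef_map; case: (supersingular_divden W_int Wd W_good W_ss) => ? <- _; rewrite v_ext. Qed.
Lemma Psi_int i : (0 < i)%N -> vgt v 0 Psi`_i.
Proof. by rewrite coef_map vgt_iota; case: (supersingular_divden W_int Wd W_good W_ss) => _ _; apply. Qed.
Lemma mulpE (P : ecpoint E) x y : ecval P = Some (x, y) -> xrep (ecval (P *+ p)) Phi.[x] Psi.[x].
Proof. exact: multiple_abscissa_map. Qed.

Lemma torsion_abscissa : [/\ root Psi xT, xT != 0 & v xT < 0].
Proof. exact: (torsion_root v_val Psi0 vPsi0 Psi_int mulpE eT T_tors). Qed.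
Lemma small_elt : exists2 t, t != 0 & v t = 1.
Proof.
have [x x0 hx] := lf_normalized K; exists (iota x); first by rewrite fmorph_eq0.
by rewrite v_ext // /vK hx.
Qed.

Lemma pchar2_omega : p = 2%N -> divden W p = (wa1 W ^+ 2) *: 'X^2 + (wa3 W ^+ 2)%:P.
Proof.
move=> p2; have ch : (2%:R : K) = 0 by rewrite -[X in X%:R]p2; exact: (pcharf0 (lf_pchar K)).
have ch4 : (4%:R : K) = 0 by rewrite -[4%N]/(2 * 2)%N natrM ch mul0r.
have chP : (2%:R : {poly K}) = 0 by rewrite -polyC_natr ch.
have chP4 : (4%:R : {poly K}) = 0 by rewrite -polyC_natr ch4.
have -> : divden W p = divden W 2 by congr (divden W _).
rewrite divden2 // /omegaW /formB /wb2 /wb4 /wb6 /mapW /= chP chP4.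
rewrite -mul_polyC !rmorphXn /=.
transitivity ((wa1 W)%:P ^+ 2 * 'X^2 + (wa3 W)%:P ^+ 2 + 2%:R * ((wa1 W)%:P * (wa3 W)%:P * 'X)); first ring.
by rewrite chP mul0r addr0.
Qed.

(** For p = 2 the multiplicity argument does not apply, since [formB] vanishes at the abscissa of a
    2-torsion point; there the denominator is written down explicitly. *)
Lemma den_roots : exists2 rs, Psi = lead_coef Psi *: \prod_(r <- rs) ('X - r%:P) &
  size rs = (p ^ 2 - p)%N /\ (odd p -> (forall r, r \in rs -> count_mem r rs = p.*2) /\
    perm_eq (undup rs) [seq abscissa (T *+ j) | j <- seq.iota 1 p./2]).
Proof.
have [rs hrs] := closed_field_poly_normal Psi; exists rs => //.
have [p_odd|p_even] := boolP (odd p).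
  have [h1 h2 h3] := den_degree_odd v_val hE p_pr Phi_monic Phi_size Phi_int Psi0 vPsi0 Psi_int
    mulpE tors_card eT T_tors hrs small_elt p_odd.
  by split.
have p2 : p = 2%N by case: (even_prime p_pr) => // h; rewrite h in p_even.
split=> //.
have [hr _ _] := torsion_root v_val Psi0 vPsi0 Psi_int mulpE eT T_tors.
have Psi_nz : Psi != 0 by apply: contraNneq Psi0 => ->; rewrite coef0.
have -> : size rs = (size Psi).-1 by rewrite hrs size_scale ?lead_coef_eq0 // size_prod_XsubC.
have -> : (p ^ 2 - p = 2)%N by rewrite p2.
rewrite size_map_poly pchar2_omega //.
have a1 : wa1 W ^+ 2 != 0.
  apply: contraTneq hr => a10; rewrite pchar2_omega // a10 scale0r add0r map_polyC rootC.
  by have := Psi0; rewrite pchar2_omega // a10 scale0r add0r map_polyC coefC eqxx.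
by rewrite size_polyDl size_scale ?size_polyXn // ltnS (leq_trans (size_polyC_leq1 _)).
Qed.

Lemma natr_psub : (p ^ 2 - p)%N%:R = p%:R * (p%:R - 1) :> rat.
Proof. by rewrite natrB ?natrX; [ring | rewrite expnS expn1 leq_pmulr]. Qed.

(** The leading coefficient of the denominator is a square in K and has valuation (p^2 - p) 2 tau;
    the valuation of its square root is the integer n. *)
Lemma exists_level : exists2 n, (0 < n)%N & n%:R = p%:R * (p%:R - 1) * tau :> rat.
Proof.
have [rs hrs [hs _]] := den_roots.
have vl := lead_den_val v_val hE p_pr Psi0 vPsi0 Psi_int mulpE tors_card eT T_tors hrs.
have Psi_nz : Psi != 0 by apply: contraNneq Psi0 => ->; rewrite coef0.
have tau0 := tau_gt0 v_val Psi0 vPsi0 Psi_int mulpE eT T_tors.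
have [psi psi0 hpsi] : exists2 c : K, c != 0 & lead_coef (divden W p) = c ^+ 2.
  have [p_odd|p_even] := boolP (odd p).
    have [psi e] := divden_odd_sqr Wd p./2.
    have e2 : (p./2.*2.+1 = p)%N by rewrite -[RHS]odd_double_half p_odd.
    rewrite e2 in e; exists (lead_coef psi); last by rewrite e lead_coef_exp.
    by rewrite lead_coef_eq0; apply: contraNneq Psi_nz => e0; rewrite e e0 expr0n rmorph0.
  have p2 : p = 2%N by case: (even_prime p_pr) => // h; rewrite h in p_even.
  have e := pchar2_omega p2.
  have [a10|a1] := eqVneq (wa1 W) 0.
    have := size_map_poly iota (divden W p); rewrite hrs size_scale ?lead_coef_eq0 //.
    rewrite size_prod_XsubC hs e a10 expr0n scale0r add0r.
    have -> : (p ^ 2 - p = 2)%N by rewrite p2.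
    by move=> h; have := size_polyC_leq1 (wa3 W ^+ 2); rewrite -h.
  exists (wa1 W) => //; rewrite e lead_coefDl ?lead_coefZ ?lead_coefXn ?mulr1 //.
  by rewrite size_scale ?expf_neq0 // size_polyXn ltnS (leq_trans (size_polyC_leq1 _)).
move: vl; rewrite lead_coef_map hpsi v_ext ?expf_neq0 // (val_X (@vK_val p K)) // hs => vl.
have hp2 := natr_psub.
have e : (lf_ord psi)%:~R = p%:R * (p%:R - 1) * tau :> rat.
  by rewrite -hp2; apply: (@mulfI rat 2) => //; rewrite [RHS]mulrCA; exact: vl.
have n0 : 0 < (lf_ord psi)%:~R :> rat.
  by rewrite e -hp2 mulr_gt0 // ltr0n subn_gt0 expnS expn1 ltn_Pmulr // prime_gt1.
rewrite ltr0z in n0; exists `|lf_ord psi|%N; first by rewrite absz_gt0 gt_eqF.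
by rewrite -e -[in RHS](gtz0_abs n0).
Qed.

Section Levels.
Variables (F : fieldType) (kF : {rmorphism K -> F}) (jF : {rmorphism F -> Om}).
Hypothesis jk : forall x, jF (kF x) = iota x.
Local Notation EF := (ec_map kF Wd).
Local Notation vF := (fun x => v (jF x)).

Lemma vF_val : valuation vF.
Proof.
have [h1 h2] := v_val; split=> x y x0 y0; first by rewrite rmorphM h1 ?fmorph_eq0.
by move=> xy; rewrite rmorphD h2 ?fmorph_eq0 // -rmorphD fmorph_eq0.
Qed.
Lemma vge_j r x : vge v r (jF x) = vge vF r x.
Proof. by rewrite /vge fmorph_eq0. Qed.
Lemma vgt_j r x : vgt v r (jF x) = vgt vF r x.
Proof. by rewrite /vgt fmorph_eq0. Qed.
Lemma horner_j (q : {poly K}) x : jF (map_poly kF q).[x] = (map_poly iota q).[jF x].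
Proof.
rewrite -horner_map -map_poly_comp; congr (_.[_]).
by apply: eq_map_poly => a /=; rewrite jk.
Qed.
Lemma integral_curveF : integral_curve vF EF.
Proof. by apply: integral_curve_map integral_curveK => x x0; rewrite jk v_ext. Qed.

Lemma kernel_mulpF (P : ecpoint EF) : in_kernel vF (ecval (P *+ p)) -> in_kernel vF (ecval P).
Proof.
have hd i : jF (map_poly kF (divden W p))`_i = Psi`_i by rewrite !coef_map /= jk.
have hn i : jF (map_poly kF (divnum W p))`_i = Phi`_i by rewrite !coef_map /= jk.
apply: (@kernel_mulp _ _ vF_val _ p (map_poly kF (divnum W p)) (map_poly kF (divden W p))).
- by move=> i; rewrite -vge_j hn; apply: Phi_int.
- by rewrite -(fmorph_eq0 jF) hd; apply: Psi0.
- by rewrite hd; apply: vPsi0.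
- by move=> i i0; rewrite -vgt_j hd; apply: Psi_int.
by move=> Q x y; apply: multiple_abscissa_map.
Qed.

(** All roots of the denominator have valuation - 2 tau. At a larger v x it is a unit, at a smaller
    one its leading term dominates, and at equality only its integrality remains, hence the
    inequality in the middle case. *)
Lemma mulp_levelF (P : ecpoint EF) x y i : ecval P = Some (x, y) -> x != 0 ->
  v (jF x) = - (2 * i) -> 0 < i ->
  [/\ i < tau -> exists x' y', [/\ ecval (P *+ p) = Some (x', y'), x' != 0 &
        v (jF x') = - (2 * ((p ^ 2)%:R * i))],
    i = tau -> level_ge vF ((p ^ 2)%:R * i) (ecval (P *+ p)) &
    tau < i -> exists x' y', [/\ ecval (P *+ p) = Some (x', y'), x' != 0 &
        v (jF x') = - (2 * (p%:R * i + p%:R * (p%:R - 1) * tau))]].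
Proof.
move=> eP x0 vx i0; have [rs hrs [hs _]] := den_roots.
have jx0 : jF x != 0 by rewrite fmorph_eq0.
have vx0 : v (jF x) < 0 by rewrite vx; lra.
have [n0 vn] := num_val v_val Phi_monic Phi_size Phi_int jx0 vx0.
have mE (Q : ecpoint EF) a b : ecval Q = Some (a, b) ->
  xrep (ecval (Q *+ p)) (map_poly kF (divnum W p)).[a] (map_poly kF (divden W p)).[a].
  exact: multiple_abscissa_map.
have hp2 := natr_psub.
have hp3 : ((p ^ 2)%:R = p%:R * p%:R :> rat) by rewrite -natrM.
have fin m : Psi.[jF x] != 0 -> v Phi.[jF x] - v Psi.[jF x] = m ->
    exists x' y', [/\ ecval (P *+ p) = Some (x', y'), x' != 0 & v (jF x') = m].
  move=> d0 hm; have [|y' ey] := mulp_abscissa mE eP.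
    by rewrite -(fmorph_eq0 jF) horner_j.
  exists ((map_poly kF (divnum W p)).[x] / (map_poly kF (divden W p)).[x]), y'; split=> //.
    by rewrite -(fmorph_eq0 jF) fmorph_div !horner_j mulf_neq0 ?invr_eq0.
  by rewrite fmorph_div !horner_j (val_div v_val) // hm.
have DL := den_val_low v_val hE p_pr Psi0 vPsi0 Psi_int mulpE tors_card eT T_tors hrs jx0.
have DH := den_val_high v_val hE p_pr Psi0 vPsi0 Psi_int mulpE tors_card eT T_tors hrs (x := jF x).
have DM := den_val_mid v_val hE p_pr Psi0 vPsi0 Psi_int mulpE tors_card eT T_tors hrs jx0.
split=> hi.
- have [|d0 vd] := DH; first by rewrite vx (negPf jx0) /=; lra.
  by apply: fin; rewrite // vn vd vx; ring.
- have hd := DM _; rewrite vx hi in hd; have {}hd := hd erefl.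
  have [s s0 [e1 e2]] := mE _ _ _ eP.
  case eQ: (ecval (P *+ p)) e1 e2 => [[x' y']|] //=; rewrite mulr1 => e1 e2.
  have s1 : Psi.[jF x] = jF s by rewrite -horner_j e2.
  have x'0 : x' != 0.
    apply: contraNneq n0 => x'0; rewrite -horner_j e1 x'0 mulr0 rmorph0; exact: eqxx.
  rewrite x'0 /=; move: vn; rewrite -horner_j e1 rmorphM (val_M v_val) ?fmorph_eq0 //.
  move: hd; rewrite s1 vge_nz ?fmorph_eq0 // vx hi.
  by move: (v (jF s)) (v (jF x')) => a b; nra || lra.
have hi2 : v (jF x) < - (2 * tau) by rewrite vx; lra.
have [d0 vd] := DL hi2.
by apply: fin; rewrite // vn vd hs hp2 vx hp3; ring.
Qed.
End Levels.
End SupersingularCurve.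

(** * Ramified cyclic extensions *)

(** After clearing denominators p divides (i - j) e. Thus monomials with different exponents below p
    and coefficients of valuation in (1/e)Z never have equal valuations. *)
Lemma ram_distinct (p e i j : nat) (a b : int) : prime p -> coprime p e ->
  (i < p)%N -> (j < p)%N -> (0 < e)%N ->
  a%:~R / e%:R + i%:R / p%:R = b%:~R / e%:R + j%:R / p%:R :> rat -> i = j.
Proof.
move=> p_pr pe hi hj e0 h.
have eR : e%:R != 0 :> rat by rewrite pnatr_eq0 -lt0n.
have pR : p%:R != 0 :> rat by rewrite pnatr_eq0 -lt0n prime_gt0.
have h2 : ((a * p%:Z + i%:Z * e%:Z)%:~R = (b * p%:Z + j%:Z * e%:Z)%:~R :> rat).
  rewrite !intrD !intrM; have := congr1 (fun x => x * (e%:R * p%:R)) h.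
  have -> : (a%:~R / e%:R + i%:R / p%:R) * (e%:R * p%:R) = a%:~R * p%:R + i%:R * e%:R :> rat.
    by field; rewrite eR pR.
  have -> // : (b%:~R / e%:R + j%:R / p%:R) * (e%:R * p%:R) = b%:~R * p%:R + j%:R * e%:R :> rat.
  by field; rewrite eR pR.
move/intr_inj: h2 => h2.
have h3 : (p%:Z %| (i%:Z - j%:Z) * e%:Z)%Z.
  by apply/dvdzP; exists (b - a); lia.
rewrite Gauss_dvdzl // in h3; move: h3 => /dvdzP[q hq].
have : q = 0.
  have : (`|q| * p < p)%N by rewrite -(absz_nat p) -{1}abszM -hq; lia.
  by rewrite -{2}(mul1n p) ltn_pmul2r ?prime_gt0 // ltnS leqn0 absz_eq0 => /eqP.
by move=> q0; move: hq; rewrite q0 mul0r; lia.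
Qed.

(** * Expansions in powers of a uniformizer *)

Section Expansion.
Variables (p e : nat) (M N : fieldType) (k : {rmorphism M -> N}) (v : N -> rat).
Hypotheses (p_pr : prime p) (pe : coprime p e) (e_gt0 : (0 < e)%N) (v_val : valuation v)
 (vM : forall m, m != 0 -> exists a : int, v (k m) = a%:~R / e%:R).
Variable pi : N.
Hypotheses (pi0 : pi != 0) (v_pi : v pi = 1 / p%:R).

Lemma term_val m i : m != 0 -> v (k m * pi ^+ i) = v (k m) + i%:R / p%:R.
Proof.
move=> m0; rewrite (val_M v_val) ?fmorph_eq0 ?expf_neq0 // (val_X v_val) // v_pi.
by rewrite mulrA mulr1.
Qed.

Lemma term_neq (c : nat -> M) (i j : 'I_p) : i != j -> k (c i) * pi ^+ i != 0 ->
  k (c j) * pi ^+ j != 0 -> v (k (c i) * pi ^+ i) != v (k (c j) * pi ^+ j).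
Proof.
move=> + hi hj; have ci : c i != 0 by apply: contraNneq hi => ->; rewrite rmorph0 mul0r.
have cj : c j != 0 by apply: contraNneq hj => ->; rewrite rmorph0 mul0r.
apply: contra_neq; rewrite !term_val //.
have [a ->] := vM ci; have [b ->] := vM cj => h; apply: val_inj.
exact: (ram_distinct p_pr pe (ltn_ord i) (ltn_ord j) e_gt0 h).
Qed.

Lemma expansion_vge (c : nat -> M) r : vge v r (\sum_(i < p) k (c i) * pi ^+ i) ->
  forall i, (i < p)%N -> vge v r (k (c i) * pi ^+ i).
Proof.
move=> h i hi.
have [h1 h2] := val_sum_min v_val (G := fun i : 'I_p => k (c i) * pi ^+ i) (@term_neq c) (Ordinal hi).
move: h; rewrite {1}/vge; have [e0|nz /= h] := eqVneq; last exact: vge_le h1.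
move=> _; have [->|t0] := eqVneq (k (c i) * pi ^+ i) 0; first exact: vge0.
by have := h2 t0; rewrite e0 eqxx.
Qed.

Lemma expansion_eq0 (c : nat -> M) : \sum_(i < p) k (c i) * pi ^+ i = 0 ->
  forall i, (i < p)%N -> c i = 0.
Proof.
move=> h i hi; apply/eqP.
have [_ h2] := val_sum_min v_val (G := fun i : 'I_p => k (c i) * pi ^+ i) (@term_neq c) (Ordinal hi).
apply: contraT => ci; have nz : k (c i) * pi ^+ i != 0 by rewrite mulf_neq0 ?fmorph_eq0 ?expf_neq0.
by have := h2 nz; rewrite h eqxx.
Qed.
End Expansion.

(** * Totally ramified extensions of degree p and their ramification break *)

Section RamifiedExtension.
Variables (p : nat) (K : fieldType) (vK : K -> rat).
Hypotheses (p_pr : prime p) (vK_val : valuation vK)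
 (vK_int : forall x, x != 0 -> exists m : int, vK x = m%:~R) (vK_unif : exists2 t, t != 0 & vK t = 1).
Variables (L : fieldExtType K) (vL : L -> rat).
Hypotheses (vL_val : valuation vL) (vL_ext : forall x, x != 0 -> vL x%:A = vK x) (L_deg : \dim {:L} = p).
Let p_gt0 := prime_gt0 p_pr.
Let p_gt1 := prime_gt1 p_pr.
Let pR : p%:R != 0 :> rat. Proof. by rewrite pnatr_eq0 -lt0n. Qed.
Local Notation kL := (in_alg L).

Lemma val_exprz x (m : int) : x != 0 -> vL (x ^ m) = m%:~R * vL x.
Proof.
move=> x0; case: m => m; first by rewrite -exprnP (val_X vL_val).
rewrite NegzE -exprnN -exprVn (val_X vL_val) ?invr_eq0 // (val_V vL_val) // mulrNz.
by rewrite mulNr mulrN.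
Qed.

Lemma uniformizer_exists : (forall x, x != 0 -> exists m : int, p%:R * vL x = m%:~R) ->
  (exists2 x, x != 0 & forall m : int, vL x <> m%:~R) ->
  exists2 pi, pi != 0 & vL pi = 1 / p%:R.
Proof.
move=> vL_int [x x0 hx]; have [m em] := vL_int x x0.
have hdvd : ~~ (p%:Z %| m)%Z.
  apply/negP => /dvdzP[q hq]; apply: (hx q); apply: (mulfI pR).
  by rewrite em hq intrM mulrC.
have [u [w huw]] := Bezoutz m p%:Z.
have hg : gcdz m p%:Z = 1.
  have : coprimez p%:Z m by rewrite /coprimez /gcdz -[_ == _]/(coprime p `|m|) prime_coprime.
  by rewrite /coprimez gcdzC => /eqP.
rewrite hg in huw; have [t t0 vt] := vK_unif.
have tA0 : t%:A != 0 :> L by rewrite (fmorph_eq0 (in_alg L)).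
exists (x ^ u * t%:A ^ w); first by rewrite mulf_neq0 ?expfz_neq0.
rewrite (val_M vL_val) ?expfz_neq0 // !val_exprz // vL_ext // vt mulr1.
have ex : vL x = m%:~R / p%:R by apply: (mulfI pR); rewrite em mulrCA mulfV // mulr1.
apply: (mulIf pR); rewrite ex mulrDl divfK // mulrA divfK //.
by rewrite -[p%:R]/(p%:Z%:~R) -!intrM -intrD huw.
Qed.

Variable pi : L.
Hypotheses (pi0 : pi != 0) (v_pi : vL pi = 1 / p%:R).

Let vkL m : m != 0 -> exists a : int, vL (kL m) = a%:~R / 1%:R.
Proof. by move=> m0; have [a ha] := vK_int m0; exists a; rewrite vL_ext // divr1. Qed.
Let cop : coprime p 1. Proof. exact: coprimen1. Qed.
Definition exps := expansion_vge (k := kL) p_pr cop (ltn0Sn 0) vL_val vkL pi0 v_pi.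

Lemma expand x : exists c : nat -> K, x = \sum_(i < p) kL (c i) * pi ^+ i.
Proof.
pose X := [tuple pi ^+ i | i < p].
have XE (i : 'I_p) : X`_i = pi ^+ i by rewrite (nth_map i) ?size_enum_ord // nth_ord_enum.
have fX : free X.
  apply/freeP => c hc i.
  pose c' j := if insub j is Some j' then c j' else 0.
  have c'E (j : 'I_p) : c' j = c j by rewrite /c' valK.
  rewrite -c'E; apply: (expansion_eq0 (k := kL) p_pr cop (ltn0Sn 0) vL_val vkL pi0 v_pi) (ltn_ord i).
  rewrite -[RHS]hc; apply: eq_bigr => j _; by rewrite c'E XE -mulr_algl.
have bX : basis_of {:L} X by rewrite basisEfree fX subvf size_tuple /= L_deg.
have := coord_basis bX (memvf x).
pose c' j := if insub j is Some j' then coord X j' x else 0.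
move=> ->; exists c'; apply: eq_bigr => j _.
by rewrite /c' valK XE -mulr_algl.
Qed.

Lemma vL_pmul x : x != 0 -> exists m : int, p%:R * vL x = m%:~R.
Proof.
move=> x0; have [c ex] := expand x.
have hmin i : (i < p)%N -> vge vL (vL x) (kL (c i) * pi ^+ i).
  by apply: exps; rewrite -ex vge_v.
have [i hi] : exists i : 'I_p, kL (c i) * pi ^+ i != 0 /\ vL (kL (c i) * pi ^+ i) = vL x.
  apply: contrapT => hno.
  have : vgt vL (vL x) x.
    rewrite {2}ex; apply: (vgt_sum vL_val) => i _; have := hmin i (ltn_ord i).
    rewrite /vge /vgt; have [//|nz /=] := eqVneq (kL (c i) * pi ^+ i) 0.
    rewrite le_eqVlt => /orP[/eqP e|//]; exfalso; apply: hno; exists i; split=> //.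
  by rewrite vgt_nz // ltxx.
have [nz <-] := hi; have c0 : c i != 0 by apply: contraNneq nz => ->; rewrite rmorph0 mul0r.
have [a ha] := vK_int c0.
exists (p%:Z * a + i%:Z).
rewrite (term_val kL vL_val pi0 v_pi) // vL_ext // ha intrD intrM mulrDr mulrCA mulfV //.
by rewrite mulr1.
Qed.

(** In the expansion of x only the constant term can have integral valuation; so at integral levels
    an element of K has the same leading term. *)
Lemma approx_base l x : vge vL l%:~R x ->
  exists2 a, vge vK l%:~R a & vgt vL l%:~R (x - a%:A).
Proof.
have [c ex] := expand x => hx.
have hc i : (i < p)%N -> vge vL l%:~R (kL (c i) * pi ^+ i) by apply: exps; rewrite -ex.
exists (c 0%N).
  have := hc 0%N p_gt0; rewrite expr0 mulr1 /vge fmorph_eq0.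
  by have [//|c0 /=] := eqVneq (c 0%N) 0; rewrite vL_ext.
rewrite ex -(prednK p_gt0) big_ord_recl /= expr0 mulr1 addrAC subrr add0r.
apply: (vgt_sum vL_val) => i _; have hi : (bump 0 i < p)%N by have := ltn_ord i; rewrite /bump; lia.
have := hc _ hi; rewrite /vge /vgt; have [//|nz /=] := eqVneq (kL (c (bump 0 i)) * pi ^+ bump 0 i) 0.
have c0 : c (bump 0 i) != 0 by apply: contraNneq nz => ->; rewrite rmorph0 mul0r.
rewrite le_eqVlt => /orP[/eqP|//]; rewrite (term_val kL vL_val pi0 v_pi) // vL_ext //.
have [a ->] := vK_int c0 => h.
have := @ram_distinct p 1 0 (bump 0 i) l a p_pr cop p_gt0 hi (ltn0Sn 0).
by rewrite !divr1 mul0r addr0 => /(_ h).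
Qed.

Lemma complete_ext : complete_val vK -> complete_val vL.
Proof.
move=> Kc u hu.
have ex n : exists c : nat -> K, u n = \sum_(i < p) kL (c i) * pi ^+ i by apply: expand.
pose c n := proj1_sig (cid (ex n)); have hc n : u n = \sum_(i < p) kL (c n i) * pi ^+ i.
  exact: (proj2_sig (cid (ex n))).
have hcau i : (i < p)%N -> forall n, vge vK n%:R (c n.+1 i - c n i).
  move=> hi n; have h := hu n.
  have e : u n.+1 - u n = \sum_(i < p) kL (c n.+1 i - c n i) * pi ^+ i.
    by rewrite !hc -sumrB; apply: eq_bigr => j _; rewrite rmorphB mulrBl.
  have := exps (c := fun i => c n.+1 i - c n i) (r := n%:R); rewrite -e => /(_ h i hi).
  rewrite /vge; have [//|nz] := eqVneq (c n.+1 i - c n i) 0.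
  rewrite mulf_eq0 fmorph_eq0 (negPf nz) expf_eq0 (negPf pi0) andbF /=.
  rewrite (term_val kL vL_val pi0 v_pi) // vL_ext //; have [a ->] := vK_int nz => h2.
  have : i%:R / p%:R < 1 :> rat by rewrite ltr_pdivrMr ?ltr0n // mul1r ltr_nat.
  move: h2; rewrite -[n%:R]/(n%:Z%:~R) => h2 h3; rewrite ler_int -ltzD1 -(ltr_int rat) intrD.
  lra.
have lim i : exists l, (i < p)%N -> forall n, vge vK n%:R (c n i - l).
  have [hi|_] := boolP (i < p)%N; last by exists 0.
  by have [l hl] := Kc (fun n => c n i) (hcau i hi); exists l.
pose l i := proj1_sig (cid (lim i)); have hl i := proj2_sig (cid (lim i)).
exists (\sum_(i < p) kL (l i) * pi ^+ i) => n.
rewrite hc -sumrB; apply: (vge_sum vL_val) => i _; rewrite -mulrBl -rmorphB.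
rewrite -[n%:R]addr0; apply: (vgeM vL_val).
  rewrite /vge fmorph_eq0; have := hl i (ltn_ord i) n; rewrite /vge -/(l i).
  by have [//|nz /=] := eqVneq (c n i - l i) 0; rewrite vL_ext.
by apply: (vgeX vL_val); rewrite vge_nz // v_pi divr_ge0.
Qed.

Section Cyclic.
Hypothesis charp : p \in [pchar K].
Variable s : {rmorphism L -> L}.
Hypotheses (s_K : forall a : K, s a%:A = a%:A) (s_p : forall x, iter p s x = x)
 (s_fix : forall x, s x = x -> exists a : K, x = a%:A) (vL_s : forall x, vL (s x) = vL x).

Local Notation D x := (s x - x).
Let u := s pi / pi.

Lemma iter_vL m x : vL (iter m s x) = vL x.
Proof. by elim: m => // m IH; rewrite iterS vL_s. Qed.
Lemma iter_rmorph m : exists f : {rmorphism L -> L}, iter m s =1 f.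
Proof. by elim: m => [|m [f hf]]; [exists idfun | exists (s \o f) => x /=; rewrite hf]. Qed.
Lemma iter_vge m r x : vge vL r (iter m s x) = vge vL r x.
Proof. by have [f hf] := iter_rmorph m; rewrite /vge iter_vL hf fmorph_eq0. Qed.
Lemma iter_vgt m r x : vgt vL r (iter m s x) = vgt vL r x.
Proof. by have [f hf] := iter_rmorph m; rewrite /vgt iter_vL hf fmorph_eq0. Qed.

Let u0 : u != 0. Proof. by rewrite mulf_neq0 ?invr_eq0 ?fmorph_eq0. Qed.
Let vu : vL u = 0. Proof. by rewrite (val_div vL_val) ?fmorph_eq0 // vL_s subrr. Qed.

Lemma unit_cocycle m : iter m s pi = pi * \prod_(k < m) iter k s u.
Proof.
elim: m => [|m IH]; first by rewrite big_ord0 mulr1.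
have [f hf] := iter_rmorph m.
have e : s pi = pi * u by rewrite /u mulrC divfK.
by rewrite iterSr e hf rmorphM -!hf IH big_ord_recr /= mulrA.
Qed.

Let pcharL : p \in [pchar L]. Proof. by rewrite (fmorph_pchar (in_alg L)). Qed.

(** By [approx_base] u and all its conjugates are congruent to one a in K, and the conjugates of u
    have product 1. Hence a^p is congruent to 1, and (a - 1)^p = a^p - 1 in characteristic p. *)
Lemma unit_cong1 : vgt vL 0 (u - 1).
Proof.
have hu : vge vL 0%:~R u by rewrite vge_nz // vu.
have [a ha hua] := approx_base hu; rewrite mulr0z in ha hua hu.
have haL : vge vL 0 (a%:A : L).
  move: ha; rewrite /vge (fmorph_eq0 (in_alg L)); case: eqP => //= /eqP a0.
  by rewrite vL_ext.
have hc m : cong vL (iter m s u) a%:A.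
  rewrite /cong iter_vge hu haL /=.
  have [f hf] := iter_rmorph m.
  have fa : iter m s a%:A = a%:A by elim: (m) => //= m' ->.
  by rewrite -fa !hf -rmorphB -hf iter_vgt.
have hp m : cong vL (\prod_(k < m) iter k s u) (a%:A ^+ m).
  elim: m => [|m IH]; first by rewrite big_ord0 expr0; apply: (cong1 vL_val).
  by rewrite big_ord_recr exprSr; apply: (congM vL_val).
have e1 : \prod_(k < p) iter k s u = 1.
  by apply: (mulfI pi0); rewrite -unit_cocycle s_p mulr1.
have := hp p; rewrite e1 => /and3P[_ _ h].
have hK : vgt vK 0 ((a - 1) ^+ p).
  have -> : (a - 1) ^+ p = - (1 - a ^+ p).
    by rewrite -!(pFrobenius_autE charp) rmorphB rmorph1 opprB.
  rewrite vgtN //; move: h; have -> : 1 - a%:A ^+ p = (1 - a ^+ p)%:A :> L.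
    by rewrite -[(1 - a ^+ p)%:A]/(in_alg L (1 - a ^+ p)) rmorphB rmorphXn rmorph1.
  rewrite /vgt (fmorph_eq0 (in_alg L)); case: eqP => //= /eqP a0.
  by rewrite vL_ext.
have ha1 : vgt vL 0 ((a - 1)%:A : L).
  move: hK; rewrite /vgt (fmorph_eq0 (in_alg L)) expf_eq0 p_gt0 /=; case: eqP => //= /eqP a0.
  by rewrite vL_ext // (val_X vK_val) // pmulr_rgt0 // ltr0n.
have -> : u - 1 = (u - a%:A) + (a - 1)%:A.
  by rewrite -[(a - 1)%:A]/(in_alg L (a - 1)) rmorphB rmorph1 addrA subrK.
exact: (vgtD vL_val).
Qed.

Lemma unit_neq1 : u != 1.
Proof.
apply/eqP => e; have [a ea] : exists a : K, pi = a%:A.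
  by apply: s_fix; rewrite -[RHS]mul1r -e /u divfK.
have a0 : a != 0 by apply: contraNneq pi0 => a0; rewrite ea a0 scale0r.
have [m hm] := vK_int a0; move: v_pi; rewrite ea vL_ext // hm => h.
have := @ram_distinct p 1 0 1 m 0 p_pr cop p_gt0 p_gt1 (ltn0Sn 0).
by rewrite !divr1 mul0r addr0 mulr0z add0r => /(_ h).
Qed.

Lemma break_exists : exists2 lam : nat, (0 < lam)%N & vL (u - 1) = lam%:R / p%:R.
Proof.
have nz : u - 1 != 0 by rewrite subr_eq0 unit_neq1.
have [m hm] := vL_pmul nz.
have m0 : 0 < m.
  have := unit_cong1; rewrite vgt_nz // => h; rewrite -(ltr_int rat) -hm mulr0z.
  by rewrite mulr_gt0 // ltr0n.
exists `|m|%N; first by rewrite absz_gt0 gt_eqF.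
apply: (mulfI pR); rewrite hm mulrCA mulfV // mulr1 -[in LHS](gtz0_abs m0) //.
Qed.

Variable lam : nat.
Hypotheses (lam_gt0 : (0 < lam)%N) (v_u1 : vL (u - 1) = lam%:R / p%:R).
Local Notation brk := (lam%:R / p%:R : rat).

(** The cofactor 1 + u + ... + u^(k-1) of u - 1 is congruent to k, which is a unit. *)
Lemma pow_val k : (0 < k < p)%N -> u ^+ k - 1 != 0 /\ vL (u ^+ k - 1) = brk.
Proof.
move=> /andP[k0 kp]; have u1 : u - 1 != 0 by rewrite subr_eq0 unit_neq1.
have hc m : cong vL (\sum_(i < m) u ^+ i) m%:R.
  have h1 : cong vL u 1 by rewrite /cong vge_nz // vu lexx (vge01 vL_val) unit_cong1.
  elim: m => [|m IH]; first by rewrite big_ord0; apply/(cong_refl)/vge0.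
  rewrite big_ord_recr /= -[m.+1]addn1 natrD; apply: (congD vL_val) => //.
  by rewrite -(expr1n _ m); apply: (congX vL_val).
have kR : k%:R != 0 :> L by rewrite -(dvdn_pcharf pcharL) gtnNdvd.
have [n0 v0] := cong_unit vL_val (hc k) kR (val_nat vL_val pcharL kR).
by rewrite subrX1 mulf_neq0 // (val_M vL_val) // v0 addr0 v_u1.
Qed.

Lemma D_expand (c : nat -> K) : D (\sum_(i < p) kL (c i) * pi ^+ i) =
  \sum_(i < p) kL (c i) * pi ^+ i * (u ^+ i - 1).
Proof.
rewrite rmorph_sum -sumrB; apply: eq_bigr => i _.
have e : s pi = pi * u by rewrite /u mulrC divfK.
rewrite rmorphM rmorphXn e exprMn mulrBr mulr1 -[s (kL _)]/(s (c i)%:A) s_K.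
by rewrite mulrA.
Qed.

Lemma D_vge r x : vge vL r x -> vge vL (r + brk) (D x).
Proof.
have [c ->] := expand x => h; rewrite D_expand; apply: (vge_sum vL_val) => i _.
have hi := exps h (ltn_ord i).
have [i0|i0] := posnP (i : nat); first by rewrite i0 subrr mulr0 vge0.
have [|n0 v0] := @pow_val i; first by rewrite i0 ltn_ord.
by apply: (vgeM vL_val) => //; rewrite vge_nz // v0.
Qed.

Lemma D_terms (c : nat -> K) r : vgt vL (r + brk) (D (\sum_(i < p) kL (c i) * pi ^+ i)) ->
  forall i, (0 < i < p)%N -> vgt vL r (kL (c i) * pi ^+ i).
Proof.
rewrite D_expand => h i /andP[i0 hi].
pose G (i : 'I_p) := kL (c i) * pi ^+ i * (u ^+ i - 1).
have GE (a : 'I_p) : G a != 0 -> kL (c a) * pi ^+ a != 0 /\ vL (G a) = vL (kL (c a) * pi ^+ a) + brk.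
  rewrite /G; have [a0|a0] := posnP (a : nat); first by rewrite a0 subrr mulr0 eqxx.
  have [|n0 v0] := @pow_val a; first by rewrite a0 ltn_ord.
  by rewrite mulf_eq0 negb_or n0 andbT => nz; rewrite (val_M vL_val) // v0.
have hd (a b : 'I_p) : a != b -> G a != 0 -> G b != 0 -> vL (G a) != vL (G b).
  move=> ab /GE[na ->] /GE[nb ->]; rewrite (inj_eq (addIr _)).
  exact: (term_neq p_pr cop (ltn0Sn 0) vL_val vkL pi0 v_pi ab na nb).
have [h1 h2] := val_sum_min vL_val hd (Ordinal hi).
have [|n0 v0] := @pow_val i; first by rewrite i0.
have [->|t0] := eqVneq (kL (c i) * pi ^+ i) 0; first exact: vgt0.
have G0 : G (Ordinal hi) != 0 by rewrite /G mulf_neq0.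
have [_ vG] := GE _ G0.
move: h; rewrite {1}/vgt (negPf (h2 G0)) /= => h.
have := vge_gt h h1; rewrite vgt_nz // vG /= ltrD2r => hh.
by rewrite vgt_nz.
Qed.

Lemma D_strict i x : ~~ (p %| i)%N -> vge vL (i%:R / p%:R) x ->
  vgt vL ((i + lam)%:R / p%:R) (D x) -> vgt vL (i%:R / p%:R) x.
Proof.
move=> hi; have [c ->] := expand x; rewrite natrD mulrDl => h1 h2.
apply: (vgt_sum vL_val) => j _.
have [j0|j0] := posnP (j : nat); last by apply: (D_terms h2); rewrite j0 ltn_ord.
have := exps h1 (ltn_ord j); rewrite j0 expr0 mulr1 /vge /vgt.
have [//|nz /=] := eqVneq (kL (c 0%N)) 0; rewrite le_eqVlt => /orP[/eqP|//].
have c0 : c 0%N != 0 by apply: contraNneq nz => ->; rewrite rmorph0.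
rewrite vL_ext //; have [a ->] := vK_int c0 => e.
have := @ram_distinct p 1 (i %% p) 0 (i %/ p)%N%:Z a p_pr cop (ltn_pmod i p_gt0) p_gt0 (ltn0Sn 0).
rewrite !divr1 mul0r addr0 => hh; move: hi; rewrite /dvdn hh ?eqxx //.
by rewrite -e [in RHS](divn_eq i p) natrD natrM mulrDl mulfK.
Qed.

Lemma D_exact i x : ~~ (p %| i)%N -> x != 0 -> vL x = i%:R / p%:R ->
  D x != 0 /\ vL (D x) = (i + lam)%:R / p%:R.
Proof.
move=> hi x0 vx.
have h : vge vL (i%:R / p%:R) x by rewrite vge_nz // vx.
have hn : ~~ vgt vL ((i + lam)%:R / p%:R) (D x).
  by apply/negP => /(D_strict hi h); rewrite vgt_nz // vx ltxx.
have := D_vge h; rewrite -mulrDl -natrD.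
move: hn; rewrite /vgt /vge negb_or -leNgt => /andP[nz h1].
by rewrite (negPf nz) /= => h2; split=> //; apply/eqP; rewrite eq_le h1.
Qed.

Lemma sB : {morph s : x y / x - y}. Proof. exact: rmorphB. Qed.

(** If p divided lam, then D would keep pi at levels congruent to 1 modulo p, where it acts exactly,
    so no D^k pi would vanish. But in characteristic p the binomial formula reduces s^p = 1 to D^p =
    0. *)
Lemma lam_ndvd : ~~ (p %| lam)%N.
Proof.
apply/negP => hd.
have hk k : Dk s k pi != 0 /\ vL (Dk s k pi) = (1 + k * lam)%:R / p%:R.
  elim: k => [|k [nz IH]]; first by rewrite mul0n addn0.
  have hp : ~~ (p %| 1 + k * lam)%N.
    by rewrite dvdn_addl ?dvdn_mull // dvdn1 gtn_eqF.
  by have [h1 h2] := D_exact hp nz IH; rewrite DkS h1 h2 mulSn [(lam + _)%N]addnC addnA.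
have := iter_sg_bin sB p pi; rewrite s_p (sum_pred (fun k => Dk s k pi *+ 'C(p, k))) //=.
rewrite binn mulr1n (sum_predl (fun k => Dk s k pi *+ 'C(p, k))) // bin0 mulr1n big1 ?addr0; last first.
  move=> k _; have hb : (p %| 'C(p, k.+1))%N by apply: prime_dvd_bin => //=; have := ltn_ord k; lia.
  by apply/eqP; rewrite -mulr_natr mulf_eq0 -(dvdn_pcharf pcharL) hb orbT.
rewrite {1}/Dk /= => e; have [nz _] := hk p.
by move: nz; rewrite -[X in X != 0](addKr pi) -e addNr eqxx.
Qed.

Lemma iter_D_vge m r y : vge vL r y -> vge vL (r + brk) (iter m s y - y).
Proof.
move=> h; elim: m => [|m IH]; first by rewrite subrr vge0.
have -> : iter m.+1 s y - y = D (iter m s y) + (iter m s y - y) by rewrite iterS addrA subrK.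
by apply: (vgeD vL_val) => //; apply: D_vge; rewrite iter_vge.
Qed.

(** The difference telescopes into the conjugates of D pi, each equal to D pi up to higher
    valuation; it is m D pi to leading order, and m is a unit. *)
Lemma conj_diff m : (0 < m < p)%N -> iter m s pi - pi != 0 /\
  vL (iter m s pi - pi) = lam.+1%:R / p%:R.
Proof.
move=> /andP[m0 mp].
have p1 : ~~ (p %| 1)%N by rewrite dvdn1 gtn_eqF.
have [D0 vD] := D_exact p1 pi0 v_pi.
have e : iter m s pi - pi = D pi *+ m + \sum_(k < m) (iter k s (D pi) - D pi).
  rewrite sumrB sumr_const card_ord addrCA subrr addr0.
  elim: m {m0 mp} => [|m IH]; first by rewrite big_ord0 subrr.
  rewrite big_ord_recr /= -IH; have [f hf] := iter_rmorph m.
  by rewrite [iter m s (D pi)]hf rmorphB -!hf -iterSr addrC addrA subrK.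
have mR : m%:R != 0 :> L by rewrite -(dvdn_pcharf pcharL) gtnNdvd.
have mD0 : D pi *+ m != 0 by rewrite -mulr_natr mulf_neq0.
have vmD : vL (D pi *+ m) = lam.+1%:R / p%:R.
  by rewrite -mulr_natr (val_M vL_val) // (val_nat vL_val pcharL mR) addr0 vD.
rewrite e -vmD; apply: (val_dom vL_val) => //.
apply: (vgt_sum vL_val) => k _; have h : vge vL (lam.+1%:R / p%:R) (D pi) by rewrite vge_nz // vD.
apply: vge_gt (iter_D_vge k h); by rewrite vmD ltrDl divr_gt0 ?ltr0n.
Qed.

Lemma conj_val_diff a b : (a < p)%N -> (b < p)%N -> a != b ->
  iter a s pi - iter b s pi != 0 /\ vL (iter a s pi - iter b s pi) = lam.+1%:R / p%:R.
Proof.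
wlog lt_ba : a b / (b < a)%N.
  move=> h ha hb ab; case: (ltngtP a b) => hab; [|exact: h|by rewrite hab eqxx in ab].
  have [h1 h2] := h b a hab hb ha (contra_neq esym ab).
  by rewrite -opprB oppr_eq0 (val_N vL_val).
move=> ha hb _; have [|n0 v0] := @conj_diff (a - b)%N; first by lia.
have -> : iter a s pi - iter b s pi = iter b s (iter (a - b)%N s pi - pi).
  have [f hf] := iter_rmorph b; rewrite [RHS]hf rmorphB -!hf -iterD subnKC //; exact: ltnW.
by have [f hf] := iter_rmorph b; rewrite iter_vL v0 hf fmorph_eq0.
Qed.
End Cyclic.
End RamifiedExtension.

(** * Valuations on algebraic extensions *)

Section AlgebraicElements.
Lemma exists_irreducible (F : fieldType) (Om : closedFieldType) (iota : {rmorphism F -> Om}) x :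
  algebraicOver iota x -> exists mu : {poly F}, irreducible_poly mu /\ root (map_poly iota mu) x.
Proof.
move=> alg; have dec : decidable_embedding iota by move=> y; apply: pselect.
by have [mu [_ h1 h2]] := minPoly_decidable_closure dec ((integral_algebraic iota x).1 alg); exists mu.
Qed.

Lemma in_alg_root (F : fieldType) (N : fieldExtType F) (Om : fieldType) (j : {rmorphism N -> Om})
  (iota : {rmorphism F -> Om}) : (forall x, j x%:A = iota x) ->
  forall (f : {poly F}) x, j (map_poly (in_alg N) f).[x] = (map_poly iota f).[j x].
Proof.
move=> h f x; rewrite -horner_map -map_poly_comp; congr (_.[_]).
by apply: eq_map_poly => a /=; rewrite h.
Qed.

Lemma generated_hom (F : fieldType) (N : fieldExtType F) (Om : fieldType) (iota : {rmorphism F -> Om})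
  (mu : {poly F}) (beta : N) (b' : Om) :
  (forall x : N, exists q, x = (map_poly (in_alg N) q).[beta]) ->
  irreducible_poly mu -> root (map_poly (in_alg N) mu) beta -> root (map_poly iota mu) b' ->
  exists s : {rmorphism N -> Om}, (forall x, s x%:A = iota x) /\ s beta = b'.
Proof.
move=> gen irr rb rb'.
pose q x := proj1_sig (cid (gen x)); have hq x : x = (map_poly (in_alg N) (q x)).[beta].
  exact: (proj2_sig (cid (gen x))).
pose s x := (map_poly iota (q x)).[b'].
have sE f x : x = (map_poly (in_alg N) f).[beta] -> s x = (map_poly iota f).[b'].
  move=> e; apply/eqP; rewrite -subr_eq0 /s -hornerN -hornerD -rmorphN -rmorphD.
  rewrite (root_ev_eq0 irr _ rb') -(root_ev_eq0 irr _ rb) rmorphD rmorphN hornerD hornerN.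
  by rewrite -hq -e subrr.
have sB : zmod_morphism s.
  move=> x y; rewrite (sE (q x - q y)) ?rmorphB ?hornerD ?hornerN //.
  by rewrite -!hq.
have sM : monoid_morphism s.
  split; first by rewrite (sE 1) ?rmorph1 ?hornerC.
  move=> x y; rewrite (sE (q x * q y)) ?rmorphM ?hornerM //.
  by rewrite -!hq.
pose s1 := GRing.isZmodMorphism.Build N Om s sB; pose s2 := GRing.isMonoidMorphism.Build N Om s sM.
pose S : {rmorphism N -> Om} := HB.pack s s1 s2.
exists S; split=> [x|]; first by rewrite /S /= (sE x%:P) ?map_polyC ?hornerC.
by rewrite /S /= (sE 'X) ?map_polyX ?hornerX.
Qed.

Lemma simple_extension (F Om : fieldType) (iota : {rmorphism F -> Om}) (mu : {poly F}) b :
  irreducible_poly mu -> root (map_poly iota mu) b ->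
  exists (N : fieldExtType F) (j : {rmorphism N -> Om}) (beta : N),
  [/\ forall x, j x%:A = iota x, j beta = b, \dim {:N} = (size mu).-1 &
   forall x : N, exists q, x = (map_poly (in_alg N) q).[beta]].
Proof.
move=> irr rb; have nz := irredp_neq0 irr.
pose N := SubFieldExtType rb irr.
exists N, (subfx_inj : {rmorphism subFExtend iota b mu -> Om}), (subfx_root iota b mu); split.
- exact: (subfx_inj_base rb nz).
- exact: (subfx_inj_root rb nz).
- by rewrite dimvf.
by move=> x; have [q hq] := subfxEroot rb nz x; exists q.
Qed.

Lemma extension_irreducible (F : fieldType) (N : fieldExtType F) (x : N) :
  exists mu : {poly F}, [/\ irreducible_poly mu, root (map_poly (in_alg N) mu) x,
    ((size mu).-1 %| \dim {:N})%N & (size mu).-1 = \dim <<1; x>>].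
Proof.
have /polyOver1P[mu emu] := minPolyOver 1 x.
have sz : (size mu).-1 = \dim <<1; x>>.
  by rewrite dim_Fadjoin dimv1 muln1 -(size_map_poly (in_alg N)) -emu size_minPoly.
exists mu; split=> //.
- split=> [|q q1 qd].
    by rewrite -(size_map_poly (in_alg N)) -emu size_minPoly ltnS /adjoin_degree.
  have : map_poly (in_alg N) q %| minPoly 1 x by rewrite emu dvdp_map.
  move=> /minPoly_irr -/(_ _)/orP[|h|h].
  + by apply/polyOver1P; exists q.
  + by rewrite -(eqp_map (in_alg N)) -emu.
  by have := eqp_size h; rewrite size_map_poly size_poly1 => e; rewrite e eqxx in q1.
- by rewrite -emu root_minPoly.
by rewrite sz; apply: field_dimS; apply: subvf.
Qed.

Section ExtensionValuation.
Variables (K : fieldType) (vK : K -> rat).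
Hypotheses (vK_val : valuation vK) (vK_complete : complete_val vK).
Variables (Om : closedFieldType) (v : Om -> rat) (iota : {rmorphism K -> Om}).
Hypotheses (v_val : valuation v) (v_ext : forall x, x != 0 -> v (iota x) = vK x).

Lemma conj_val_root (mu : {poly K}) b b' : irreducible_poly mu ->
  root (map_poly iota mu) b -> root (map_poly iota mu) b' -> v b = v b'.
Proof.
move=> irr h h'; have := conj_val vK_val vK_complete v_val v_ext irr 'X h h'.
by rewrite map_polyX !hornerX.
Qed.

(** The roots of mu all have the valuation of b, and their product is, up to sign, the quotient of
    the constant by the leading coefficient: the norm formula for the valuation. *)
Lemma irreducible_val (mu : {poly K}) b : irreducible_poly mu -> root (map_poly iota mu) b -> b != 0 ->
  exists2 a : K, a != 0 & (size mu).-1%:R * v b = vK a.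
Proof.
move=> irr rb b0; have nz := irredp_neq0 irr.
have [rs hrs] := closed_field_poly_normal (map_poly iota mu).
have lc0 : lead_coef mu != 0 by rewrite lead_coef_eq0.
have rr r : r \in rs -> root (map_poly iota mu) r.
  by move=> h; rewrite hrs rootE hornerZ (rootP _) ?mulr0 // root_prod_XsubC.
have r0 r : r \in rs -> r != 0 /\ v r = v b.
  move=> /rr h; split; last exact: conj_val_root irr _ _.
  have := root_ev_eq0 irr 'X h; rewrite -(root_ev_eq0 irr 'X rb) map_polyX !hornerX => ->.
  by rewrite b0.
have c0 : (map_poly iota mu)`_0 = iota (lead_coef mu) * ((-1) ^+ size rs * \prod_(r <- rs) r).
  rewrite -horner_coef0 hrs hornerZ lead_coef_map horner_prod; congr (_ * _).
  rewrite (eq_bigr (fun r => -1 * r)); last by move=> r _; rewrite !hornerE mulN1r.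
  by rewrite big_split /= big_const_seq count_predT iter_mulr_1.
have p0 : \prod_(r <- rs) r != 0 by rewrite prodf_seq_neq0; apply/allP => r /r0[].
have vp : v (\prod_(r <- rs) r) = (size rs)%:R * v b.
  elim: rs {hrs rr c0 p0} r0 => [|r rs IH] h; first by rewrite big_nil (val_1 v_val) mul0r.
  have [h0 h1] := h r (mem_head _ _).
  have h' x : x \in rs -> x != 0 /\ v x = v b by move=> hx; apply: h; rewrite inE hx orbT.
  rewrite big_cons (val_M v_val) // ?IH // ?h1; first by rewrite /= -[(size rs).+1]add1n natrD; ring.
  by rewrite prodf_seq_neq0; apply/allP => x /h'[].
have sg0 : (-1) ^+ size rs != 0 :> Om by rewrite expf_neq0 // oppr_eq0 oner_eq0.
exists ((-1) ^+ size rs * mu`_0 / lead_coef mu).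
  rewrite !mulf_neq0 ?invr_eq0 ?expf_neq0 ?oppr_eq0 ?oner_eq0 //.
  rewrite -(fmorph_eq0 iota) -coef_map c0 !mulf_neq0 // fmorph_eq0 //.
have -> : (size mu).-1 = size rs.
  by rewrite -(size_map_poly iota) hrs size_scale ?lead_coef_eq0 ?map_poly_eq0 // size_prod_XsubC.
rewrite -vp -v_ext; last first.
  rewrite !mulf_neq0 ?invr_eq0 ?expf_neq0 ?oppr_eq0 ?oner_eq0 //.
  by rewrite -(fmorph_eq0 iota) -coef_map c0 !mulf_neq0 // fmorph_eq0.
congr v; rewrite !rmorphM fmorphV rmorphXn rmorphN1 -coef_map c0.
have l0 : iota (lead_coef mu) != 0 by rewrite fmorph_eq0.
have e2 : (-1) ^+ size rs * (-1) ^+ size rs = 1 :> Om by rewrite -exprMn mulrNN mul1r expr1n.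
transitivity (((-1) ^+ size rs * (-1) ^+ size rs) * \prod_(r <- rs) r * (iota (lead_coef mu) / iota (lead_coef mu))).
  by rewrite e2 mulfV // !mulr1 mul1r.
by ring.
Qed.

Variables (N : fieldExtType K) (j : {rmorphism N -> Om}).
Hypothesis j_ext : forall x, j x%:A = iota x.

Lemma extension_val x : x != 0 -> exists2 a : K, a != 0 & (\dim {:N})%:R * v (j x) = vK a.
Proof.
move=> x0; have [mu [irr rx /dvdnP[k ek] _]] := extension_irreducible x.
have rjx : root (map_poly iota mu) (j x).
  by rewrite rootE -(in_alg_root j_ext) (rootP rx) rmorph0.
have jx0 : j x != 0 by rewrite fmorph_eq0.
have [a a0 ha] := irreducible_val irr rjx jx0; exists (a ^+ k); first exact: expf_neq0.
by rewrite (val_X vK_val) // -ha ek natrM mulrA.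
Qed.

Lemma extension_conj_val (s : {rmorphism N -> N}) x : (forall a : K, s a%:A = a%:A) ->
  v (j (s x)) = v (j x).
Proof.
move=> sK; have [mu [irr rx _ _]] := extension_irreducible x.
apply: (conj_val_root irr); rewrite rootE -(in_alg_root j_ext).
  by rewrite -[map_poly _ mu]/(map_poly (in_alg N) mu) -(in_alg_root (iota := in_alg N) sK) (rootP rx) !rmorph0.
by rewrite (rootP rx) rmorph0.
Qed.
End ExtensionValuation.

Lemma localField_complete p (K : localField p) : complete_val (@vK p K).
Proof.
move=> u hu.
have close n m : (n <= m)%N -> vge (@vK p K) n%:R (u m - u n).
  elim: m => [|m IH]; first by rewrite leqn0 => /eqP ->; rewrite subrr vge0.
  rewrite leq_eqVlt => /orP[/eqP ->|]; first by rewrite subrr vge0.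
  rewrite ltnS => h; have -> : u m.+1 - u n = (u m.+1 - u m) + (u m - u n) by rewrite addrA subrK.
  by apply: (vgeD (@vK_val p K)); [apply: vge_le (hu m); rewrite ler_nat | apply: IH].
have clP N x y : close_at (@lf_ord p K) N x y <-> vge (@vK p K) N%:~R (x - y).
  rewrite /close_at /vge /vK ler_int subr_eq0; split=> [[->|->]|/orP[/eqP|]]; rewrite ?eqxx ?orbT //; auto.
have [|l hl] := @lf_complete p K u.
  move=> N; exists `|N|%N => m n hm hn; apply/clP.
  have -> : u m - u n = (u m - u `|N|%N) - (u n - u `|N|%N) by rewrite opprB addrA subrK.
  apply: (@vge_le _ _ `|N|%N%:R); first by rewrite -[_%:R]/(`|N|%N%:Z%:~R) ler_int; lia.
  by apply: (vgeB (@vK_val p K)); apply: close.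
exists l => k; have [n0 h] := hl k%:Z.
have /clP h1 := h (maxn n0 k) (leq_maxl _ _).
have -> : u k - l = (u (maxn n0 k) - l) - (u (maxn n0 k) - u k) by ring.
by apply: (vgeB (@vK_val p K)) => //; apply: close; rewrite leq_maxr.
Qed.
End AlgebraicElements.

Section Uniformizers.
Variables (Om : fieldType) (v : Om -> rat).

(** The element t shows that uniformizers exist, so the default value of [xget] is not taken, and
    the choice does not matter as all uniformizers have the least positive valuation. *)
Lemma uniformizer_val (M : set Om) (e : nat) t : (0 < e)%N -> M t -> t != 0 -> v t = 1 / e%:R ->
  (forall x, M x -> x != 0 -> exists a : int, v x = a%:~R / e%:R) ->
  v (xget 0 (uniformizers v M)) = 1 / e%:R.
Proof.
move=> e0 Mt t0 vt hM; have e0R : 0 < e%:R :> rat by rewrite ltr0n.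
have hmin x : M x -> x != 0 -> 0 < v x -> 1 / e%:R <= v x.
  move=> Mx x0; have [a ->] := hM x Mx x0.
  rewrite pmulr_lgt0 ?invr_gt0 // ltr0z => a0.
  by rewrite ler_pM2r ?invr_gt0 // ler1z.
have ut : uniformizers v M t.
  by split; rewrite ?vt ?divr_gt0 //; apply: hmin.
have [Mu u0 vu hu] := xgetPex 0 (ex_intro _ t ut).
by apply/eqP; rewrite eq_le hmin // andbT -vt hu // vt divr_gt0.
Qed.

Lemma ord_at_val (M : set Om) (e : nat) t x : (0 < e)%N -> M t -> t != 0 -> v t = 1 / e%:R ->
  (forall x, M x -> x != 0 -> exists a : int, v x = a%:~R / e%:R) ->
  ord_at v M x = e%:R * v x.
Proof. by move=> e0 Mt t0 vt hM; rewrite /ord_at (uniformizer_val e0 Mt) // mul1r invrK mulrC. Qed.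

Lemma ram_index_val (N M : set Om) (e f : nat) t u : (0 < e)%N -> (0 < f)%N ->
  M t -> t != 0 -> v t = 1 / e%:R ->
  (forall x, M x -> x != 0 -> exists a : int, v x = a%:~R / e%:R) ->
  N u -> u != 0 -> v u = 1 / (e * f)%:R ->
  (forall x, N x -> x != 0 -> exists a : int, v x = a%:~R / (e * f)%:R) ->
  ram_index v N M = f.
Proof.
move=> e0 f0 Mt t0 vt hM Nu u0 vu hN.
rewrite /ram_index (@ord_at_val N (e * f)%N u) ?muln_gt0 ?e0 // (uniformizer_val e0 Mt) //.
have -> : (e * f)%:R * (1 / e%:R) = f%:R :> rat.
  by rewrite natrM mul1r mulrAC mulfV ?mul1r // pnatr_eq0 -lt0n.
exact: Num.Theory.natrK.
Qed.
End Uniformizers.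

Section CyclicExtension.
Variables (F : fieldType) (L : splittingFieldType F) (p : nat).
Hypotheses (L_gal : galois 1 {:L}) (L_cyc : cyclic 'Gal({:L} / 1)%g) (L_deg : \dim {:L} = p).

Lemma iter_gal (g : gal_of {:L}) i x : (g ^+ i)%g x = iter i g x.
Proof.
elim: i x => [|i IH] x; first by rewrite expg0 gal_id.
by rewrite expgS galM ?memvf // IH -iterSr.
Qed.

Lemma cyclic_generator : exists g : gal_of {:L}, [/\ 'Gal({:L} / 1)%g = <[g]>%g, #[g]%g = p,
  forall a : F, g a%:A = a%:A, forall x, iter p g x = x &
  forall x, g x = x -> exists a : F, x = a%:A].
Proof.
have /cyclicP[g eg] := L_cyc; exists g.
have og : #[g]%g = p by rewrite /order -eg -(galois_dim L_gal) dimv1 divn1.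
have gK (a : F) : g a%:A = a%:A by rewrite linearZ /= rmorph1.
split=> // [x|x gx].
  by rewrite -iter_gal -og expg_order gal_id.
have : x \in fixedField 'Gal({:L} / 1)%g.
  apply/fixedFieldP; first exact: memvf.
  move=> h; rewrite eg => /cycleP[i ->]; rewrite iter_gal.
  by elim: i => //= i ->.
by rewrite (galois_fixedField L_gal) => /vlineP[a ->]; exists a.
Qed.
End CyclicExtension.

Section RamifiedCyclicExtension.
Variables (p : nat) (K : localField p) (Om : closedFieldType) (iota : {rmorphism K -> Om}) (v : Om -> rat).
Hypotheses (v_val : valuation v) (v_ext : forall x : K, x != 0 -> v (iota x) = vK x).
Variables (L : splittingFieldType K) (j : {rmorphism L -> Om}).
Hypotheses (j_ext : forall x : K, j x%:A = iota x) (L_gal : galois 1 {:L}) (L_cyc : cyclic 'Gal({:L} / 1)%g)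
 (L_deg : \dim {:L} = p) (L_ram : (1 < ram_index v (range j) (range iota))%N).
Local Notation vL := (fun x => v (j x)).

Lemma localField_prime : prime p. Proof. by have /andP[] := lf_pchar K. Qed.
Lemma vK_int (x : K) : x != 0 -> exists m : int, vK x = m%:~R.
Proof. by exists (lf_ord x). Qed.
Lemma vK_unif : exists2 t : K, t != 0 & vK t = 1.
Proof. by have [x x0 hx] := lf_normalized K; exists x; rewrite // /vK hx. Qed.
Lemma vj_ext (x : K) : x != 0 -> vL x%:A = vK x.
Proof. by move=> x0; rewrite /= j_ext v_ext. Qed.
Lemma vj_val : valuation vL. Proof. exact: (vF_val v_val). Qed.
Lemma vj_int x : x != 0 -> exists m : int, p%:R * vL x = m%:~R.
Proof.
move=> x0; have [a a0] := extension_val (@vK_val p K) (@localField_complete p K) v_val v_ext j_ext x0.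
by rewrite L_deg => ->; exists (lf_ord a).
Qed.
Lemma range_iota_int x : range iota x -> x != 0 -> exists a : int, v x = a%:~R / 1%:R.
Proof.
move=> [y _ <-]; rewrite fmorph_eq0 => y0; have [m e] := vK_int y0; exists m; by rewrite v_ext // divr1.
Qed.

Lemma ramified_uniformizer : exists2 pi, pi != 0 & vL pi = 1 / p%:R.
Proof.
have p_pr := localField_prime.
have [t t0 vt] := vK_unif.
have H := @uniformizer_exists p _ _ p_pr vK_unif L _ vj_val vj_ext vj_int; apply: H.
apply: contrapT => hno.
have all_int x : range j x -> x != 0 -> exists a : int, v x = a%:~R / (1 * 1)%:R.
  move=> [y _ <-]; rewrite fmorph_eq0 => y0; apply: contrapT => h; apply: hno.
  by exists y => // m e; apply: h; exists m; rewrite divr1.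
move: L_ram; rewrite (@ram_index_val _ v (range j) (range iota) 1 1 (iota t) (iota t)) //.
- by rewrite fmorph_eq0.
- by rewrite v_ext // vt divr1.
- exact: range_iota_int.
- by exists t%:A; rewrite // j_ext.
- by rewrite fmorph_eq0.
by rewrite v_ext // vt divr1.
Qed.

Lemma galois_val (g : gal_of {:L}) x : vL (g x) = vL x.
Proof.
apply: (extension_conj_val (@vK_val p K) (@localField_complete p K) v_val v_ext j_ext (s := g)) => a.
by rewrite /= linearZ /= rmorph1.
Qed.
End RamifiedCyclicExtension.

Section SubfieldClosure.
Variable Om : fieldType.
Implicit Types A S : set Om.

Lemma subfieldP A : is_subfield A <->
  [/\ A 1, forall x y, A x -> A y -> A (x - y) & forall x y, A x -> A y -> A (x / y)].
Proof.
split=> [[h1 hB hV]|[h1 hB hV]].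
  split; first by have := h1; rewrite inE.
    by move=> x y Ax Ay; have := hB x y; rewrite !inE; apply.
  by move=> x y Ax Ay; have := hV x y; rewrite !inE; apply.
by split=> [|x y|x y]; rewrite !inE //; [apply: hB | apply: hV].
Qed.

Section Closed.
Variable A : set Om.
Hypothesis hA : is_subfield A.
Lemma subfieldB x y : A x -> A y -> A (x - y). Proof. by move: x y; have /subfieldP[] := hA. Qed.
Lemma subfield1 : A 1. Proof. by have /subfieldP[] := hA. Qed.
Lemma subfieldV x y : A x -> A y -> A (x / y). Proof. by move: x y; have /subfieldP[] := hA. Qed.
Lemma subfield0 : A 0. Proof. by rewrite -(subrr 1); apply: subfieldB; apply: subfield1. Qed.
Lemma subfieldN x : A x -> A (- x). Proof. by rewrite -sub0r; apply: subfieldB; apply: subfield0. Qed.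
Lemma subfieldD x y : A x -> A y -> A (x + y).
Proof. by move=> hx /subfieldN hy; rewrite -[y]opprK; apply: subfieldB. Qed.
Lemma subfieldM x y : A x -> A y -> A (x * y).
Proof.
move=> hx hy; rewrite -[y]invrK; apply: subfieldV => //.
by rewrite -[y^-1]mul1r; apply: subfieldV => //; apply: subfield1.
Qed.
Lemma subfieldX x n : A x -> A (x ^+ n).
Proof. by move=> hx; elim: n => [|n IH]; [exact: subfield1 | rewrite exprS; apply: subfieldM]. Qed.
Lemma subfield_sum n (G : nat -> Om) : (forall i, (i < n)%N -> A (G i)) -> A (\sum_(i < n) G i).
Proof.
elim: n => [|n IH] h; first by rewrite big_ord0; apply: subfield0.
rewrite big_ord_recr; apply: subfieldD; last exact: h.
by apply: IH => i hi; apply: h; apply: leqW.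
Qed.
Lemma subfield_horner (M : nzRingType) (k : {rmorphism M -> Om}) (f : {poly M}) x :
  (forall m, A (k m)) -> A x -> A (map_poly k f).[x].
Proof.
move=> hk hx; rewrite horner_coef; apply: (@subfield_sum _ (fun i => (map_poly k f)`_i * x ^+ i)) => i _.
by apply: subfieldM; [rewrite coef_map; apply: hk | apply: subfieldX].
Qed.
End Closed.

Lemma subfield_gen_min S A : is_subfield A -> S `<=` A -> subfield_gen S `<=` A.
Proof. by move=> hA hS x; apply. Qed.
Lemma subfield_gen_sub S : S `<=` subfield_gen S.
Proof. by move=> x Sx A [_]; apply. Qed.
Lemma subfield_genP S : is_subfield (subfield_gen S).
Proof.
apply/subfieldP; split=> [A [hA _]|x y hx hy A h|x y hx hy A h]; first exact: subfield1.
  by apply: (subfieldB h.1); [apply: hx | apply: hy].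
by apply: (subfieldV h.1); [apply: hx | apply: hy].
Qed.

Lemma range_subfield (F : fieldType) (k : {rmorphism F -> Om}) : is_subfield (range k).
Proof.
apply/subfieldP; split; first by exists 1; rewrite ?rmorph1.
  by move=> _ _ [x _ <-] [y _ <-]; exists (x - y); rewrite ?rmorphB.
by move=> _ _ [x _ <-] [y _ <-]; exists (x / y); rewrite ?fmorph_div.
Qed.
End SubfieldClosure.

(** The terms i and p - i pair up: e i / p and e (p - i) / p are not integers and add up to e, so
    their floors add up to e - 1. *)
Lemma sum_floor (p e : nat) : prime p -> coprime p e -> (0 < e)%N ->
  (2 * \sum_(i < p) (e * i) %/ p = p.-1 * e.-1)%N.
Proof.
move=> p_pr pe e0; have p0 := prime_gt0 p_pr.
rewrite -(big_mkord xpredT (fun i => (e * i) %/ p)%N) big_ltn // muln0 div0n add0n big_add1 big_mkord mul2n -addnn.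
rewrite {1}(reindex_inj rev_ord_inj) /= -big_split /= (eq_bigr (fun=> e.-1)).
  by rewrite sum_nat_const card_ord.
move=> i _; have hi := ltn_ord i.
have hd : ~~ (p %| e * i.+1)%N.
  rewrite Gauss_dvdr //; apply/negP => /dvdn_leq -/(_ isT); lia.
have -> : (e * (p.-1 - i.+1).+1 = e * p - e * i.+1)%N by rewrite -mulnBr; congr (_ * _)%N; lia.
set m := (e * i.+1)%N in hd *.
have hm : (m <= e * p)%N by rewrite leq_mul2l; apply/orP; right; lia.
have e1 := divn_eq m p; have r0 : (0 < m %% p)%N by rewrite lt0n.
have r1 := ltn_pmod m p0.
have -> : (e * p - m = (e - (m %/ p).+1) * p + (p - m %% p))%N.
  rewrite mulnBl; have : ((m %/ p).+1 * p <= e * p)%N.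
    by rewrite leq_pmul2r // -(ltn_pmul2r p0) in r0 *; nia.
  move=> h; rewrite [in LHS]e1; move: h r0 r1; rewrite !mulSn; clear; move: (m %/ p)%N (m %% p)%N => x y.
  move: (x * p)%N (e * p)%N => X Y; lia.
have hs : (p - m %% p < p)%N by lia.
rewrite divnMDl // (divn_small hs) addn0.
by have : (m %/ p < e)%N; [rewrite ltn_divLR //; rewrite ltn_neqAle hm andbT; apply: contraNneq hd => ->; rewrite dvdn_mull | lia].
Qed.

Lemma floor_arith (a : int) (q r m p : nat) : (0 < p)%N -> 0 <= a * p%:Z + m%:Z -> (r < p)%N ->
  m = (q * p + r)%N -> 0 <= a + q%:Z.
Proof.
move=> p0 h1 h2 h3; rewrite leNgt; apply/negP => h4.
have : (a + q%:Z + 1) * p%:Z <= 0 by rewrite mulr_le0_ge0 //; lia.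
rewrite !mulrDl mul1r; lia.
Qed.

(** * The discriminant over a base of ramification index prime to p *)

Section Discriminant.
Variables (p e lam : nat).
Hypotheses (p_pr : prime p) (pe : coprime p e) (e_gt0 : (0 < e)%N).
Variables (K M : fieldType) (Om : fieldType) (iota : {rmorphism K -> Om}) (k : {rmorphism M -> Om})
  (h : {rmorphism K -> M}).
Hypothesis kh : forall x, k (h x) = iota x.
Variable v : Om -> rat.
Hypotheses (v_val : valuation v) (vM : forall m, m != 0 -> exists a : int, v (k m) = a%:~R / e%:R)
 (tM : exists2 t, t != 0 & v (k t) = 1 / e%:R).
(* [pi m], m < p, are the conjugates of a uniformizer [pi 0] of L *)
Variables (mu : {poly K}) (pi : nat -> Om).
Hypotheses (mu_size : size mu = p.+1) (mu_root : forall m, (m < p)%N -> root (map_poly iota mu) (pi m))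
 (v_pi : forall m, (m < p)%N -> pi m != 0 /\ v (pi m) = 1 / p%:R)
 (v_pi_diff : forall a b, (a < p)%N -> (b < p)%N -> a != b ->
  pi a - pi b != 0 /\ v (pi a - pi b) = lam.+1%:R / p%:R).
Let p_gt0 := prime_gt0 p_pr.
Let pR : p%:R != 0 :> rat. Proof. by rewrite pnatr_eq0 -lt0n. Qed.
Let eR : e%:R != 0 :> rat. Proof. by rewrite pnatr_eq0 -lt0n. Qed.
Let pi0 := (v_pi p_gt0).1.
Let vpi0 := (v_pi p_gt0).2.
Local Notation ev f x := (map_poly k f).[x].
Local Notation nu := (map_poly h mu).

Lemma nu_root m : (m < p)%N -> root (map_poly k nu) (pi m).
Proof.
move=> /mu_root hm; rewrite -map_poly_comp (_ : map_poly _ mu = map_poly iota mu) //.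
by apply: eq_map_poly => x /=; rewrite kh.
Qed.
Lemma ev_small (f : {poly M}) : (size f <= p)%N -> forall x, ev f x = \sum_(i < p) k f`_i * x ^+ i.
Proof.
move=> sf x; rewrite (horner_coef_wide (n := p)) ?(leq_trans (size_poly _ _)) //.
by apply: eq_bigr => i _; rewrite coef_map.
Qed.

Lemma ev_eq0_small (f : {poly M}) : (size f <= p)%N -> ev f (pi 0) = 0 -> f = 0.
Proof.
move=> sf; rewrite ev_small // => hf; apply/polyP => i; rewrite coef0.
case: (ltnP i p) => hi; last by rewrite nth_default // (leq_trans sf).
exact: (expansion_eq0 p_pr pe e_gt0 v_val vM pi0 vpi0 hf hi).
Qed.

Lemma nu_irr : irreducible_poly nu.
Proof.
have nz : nu != 0 by rewrite map_poly_eq0 -size_poly_gt0 mu_size.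
apply/(subfx_irreducibleP (nu_root p_gt0) nz) => q; rewrite size_map_poly mu_size => /rootP rq q0.
rewrite ltnNge; apply: contra q0 => sq; apply/eqP; exact: ev_eq0_small.
Qed.

Lemma ev_conj (f g : {poly M}) : ev f (pi 0) = ev g (pi 0) -> forall m, (m < p)%N -> ev f (pi m) = ev g (pi m).
Proof.
move=> /eqP; rewrite -subr_eq0 -hornerN -hornerD -rmorphN -rmorphD.
rewrite (root_ev_eq0 nu_irr _ (nu_root p_gt0)) => hd m hm.
by apply/eqP; rewrite -subr_eq0 -hornerN -hornerD -rmorphN -rmorphD (root_ev_eq0 nu_irr _ (nu_root hm)).
Qed.

Definition ramified_field : set Om := [set x | exists f, x = ev f (pi 0)].
Local Notation N := ramified_field.

Lemma ramified_fieldP : is_subfield N.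
Proof.
apply/subfieldP; split.
- by exists 1; rewrite rmorph1 hornerC.
- by move=> _ _ [f ->] [g ->]; exists (f - g); rewrite rmorphB hornerD hornerN.
move=> _ _ [f ->] [g ->].
have [->|nz] := eqVneq (ev g (pi 0)) 0; first by exists 0; rewrite invr0 mulr0 rmorph0 horner0.
have : coprimep nu g.
  rewrite irreducible_poly_coprime; last exact: nu_irr.
  by rewrite -(root_ev_eq0 nu_irr _ (nu_root p_gt0)).
move=> /Bezout_eq1_coprimepP[[u w] /= e1]; exists (f * w); rewrite rmorphM hornerM; congr (_ * _).
have := congr1 (fun f => ev f (pi 0)) e1; rewrite rmorphD !rmorphM hornerD !hornerM rmorph1 hornerC.
by rewrite (rootP (nu_root p_gt0)) mulr0 add0r => /(canRL (mulfK nz)); rewrite mul1r.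
Qed.

Lemma ramified_expand x : N x -> exists c : nat -> M, x = \sum_(i < p) k (c i) * pi 0 ^+ i.
Proof.
move=> [f ->]; exists (fun i => (f %% nu)`_i); rewrite -ev_small.
  by rewrite (root_ev_mod _ (nu_root p_gt0)).
have nz := irredp_neq0 nu_irr; have := ltn_modp f nu.
by rewrite nz size_map_poly mu_size ltnS.
Qed.

Lemma ramified_fieldE (S : set Om) : S (pi 0) -> S `<=` N ->
  subfield_gen (range k `|` S) = N.
Proof.
move=> S0 SN; apply/seteqP; split.
  apply: subfield_gen_min; first exact: ramified_fieldP.
  move=> _ [[m _ <-]|/SN //]; exists m%:P; by rewrite map_polyC hornerC.
move=> _ [f ->]; apply: (subfield_horner (@subfield_genP _ _)).
  by move=> m; apply: subfield_gen_sub; left; exists m.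
by apply: subfield_gen_sub; right.
Qed.

Let t := sval (cid2 tM).
Let t0 : t != 0. Proof. by rewrite /t; case: cid2. Qed.
Let vt : v (k t) = 1 / e%:R. Proof. by rewrite /t; case: cid2. Qed.
Let kt0 : k t != 0. Proof. by rewrite fmorph_eq0. Qed.
(** The largest power of t, of valuation 1/e, by which pi^i, of valuation i/p, stays divisible. The
    quotients form an integral basis. *)
Definition bexp i := ((e * i) %/ p)%N.
Definition bpoly i : {poly M} := t ^- bexp i *: 'X^i.
Definition bas (i : 'I_p) : Om := ev (bpoly i) (pi 0).

Lemma ev_bpoly i x : ev (bpoly i) x = k t ^- bexp i * x ^+ i.
Proof. by rewrite map_polyZ hornerZ map_polyXn hornerXn fmorphV rmorphXn. Qed.
Lemma val_tX i : v (k t ^- bexp i) = - ((bexp i)%:R / e%:R).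
Proof. by rewrite (val_V v_val) ?expf_neq0 // (val_X v_val) // vt mulrA mulr1. Qed.

Lemma bas_int i : int_ring v N (bas i).
Proof.
split; first by exists (bpoly i).
right; rewrite /bas ev_bpoly (val_M v_val) ?invr_eq0 ?expf_neq0 // val_tX (val_X v_val) // vpi0.
rewrite addrC subr_ge0 ler_pdivrMr ?ltr0n // mulrAC mulrA mulr1 ler_pdivlMr ?ltr0n //.
by rewrite -!natrM ler_nat [(i * e)%N]mulnC leq_divM.
Qed.

Lemma integral_coef (c : nat -> M) : vge v 0 (\sum_(i < p) k (c i) * pi 0 ^+ i) ->
  forall i, (i < p)%N -> vge v 0 (k (c i * t ^+ bexp i)).
Proof.
move=> hc i hi; have := expansion_vge p_pr pe e_gt0 v_val vM pi0 vpi0 hc hi.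
have [->|ci] := eqVneq (c i) 0; first by rewrite mul0r rmorph0 vge0.
have kci : k (c i) != 0 by rewrite fmorph_eq0.
rewrite !vge_nz ?mulf_neq0 ?expf_neq0 //; last by rewrite fmorph_eq0 mulf_neq0 ?expf_neq0.
rewrite rmorphM rmorphXn !(val_M v_val) ?expf_neq0 // !(val_X v_val) // vt vpi0.
have [a ->] := vM ci => h1.
have h2 : 0 <= (a * p%:Z + (e * i)%N%:Z)%:~R :> rat.
  have -> : (a * p%:Z + (e * i)%N%:Z)%:~R = (a%:~R / e%:R + i%:R * (1 / p%:R)) * (e%:R * p%:R) :> rat.
    by rewrite intrD intrM -[((e * i)%N%:Z)%:~R]/((e * i)%N%:R) natrM -[(p%:Z)%:~R]/(p%:R); field; rewrite eR pR.
  by rewrite mulr_ge0 // mulr_ge0.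
rewrite ler0z in h2.
have h3 : 0 <= a + (bexp i)%:Z.
  exact: (floor_arith p_gt0 h2 (ltn_pmod _ p_gt0) (divn_eq _ p)).
rewrite mulrA mulr1 -mulrDl divr_ge0 //.
by rewrite -[(bexp i)%:R]/((bexp i)%:Z%:~R) -intrD ler0z.
Qed.

Lemma bas_basis : integral_basis v N (range k) bas.
Proof.
split; first exact: bas_int.
move=> x [/ramified_expand[c ex] hx].
have hx' : vge v 0 (\sum_(i < p) k (c i) * pi 0 ^+ i).
  by rewrite -ex /vge; case: hx => [->|->]; rewrite ?eqxx ?orbT.
exists (\row_i k (c i * t ^+ bexp i)); split.
  split=> [i|].
    rewrite mxE; split; first by exists (c i * t ^+ bexp i).
    by have := integral_coef hx' (ltn_ord i); rewrite /vge => /orP[/eqP|]; [left|right].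
  rewrite ex; apply: eq_bigr => i _; rewrite mxE /bas ev_bpoly rmorphM rmorphXn.
  by rewrite mulrA mulfK ?expf_neq0.
move=> c' [hc' ex']; apply/rowP => i; rewrite mxE.
have ex2 (i0 : 'I_p) : exists m, c' 0 i0 = k m by have [[m _ <-] _] := hc' i0; exists m.
pose d (i : nat) := if insub i is Some i' then sval (cid (ex2 i')) else 0.
have dE (i0 : 'I_p) : c' 0 i0 = k (d i0) by rewrite /d valK; exact: (svalP (cid (ex2 i0))).
have h0 : \sum_(i < p) k (c i - d i * t ^- bexp i) * pi 0 ^+ i = 0.
  transitivity (x - x); last exact: subrr.
  rewrite {1}ex ex' -sumrB; apply: eq_bigr => a _.
  by rewrite rmorphB mulrBl rmorphM fmorphV rmorphXn dE /bas ev_bpoly mulrA.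
have := expansion_eq0 (c := fun i => c i - d i * t ^- bexp i) p_pr pe e_gt0 v_val vM pi0 vpi0 h0 (ltn_ord i).
by move=> /subr0_eq ->; rewrite dE divfK // expf_neq0.
Qed.

Lemma coordinates n m (g : 'I_m -> Om) (x : 'I_n -> Om) : integral_basis v N (range k) g ->
  (forall i, int_ring v N (x i)) -> exists U : 'M[M]_(n, m),
  (forall i l, vge v 0 (k (U i l))) /\ forall i, x i = \sum_l k (U i l) * g l.
Proof.
move=> [_ hg] hx.
have ex i : exists r : 'rV[M]_m, (forall l, vge v 0 (k (r 0 l))) /\ x i = \sum_l k (r 0 l) * g l.
  have [c [[hc1 hc2] _]] := hg _ (hx i).
  have hm l : exists u, c 0 l = k u by have [[u _ <-] _] := hc1 l; exists u.
  exists (\row_l sval (cid (hm l))); have hE l : k ((\row_l sval (cid (hm l))) 0 l) = c 0 l.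
    by rewrite mxE -(svalP (cid (hm l))).
  split=> [l|]; last by rewrite hc2; apply: eq_bigr => l _; rewrite hE.
  by rewrite hE; case: (hc1 l) => _ [->|h1]; rewrite /vge ?eqxx // h1 orbT.
exists (\matrix_(i, l) sval (cid (ex i)) 0 l); split=> [i l|i].
  by rewrite mxE; have [h1 _] := svalP (cid (ex i)).
have [_ h2] := svalP (cid (ex i)); rewrite {1}h2; apply: eq_bigr => l _; by rewrite mxE.
Qed.

Lemma inverse_coordinates n m (g : 'I_n -> Om) (g' : 'I_m -> Om) (U : 'M[M]_(n, m)) (V : 'M[M]_(m, n)) :
  integral_basis v N (range k) g ->
  (forall i l, vge v 0 (k (U i l))) -> (forall i, g i = \sum_l k (U i l) * g' l) ->
  (forall i l, vge v 0 (k (V i l))) -> (forall i, g' i = \sum_l k (V i l) * g l) ->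
  U *m V = 1%:M.
Proof.
move=> [hgi hg] hU eU hV eV; apply/matrixP => i l.
have [c [_ hc]] := hg _ (hgi i).
have int1 : forall x, vge v 0 (k x) -> int_ring v (range k) (k x).
  move=> x; rewrite /vge => hx; split; first by exists x.
  by case/orP: hx => [/eqP|]; [left|right].
have c1 : c = \row_l k ((U *m V) i l).
  apply: hc; split=> [a|].
    rewrite mxE; apply: int1; rewrite mxE rmorph_sum; apply: (vge_sum v_val) => a' _.
    by rewrite rmorphM; apply: (vgeM0 v_val).
  rewrite {1}eU (eq_bigr (fun a => \sum_l' k (U i a * V a l') * g l')).
    rewrite exchange_big; apply: eq_bigr => a _; rewrite !mxE rmorph_sum mulr_suml.
    by apply: eq_bigr => a' _.
  by move=> a _; rewrite eV mulr_sumr; apply: eq_bigr => l' _; rewrite rmorphM mulrA.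
have c2 : c = \row_l k ((1%:M : 'M[M]_n) i l).
  apply: hc; split=> [a|].
    rewrite mxE; apply: int1; rewrite mxE; case: eqP => _; rewrite ?rmorph1 ?rmorph0 ?vge0 //.
    exact: vge01 v_val.
  rewrite (bigD1 i) //= !mxE eqxx rmorph1 mul1r big1 ?addr0 // => a hai.
  by rewrite !mxE eq_sym (negPf hai) rmorph0 mul0r.
apply: (fmorph_inj k); have := congr1 (fun r : 'rV_n => r 0 l) (etrans (esym c1) c2).
by rewrite mxE [X in _ = X -> _]mxE.
Qed.

Section TraceForm.
Variables (b : 'I_p -> Om) (C : 'I_p -> 'I_p -> 'M[Om]_p).
Hypotheses (b_basis : integral_basis v N (range k) b) (CM : forall i j a l, range k (C i j a l))
 (CE : forall i j a, b i * b j * b a = \sum_l C i j a l * b l).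

Let f i : {poly M} := sval (cid ((b_basis.1 i).1)).
Let fE i : b i = ev (f i) (pi 0). Proof. exact: (svalP (cid ((b_basis.1 i).1))). Qed.
Let B : 'M[Om]_p := \matrix_(i, m) ev (f i) (pi m).
Let Bb : 'M[Om]_p := \matrix_(i, m) ev (bpoly i) (pi m).

(** The matrix of conjugates of the basis diagonalizes every multiplication matrix, with the
    conjugates of the multiplier as eigenvalues; the trace is their sum. *)
Lemma trace_form i j : \det B != 0 -> \tr (C i j) = (B *m B^T) i j.
Proof.
move=> dB; have CB : C i j *m B = B *m diag_mx (\row_m (B i m * B j m)).
  apply/matrixP => a m; rewrite mul_mx_diag !mxE.
  have cM l : exists u, C i j a l = k u by have [u _ <-] := CM i j a l; exists u.
  pose q : {poly M} := \sum_l (sval (cid (cM l)))%:P * f l.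
  have qE x : ev q x = \sum_l C i j a l * ev (f l) x.
    rewrite rmorph_sum horner_sum; apply: eq_bigr => l _.
    by rewrite rmorphM hornerM /= map_polyC hornerC /= -(svalP (cid (cM l))).
  have := @ev_conj (f i * f j * f a) q; rewrite !rmorphM !hornerM qE -!fE CE.
  rewrite (eq_bigr (fun l => C i j a l * ev (f l) (pi 0))) => [|l _]; last by rewrite fE.
  move=> /(_ erefl) hm; have := hm m (ltn_ord m); rewrite !hornerM qE => hh.
  rewrite (eq_bigr (fun l => C i j a l * ev (f l) (pi m))) => [|l _]; last by rewrite mxE.
  by rewrite -hh mulrC.
have uB : B \in unitmx by rewrite unitmxE unitfE.
have -> : C i j = B *m diag_mx (\row_m (B i m * B j m)) *m invmx B by rewrite -CB mulmxK.
rewrite mxtrace_mulC mulmxA mulVmx // mul1mx mxtrace_diag mxE.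
by apply: eq_bigr => m _; rewrite !mxE.
Qed.

(** The matrix is a diagonal one times the Vandermonde matrix of the conjugates of pi, whose
    differences all have valuation (lam + 1)/p. The diagonal factor contributes - (p - 1) (e - 1)/e
    by [sum_floor]. *)
Lemma det_Bb : \det Bb != 0 /\ 2 * v (\det Bb) = p.-1%:R * (lam%:R + 1 / e%:R).
Proof.
have BbE : Bb = diag_mx (\row_i k t ^- bexp i) *m Vandermonde p (\row_m pi m).
  by rewrite mul_diag_mx; apply/matrixP => i m; rewrite !mxE ev_bpoly.
have dneq (i j : 'I_p) : (i < j)%N -> pi j - pi i != 0 /\ v (pi j - pi i) = lam.+1%:R / p%:R.
  by move=> ij; apply: v_pi_diff; rewrite ?gtn_eqF.
rewrite BbE det_mulmx det_diag det_Vandermonde.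
have n1 : \prod_i (\row_(i < p) k t ^- bexp i) 0 i != 0.
  by apply/prodf_neq0 => i _; rewrite mxE invr_eq0 expf_neq0.
have n3 (i : 'I_p) : \prod_(j < p | (i < j)%N) ((\row_m pi m) 0 j - (\row_m pi m) 0 i) != 0 :> Om.
  by apply/prodf_neq0 => j ij; rewrite !mxE; have [] := dneq i j ij.
have n2 : \prod_(i < p) \prod_(j < p | (i < j)%N) ((\row_m pi m) 0 j - (\row_m pi m) 0 i) != 0 :> Om.
  by apply/prodf_neq0 => i _.
split; first by rewrite mulf_neq0.
rewrite (val_M v_val) // (val_prod v_val); last by move=> i _; rewrite mxE invr_eq0 expf_neq0.
rewrite (val_prod v_val) //.
have -> : \sum_(i < p) v ((\row_(i < p) k t ^- bexp i) 0 i) = - ((\sum_(i < p) bexp i)%N%:R / e%:R).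
  rewrite natr_sum mulr_suml -sumrN; apply: eq_bigr => i _; rewrite mxE; exact: val_tX.
have -> : \sum_(i < p) v (\prod_(j < p | (i < j)%N) ((\row_m pi m) 0 j - (\row_m pi m) 0 i)) =
    \sum_(i < p) ((p - i.+1)%N%:R * (lam.+1%:R / p%:R)).
  apply: eq_bigr => i _; rewrite (val_prod v_val); last by move=> j ij; rewrite !mxE; have [] := dneq i j ij.
  rewrite (eq_bigr (fun=> lam.+1%:R / p%:R)); last by move=> j ij; rewrite !mxE; have [] := dneq i j ij.
  rewrite sumr_const [RHS]mulr_natl; congr (_ *+ _).
  have -> : #|[pred j : 'I_p | (i < j)%N]| = #|~: [set j : 'I_p | (j < i.+1)%N]|.
    by apply: eq_card => j; rewrite !inE ltnS -ltnNge.
  rewrite cardsCs finset.setCK card_ord; congr (_ - _)%N.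
  rewrite cardsE -sum1_card; transitivity (\sum_(j < p | (j < i.+1)%N) 1)%N => //.
  by rewrite (big_ord_narrow (ltn_ord i)) sum1_card card_ord.
rewrite -mulr_suml -natr_sum.
have e1 : 2 * (\sum_(i < p) bexp i)%N%:R = (p.-1 * e.-1)%N%:R :> rat.
  by rewrite -natrM; congr (_%:R); exact: sum_floor.
have e2 : 2 * (\sum_(i < p) (p - i.+1))%N%:R = (p * p.-1)%N%:R :> rat.
  rewrite -natrM; congr (_%:R); have -> : (\sum_(i < p) (p - i.+1) = \sum_(i < p) i)%N.
    by rewrite (reindex_inj rev_ord_inj); apply: eq_bigr => i _ /=; have := ltn_ord i; lia.
  have := bin2_sum p; rewrite big_mkord => ->; rewrite bin2 mul2n -[RHS]odd_double_half.
  by rewrite oddM; case: (p) p_gt0 => // m _ /=; case: (odd m).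
rewrite mulrDr mulrN !mulrA e1 e2 !natrM -[lam.+1%:R]natr1.
have -> : e.-1%:R = e%:R - 1 :> rat by rewrite -subn1 natrB.
have -> : p.-1%:R = p%:R - 1 :> rat by rewrite -subn1 natrB.
by field; rewrite eR pR.
Qed.

Lemma val_disc : let d := \det (\matrix_(i, j) \tr (C i j)) in
  v d = p.-1%:R * (lam%:R + 1 / e%:R).
Proof.
have [U [hU eU]] := coordinates bas_basis b_basis.1.
have [V [hV eV]] := coordinates b_basis bas_int.
have UV : U *m V = 1%:M := inverse_coordinates b_basis hU eU hV eV.
have intdet (A : 'M[M]_p) : (forall i l, vge v 0 (k (A i l))) -> vge v 0 (k (\det A)).
  move=> hA; rewrite /determinant rmorph_sum; apply: (vge_sum v_val) => s _.
  rewrite rmorphM rmorph_sign -signr_odd; apply: (vgeM0 v_val).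
    by case: (odd _); rewrite ?expr1 ?expr0 ?vgeN //; exact: (vge01 v_val).
  rewrite rmorph_prod; elim/big_ind: _ => //; first exact: (vge01 v_val).
  by move=> x y; apply: (vgeM0 v_val).
have dUV : \det U * \det V = 1 by rewrite -det_mulmx UV det1.
have dU0 : \det U != 0 by apply: contra_eq_neq dUV => ->; rewrite mul0r eq_sym oner_neq0.
have dV0 : \det V != 0 by apply: contra_eq_neq dUV => ->; rewrite mulr0 eq_sym oner_neq0.
have vU : v (k (\det U)) = 0.
  have := congr1 (fun x => v (k x)) dUV; rewrite rmorphM rmorph1 (val_M v_val) ?fmorph_eq0 // (val_1 v_val).
  have := intdet U hU; have := intdet V hV; rewrite !vge_nz ?fmorph_eq0 //; lra.
have BE : B = map_mx k U *m Bb.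
  apply/matrixP => i m; rewrite !mxE.
  pose q : {poly M} := \sum_l (U i l)%:P * bpoly l.
  have qE x : ev q x = \sum_l k (U i l) * ev (bpoly l) x.
    rewrite rmorph_sum horner_sum; apply: eq_bigr => l _.
    by rewrite rmorphM hornerM /= map_polyC hornerC.
  have := @ev_conj (f i) q; rewrite qE -fE eU => /(_ erefl m (ltn_ord m)) ->.
  by rewrite qE; apply: eq_bigr => l _; rewrite !mxE.
have [n0 v0] := det_Bb.
have dB : \det B != 0 by rewrite BE det_mulmx det_map_mx mulf_neq0 ?fmorph_eq0.
have -> : \matrix_(i, j) \tr (C i j) = B *m B^T.
  by apply/matrixP => i l; rewrite mxE; apply: trace_form.
rewrite /= det_mulmx det_tr (val_M v_val) // BE det_mulmx det_map_mx (val_M v_val) ?fmorph_eq0 //.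
by rewrite vU add0r -v0 mulr_natl mulr2n.
Qed.
End TraceForm.

Lemma bas_structure : exists C : 'I_p -> 'I_p -> 'M[Om]_p, (forall i j a l, range k (C i j a l)) /\
  forall i j a, bas i * bas j * bas a = \sum_l C i j a l * bas l.
Proof.
have ex i j a : exists r : 'rV[Om]_p, (forall l, range k (r 0 l)) /\ bas i * bas j * bas a = \sum_l r 0 l * bas l.
  have hx : int_ring v N (bas i * bas j * bas a).
    have [[[f1 e1] h1] [[f2 e2] h2] [[f3 e3] h3]] := And3 (bas_int i) (bas_int j) (bas_int a).
    split; first by exists (f1 * f2 * f3); rewrite !rmorphM !hornerM e1 e2 e3.
    have hv x : integral_at v x -> vge v 0 x by move=> [->|hx]; rewrite /vge ?eqxx // hx orbT.
    have : vge v 0 (bas i * bas j * bas a) by rewrite !(vgeM0 v_val) ?hv.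
    by rewrite /vge => /orP[/eqP|]; [left|right].
  by have [r [[h1 h2] _]] := bas_basis.2 _ hx; exists r; split=> // l; have [] := h1 l.
exists (fun i j => \matrix_(a, l) sval (cid (ex i j a)) 0 l); split=> [i j a l|i j a].
  by rewrite mxE; have [h1 _] := svalP (cid (ex i j a)).
have [_ h2] := svalP (cid (ex i j a)); rewrite {1}h2; apply: eq_bigr => l _; by rewrite mxE.
Qed.

Theorem ord_disc_ramified : ord_disc v N (range k) = p.-1%:R * ((e * lam)%N%:R + 1).
Proof.
have [t' tt0 vtt] := tM.
rewrite /ord_disc (@ord_at_val _ v (range k) e (k t')) //; last first.
  by move=> x [m _ <-]; rewrite fmorph_eq0; apply: vM.
  by rewrite fmorph_eq0.
have [C0 [CM0 CE0]] := bas_structure.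
have := xgetPex 0 (ex_intro (discriminants v N (range k)) _ (ex_intro _ p (ex_intro _ bas
  (ex_intro _ C0 (And4 bas_basis CM0 CE0 erefl))))).
move=> [n [b [C [hb CM CE ->]]]].
(* The chosen discriminant comes from a basis of unspecified size n; mutually inverse integral base
   changes with the explicit basis force n = p. *)
have [U [hU eU]] := coordinates bas_basis hb.1.
have [V [hV eV]] := coordinates hb bas_int.
have UV : U *m V = 1%:M := inverse_coordinates hb hU eU hV eV.
have VU : V *m U = 1%:M := inverse_coordinates bas_basis hV eV hU eU.
have np : n = p by apply/eqP; rewrite eqn_leq (mulmx1_min UV) (mulmx1_min VU).
clear U hU eU V hV eV UV VU; subst n.
rewrite (val_disc hb CM CE) mulrCA natrM mulrDr div1r mulfV //.
Qed.
End Discriminant.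

(* In the coordinates z = -x/y, w = -1/y the curve is w = z^3 + ..., and for
   small z the right-hand side is a contraction in w. *)
Section FormalParameter.
Variables (F : fieldType) (v : F -> rat).
Hypotheses (v_val : valuation v) (v_complete : complete_val v).
Variable E : ecurve F.
Hypothesis hE : integral_curve v E.

Lemma zc_exists z : vgt v 0 z -> exists P : ecpoint E, in_kernel v (ecval P) /\ zc (ecval P) = z.
Proof.
move=> hz; have [->|z0] := eqVneq z 0; first by exists 0.
have vz : 0 < v z by rewrite -vgt_nz.
have [i1 i2 i3 i4 i6] := hE.
set a1 := wa1 E in i1; set a2 := wa2 E in i2; set a3 := wa3 E in i3; set a4 := wa4 E in i4; set a6 := wa6 E in i6.
pose f w := z ^+ 3 + a1 * z * w + a2 * z ^+ 2 * w + a3 * w ^+ 2 + a4 * z * w ^+ 2 + a6 * w ^+ 3.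
set d := v z in vz.
have hz' : vge v d z by rewrite vge_nz.
have zz : vge v 0 z by apply: vge_le hz'; exact: ltW.
have hsub w w' r : vge v d w -> vge v d w' -> vge v r (w - w') -> vge v (r + d) (f w - f w').
  move=> hw hw' h.
  have hw0 : vge v 0 w by apply: vge_le hw; exact: ltW.
  have hw0' : vge v 0 w' by apply: vge_le hw'; exact: ltW.
  have -> : f w - f w' = (w - w') * (z * (a1 + a2 * z + a4 * (w + w')) + w * (a3 + a6 * w) + w' * (a3 + a6 * (w + w'))).
    by rewrite /f; ring.
  have t1 x y : vge v d x -> vge v 0 y -> vge v d (x * y).
    by move=> hx hy; rewrite -[d]addr0; apply: (vgeM v_val).
  apply: (vgeM v_val) => //; apply: (vgeD v_val); first apply: (vgeD v_val); apply: t1 => //;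
    by repeat first [assumption | apply: (vgeD v_val) | apply: (vgeM0 v_val)].
have hf w : vge v d w -> vge v d (f w).
  move=> hw; have h0 : vge v d (f 0).
    rewrite /f !mulr0 !expr0n !mulr0 !addr0 exprS -[d]addr0; apply: (vgeM v_val) => //.
    exact: (vgeX v_val).
  rewrite -[f w](subrK (f 0)); apply: (vgeD v_val) => //.
  apply: (@vge_le _ _ (d + d)); first by rewrite lerDl ltW.
  by apply: hsub => //; rewrite ?vge0 // subr0.
pose w n := iter n f 0.
have hw n : vge v d (w n) by elim: n => [|n IH]; [exact: vge0 | apply: hf].
have hstep n : vge v (n.+1%:R * d) (w n.+1 - w n).
  elim: n => [|n IH]; first by rewrite mul1r /w /= subr0; apply: (hw 1%N).
  have -> : n.+2%:R * d = n.+1%:R * d + d by rewrite -[n.+2]addn1 natrD mulrDl mul1r.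
  exact: (hsub (w n.+1) (w n)).
(* Each iteration gains only d, so every m-th iterate is kept in order to gain 1 per step, as
   completeness is formulated. *)
have [m hm] : exists m : nat, 1 <= m%:R * d.
  exists (Num.bound d^-1); have h0 : 0 <= d^-1 by rewrite invr_ge0 ltW.
  by rewrite -ler_pdivrMr // mul1r ltW // archi_boundP.
have hmk k : k%:R <= (m * k)%:R * d.
  by rewrite natrM mulrAC -[X in X <= _]mul1r ler_wpM2r.
have hab a b : (a <= b)%N -> vge v (a%:R * d) (w b - w a).
  elim: b => [|b IH]; first by rewrite leqn0 => /eqP ->; rewrite subrr vge0.
  rewrite leq_eqVlt => /orP[/eqP ->|]; first by rewrite subrr vge0.
  rewrite ltnS => ab; have -> : w b.+1 - w a = (w b.+1 - w b) + (w b - w a) by rewrite addrA subrK.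
  apply: (vgeD v_val); last exact: IH.
  apply: vge_le (hstep b); apply: (ler_wpM2r (ltW vz)); by rewrite ler_nat leqW.
have [|l hl] := v_complete (u := fun k => w (m * k)%N).
  by move=> k; apply: vge_le (hab (m * k)%N _ _) => //; rewrite leq_mul2l leqnSn orbT.
have dl : vge v d l.
  pose k := Num.bound d; have hk : d <= k%:R by apply/ltW/archi_boundP/ltW.
  rewrite -[l](subKr (w (m * k)%N)); apply: (vgeB v_val) => //.
  exact: vge_le (hl k).
have fl : f l = l.
  apply/eqP; rewrite -subr_eq0; apply/eqP; apply: (vge_all (v := v)) => n.
  have -> : f l - l = - (f (w (m * n)%N) - f l) + (w (m * n).+1 - w (m * n)%N) + (w (m * n)%N - l).
    by rewrite /w iterS -/(w _); ring.
  apply: (vgeD v_val); last exact: hl; apply: (vgeD v_val).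
    by rewrite (vgeN v_val); apply: vge_le (hsub _ _ n%:R _ _ _) => //; rewrite lerDl ltW.
  by apply: vge_le (hab (m * n)%N _ (leqnSn _)).
have l0 : l != 0.
  apply: contra_eq_neq fl => ->; rewrite /f !mulr0 !expr0n !mulr0 !addr0 expf_neq0 //.
(* The fixed point equation reads l (1 - g) = z^3 with g small. Hence v l = 3 v z, and the abscissa
   z / l has negative valuation. *)
pose g := a1 * z + a2 * z ^+ 2 + a3 * l + a4 * z * l + a6 * l ^+ 2.
have hg : vgt v 0 g.
  have t1 x y : vge v 0 x -> vge v d y -> vge v d (x * y).
    by move=> hx hy; rewrite -[d]add0r; apply: (vgeM v_val).
  apply: (@vge_gt _ _ d) => //; rewrite /g.
  have -> : a1 * z + a2 * z ^+ 2 + a3 * l + a4 * z * l + a6 * l ^+ 2 =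
    (a1 + a2 * z) * z + (a3 + a4 * z + a6 * l) * l by ring.
  have ll : vge v 0 l by apply: vge_le dl; exact: ltW.
  apply: (vgeD v_val); apply: t1 => //;
    by repeat first [assumption | apply: (vgeD v_val) | apply: (vgeM0 v_val)].
have [g1 vg1] : 1 - g != 0 /\ v (1 - g) = 0.
  have := @val_dom _ v v_val 1 (- g) (oner_neq0 F); rewrite (val_1 v_val) vgtN // => /(_ hg).
  by [].
have elz : l * (1 - g) = z ^+ 3 by rewrite mulrBr mulr1 -{1}fl /f /g; ring.
have vl : v l = 3%:R * d.
  have := congr1 v elz; rewrite (val_M v_val) // vg1 addr0 (val_X v_val) //.
have hc : on_curve E (Some (z / l, - l^-1)).
  rewrite /= -/a1 -/a2 -/a3 -/a4 -/a6; apply/eqP; rewrite -subr_eq0.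
  have -> : (- l^-1) ^+ 2 + a1 * (z / l) * (- l^-1) + a3 * (- l^-1) -
    ((z / l) ^+ 3 + a2 * (z / l) ^+ 2 + a4 * (z / l) + a6) = (l - f l) / l ^+ 3 by rewrite /f; field.
  by rewrite fl subrr mul0r.
exists (mkpt hc); split => /=; last by rewrite invrN invrK; field.
by rewrite mulf_neq0 ?invr_eq0 // (val_div v_val) // vl -/d; lra.
Qed.
End FormalParameter.

(** * Functoriality of the group of points *)

Section PointMaps.
Lemma mapP_addP (F F' : fieldType) (f : {rmorphism F -> F'}) W (P Q : cpoint F) :
  cmap f (addP W P Q) = addP (mapW f W) (cmap f P) (cmap f Q).
Proof.
case: W => a1 a2 a3 a4 a6; case: P => [[x1 y1]|]; case: Q => [[x2 y2]|] //=.
have e1 : (f x1 == f x2) = (x1 == x2) by rewrite (inj_eq (fmorph_inj f)).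
have e2 : (f y1 + f y2 + f a1 * f x2 + f a3 == 0) = (y1 + y2 + a1 * x2 + a3 == 0).
  by rewrite -rmorphM -!rmorphD fmorph_eq0.
rewrite e1 e2; case: (x1 == x2) => /=.
  case: (y1 + _ + _ + _ == 0) => //=.
  have -> : (3%:R * f x1 ^+ 2 + 2%:R * f a2 * f x1 + f a4 - f a1 * f y1) / (2%:R * f y1 + f a1 * f x1 + f a3)
    = f ((3%:R * x1 ^+ 2 + 2%:R * a2 * x1 + a4 - a1 * y1) / (2%:R * y1 + a1 * x1 + a3)).
    by rewrite fmorph_div !(rmorph_nat, rmorphB, rmorphD, rmorphM, rmorphXn).
  have -> : (- f x1 ^+ 3 + f a4 * f x1 + 2%:R * f a6 - f a3 * f y1) / (2%:R * f y1 + f a1 * f x1 + f a3)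
    = f ((- x1 ^+ 3 + a4 * x1 + 2%:R * a6 - a3 * y1) / (2%:R * y1 + a1 * x1 + a3)).
    by rewrite fmorph_div !(rmorph_nat, rmorphB, rmorphD, rmorphN, rmorphM, rmorphXn).
  move: (_ / _) (_ / _) => l n.
  by congr (Some (_, _)); rewrite !(rmorphB, rmorphD, rmorphN, rmorphM, rmorphXn).
have -> : (f y2 - f y1) / (f x2 - f x1) = f ((y2 - y1) / (x2 - x1)) by rewrite fmorph_div !rmorphB.
have -> : (f y1 * f x2 - f y2 * f x1) / (f x2 - f x1) = f ((y1 * x2 - y2 * x1) / (x2 - x1)).
  by rewrite fmorph_div !(rmorphB, rmorphM).
move: (_ / _) (_ / _) => l n.
by congr (Some (_, _)); rewrite !(rmorphB, rmorphD, rmorphN, rmorphM, rmorphXn).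
Qed.

Lemma mapP_oppP (F F' : fieldType) (f : {rmorphism F -> F'}) W (P : cpoint F) :
  cmap f (oppP W P) = oppP (mapW f W) (cmap f P).
Proof. by case: P => [[x y]|] //=; rewrite !(rmorphB, rmorphN, rmorphM). Qed.

Lemma mapP_on_curve (F F' : fieldType) (f : {rmorphism F -> F'}) W (P : cpoint F) :
  on_curve W P <-> on_curve (mapW f W) (cmap f P).
Proof.
case: P => [[x y]|] //=; rewrite -!(rmorphXn, rmorphM, rmorphD).
by split=> [->|/fmorph_inj].
Qed.

Variables (F F' : fieldType) (f : {rmorphism F -> F'}) (E : ecurve F) (E' : ecurve F').
Hypothesis eE : ecW E' = mapW f E.

Lemma ecmap_subproof (P : ecpoint E) : on_curve E' (cmap f (ecval P)).
Proof. by rewrite eE; apply/(mapP_on_curve f); exact: ecpP. Qed.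
Definition ecmap (P : ecpoint E) : ecpoint E' := mkpt (ecmap_subproof P).

Lemma ecmapD P Q : ecmap (P + Q) = ecmap P + ecmap Q.
Proof. by apply: ecval_inj; rewrite /= eE mapP_addP. Qed.
Lemma ecmapN P : ecmap (- P) = - ecmap P.
Proof. by apply: ecval_inj; rewrite /= eE mapP_oppP. Qed.
Lemma ecmapB P Q : ecmap (P - Q) = ecmap P - ecmap Q.
Proof. by rewrite ecmapD ecmapN. Qed.
Lemma ecmapMn P n : ecmap (P *+ n) = ecmap P *+ n.
Proof. by elim: n => [|n IH]; [exact: ecval_inj | rewrite !mulrS ecmapD IH]. Qed.
Lemma ecmap_inj : injective ecmap.
Proof.
move=> P Q /(congr1 (@ecval _ _)) /= e; apply: ecval_inj.
by case: (ecval P) (ecval Q) e => [[x y]|] [[x' y']|] //= [/fmorph_inj -> /fmorph_inj ->].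
Qed.
Lemma ecmap_eq0 P : (ecmap P == 0) = (P == 0).
Proof. by rewrite -(inj_eq ecmap_inj); congr (_ == _); apply: ecval_inj. Qed.
End PointMaps.

(** The degree is prime to the characteristic, so the derivative is non-zero and of smaller degree
    than the irreducible f. *)
Lemma separable_small_degree (p : nat) (F : fieldType) (f : {poly F}) : p \in [pchar F] ->
  irreducible_poly f -> (size f <= p)%N -> separable_poly f.
Proof.
move=> pF irr sf; rewrite unlock irreducible_poly_coprime //.
have [m em] : exists m, size f = m.+2 by have [] := irr; case: (size f) => [|[|m]] // _ _; exists m.
have d0 : f^`() != 0.
  apply/eqP => e; have /eqP := congr1 (fun q : {poly F} => q`_m) e.
  rewrite coef_deriv coef0 -mulr_natr mulf_eq0 -(dvdn_pcharf pF) gtnNdvd ?orbF -?em //.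
  have /negPf := irredp_neq0 irr; rewrite -lead_coef_eq0 /lead_coef em /= => -> //.
apply: contraTN isT => /(dvdp_leq d0); rewrite leqNgt lt_size_deriv //.
exact: irredp_neq0.
Qed.

(** * Changes of Weierstrass equation *)

Section IsoEquations.
Variable R : comNzRingType.
Implicit Types W : weierstrass R.

(** The relations of [isoW] solved for the coefficients of W. They can be substituted, involve no
    inverse, and so pass to the ring of integers and from there to the residue field. *)
Definition iso_eqs (u r s t : R) W W' :=
  [/\ wa1 W = u * wa1 W' - 2%:R * s,
      wa2 W = u ^+ 2 * wa2 W' + s * wa1 W - 3%:R * r + s ^+ 2,
      wa3 W = u ^+ 3 * wa3 W' - r * wa1 W - 2%:R * t,
      wa4 W = u ^+ 4 * wa4 W' + s * wa3 W - 2%:R * r * wa2 W + (t + r * s) * wa1 W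
              - 3%:R * r ^+ 2 + 2%:R * s * t &
      wa6 W = u ^+ 6 * wa6 W' - r * wa4 W - r ^+ 2 * wa2 W - r ^+ 3 + t * wa3 W
              + t ^+ 2 + r * t * wa1 W].

Lemma iso_wb u r s t W W' : iso_eqs u r s t W W' ->
  [/\ u ^+ 6 * wb6 W' = wb6 W + 2%:R * r * wb4 W + r ^+ 2 * wb2 W + 4%:R * r ^+ 3 &
      u ^+ 8 * wb8 W' = wb8 W + 3%:R * r * wb6 W + 3%:R * r ^+ 2 * wb4 W + r ^+ 3 * wb2 W
        + 3%:R * r ^+ 4].
Proof.
case: W W' => a1 a2 a3 a4 a6 [c1 c2 c3 c4 c6] [/= -> -> -> -> ->].
by rewrite /wb2 /wb4 /wb6 /wb8 /=; split; ring.
Qed.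
End IsoEquations.

Lemma iso_eqs_morph (R S : comNzRingType) (f : {rmorphism R -> S}) u r s t W W' :
  iso_eqs u r s t W W' -> iso_eqs (f u) (f r) (f s) (f t) (mapW f W) (mapW f W').
Proof.
move=> [/= e1 e2 e3 e4 e6]; split; rewrite /= -?(rmorph_nat f) -!(rmorphXn, rmorphM, rmorphB, rmorphD);
  congr (f _) => //.
Qed.

Lemma iso_eqs_inj (R S : comNzRingType) (f : {rmorphism R -> S}) u r s t W W' : injective f ->
  iso_eqs (f u) (f r) (f s) (f t) (mapW f W) (mapW f W') -> iso_eqs u r s t W W'.
Proof.
move=> fI [/= e1 e2 e3 e4 e6]; split; apply: fI;
  by rewrite !(rmorph_nat, rmorphXn, rmorphB, rmorphD, rmorphM).
Qed.

Section IsoField.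
Variable F : fieldType.
Implicit Types W : weierstrass F.

Lemma isoWP W W' : isoW W W' <-> exists u r s t, u != 0 /\ iso_eqs u r s t W W'.
Proof.
case: W W' => a1 a2 a3 a4 a6 [c1 c2 c3 c4 c6]; rewrite /isoW /iso_eqs /=; split.
  move=> [u [r [s [t [u0 [e1 e2 e3 e4 e6]]]]]]; exists u, r, s, t; split=> //.
  by rewrite e1 e2 e3 e4 e6; split; ring.
move=> [u [r [s [t [u0 [e1 e2 e3 e4 e6]]]]]]; exists u, r, s, t; split=> //.
split; [rewrite e1|rewrite e2|rewrite e3|rewrite e4|rewrite e6]; ring.
Qed.

Lemma iso_disc u r s t W W' : iso_eqs u r s t W W' -> discW W = u ^+ 12 * discW W'.
Proof.
case: W W' => a1 a2 a3 a4 a6 [c1 c2 c3 c4 c6] [/= -> -> -> -> ->]; rewrite /discW; ring.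
Qed.

Lemma iso_eqs_comp A W0 W u0 r0 s0 t0 u r s t : u0 != 0 -> u != 0 ->
  iso_eqs u0 r0 s0 t0 A W0 -> iso_eqs u r s t A W ->
  iso_eqs (u / u0) ((r - r0) / u0 ^+ 2) ((s - s0) / u0) ((t - t0 - s0 * (r - r0)) / u0 ^+ 3) W0 W.
Proof.
case: A W0 W => a1 a2 a3 a4 a6 [b1 b2 b3 b4 b6] [c1 c2 c3 c4 c6] h0 h.
move=> [/= e1 e2 e3 e4 e6] [/= f1 f2 f3 f4 f6].
have E1 : b1 = (a1 + 2%:R * s0) / u0 by rewrite e1; field.
have E2 : b2 = (a2 - s0 * a1 + 3%:R * r0 - s0 ^+ 2) / u0 ^+ 2 by rewrite e2; field.
have E3 : b3 = (a3 + r0 * a1 + 2%:R * t0) / u0 ^+ 3 by rewrite e3; field.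
have E4 : b4 = (a4 - s0 * a3 + 2%:R * r0 * a2 - (t0 + r0 * s0) * a1 + 3%:R * r0 ^+ 2 - 2%:R * s0 * t0) / u0 ^+ 4.
  by rewrite e4; field.
have E6 : b6 = (a6 + r0 * a4 + r0 ^+ 2 * a2 + r0 ^+ 3 - t0 * a3 - t0 ^+ 2 - r0 * t0 * a1) / u0 ^+ 6.
  by rewrite e6; field.
have F1 : c1 = (a1 + 2%:R * s) / u by rewrite f1; field.
have F2 : c2 = (a2 - s * a1 + 3%:R * r - s ^+ 2) / u ^+ 2 by rewrite f2; field.
have F3 : c3 = (a3 + r * a1 + 2%:R * t) / u ^+ 3 by rewrite f3; field.
have F4 : c4 = (a4 - s * a3 + 2%:R * r * a2 - (t + r * s) * a1 + 3%:R * r ^+ 2 - 2%:R * s * t) / u ^+ 4.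
  by rewrite f4; field.
have F6 : c6 = (a6 + r * a4 + r ^+ 2 * a2 + r ^+ 3 - t * a3 - t ^+ 2 - r * t * a1) / u ^+ 6.
  by rewrite f6; field.
clear e1 e2 e3 e4 e6 f1 f2 f3 f4 f6; split=> /=; rewrite ?E1 ?E2 ?E3 ?E4 ?E6 ?F1 ?F2 ?F3 ?F4 ?F6;
  by field; rewrite ?h0 ?h.
Qed.

Variables (u r s t : F) (W W' : weierstrass F).
Hypotheses (u0 : u != 0) (eqs : iso_eqs u r s t W W').

Definition isoP (P : cpoint F) : cpoint F :=
  if P is Some (x, y) then Some (u ^+ 2 * x + r, u ^+ 3 * y + u ^+ 2 * s * x + t) else None.

Lemma isoP_on_curve P : on_curve W' P <-> on_curve W (isoP P).
Proof.
case: P => [[x y]|] //=.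
have e : (u ^+ 3 * y + u ^+ 2 * s * x + t) ^+ 2 + wa1 W * (u ^+ 2 * x + r) * (u ^+ 3 * y + u ^+ 2 * s * x + t)
    + wa3 W * (u ^+ 3 * y + u ^+ 2 * s * x + t)
    - ((u ^+ 2 * x + r) ^+ 3 + wa2 W * (u ^+ 2 * x + r) ^+ 2 + wa4 W * (u ^+ 2 * x + r) + wa6 W) =
    u ^+ 6 * (y ^+ 2 + wa1 W' * x * y + wa3 W' * y - (x ^+ 3 + wa2 W' * x ^+ 2 + wa4 W' * x + wa6 W')).
  by case: W W' eqs => a1 a2 a3 a4 a6 [c1 c2 c3 c4 c6] [/= ? ? ? ? ?]; subst; ring.
split=> /eqP; rewrite -subr_eq0 => h; apply/eqP; rewrite -subr_eq0.
  by rewrite e (eqP h) mulr0.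
by move: h; rewrite e mulf_eq0 expf_eq0 (negPf u0) andbF.
Qed.

Lemma isoP_inj : injective isoP.
Proof.
have u2 : u ^+ 2 != 0 by rewrite expf_neq0.
have u3 : u ^+ 3 != 0 by rewrite expf_neq0.
move=> [[x y]|] [[x' y']|] //= [/addIr/(mulfI u2) -> /addIr/addIr/(mulfI u3) -> //].
Qed.

Lemma isoP_surj P : exists Q, isoP Q = P.
Proof.
case: P => [[x y]|]; last by exists None.
exists (Some ((x - r) / u ^+ 2, (y - t - s * (x - r)) / u ^+ 3)) => /=.
by congr (Some (_, _)); field.
Qed.

Lemma isoP_opp P : isoP (oppP W' P) = oppP W (isoP P).
Proof.
case: P => [[x y]|] //=; congr (Some (_, _)).
by case: W W' eqs => a1 a2 a3 a4 a6 [c1 c2 c3 c4 c6] [/= ? ? ? ? ?]; subst; ring.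
Qed.

(** The change of coordinates maps lines to lines, slope l going to u l + s; comparing slopes and
    intercepts reduces the claim to the Vieta relations of the third point. *)
Lemma isoP_add P Q : on_curve W' P -> on_curve W' Q ->
  isoP (addP W' P Q) = addP W (isoP P) (isoP Q).
Proof.
move=> hP hQ; case: P Q hP hQ => [[x1 y1]|] [[x2 y2]|] // hP hQ.
have [ho|hno] := boolP ((x1 == x2) && (y1 + y2 + wa1 W' * x2 + wa3 W' == 0)).
  have [/eqP e1 /eqP e2] := andP ho; rewrite (addP_opp ho).
  have : Some (x2, y2) = oppP W' (Some (x1, y1)).
    rewrite /= e1; congr (Some (_, _)); apply/eqP; rewrite -subr_eq0 -[X in _ == X]e2.
    by apply/eqP; ring.
  by move=> ->; rewrite isoP_opp addPN.
have u2 : u ^+ 2 != 0 by rewrite expf_neq0.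
have u3 : u ^+ 3 != 0 by rewrite expf_neq0.
have xE : (u ^+ 2 * x1 + r == u ^+ 2 * x2 + r) = (x1 == x2).
  by rewrite (inj_eq (addIr _)) (inj_eq (mulfI u2)).
have yE a b x : u ^+ 3 * a + u ^+ 2 * s * x + t + (u ^+ 3 * b + u ^+ 2 * s * x + t) + wa1 W * (u ^+ 2 * x + r) + wa3 W
    = u ^+ 3 * (a + b + wa1 W' * x + wa3 W').
  by case: W W' eqs {hP hQ hno} => a1 a2 a3 a4 a6 [c1 c2 c3 c4 c6] [/= ? ? ? ? ?]; subst; ring.
have dE0 y x : 2%:R * (u ^+ 3 * y + u ^+ 2 * s * x + t) + wa1 W * (u ^+ 2 * x + r) + wa3 W
    = u ^+ 3 * (2%:R * y + wa1 W' * x + wa3 W').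
  by case: W W' eqs {hP hQ hno yE} => a1 a2 a3 a4 a6 [c1 c2 c3 c4 c6] [/= ? ? ? ? ?]; subst; ring.
have hno' : ~~ ((u ^+ 2 * x1 + r == u ^+ 2 * x2 + r) && (u ^+ 3 * y1 + u ^+ 2 * s * x1 + t
    + (u ^+ 3 * y2 + u ^+ 2 * s * x2 + t) + wa1 W * (u ^+ 2 * x2 + r) + wa3 W == 0)).
  rewrite xE; apply: contra hno => /andP[/eqP ->]; rewrite eqxx yE mulf_eq0 (negPf u3) //.
have [l [n [x3 [-> [ea eb] [cl _ _] hl]]]] := addP_line hP hQ hno.
have hP' := (isoP_on_curve (Some (x1, y1))).1 hP; have hQ' := (isoP_on_curve (Some (x2, y2))).1 hQ.
have [l' [n' [x3' [-> [ea' eb'] [cl' _ _] hl']]]] := addP_line hP' hQ' hno'.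
have el : l' = u * l + s.
  case: hl => [[nx ->]|[ex ey d0 hl]].
    case: hl' => [[_ ->]|[/eqP ex _ _ _]]; last by rewrite xE (negPf nx) in ex.
    have d1 : x2 - x1 != 0 by rewrite subr_eq0 eq_sym.
    have d2 : u ^+ 2 * x2 + r - (u ^+ 2 * x1 + r) != 0.
      by rewrite (_ : _ - _ = u ^+ 2 * (x2 - x1)) ?mulf_neq0 //; ring.
    have -> : u ^+ 2 * x2 + r - (u ^+ 2 * x1 + r) = u ^+ 2 * (x2 - x1) by ring.
    by field; rewrite d1 u0.
  case: hl' => [[]|[_ _ d0' hl']]; first by rewrite xE ex eqxx.
  have dE : 2%:R * (u ^+ 3 * y1 + u ^+ 2 * s * x1 + t) + wa1 W * (u ^+ 2 * x1 + r) + wa3 W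
      = u ^+ 3 * (2%:R * y1 + wa1 W' * x1 + wa3 W').
    exact: dE0.
  apply: (mulIf d0'); rewrite hl' dE.
  have -> : (u * l + s) * (u ^+ 3 * (2%:R * y1 + wa1 W' * x1 + wa3 W')) =
     u ^+ 4 * (l * (2%:R * y1 + wa1 W' * x1 + wa3 W')) + s * u ^+ 3 * (2%:R * y1 + wa1 W' * x1 + wa3 W') by ring.
  rewrite hl; case: W W' eqs {hP hQ hno hno' hP' hQ' cl cl' xE yE dE0 dE d0 d0' hl hl'} => a1 a2 a3 a4 a6 [c1 c2 c3 c4 c6].
  by move=> [/= ? ? ? ? ?]; subst; ring.
have en : n' = u ^+ 3 * n + t - r * (u * l + s).
  have -> : n' = (u ^+ 3 * y1 + u ^+ 2 * s * x1 + t) - l' * (u ^+ 2 * x1 + r) by rewrite ea'; ring.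
  by rewrite el ea; ring.
have ex3 : x3' = u ^+ 2 * x3 + r.
  have -> : x3' = l' ^+ 2 + wa1 W * l' - wa2 W - (u ^+ 2 * x1 + r) - (u ^+ 2 * x2 + r) by rewrite cl'; ring.
  have -> : x3 = l ^+ 2 + wa1 W' * l - wa2 W' - x1 - x2 by rewrite cl; ring.
  rewrite el; case: W W' eqs {hP hQ hno hno' hP' hQ' cl cl' xE yE dE0 hl hl'} => a1 a2 a3 a4 a6 [c1 c2 c3 c4 c6].
  by move=> [/= ? ? ? ? ?]; subst; ring.
rewrite /= ex3 en el; congr (Some (_, _)).
case: W W' eqs {hP hQ hno hno' hP' hQ' cl cl' xE yE dE0 hl hl'} => a1 a2 a3 a4 a6 [c1 c2 c3 c4 c6].
by move=> [/= ? ? ? ? ?]; subst; ring.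
Qed.

Lemma isoP_mulP n P : on_curve W' P -> isoP (mulP W' n P) = mulP W n (isoP P).
Proof.
move=> hP; have hm m : on_curve W' (mulP W' m P).
  by elim: m => // m IH; rewrite /mulP iterS; apply: addP_on_curve.
by elim: n => // n IH; rewrite /mulP !iterS -!/(mulP _ _ _) isoP_add // IH.
Qed.

Lemma isoP_torsion n P : torsion W' n P <-> torsion W n (isoP P).
Proof.
rewrite /torsion /=; split=> [[h1 h2]|[h1 h2]]; have h3 := (isoP_on_curve P); split; rewrite -?h3 //.
- by rewrite -isoP_mulP // h2.
- exact/h3.
- by apply: isoP_inj; rewrite isoP_mulP //; apply/h3.
Qed.

Lemma iso_torsion_card n m : (torsion W n #= `I_m)%card -> (torsion W' n #= `I_m)%card.
Proof.
apply: card_eq_trans; rewrite -[X in (_ #= X)%card](_ : isoP @` (torsion W' n) = _).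
  by rewrite card_eq_sym; apply: inj_card_eq => P Q _ _; apply: isoP_inj.
apply/seteqP; split=> [_ [P hP <-]|P hP]; first exact/isoP_torsion.
by have [Q hQ] := isoP_surj P; exists Q => //; apply/isoP_torsion; rewrite hQ.
Qed.
End IsoField.

Section IntegralIsomorphism.
Variables (F : fieldType) (v : F -> rat).
Hypothesis v_val : valuation v.

Lemma integral_root (c r : F) (n : nat) (d : nat -> F) : c != 0 -> v c = 0 ->
  (forall i, (i < n.+1)%N -> vge v 0 (d i)) ->
  c * r ^+ n.+1 = \sum_(i < n.+1) d i * r ^+ i -> vge v 0 r.
Proof.
move=> c0 vc hd e; have [->|r0] := eqVneq r 0; first exact: vge0.
rewrite vge_nz // leNgt; apply/negP => vr.
have h : vge v (n%:R * v r) (c * r ^+ n.+1).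
  rewrite e; apply: (vge_sum v_val) => i _; rewrite -[_ * v r]add0r; apply: (vgeM v_val); first exact: hd.
  rewrite vge_nz ?expf_neq0 // (val_X v_val) //.
  have : (i%:R <= n%:R :> rat) by rewrite ler_nat -ltnS.
  by move: (i%:R : rat) (n%:R : rat) => a b; nra.
move: h; rewrite vge_nz ?mulf_neq0 ?expf_neq0 // (val_M v_val) ?expf_neq0 // vc add0r (val_X v_val) //.
by rewrite -natr1 mulrDl mul1r; lra.
Qed.

Local Ltac integral := repeat first [assumption | solve [exact: (vge_nat v_val)] | apply: (vgeD v_val)
  | rewrite (vgeN v_val) | apply: (vgeX v_val) | apply: (vgeM0 v_val)].

(** The transformation rules of b6 and b8 are equations for r with leading coefficients 4 and 3,
    which are not both zero, and a non-zero integer is a unit in characteristic p. Those of a2 and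
    a6 are then monic equations for s and t. *)
Lemma iso_integral (p : nat) u r s t (W W' : ecurve F) : p \in [pchar F] ->
  integral_curve v W -> integral_curve v W' -> vge v 0 u -> iso_eqs u r s t W W' ->
  [/\ vge v 0 r, vge v 0 s & vge v 0 t].
Proof.
move=> pF hW hW' hu eqs.
have vnat m : vge v 0 m%:R by exact: vge_nat.
have [i1 i2 i3 i4 i6] := hW; have [j1 j2 j3 j4 j6] := hW'.
have [ib2 ib4 ib6 ib8] := int_wb v_val hW; have [jb2 jb4 jb6 jb8] := int_wb v_val hW'.
have uX n : vge v 0 (u ^+ n) by apply: (vgeX v_val).
have hr : vge v 0 r.
  have [e6 e8] := iso_wb eqs.
  have [p2|p2] := eqVneq (4%:R : F) 0.
    have c3 : 3%:R != 0 :> F.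
      have -> : 3%:R = 4%:R - 1 :> F by ring.
      by rewrite p2 sub0r oppr_eq0 oner_eq0.
    apply: (@integral_root 3%:R r 3 (fun i => [:: u ^+ 8 * wb8 W' - wb8 W; - (3%:R * wb6 W); - (3%:R * wb4 W); - wb2 W]`_i)) => //.
    - exact: (val_nat v_val pF c3).
    - by case=> [|[|[|[|i]]]] //= _; integral.
    by rewrite !big_ord_recr big_ord0 /= e8; ring.
  apply: (@integral_root 4%:R r 2 (fun i => [:: u ^+ 6 * wb6 W' - wb6 W; - (2%:R * wb4 W); - wb2 W]`_i)) => //.
  - exact: (val_nat v_val pF p2).
  - by case=> [|[|[|i]]] //= _; integral.
  by rewrite !big_ord_recr big_ord0 /= e6; ring.
have v1 : v 1 = 0 := val_1 v_val.
have hs : vge v 0 s.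
  apply: (@integral_root 1 s 1 (fun i => [:: wa2 W - u ^+ 2 * wa2 W' + 3%:R * r; - wa1 W]`_i)) => //; first exact: oner_neq0.
    by case=> [|[|i]] //= _; integral.
  by case: eqs => e1 e2 _ _ _; rewrite !big_ord_recr big_ord0 /= e2; ring.
split=> //; apply: (@integral_root 1 t 1 (fun i => [:: wa6 W - u ^+ 6 * wa6 W' + r * wa4 W + r ^+ 2 * wa2 W + r ^+ 3; - (wa3 W + r * wa1 W)]`_i)) => //; first exact: oner_neq0.
  have rX n : vge v 0 (r ^+ n) by apply: (vgeX v_val).
  by case=> [|[|i]] //= _; integral.
by case: eqs => e1 e2 _ _ e6; rewrite !big_ord_recr big_ord0 /= e6; ring.
Qed.
End IntegralIsomorphism.

(** * Independence of the minimal equation *)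

Section MinimalModel.
Variables (p : nat) (K : localField p).
Implicit Types A W : weierstrass K.

Lemma integralW_oint W : integralW W -> integral_curve (@vK p K) W.
Proof. by move=> [/ointP h1 /ointP h2 /ointP h3 /ointP h4 /ointP h6]; split; rewrite -oint_vge. Qed.

(** Good supersingular reduction is given on some minimal equation W0. Two minimal equations have
    discriminants of equal valuation, so u is a unit and r, s, t are integral; the change of
    equation reduces to one over the residue field, which respects torsion. *)
Lemma minimal_good A W : elliptic A -> supersingular_reduction A -> minimal_equation A W ->
  [/\ integralW W, elliptic W, elliptic (mapW (@lf_red p K) W) & supersingular p (mapW (@lf_red p K) W)].
Proof.
move=> Ad [W0 [[iso0 int0 min0] red0 ss0]] [iso intW minW].
have [u0 [r0 [s0 [t0 [hu0 eq0]]]]] := (isoWP A W0).1 iso0.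
have [u1 [r1 [s1 [t1 [hu1 eq1]]]]] := (isoWP A W).1 iso.
have Wd : elliptic W.
  by move: Ad; rewrite /elliptic (iso_disc eq1) mulf_eq0 negb_or => /andP[].
have W0d : elliptic W0.
  by move: Ad; rewrite /elliptic (iso_disc eq0) mulf_eq0 negb_or => /andP[].
have := iso_eqs_comp hu0 hu1 eq0 eq1.
move: (u1 / u0) (mulf_neq0 hu1 (invr_neq0 hu0 : u0^-1 != 0)) => u hu.
move: (_ / u0 ^+ 2) (_ / u0) (_ / u0 ^+ 3) => r s t eqs.
have vd : vK (discW W0) = vK (discW W).
  by congr (_%:~R); apply/eqP; rewrite eq_le min0 // minW.
have vu : vK u = 0.
  have := congr1 (@vK p K) (iso_disc eqs); rewrite (val_M (@vK_val p K)) ?expf_neq0 // (val_X (@vK_val p K)) // vd.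
  lra.
have hu' : vge (@vK p K) 0 u by rewrite vge_nz // vu.
have [hr hs ht] := iso_integral (W := ECurve W0d) (W' := ECurve Wd) (@vK_val p K) (lf_pchar K) (integralW_oint int0) (integralW_oint intW) hu' eqs.
have [V eV] := integralW_lift intW; have [V0 eV0] := integralW_lift int0.
rewrite -!oint_vge in hr hs ht hu'.
have eqsO : iso_eqs (ORing hu') (ORing hr) (ORing hs) (ORing ht) V0 V.
  by apply: (iso_eqs_inj (f := @oval p K)); [exact: oval_inj | rewrite eV eV0].
have redE W1 V1 : mapW (@oval p K) V1 = W1 -> mapW (@lf_red p K) W1 = mapW (@ored p K) V1.
  by move=> <-; rewrite mapW_comp.
have eqsR := iso_eqs_morph (@ored p K) eqsO.
have uR : ored (ORing hu') != 0 by rewrite ored_eq0 /= vgt_nz // vu ltxx.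
rewrite (redE _ _ eV0) in red0 ss0; split=> //; rewrite (redE _ _ eV).
  by move: red0; rewrite /elliptic (iso_disc eqsR) mulf_eq0 negb_or => /andP[].
move=> kbar i hi; have h0 := ss0 kbar i hi.
have eqsk := iso_eqs_morph i eqsR.
have uk : i (ored (ORing hu')) != 0 by rewrite fmorph_eq0.
apply/seteqP; split=> [P /(isoP_torsion uk eqsk) hP|_ ->].
  have : [set None] (isoP (i (ored (ORing hu'))) (i (ored (ORing hr))) (i (ored (ORing hs))) (i (ored (ORing ht))) P) by rewrite -h0.
  by case: P {hP} => [[x y]|].
by apply/(isoP_torsion uk eqsk); rewrite h0.
Qed.
End MinimalModel.

(** * The field k_w *)

(** A subgroup of (1/d)Z is cyclic, generated by its least positive element g/d; containing 1, it
    has g dividing d, so that e = d/g. *)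
Lemma value_group_index (G : rat -> Prop) (d : nat) : (0 < d)%N -> G 1 ->
  (forall x y, G x -> G y -> G (x - y)) ->
  (forall x, G x -> exists m : int, d%:R * x = m%:~R) ->
  exists e, [/\ (0 < e)%N, e %| d, G (1 / e%:R) & forall x, G x -> exists a : int, x = a%:~R / e%:R]%N.
Proof.
move=> d0 G1 GB hd; have dR : d%:R != 0 :> rat by rewrite pnatr_eq0 -lt0n.
have G0 : G 0 by rewrite -(subrr 1); apply: GB.
have GN x : G x -> G (- x) by rewrite -sub0r; apply: GB.
have GD x y : G x -> G y -> G (x + y) by move=> hx /GN hy; rewrite -[y]opprK; apply: GB.
have GM x n : G x -> G (x *+ n).
  by move=> hx; elim: n => [|n IH]; rewrite ?mulr0n // mulrS; apply: GD.
have GZ x (m : int) : G x -> G (m%:~R * x).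
  by move=> hx; case: m => m; rewrite ?NegzE ?mulrNz ?mulNr; [|apply: GN]; rewrite mulr_natl; apply: GM.
have ex : exists g, (0 < g)%N && `[< G (g%:R / d%:R) >].
  by exists d; rewrite d0; apply/asboolP; rewrite mulfV.
pose g := ex_minn ex; have : (0 < g)%N && `[< G (g%:R / d%:R) >] by rewrite /g; case: ex_minnP.
move=> /andP[g0 /asboolP Gg].
have gmin m : (0 < m)%N -> G (m%:R / d%:R) -> (g <= m)%N.
  by rewrite /g; case: ex_minnP => k _ hk m0 hm; apply: hk; rewrite m0; apply/asboolP.
have gdiv (m : int) : G (m%:~R / d%:R) -> (g%:Z %| m)%Z.
  move=> hm; have h : G ((m %% g%:Z)%Z%:~R / d%:R).
    have -> : (m %% g%:Z)%Z%:~R / d%:R = m%:~R / d%:R - (m %/ g%:Z)%Z%:~R * (g%:R / d%:R) :> rat.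
      have em : m%:~R = (m %/ g%:Z)%Z%:~R * g%:R + (m %% g%:Z)%Z%:~R :> rat.
        by rewrite {1}(divz_eq m g%:Z) intrD intrM.
      by rewrite em; field.
    by apply: GB => //; apply: GZ.
  have r0 : 0 <= (m %% g%:Z)%Z by rewrite modz_ge0 // eqz_nat -lt0n.
  have r1 : (m %% g%:Z)%Z < g%:Z by rewrite ltz_pmod // ltz_nat.
  apply/dvdz_mod0P; move: h r0 r1; case: (m %% g%:Z)%Z => // r hr _; rewrite ltz_nat => rg.
  by case: r hr rg => // r hr; rewrite ltnNge gmin.
have : (g%:Z %| d%:Z)%Z by apply: gdiv; rewrite -[(d%:Z)%:~R]/(d%:R) mulfV.
rewrite dvdzE !absz_nat => gd; have := divnK gd; set e := (d %/ g)%N => ed.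
have e0 : (0 < e)%N by rewrite divn_gt0 // dvdn_leq.
have eR : e%:R != 0 :> rat by rewrite pnatr_eq0 -lt0n.
have gR : g%:R != 0 :> rat by rewrite pnatr_eq0 -lt0n.
exists e; split=> //; first by rewrite -ed dvdn_mulr.
  by have -> : 1 / e%:R = g%:R / d%:R :> rat by rewrite -ed natrM; field; rewrite eR gR.
move=> x hx; have [m hm] := hd x hx.
have xE : x = m%:~R / d%:R by rewrite -hm mulrAC mulfV ?mul1r.
have /dvdzP[a ea] : (g%:Z %| m)%Z by apply: gdiv; rewrite -xE.
by exists a; rewrite xE ea intrM -ed natrM -[(g%:Z)%:~R]/(g%:R); field; rewrite eR gR.
Qed.

(** * Embeddings of the field generated by a torsion point *)

Section TwistField.
Variables (p : nat) (K : localField p) (Om : closedFieldType) (iota : {rmorphism K -> Om}) (v : Om -> rat).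
Hypotheses (v_val : valuation v) (v_ext : forall x : K, x != 0 -> v (iota x) = vK x).
Variable W' : weierstrass K.
Hypothesis W'd : elliptic W'.
Local Notation E' := (ec_map iota W'd).
Variables (T' : ecpoint E') (X0 Y0 : Om).
Hypotheses (eT' : ecval T' = Some (X0, Y0)) (T'_p : T' *+ p = 0)
 (T'_gen : forall Q : ecpoint E', Q *+ p = 0 -> exists2 m, (m < p)%N & Q = T' *+ m).
Let p_pr : prime p. Proof. exact: (localField_prime K). Qed.
Let p_gt0 := prime_gt0 p_pr.
Let T'0 : T' != 0. Proof. by apply/eqP => e; move: eT'; rewrite e. Qed.

(* N is the field generated by the coordinates of T' *)
Variables (N : fieldExtType K) (j : {rmorphism N -> Om}) (Xn Yn : N).
Hypotheses (j_ext : forall x, j x%:A = iota x) (jX : j Xn = X0) (jY : j Yn = Y0)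
 (N_gen : forall P : N -> Prop, (forall x, P x%:A) -> P Xn -> P Yn ->
  (forall x y, P x -> P y -> P (x + y)) -> (forall x y, P x -> P y -> P (x * y)) -> forall x, P x)
 (N_dim : (\dim {:N} <= p.-1)%N).

Local Notation EN := (ec_map (in_alg N) W'd).
Lemma hom_curve (s : {rmorphism N -> Om}) : (forall x, s x%:A = iota x) -> ecW E' = mapW s EN.
Proof. by move=> hs; rewrite /= mapW_comp; apply: eq_mapW => x /=; rewrite hs. Qed.

Lemma gen_point_subproof : on_curve EN (Some (Xn, Yn)).
Proof.
by apply/(mapP_on_curve j); rewrite -(hom_curve j_ext) /= jX jY; have := ecpP T'; rewrite eT'.
Qed.
Definition gen_point : ecpoint EN := mkpt gen_point_subproof.
Local Notation t := gen_point.
Definition homP (s : {rmorphism N -> Om}) (hs : forall x, s x%:A = iota x) := ecmap (hom_curve hs).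

Lemma homP_j : homP j_ext t = T'.
Proof. by apply: ecval_inj; rewrite eT' /= jX jY. Qed.
Lemma gen_point_p : t *+ p = 0.
Proof. by apply/eqP; rewrite -(ecmap_eq0 (hom_curve j_ext)) ecmapMn -/(homP _ _) homP_j T'_p. Qed.
Lemma homP_multiple (s : {rmorphism N -> Om}) (hs : forall x, s x%:A = iota x) : exists2 m, (m < p)%N & homP hs t = T' *+ m.
Proof. by apply: T'_gen; rewrite -ecmapMn gen_point_p; apply: ecval_inj. Qed.

Lemma hom_unique (s s' : {rmorphism N -> Om}) (hs : forall x, s x%:A = iota x) (hs' : forall x, s' x%:A = iota x) :
  homP hs t = homP hs' t -> forall x, s x = s' x.
Proof.
move=> /(congr1 (@ecval _ _)) /= [eX eY]; apply: N_gen => // [x|x y ex ey|x y ex ey].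
- by rewrite hs hs'.
- by rewrite !rmorphD ex ey.
by rewrite !rmorphM ex ey.
Qed.

Lemma torsion_in_range (Q : ecpoint E') x y : Q *+ p = 0 -> ecval Q = Some (x, y) ->
  range j x /\ range j y.
Proof.
move=> /T'_gen[m _ ->]; rewrite -homP_j -ecmapMn /=.
by case: (ecval _) => [[x' y']|] //= [<- <-]; split; [exists x' | exists y'].
Qed.

(** Normality of N: an embedding sends T' to one of its multiples, whose coordinates lie in N
    again. *)
Lemma hom_endo (s : {rmorphism N -> Om}) : (forall x, s x%:A = iota x) ->
  exists2 s' : {rmorphism N -> N}, (forall x, s' x%:A = x%:A) & forall x, j (s' x) = s x.
Proof.
move=> hs; have ex x : exists y, j y = s x.
  have hr : homP hs t *+ p = 0 by rewrite -ecmapMn gen_point_p; apply: ecval_inj.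
  have [[x' _ hx'] [y' _ hy']] := torsion_in_range hr erefl.
  move: x; apply: N_gen => [x|||x y [x1 e1] [y1 e2]|x y [x1 e1] [y1 e2]].
  - by exists x%:A; rewrite j_ext hs.
  - by exists x'.
  - by exists y'.
  - by exists (x1 + y1); rewrite !rmorphD e1 e2.
  by exists (x1 * y1); rewrite !rmorphM e1 e2.
pose f x := sval (cid (ex x)); have fE x : j (f x) = s x by exact: (svalP (cid (ex x))).
have fB : zmod_morphism f by move=> x y; apply: (fmorph_inj j); rewrite rmorphB !fE rmorphB.
have fM : monoid_morphism f.
  by split=> [|x y]; apply: (fmorph_inj j); rewrite ?rmorphM !fE ?rmorph1 ?rmorphM.
pose S : {rmorphism N -> N} := HB.pack f (GRing.isZmodMorphism.Build N N f fB)
  (GRing.isMonoidMorphism.Build N N f fM).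
by exists S => // x; apply: (fmorph_inj j); rewrite [j (S _)]fE hs j_ext.
Qed.

(** The image of the character c_w, described through embeddings of N instead of automorphisms. *)
Definition hom_units : {set {unit 'F_p}} :=
  [set u | `[< exists s : {rmorphism N -> Om}, exists2 hs : forall x, s x%:A = iota x,
     True & homP hs t = T' *+ (val u : 'F_p) >]].

Lemma Fp_mulrn (a b : 'F_p) (Q : ecpoint E') : Q *+ p = 0 -> Q *+ (a * b : 'F_p)%R = Q *+ a *+ b.
Proof.
move=> hQ; rewrite -mulrnA; have hmod m d : d = p -> Q *+ (m %% d) = Q *+ m.
  by move=> ->; rewrite [in RHS](divn_eq m p) mulrnDr mulnC mulrnA hQ mul0rn add0r.
exact: hmod (Fp_cast p_pr).
Qed.

Lemma hom_units_group : group_set hom_units.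
Proof.
apply/group_setP; split.
  rewrite inE; apply/asboolP; exists j, j_ext => //; rewrite homP_j.
  by rewrite FinRing.val_unit1 /= modn_small // mulr1n.
move=> a b ha hb; move: ha; rewrite inE => /asboolP[s [hs _ es]].
move: hb; rewrite inE => /asboolP[s2 [hs2 _ es2]]; rewrite inE.
have [s2' h2 hj] := hom_endo hs2; apply/asboolP.
pose c : {rmorphism N -> Om} := s \o s2'.
have hc x : c x%:A = iota x by rewrite /= h2 hs.
exists c, hc => //; have e2 : ecval (t *+ (val b : 'F_p)) = cmap s2' (ecval t).
  have := congr1 (@ecval _ _) es2; rewrite -homP_j -ecmapMn /= -!hj.
  by case: (ecval _) => [[x y]|] //= [/fmorph_inj -> /fmorph_inj ->].
have -> : homP hc t = homP hs (t *+ (val b : 'F_p)).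
  by apply: ecval_inj; rewrite [RHS]/= e2.
have -> : homP hs (t *+ (val b : 'F_p)) = homP hs t *+ (val b : 'F_p) by exact: ecmapMn.
by rewrite es -Fp_mulrn // T'_p.
Qed.

Variables (mu : {poly K}) (beta : N).
Hypotheses (mu_irr : irreducible_poly mu) (mu_root : root (map_poly (in_alg N) mu) beta)
 (mu_size : (size mu).-1 = \dim {:N}) (beta_gen : forall x : N, exists q, x = (map_poly (in_alg N) q).[beta]).

(** The minimal polynomial of a generator has degree below p, so it is separable, and its roots
    correspond to the embeddings of N. These correspond to the subgroup [hom_units] of the p - 1
    units, to which Lagrange applies. *)
Lemma dim_dvd : (\dim {:N} %| p.-1)%N.
Proof.
have [rs hrs] := closed_field_poly_normal (map_poly iota mu).
have mu0 := irredp_neq0 mu_irr.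
have lc0 : lead_coef (map_poly iota mu) != 0 by rewrite lead_coef_eq0 map_poly_eq0.
have rs_root r : (r \in rs) = root (map_poly iota mu) r.
  by rewrite hrs rootZ // root_prod_XsubC.
have rs_size : size rs = \dim {:N}.
  by rewrite -mu_size -(size_map_poly iota) hrs size_scale // size_prod_XsubC.
have rs_uniq : uniq rs.
  have sep : separable_poly mu.
    apply: (separable_small_degree (lf_pchar K) mu_irr).
    by move: N_dim; rewrite -mu_size; have := mu_irr.1; have := prime_gt1 p_pr; lia.
  by rewrite -separable_prod_XsubC -(eqp_separable (eqp_scale _ lc0)) -hrs separable_map.
have pval (s : {rmorphism N -> Om}) (hs : forall x, s x%:A = iota x) : s beta \in rs.
  by rewrite rs_root rootE -(in_alg_root hs) (rootP mu_root) rmorph0.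
pose S (u : {unit 'F_p}) : set Om := [set b | exists s : {rmorphism N -> Om},
   exists2 hs : forall x, s x%:A = iota x, s beta = b & homP hs t = T' *+ (val u : 'F_p)].
pose rt u := xget 0 (S u).
have rtP u : u \in hom_units -> S u (rt u).
  by rewrite inE => /asboolP[s [hs _ e]]; apply: xgetPex; exists (s beta), s, hs.
have rt_inj : {in hom_units &, injective rt}.
  move=> a b /rtP[s [hs e1 e2]] /rtP[s2 [hs2 e3 e4]] e.
  have ess x : s x = s2 x.
    have [q ->] := beta_gen x; rewrite (in_alg_root hs) (in_alg_root hs2) e1 e3 e //.
  have : homP hs t = homP hs2 t by apply: ecval_inj; rewrite /= !ess.
  rewrite e2 e4 => /(torsion_inj p_pr T'0 T'_p) h; apply/val_inj/val_inj/h; first by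
    rewrite -[X in (_ < X)%N](Fp_cast p_pr) ltn_ord.
  by rewrite -[X in (_ < X)%N](Fp_cast p_pr) ltn_ord.
have card : #|hom_units| = size rs.
  rewrite cardE -(size_map rt); apply/perm_size/uniq_perm => //.
    by rewrite map_inj_in_uniq ?enum_uniq // => a b; rewrite !mem_enum; apply: rt_inj.
  move=> r; apply/mapP/idP => [[u]|].
    by rewrite mem_enum => /rtP[s [hs e1 _]] ->; rewrite -e1; apply: pval.
  rewrite rs_root => /(generated_hom beta_gen mu_irr mu_root)[s [hs e]].
  have [m hm em] := homP_multiple hs.
  have m0 : (0 < m)%N.
    rewrite lt0n; apply: contraTneq isT => m0; move: em; rewrite m0 mulr0n => /(congr1 (@ecval _ _)).
    by [].
  have um : (m%:R : 'F_p) \is a GRing.unit.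
    by rewrite unitfE -(dvdn_pcharf (pchar_Fp p_pr)) gtnNdvd.
  pose u : {unit 'F_p} := FinRing.unit 'F_p um; exists u.
    rewrite mem_enum inE; apply/asboolP; exists s, hs => //.
    by rewrite em /= val_Fp_nat // modn_small.
  have uS : u \in hom_units.
    rewrite inE; apply/asboolP; exists s, hs => //.
    by rewrite em /= val_Fp_nat // modn_small.
  have [s2 [hs2 <- e2]] := rtP u uS; rewrite -e; apply: hom_unique.
  by rewrite e2 em /= val_Fp_nat // modn_small.
rewrite -rs_size -card; have := cardSg (finset.subsetT (Group hom_units_group)).
by rewrite /= card_finField_unit card_Fp.
Qed.
End TwistField.

(** * Passing from a subgroup to the whole group *)

Section Subgroup.
Variables (V : zmodType) (S : {pred V}).
Record subgroup (hS : zmod_closed S) := SubGroup { sgval : V; sgvalP : sgval \in S }.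
Variable hS : zmod_closed S.
Local Notation G := (subgroup hS).
HB.instance Definition _ := [isSub of G for @sgval hS].
HB.instance Definition _ := [Choice of G by <:].
Lemma sgval_inj : injective (@sgval hS). Proof. exact: val_inj. Qed.
Let S0 : 0 \in S. Proof. by case: hS. Qed.
Let SB x y : x \in S -> y \in S -> x - y \in S. Proof. by case: hS => _; apply. Qed.
Let SN x : x \in S -> - x \in S. Proof. by move=> h; rewrite -sub0r SB. Qed.
Let SD x y : x \in S -> y \in S -> x + y \in S.
Proof. by move=> hx hy; rewrite -[y]opprK SB // SN. Qed.
Definition sg_zero : G := SubGroup hS S0.
Definition sg_opp (x : G) : G := SubGroup hS (SN (sgvalP x)).
Definition sg_add (x y : G) : G := SubGroup hS (SD (sgvalP x) (sgvalP y)).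
Fact sg_addA : associative sg_add. Proof. by move=> x y z; apply: sgval_inj; rewrite /= addrA. Qed.
Fact sg_addC : commutative sg_add. Proof. by move=> x y; apply: sgval_inj; rewrite /= addrC. Qed.
Fact sg_add0 : left_id sg_zero sg_add. Proof. by move=> x; apply: sgval_inj; rewrite /= add0r. Qed.
Fact sg_addN : left_inverse sg_zero sg_opp sg_add.
Proof. by move=> x; apply: sgval_inj; rewrite /= addNr. Qed.
HB.instance Definition _ := GRing.isZmodule.Build G sg_addA sg_addC sg_add0 sg_addN.
Lemma sgvalB (x y : G) : sgval (x - y) = sgval x - sgval y. Proof. by []. Qed.
Lemma sgvalMn (x : G) n : sgval (x *+ n) = sgval x *+ n.
Proof. by elim: n => [|n IH]; rewrite ?mulr0n // !mulrS -IH. Qed.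
End Subgroup.

Section SubgroupIndex.
(** If the norm of x vanishes, then - p x is the sum of the f^k x - x for k < p, and each of these
    is a value of f - 1. *)
Lemma kerN_mulp (V : zmodType) (f : V -> V) p x : (forall x y, f (x - y) = f x - f y) ->
  kerN f p x -> DM f (x *+ p).
Proof.
move=> fB hx; have S := @DM_sub V f fB.
have it k : DM f (iter k f x - x).
  elim: k => [|k IH]; first by rewrite subrr; apply: S.1.
  rewrite [iter _ _ _]/= -(subrK (iter k f x) (f _)) -addrA; apply: (sgrpD S) => //.
  by exists (iter k f x).
rewrite -[x *+ p]opprK; apply: (sgrpN S).
have -> : - (x *+ p) = \sum_(k < p) (iter k f x - x); last by apply: sgrp_sum => // k _; apply: it.
by rewrite sumrB sumr_const card_ord -[X in X - _]/(nrm f p x) hx sub0r.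
Qed.

Variables (V : zmodType) (S : {pred V}) (hS : zmod_closed S) (f : V -> V) (p : nat).
Hypothesis fB : forall x y, f (x - y) = f x - f y.
Local Notation G := (subgroup hS).
Variable g : G -> G.
Hypothesis gE : forall x, sgval (g x) = f (sgval x).
Variables (m t : nat).
Hypotheses (mt : m.+1 = (p * t)%N) (mS : forall x, x *+ m \in S).

Let gB x y : g (x - y) = g x - g y.
Proof. by apply: sgval_inj; rewrite !(sgvalB, gE) fB. Qed.
Let sgval_nrm x : sgval (nrm g p x) = nrm f p (sgval x).
Proof.
rewrite /nrm (big_morph (@sgval _ _ hS) (id1 := 0) (op1 := +%R)) //.
by apply: eq_bigr => k _; elim: {k}(k : nat) => //= k <-; rewrite gE.
Qed.

(* A kernel element z is killed modulo the image of f - 1 by p, and it is moved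
   into S by m, where m = -1 modulo p. *)
Lemma idx_subgroup c : idx (kerN g p) (DM g) c -> idx (kerN f p) (DM f) c.
Proof.
move=> [s [sz us sK sep cov]]; have DV := DM_sub fB; have DG := DM_sub gB.
have DMs x : DM g x -> DM f (sgval x).
  by move=> [y <-]; exists (sgval y); rewrite sgvalB gE.
have fM x k : f (x *+ k) = f x *+ k.
  have f0 : f 0 = 0 by rewrite -[X in f X](subrr (0 : V)) fB subrr.
  have fN y : f (- y) = - f y by rewrite -sub0r fB f0 sub0r.
  by elim: k => [|k IH]; rewrite ?mulr0n // !mulrS -IH -[x *+ k]opprK fB !fN !opprK.
exists [seq sgval x | x <- s]; split.
- by rewrite size_map.
- by rewrite map_inj_uniq //; apply: sgval_inj.
- by move=> _ /mapP[x /sK hx ->]; rewrite /kerN -sgval_nrm hx.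
- move=> _ _ /mapP[x hx ->] /mapP[y hy ->] [P hP]; congr sgval; apply: sep => //.
  have hz : kerN g p (x - y).
    by apply: sgval_inj; rewrite sgval_nrm sgvalB (nrmB _ fB) -!sgval_nrm !sK // subrr.
  have -> : x - y = (x - y) *+ p *+ t - (x - y) *+ m by rewrite -mulrnA -mt mulrS addrK.
  apply: DG.2; first exact: (sgrpMn _ DG (kerN_mulp gB hz)).
  exists (SubGroup hS (mS P)); apply: sgval_inj.
  by rewrite sgvalB gE sgvalMn sgvalB -hP mulrnBl fM.
move=> P hP; have h1 : kerN g p (- (SubGroup hS (mS P))).
  have N0 : nrm f p 0 = 0 by rewrite -[X in nrm _ _ X](subrr (0 : V)) (nrmB _ fB) subrr.
  have NN x : nrm f p (- x) = - nrm f p x by rewrite -sub0r (nrmB _ fB) N0 sub0r.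
  apply: sgval_inj; rewrite sgval_nrm /= NN.
  suff -> : nrm f p (P *+ m) = nrm f p P *+ m by rewrite hP mul0rn oppr0.
  elim: (m) => [|k IH]; first by rewrite !mulr0n.
  by rewrite !mulrS -IH -[P *+ k]opprK (nrmB _ fB) !NN !opprK.
have [y hy hd] := cov _ h1; exists (sgval y); first by apply/mapP; exists y.
have -> : P - sgval y = P *+ p *+ t + (sgval (- SubGroup hS (mS P) - y)).
  by rewrite -mulrnA -mt mulrS sgvalB /= addrA addrK.
apply: (sgrpD DV); first exact: (sgrpMn _ DV (kerN_mulp fB hP)).
exact: DMs.
Qed.
End SubgroupIndex.

Lemma pigeonhole (T : finType) (a : nat -> T) : exists i k, [/\ (i < k)%N, (k <= #|T|)%N & a i = a k].
Proof.
have : ~~ injectiveb (fun i : 'I_#|T|.+1 => a i).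
  by apply/negP => /injectiveP /leq_card; rewrite card_ord ltnn.
move=> /injectivePn[x [y ne e]]; have ne' : (x : nat) != y by [].
have [lt|lt] : (x < y)%N \/ (y < x)%N by move: ne'; rewrite neq_ltn => /orP.
  by exists x, y; split=> //; rewrite -ltnS ltn_ord.
by exists y, x; split=> //; rewrite -ltnS ltn_ord.
Qed.

(** Two of the p^i x lie in the same coset of S, and powers of p can be cancelled modulo S, so some
    (p^d - 1) x with d at most #|T| lies in S. Each such p^d - 1 divides p^(#|T|!) - 1. *)
Lemma kill_quotient (V : zmodType) (S : {pred V}) (p : nat) (T : finType) (cls : V -> T) :
  zmod_closed S -> (forall x y, cls x = cls y -> x - y \in S) ->
  (forall x, x *+ p \in S -> x \in S) -> (1 < p)%N ->
  forall x, x *+ (p ^ (#|T|)`!).-1 \in S.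
Proof.
move=> hS hc hp p1 x; have p0 : (0 < p)%N by apply: ltnW.
have [i [k [ik kT e]]] := pigeonhole (fun i => cls (x *+ p ^ i)).
have h := hc _ _ (esym e).
have {}h : x *+ (p ^ (k - i)).-1 \in S.
  have : x *+ (p ^ (k - i)).-1 *+ p ^ i \in S.
    rewrite -mulrnA -subn1 mulnBl mul1n -expnD subnK ?(ltnW ik) // mulrnBr //.
    by rewrite leq_exp2l // ltnW.
  move: (x *+ _) => z; elim: (i) => // i' IH; rewrite expnS mulrnA mulrnAC => /hp; apply: IH.
have /dvdnP[c ec] : ((p ^ (k - i)).-1 %| (p ^ (#|T|)`!).-1)%N.
  have /dvdnP[c ->] : (k - i %| (#|T|)`!)%N.
    by apply: dvdn_fact; rewrite subn_gt0 ik /=; apply: leq_trans kT; rewrite leq_subr.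
  rewrite mulnC expnM -!subn1; move: (p ^ _)%N => a.
  by rewrite -{2}(exp1n c) subn_exp dvdn_mulr.
have S0 : 0 \in S by case: hS.
have SN y : y \in S -> - y \in S by move=> hy; rewrite -sub0r hS.2.
rewrite ec mulnC mulrnA; elim: c {ec} => // c IH.
by rewrite mulrS -[_ *+ c]opprK hS.2 // SN.
Qed.

Lemma covered_arith P l m n : (0 < P)%N -> (P.+1 * m < l)%N -> (P * m < n)%N ->
  [/\ 0 < l - P * m, l - P * m + P * (l + m) = P.+1 * l, l < P.+1 * (l - P * m) & l < l - P * m + n]%N.
Proof.
move=> P0 h1 h2; have [i ei] : exists i, l = (P * m + i)%N by exists (l - P * m)%N; lia.
by move: h1 h2; rewrite ei addKn => h1 h2; split; nia.
Qed.

Section SupersingularReduction.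
Variables (p : nat) (K : localField p) (Om : closedFieldType) (iota : {rmorphism K -> Om}).
Hypothesis Om_closure : alg_closure iota.
Variables (v : Om -> rat).
Hypotheses (v_val : valuation v) (v_ext : forall x : K, x != 0 -> v (iota x) = vK x).
Variable W : weierstrass K.
Hypotheses (Wd : elliptic W) (W_int : integralW W) (W_good : elliptic (mapW (@lf_red p K) W))
 (W_ss : supersingular p (mapW (@lf_red p K) W)).
Local Notation E := (ec_map iota Wd).
Hypothesis tors_card : (torsion E p #= `I_p)%card.
Variables (T : ecpoint E) (xT yT : Om).
Hypotheses (eT : ecval T = Some (xT, yT)) (T_tors : T *+ p = 0).
Let p_pr : prime p. Proof. exact: (localField_prime K). Qed.
Let p_gt0 := prime_gt0 p_pr.

(** * The Frobenius twist and the explicit description of k_w *)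

Section FrobeniusTwist.
Let pOm : p \in [pchar Om]. Proof. by rewrite (fmorph_pchar iota) lf_pchar. Qed.

(** The denominator is a square whose roots have multiplicity 2 p, so its square root is a
    polynomial in X^p. Replacing X^p by X gives a polynomial over K with the p-th powers of the
    abscissas as simple roots: this is why the twist has separable torsion. *)
Lemma twisted_abscissa_poly : odd p -> exists G : {poly K},
  [/\ separable_poly G, size G = p./2.+1 & root (map_poly iota G) (xT ^+ p)].
Proof.
move=> p_odd; have [rs hrs [srs /(_ p_odd)[hcount hperm]]] :=
  den_roots v_val v_ext W_int W_good W_ss tors_card eT T_tors.
have [psi epsi] := divden_odd_sqr Wd p./2.
have e2 : (p./2.*2.+1 = p)%N by rewrite -[RHS]odd_double_half p_odd.
rewrite e2 in epsi.
pose us := undup rs; have us_uniq : uniq us by apply: undup_uniq.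
have sus : size us = p./2 by rewrite (perm_size hperm) size_map size_iota.
pose Q := \prod_(r <- us) ('X - r%:P) ^+ p.
have QE : \prod_(r <- rs) ('X - r%:P) = Q ^+ 2.
  rewrite -[LHS]big_undup_iterop_count /Q -prodrXl.
  apply: eq_big_seq => r; rewrite mem_undup => /hcount ->.
  by rewrite -exprM muln2.
have [c ec] : exists c, map_poly iota psi = c *: Q.
  have : (map_poly iota psi) ^+ 2 = (lead_coef (map_poly iota psi) *: Q) ^+ 2.
    have lc2 : lead_coef (map_poly iota (divden W p)) = lead_coef (map_poly iota psi) ^+ 2.
      by rewrite epsi rmorphXn lead_coef_exp.
    have e3 : (map_poly iota psi) ^+ 2 = map_poly iota (divden W p) by rewrite epsi rmorphXn.
    by rewrite e3 hrs QE lc2 exprZn.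
  move=> /eqP; rewrite eqf_sqr => /orP[/eqP ->|/eqP ->]; first by eexists.
  by eexists; rewrite -scaleNr.
have c0 : c != 0.
  apply: contraTneq (Psi0 iota Wd W_int W_good W_ss) => c0.
  have -> : map_poly iota (divden W p) = (map_poly iota psi) ^+ 2 by rewrite epsi rmorphXn.
  by rewrite ec c0 scale0r expr0n coef0 eqxx.
pose H := c *: \prod_(r <- us) ('X - (r ^+ p)%:P).
have HE : H = c *: \prod_(r <- [seq x ^+ p | x <- us]) ('X - r%:P) by rewrite /H big_map.
have QH : map_poly iota psi = H \Po 'X^p.
  rewrite ec comp_polyZ rmorph_prod; congr (_ *: _); apply: eq_bigr => r _.
  rewrite rmorphB /= comp_polyX comp_polyC rmorphXn /=.
  have pP : p \in [pchar {poly Om}] by rewrite pchar_poly.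
  by rewrite -!(pFrobenius_autE pP) rmorphB.
pose G := \poly_(i < p./2.+1) psi`_(p * i).
have sH : size H = p./2.+1.
  by rewrite HE size_scale // size_prod_XsubC size_map sus.
have GH : map_poly iota G = H.
  apply/polyP => i; rewrite /G coef_map coef_poly; case: ltnP => hi /=; last by rewrite rmorph0 nth_default ?sH.
  by rewrite -coef_map QH coef_comp_poly_Xn // dvdn_mulr // mulKn.
exists G; split.
- rewrite -(separable_map iota) GH HE (eqp_separable (eqp_scale _ c0)) separable_prod_XsubC map_inj_uniq //.
  by move=> x y; rewrite -!(pFrobenius_autE pOm) => /fmorph_inj.
- by rewrite -(size_map_poly iota) GH.
have xrs : xT \in us.
  rewrite mem_undup; have [h1 _ _] := torsion_abscissa v_val v_ext W_int W_good W_ss eT T_tors.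
  by move: h1; rewrite hrs rootZ ?root_prod_XsubC // lead_coef_eq0; apply: contraTneq
     (Psi0 iota Wd W_int W_good W_ss) => ->; rewrite coef0 eqxx.
rewrite GH HE rootZ // root_prod_XsubC.
exact: map_f.
Qed.

Local Notation Wp := (mapW (fun x => x ^+ p) W).

Lemma twist_elliptic : elliptic Wp.
Proof.
rewrite (_ : Wp = mapW (pFrobenius_aut (lf_pchar K)) W) ?elliptic_map //.
Qed.
Local Notation E' := (ec_map iota twist_elliptic).

Lemma twist_map : ecW E' = mapW (pFrobenius_aut pOm) E.
Proof.
by rewrite /= !mapW_comp; apply: eq_mapW => x /=; rewrite pFrobenius_autE rmorphXn.
Qed.
Definition frob_point : ecpoint E -> ecpoint E' := ecmap twist_map.
Definition twisted_torsion := frob_point T.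
Local Notation T' := twisted_torsion.

Lemma twisted_torsion_val : ecval T' = Some (xT ^+ p, yT ^+ p).
Proof. by rewrite /= eT /= !pFrobenius_autE. Qed.
Lemma twisted_torsion_p : T' *+ p = 0.
Proof. by rewrite -ecmapMn T_tors; apply: ecval_inj. Qed.
Lemma pth_root (x : Om) : exists y, y ^+ p = x.
Proof.
have [|y hy] := @closed_rootP Om ('X^p - x%:P) _; first by rewrite size_XnsubC // -(prednK p_gt0).
by exists y; apply/eqP; rewrite -subr_eq0; move: hy; rewrite /root !hornerE.
Qed.

(** Frobenius is bijective on the algebraically closed [Om], so every torsion point of the twist
    comes from a torsion point of the curve. *)
Lemma twisted_torsion_multiple (Q : ecpoint E') : Q *+ p = 0 -> exists2 m, (m < p)%N & Q = T' *+ m.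
Proof.
move=> hQ; have [P eP] : exists P, Q = frob_point P.
  case eQ: (ecval Q) => [[X Y]|]; last by exists 0; apply: ecval_inj; rewrite eQ.
  have [x ex] := pth_root X; have [y ey] := pth_root Y.
  have hc : on_curve E (Some (x, y)).
    have := ecpP Q; rewrite eQ => h; apply/(mapP_on_curve (pFrobenius_aut pOm)).
    by rewrite -twist_map [cmap _ _]/= !pFrobenius_autE ex ey.
  by exists (mkpt hc); apply: ecval_inj; rewrite eQ /= !pFrobenius_autE ex ey.
have hP : P *+ p = 0 by apply/eqP; rewrite -(ecmap_eq0 twist_map) ecmapMn -/(frob_point P) -eP hQ.
have T0 : T != 0 by apply/eqP => e; move: eT; rewrite e.
have [m hm ePm] := torsion_multiple p_pr tors_card T0 T_tors hP.
by exists m => //; rewrite eP ePm -ecmapMn.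
Qed.

Lemma local_field_infinite (r : {poly Om}) : r != 0 -> exists t : K, ~~ root r (iota t).
Proof.
move=> r0; have [w w0 vw] := vK_unif K; apply: contrapT => hno.
have := @max_poly_roots _ r [seq iota (w ^+ i) | i <- seq.iota 0 (size r)] r0.
rewrite size_map size_iota ltnn => h; apply: notF; apply: h.
  by apply/allP => _ /mapP[i _ ->]; apply: contrapT => /negP h; apply: hno; eexists; exact: h.
rewrite map_inj_uniq ?iota_uniq // => i1 i2 /fmorph_inj /(congr1 (@vK p K)).
by rewrite !(val_X (@vK_val p K)) // vw !mulr1 => /eqP; rewrite eqr_nat => /eqP.
Qed.

(** An abstract model of k_w inside [Om]. Generation by the two coordinates is stated as an
    induction principle, and a primitive element is kept for counting embeddings. *)
Definition coordinate_field (N : fieldExtType K) (j : {rmorphism N -> Om}) (Xn Yn : N) :=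
  [/\ forall x, j x%:A = iota x, j Xn = xT ^+ p /\ j Yn = yT ^+ p,
  forall P : N -> Prop, (forall x, P x%:A) -> P Xn -> P Yn ->
  (forall x y, P x -> P y -> P (x + y)) -> (forall x y, P x -> P y -> P (x * y)) -> forall x, P x,
  (\dim {:N} <= p.-1)%N &
  exists (mu : {poly K}) (beta : N), [/\ irreducible_poly mu, root (map_poly (in_alg N) mu) beta,
   (size mu).-1 = \dim {:N} & forall x : N, exists q, x = (map_poly (in_alg N) q).[beta]]].

(** For p = 2 the abscissa of T satisfies a1 x + a3 = 0, and the curve equation then gives y^2 in K.
    The twisted point is rational over K, so N is K itself, presented as the extension by the root 0
    of 'X. *)
Lemma coordinate_field2 : p = 2%N -> exists N j Xn Yn, @coordinate_field N j Xn Yn.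
Proof.
move=> p2; have [hr _ _] := torsion_abscissa v_val v_ext W_int W_good W_ss eT T_tors.
have ch2 : 2%N \in [pchar Om] by rewrite -p2 (fmorph_pchar iota) lf_pchar.
have P0 := Psi0 iota Wd W_int W_good W_ss.
have eP : divden W p = (wa1 W ^+ 2) *: 'X^2 + (wa3 W ^+ 2)%:P by apply: pchar2_omega.
have hr2 : iota (wa1 W) * xT + iota (wa3 W) = 0.
  have : (iota (wa1 W) * xT + iota (wa3 W)) ^+ 2 = 0.
    move/rootP: hr; rewrite eP rmorphD /= map_polyZ map_polyXn map_polyC hornerD hornerZ hornerXn hornerC.
    rewrite -!(pFrobenius_autE ch2) rmorphD rmorphM /= !pFrobenius_autE !rmorphXn => <-.
    by rewrite exprMn.
  by move/eqP; rewrite expf_eq0 => /eqP.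
have a1 : wa1 W != 0.
  apply: contraTneq hr => a1; move: P0; rewrite eP a1 expr0n scale0r add0r map_polyC coefC eqxx /=.
  by rewrite /root hornerC.
have xK : xT = iota (- wa3 W / wa1 W).
  rewrite fmorph_div rmorphN; have ia1 : iota (wa1 W) != 0 by rewrite fmorph_eq0.
  apply: (mulfI ia1); rewrite mulrCA mulfV // mulr1.
  by apply/eqP; rewrite -addr_eq0 hr2.
move: (- wa3 W / wa1 W) xK => x0 xK.
have yK : yT ^+ p = iota (x0 ^+ 3 + wa2 W * x0 ^+ 2 + wa4 W * x0 + wa6 W).
  rewrite [in LHS]p2 !(rmorphD, rmorphXn, rmorphM) -xK.
  have := ecpP T; rewrite eT /= => <-.
  by rewrite -addrA -mulrDl hr2 mul0r addr0.
have Xirr : irreducible_poly ('X : {poly K}).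
  by have := irredp_XsubC (0 : K); rewrite polyC0 subr0.
have X0 : root (map_poly iota 'X) 0 by rewrite map_polyX rootX.
have [N [j [beta [jE jb dN gN]]]] := simple_extension Xirr X0.
have b0 : beta = 0 by apply: (fmorph_inj j); rewrite jb rmorph0.
have allK (x : N) : exists a : K, x = a%:A.
  have [q ->] := gN x; exists q`_0; by rewrite b0 horner_coef0 coef_map.
exists N, j, (x0 ^+ p)%:A, (x0 ^+ 3 + wa2 W * x0 ^+ 2 + wa4 W * x0 + wa6 W)%:A.
split=> //.
- by rewrite !jE yK rmorphXn -xK.
- by move=> P hK _ _ _ _ x; have [a ->] := allK x.
- by rewrite dN size_polyX p2.
exists 'X, beta; split=> //; first by rewrite map_polyX b0 rootX.
Qed.

(** The separable abscissa and the ordinate have a primitive element, a K-linear combination of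
    both. The degree is at most p - 1: the abscissa contributes at most (p - 1)/2 and the ordinate
    at most 2. *)
Lemma coordinate_field_odd : odd p -> exists N j Xn Yn, @coordinate_field N j Xn Yn.
Proof.
move=> p_odd; have [G [Gsep Gsize Groot]] := twisted_abscissa_poly p_odd.
have [qY qY0 rY] := Om_closure (yT ^+ p).
have [r r0 hr] := large_field_PET qY0 rY Groot Gsep.
have [t ht] := local_field_infinite r0.
have [[q1 e1] [q2 e2]] := hr _ ht.
set z := iota t * xT ^+ p - yT ^+ p in e1 e2.
have [mu [irr rz]] := exists_irreducible (Om_closure z).
have [N [j [beta [jE jb dN gN]]]] := simple_extension irr rz.
pose Yn := (map_poly (in_alg N) q1).[beta]; pose Xn := (map_poly (in_alg N) q2).[beta].
have jY : j Yn = yT ^+ p by rewrite (in_alg_root jE) jb.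
have jX : j Xn = xT ^+ p by rewrite (in_alg_root jE) jb.
have bE : beta = t%:A * Xn + (-1)%:A * Yn.
  by apply: (fmorph_inj j); rewrite jb rmorphD !rmorphM !jE jX jY rmorphN1 mulN1r.
have ngen (P : N -> Prop) : (forall x, P x%:A) -> P Xn -> P Yn ->
  (forall x y, P x -> P y -> P (x + y)) -> (forall x y, P x -> P y -> P (x * y)) -> forall x, P x.
  move=> PK PX PY PD PM x; have Pb : P beta by rewrite bE; apply: PD; apply: PM.
  have [q ->] := gN x; rewrite horner_coef; apply: (big_ind P) => //; first by have := PK 0; rewrite scale0r.
  move=> i _; apply: (PM); first by rewrite coef_map; apply: PK.
  by elim: (i : nat) => [|k IH]; [rewrite expr0 -(scale1r 1) | rewrite exprS; apply: (PM)].
exists N, j, Xn, Yn; split=> //.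
- have sub : ({:N} <= <<<<1; Xn>>; Yn>>)%VS.
    apply/subvP => x _; move: x; apply: ngen.
    + by move=> x; apply: rpredZ; apply: rpred1.
    + by apply: (subvP (subv_adjoin _ _)); apply: memv_adjoin.
    + exact: memv_adjoin.
    + by move=> x y; apply: rpredD.
    by move=> x y; apply: rpredM.
  have d1 : (adjoin_degree 1 Xn <= p./2)%N.
    have G0 : map_poly (in_alg N) G != 0 by rewrite map_poly_eq0 -size_poly_gt0 Gsize.
    have : minPoly 1 Xn %| map_poly (in_alg N) G.
      apply: minPoly_dvdp; first by apply/polyOver1P; exists G.
      by rewrite rootE -(fmorph_eq0 j) (in_alg_root jE) jX; exact: Groot.
    by move/(dvdp_leq G0); rewrite size_minPoly size_map_poly Gsize ltnS.
  have d2 : (adjoin_degree <<1; Xn>> Yn <= 2)%N.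
    pose a i := (i (mapW (fun x => x ^+ p) W))%:A : N.
    pose c1 := a (@wa1 K) * Xn + a (@wa3 K).
    pose c0 := Xn ^+ 3 + a (@wa2 K) * Xn ^+ 2 + a (@wa4 K) * Xn + a (@wa6 K).
    have aK i : a i \in <<1; Xn>>%VS by apply: rpredZ; apply: rpred1.
    have XK : Xn \in <<1; Xn>>%VS by apply: memv_adjoin.
    pose Q := 'X^2 + (c1 *: 'X - c0%:P).
    have sQ : size Q = 3%N.
      rewrite size_polyDl size_polyXn // ltnS (leq_trans (size_polyD _ _)) // geq_max size_polyN.
      by rewrite (leq_trans (size_scale_leq _ _)) ?size_polyX // (leq_trans (size_polyC_leq1 _)).
    have Q0 : Q != 0 by rewrite -size_poly_gt0 sQ.
    have : minPoly <<1; Xn>> Yn %| Q.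
      apply: minPoly_dvdp.
        rewrite /Q rpredD ?rpredX ?polyOverX // rpredB ?polyOverZ ?polyOverX ?polyOverC //.
          by rewrite rpredD ?rpredM.
        by rewrite !rpredD ?rpredM ?rpredX.
      have := ecpP twisted_torsion; rewrite twisted_torsion_val /= => hc.
      rewrite rootE /Q !hornerE -(fmorph_eq0 j) /c1 /c0 /a.
      rewrite !(rmorphD, rmorphB, rmorphN, rmorphM, rmorphXn) /= !jE jX jY.
      apply/eqP; transitivity ((yT ^+ p) ^+ 2 + iota (wa1 W ^+ p) * xT ^+ p * yT ^+ p + iota (wa3 W ^+ p) * yT ^+ p
        - ((xT ^+ p) ^+ 3 + iota (wa2 W ^+ p) * (xT ^+ p) ^+ 2 + iota (wa4 W ^+ p) * xT ^+ p + iota (wa6 W ^+ p))).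
        by ring.
      by rewrite hc subrr.
    by move/(dvdp_leq Q0); rewrite size_minPoly sQ ltnS.
  have h2 : (2 * p./2 <= p.-1)%N by rewrite mul2n -[X in (_ <= X.-1)%N]odd_double_half p_odd.
  apply: leq_trans h2; apply: (leq_trans (dimvS sub)).
  rewrite dim_Fadjoin dim_Fadjoin dimv1 muln1.
  exact: leq_mul d2 d1.
exists mu, beta; split=> //.
by rewrite rootE -(fmorph_eq0 j) (in_alg_root jE) jb.
Qed.

Variables (A : weierstrass K) (u r s t : K).
Hypotheses (u0 : u != 0) (A_eqs : iso_eqs u r s t A W).
Let pK := lf_pchar K.

Lemma coordinate_field_exists : exists N j Xn Yn, @coordinate_field N j Xn Yn.
Proof.
have [p_odd|p_even] := boolP (odd p).
  exact: (coordinate_field_odd p_odd).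
have p2 : p = 2%N by case: (even_prime p_pr) => // h; rewrite h in p_even.
exact: (coordinate_field2 p2).
Qed.

Variables (N : fieldExtType K) (j : {rmorphism N -> Om}) (Xn Yn : N).
Hypothesis N_coord : coordinate_field j Xn Yn.
Let jE : forall x, j x%:A = iota x. Proof. by case: N_coord. Qed.
Let jX : j Xn = xT ^+ p. Proof. by case: N_coord => _ []. Qed.
Let jY : j Yn = yT ^+ p. Proof. by case: N_coord => _ []. Qed.
Let N_gen := let: And5 _ _ h _ _ := N_coord in h.
Let N_dim : (\dim {:N} <= p.-1)%N. Proof. by case: N_coord. Qed.
Local Notation Ap := (mapW (fun x => x ^+ p) A).

Lemma coordinate_field_dvd : (\dim {:N} %| p.-1)%N.
Proof.
have [_ _ _ _ [mu [beta [h1 h2 h3 h4]]]] := N_coord.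
exact: (dim_dvd twisted_torsion_val twisted_torsion_p
  twisted_torsion_multiple jE jX jY N_gen N_dim h1 h2 h3 h4).
Qed.

Lemma N_separable x : separable_over iota (j x).
Proof.
have [mu [irr rx dv _]] := extension_irreducible x; exists mu; last first.
  by rewrite rootE -(in_alg_root jE) (rootP rx) rmorph0.
apply: (separable_small_degree pK irr).
have d0 : (0 < \dim {:N})%N by rewrite adim_gt0.
by move: (dvdn_leq d0 dv) N_dim irr.1; have := prime_gt1 p_pr; lia.
Qed.

Lemma twist_eqs : iso_eqs (u ^+ p) (r ^+ p) (s ^+ p) (t ^+ p) Ap Wp.
Proof.
have e V : mapW (fun x => x ^+ p) V = mapW (pFrobenius_aut pK) V by [].
by rewrite !e -!(pFrobenius_autE pK); apply: iso_eqs_morph.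
Qed.
Let eqsO := iso_eqs_morph iota twist_eqs.
Let uO : iota (u ^+ p) != 0. Proof. by rewrite fmorph_eq0 expf_neq0. Qed.

Lemma twist_torsion_fieldE : twist_torsion_field p iota A = range j.
Proof.
rewrite /twist_torsion_field; apply/seteqP; split.
  apply: subfield_gen_min; first exact: range_subfield.
  move=> z [[x _ <-]|[x [y [hP _ _ hz]]]]; first by exists x%:A; rewrite ?jE.
  have [Q hQ] := isoP_surj (iota (r ^+ p)) (iota (s ^+ p)) (iota (t ^+ p)) uO (Some (x, y)).
  have hT : torsion (mapW iota Wp) p Q by apply/(isoP_torsion uO eqsO); rewrite hQ.
  case eQ : Q hQ hT => [[x' y']|] //= [ex ey] hT.
  pose Q' : ecpoint E' := mkpt (hT.1 : on_curve E' (Some (x', y'))).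
  have hQ' : Q' *+ p = 0 by apply/ec_torsion.
  have [[xn _ hx] [yn _ hy]] := torsion_in_range twisted_torsion_val
    twisted_torsion_multiple jE jX jY hQ' erefl.
  have kR a : range j (iota a) by exists a%:A; rewrite ?jE.
  have hR := range_subfield j.
  have Rx : range j x by rewrite -ex; apply: subfieldD => //; apply: subfieldM; rewrite -?rmorphXn //; exists xn.
  have Ry : range j y.
    rewrite -ey; apply: subfieldD => //; apply: subfieldD => //; apply: subfieldM => //; rewrite -?rmorphXn //.
    - by exists yn.
    - by rewrite -rmorphM.
    by exists xn.
  by case: hz => ->.
set G := subfield_gen _; have hG : is_subfield G by apply: subfield_genP.
have kG a : G (iota a) by apply: subfield_gen_sub; left; exists a.
have := isoP_torsion uO eqsO p (Some (xT ^+ p, yT ^+ p)).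
have hT : torsion (mapW iota Wp) p (Some (xT ^+ p, yT ^+ p)).
  have := (ec_torsion p twisted_torsion).2 twisted_torsion_p.
  by rewrite twisted_torsion_val.
move=> [/(_ hT) + _]; rewrite /isoP.
set x := _ * xT ^+ p + _; set y := _ + _ => hP.
have sx : separable_over iota x.
  have -> : x = j (((u ^+ p) ^+ 2)%:A * Xn + (r ^+ p)%:A).
    by rewrite rmorphD rmorphM !jE jX /x; congr (_ * _ + _); rewrite [RHS]rmorphXn.
  exact: N_separable.
have sy : separable_over iota y.
  have -> : y = j (((u ^+ p) ^+ 3)%:A * Yn + ((u ^+ p) ^+ 2 * s ^+ p)%:A * Xn + (t ^+ p)%:A).
    rewrite !rmorphD [j (_ * Yn)]rmorphM [j (_ * Xn)]rmorphM !jE jX jY /y.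
    congr (_ * _ + _ * _ + _); first by rewrite [RHS]rmorphXn.
    by rewrite [RHS]rmorphM; congr (_ * _); rewrite [RHS]rmorphXn.
  exact: N_separable.
have Gx : G x by apply: subfield_gen_sub; right; exists x, y; split=> //; left.
have Gy : G y by apply: subfield_gen_sub; right; exists x, y; split=> //; right.
have e2 : iota ((u ^+ p) ^+ 2) = iota (u ^+ p) ^+ 2 := rmorphXn iota 2 (u ^+ p).
have e3 : iota ((u ^+ p) ^+ 3) = iota (u ^+ p) ^+ 3 := rmorphXn iota 3 (u ^+ p).
have e23 : iota ((u ^+ p) ^+ 2 * s ^+ p) = iota (u ^+ p) ^+ 2 * iota (s ^+ p) by rewrite rmorphM e2.
have GX : G (xT ^+ p).
  have -> : xT ^+ p = (x - iota (r ^+ p)) / iota ((u ^+ p) ^+ 2).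
    by rewrite /x e2 addrK mulrAC mulfV ?mul1r // expf_neq0.
  by apply: (subfieldV hG) => //; apply: (subfieldB hG).
have GY : G (yT ^+ p).
  have -> : yT ^+ p = (y - iota (t ^+ p) - iota ((u ^+ p) ^+ 2 * s ^+ p) * xT ^+ p) / iota ((u ^+ p) ^+ 3).
    by rewrite /y e3 e23 addrK addrK mulrAC mulfV ?mul1r // expf_neq0.
  apply: (subfieldV hG) => //; apply: (subfieldB hG) => //; first exact: (subfieldB hG).
  exact: (subfieldM hG).
move=> _ [z _ <-]; move: z; apply: N_gen => [a|||a b ha hb|a b ha hb].
- by rewrite jE.
- by rewrite jX.
- by rewrite jY.
- by rewrite rmorphD; apply: (subfieldD hG).
by rewrite rmorphM; apply: (subfieldM hG).
Qed.

(** The quotient of the coordinates of the twisted point lies in N and has valuation p tau = n / (p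
    - 1). As the value group of N is (1/e)Z, the number c = e n / (p - 1) is an integer. *)
Theorem twist_ramification n : n%:R = p%:R * (p%:R - 1) * tau v xT :> rat ->
  exists e c, [/\ (0 < e)%N, (e %| p.-1)%N, (c * p.-1 = e * n)%N,
   exists2 y, y != 0 & v (j y) = 1 / e%:R &
   forall y, y != 0 -> exists a : int, v (j y) = a%:~R / e%:R].
Proof.
move=> hn; pose G (x : rat) := exists2 y, y != 0 & v (j y) = x.
have P1 : (0 < p.-1)%N by have := prime_gt1 p_pr; lia.
have jv : valuation (fun y => v (j y)) by exact: vF_val.
have [t1 t10 vt1] := vK_unif K.
have G1 : G 1 by exists t1%:A; rewrite ?jE ?v_ext // (fmorph_eq0 (in_alg N)).
have GB x y : G x -> G y -> G (x - y).
  by move=> [a a0 <-] [b b0 <-]; exists (a / b); rewrite ?mulf_neq0 ?invr_eq0 // (val_div jv).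
have hd x : G x -> exists m : int, p.-1%:R * x = m%:~R.
  move=> [y y0 <-]; have [a a0 ha] := extension_val (@vK_val p K) (@localField_complete p K) v_val v_ext jE y0.
  have /dvdnP[q ->] := coordinate_field_dvd.
  by exists (q%:Z * lf_ord a); rewrite natrM -mulrA ha intrM.
have [e [e0 ed Ge He]] := value_group_index P1 G1 GB hd.
have He' y : y != 0 -> exists a : int, v (j y) = a%:~R / e%:R by move=> y0; apply: He; exists y.
have [xT0 yT0 vz] : [/\ xT != 0, yT != 0 & v xT - v yT = tau v xT].
  have hE : integral_curve v E := integral_curve_map v_ext (integral_curveK W_int).
  have [_ x0 vx] := torsion_abscissa v_val v_ext W_int W_good W_ss eT T_tors.
  have hc : on_curve E (Some (xT, yT)) by rewrite -eT; apply: ecpP.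
  have [y0 vy] := kernel_y v_val hE hc x0 vx; split=> //.
  by rewrite /tau; lra.
have X0 : Xn != 0 by rewrite -(fmorph_eq0 j) jX expf_neq0.
have Y0 : Yn != 0 by rewrite -(fmorph_eq0 j) jY expf_neq0.
have [a ha] := He' (Xn / Yn) (mulf_neq0 X0 (invr_neq0 Y0 : Yn^-1 != 0)).
have ha2 : p%:R * tau v xT = a%:~R / e%:R.
  by rewrite -ha fmorph_div jX jY (val_div v_val) ?expf_neq0 // !(val_X v_val) // -vz mulrBr.
have eR : e%:R != 0 :> rat by rewrite pnatr_eq0 -lt0n.
have PR : (p%:R - 1 : rat) = p.-1%:R by rewrite -subn1 natrB.
have hc : (a * p.-1%:Z)%:~R = (e * n)%N%:R :> rat.
  rewrite intrM natrM hn; have -> : p%:R * (p%:R - 1) * tau v xT = (p%:R - 1) * (p%:R * tau v xT) by ring.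
  by rewrite ha2 -[(p.-1%:Z)%:~R]/(p.-1%:R) -PR; field.
have hc2 : a * p.-1%:Z = (e * n)%N%:Z by apply/(@intr_inj rat).
have a0 : 0 <= a by rewrite -(pmulr_lge0 _ (_ : 0 < p.-1%:Z)) ?hc2 ?ltz_nat.
exists e, `|a|%N; split=> //.
by apply/eqP; rewrite -eqz_nat PoszM gez0_abs // hc2.
Qed.

Lemma twist_field2 : p = 2%N -> range j = range iota.
Proof.
move=> p2; apply/seteqP; split=> _ [x _ <-]; last by exists x%:A; rewrite ?jE.
have e : p.-1 = 1%N by rewrite p2.
have d1 : \dim {:N} = 1%N by apply/eqP; rewrite eqn_leq adim_gt0 andbT (leq_trans N_dim) // e.
have e1 : (1%VS == {:N})%VS by rewrite eqEdim sub1v /= dimv1 d1.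
by have := memvf x; rewrite -(eqP e1) => /vlineP[a ->]; exists a; rewrite ?jE.
Qed.
End FrobeniusTwist.

(** * The kernel of reduction over L *)

Section KernelFiltration.
Variables (L : fieldExtType K) (j : {rmorphism L -> Om}).
Hypotheses (j_ext : forall x : K, j x%:A = iota x) (L_deg : \dim {:L} = p).
Local Notation vL := (fun x => v (j x)).
Variable pi : L.
Hypotheses (pi0 : pi != 0) (v_pi : v (j pi) = 1 / p%:R).
Variable s : {rmorphism L -> L}.
Hypotheses (s_K : forall a : K, s a%:A = a%:A) (s_p : forall x, iter p s x = x)
 (s_fix : forall x, s x = x -> exists a : K, x = a%:A) (vL_s : forall x, v (j (s x)) = v (j x)).

Let p_gt1 := prime_gt1 p_pr.
Let pK := lf_pchar K.
Let vLv : valuation vL. Proof. exact: vF_val. Qed.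
Let vLe (x : K) : x != 0 -> v (j x%:A) = vK x. Proof. by move=> x0; rewrite j_ext v_ext. Qed.
Let vKi (x : K) : x != 0 -> exists m : int, vK x = m%:~R. Proof. exact: vK_int. Qed.

Lemma ramified_break : exists lam : nat, [/\ (0 < lam)%N, ~~ (p %| lam)%N & v (j (s pi / pi - 1)) = lam%:R / p%:R].
Proof.
have [lam lam0 h] := break_exists p_pr (@vK_val p K) vKi vLv vLe L_deg pi0 v_pi pK s_K s_p s_fix vL_s.
exists lam; split=> //.
exact: (lam_ndvd p_pr (@vK_val p K) vKi vLv vLe L_deg pi0 v_pi pK s_K s_p s_fix vL_s lam0 h).
Qed.

Variable lam : nat.
Hypotheses (lam_gt0 : (0 < lam)%N) (v_u1 : v (j (s pi / pi - 1)) = lam%:R / p%:R).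

Lemma uniformizer_minpoly : exists mu : {poly K}, size mu = p.+1 /\
  forall m, (m < p)%N -> root (map_poly iota mu) (j (iter m s pi)).
Proof.
have [mu [irr rmu dv _]] := extension_irreducible pi; exists mu; split; last first.
  move=> m _; rewrite rootE -(in_alg_root j_ext).
  have it k : (map_poly (in_alg L) mu).[iter k s pi] = 0.
    elim: k => [|k IH]; first exact/rootP.
    by rewrite /= -(in_alg_root (iota := in_alg L) s_K) IH rmorph0.
  by rewrite it rmorph0.
have nz := irredp_neq0 irr; rewrite L_deg in dv.
have sz : (0 < size mu)%N by rewrite size_poly_gt0.
have : ((size mu).-1 == 1%N) || ((size mu).-1 == p) by apply: (primeP p_pr).2.
case/orP => /eqP e; last by rewrite -(prednK sz) e.
have sz2 : size mu = 2%N by rewrite -(prednK sz) e.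
have c1 : mu`_1 != 0 by have := lead_coef_eq0 mu; rewrite /lead_coef sz2 (negPf nz) /= => ->.
have := rootP rmu; rewrite horner_coef size_map_poly sz2 big_ord_recl big_ord1 !coef_map /= expr0 expr1 mulr1.
move=> /eqP; rewrite addrC addr_eq0 => /eqP e1.
have epi : pi = (- mu`_0 / mu`_1)%:A.
  have c1L : in_alg L mu`_1 != 0 by rewrite fmorph_eq0.
  apply: (mulfI c1L); rewrite [LHS]e1 -[X in _ * X]/(in_alg L _) fmorph_div rmorphN mulrCA mulfV //.
  by rewrite mulr1.
have a0 : - mu`_0 / mu`_1 != 0 by apply: contraNneq pi0 => a0; rewrite epi a0 scale0r.
have [m hm] := vKi a0; move: v_pi; rewrite epi vLe // hm => hm1.
have : (m * p%:Z)%:~R = 1%:~R :> rat by rewrite intrM hm1 divfK // pnatr_eq0 -lt0n.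
move=> /intr_inj hm2; have : (`|m| * p = 1)%N by rewrite -[p in LHS](absz_nat p) -abszM hm2.
by move=> /eqP; rewrite muln_eq1 => /andP[_ /eqP p1]; move: p_gt1; rewrite p1.
Qed.

Theorem ramified_discriminant (M : fieldType) (k : {rmorphism M -> Om}) (h : {rmorphism K -> M}) e :
  (forall x, k (h x) = iota x) -> (0 < e)%N -> coprime p e ->
  (forall m, m != 0 -> exists a : int, v (k m) = a%:~R / e%:R) ->
  (exists2 t, t != 0 & v (k t) = 1 / e%:R) ->
  ord_disc v (subfield_gen (range k `|` range j)) (range k) = p.-1%:R * ((e * lam)%N%:R + 1).
Proof.
move=> kh e0 pe vM tM; have [mu [mu_size mu_root]] := uniformizer_minpoly.
have vpi m : (m < p)%N -> j (iter m s pi) != 0 /\ v (j (iter m s pi)) = 1 / p%:R.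
  by move=> _; rewrite fmorph_eq0; elim: m => [|m [IH1 IH2]] //=; rewrite fmorph_eq0 vL_s.
have vdiff a b : (a < p)%N -> (b < p)%N -> a != b -> j (iter a s pi) - j (iter b s pi) != 0 /\
    v (j (iter a s pi) - j (iter b s pi)) = lam.+1%:R / p%:R.
  move=> ha hb ab; rewrite -rmorphB fmorph_eq0.
  exact: (conj_val_diff p_pr (@vK_val p K) vKi vLv vLe L_deg pi0 v_pi pK s_K s_p s_fix vL_s lam_gt0 v_u1 ha hb ab).
rewrite (ramified_fieldE p_pr pe e0 kh v_val vM mu_size mu_root vpi (S := range j)).
- exact: (ord_disc_ramified p_pr pe e0 kh v_val vM tM mu_size mu_root vpi vdiff).
- by exists pi.
move=> _ [x _ <-]; have [c ->] := expand p_pr vKi vLv vLe L_deg pi0 v_pi x.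
exists (\poly_(i < p) h (c i)).
rewrite (horner_coef_wide (n := p)); last by rewrite (leq_trans (size_poly _ _)) // size_poly.
rewrite rmorph_sum; apply: eq_bigr => i _.
by rewrite coef_map coef_poly ltn_ord /= kh rmorphM rmorphXn /= j_ext.
Qed.
Variable n : nat.
Hypotheses (n_gt0 : (0 < n)%N) (n_tau : n%:R = p%:R * (p%:R - 1) * tau v xT :> rat).
Local Notation EL := (ec_map (in_alg L) Wd).

Let hEL : integral_curve vL EL. Proof. exact: (@integral_curveF p K Om iota v v_ext W Wd W_int L (in_alg L) j j_ext). Qed.
Let Lc : complete_val vL := complete_ext p_pr vKi vLv vLe L_deg pi0 v_pi (@localField_complete p K).
Let pR : p%:R != 0 :> rat. Proof. by rewrite pnatr_eq0 -lt0n. Qed.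
Let pR0 : 0 < p%:R :> rat. Proof. by rewrite ltr0n. Qed.
Definition lev (i : nat) : rat := i%:R / p%:R.

Lemma lev_le i k : (i <= k)%N -> lev i <= lev k.
Proof. by move=> h; rewrite ler_pM2r ?invr_gt0 // ler_nat. Qed.
Lemma lev_gt0 i : (0 < i)%N -> 0 < lev i. Proof. by move=> h; rewrite divr_gt0 // ltr0n. Qed.
Lemma lev_mul k i : lev (k * i) = k%:R * lev i.
Proof. by rewrite /lev natrM mulrA. Qed.
Lemma lev_mulp k : lev (p * k) = k%:R.
Proof. by rewrite /lev natrM mulrAC mulfV // mul1r. Qed.

Lemma vgt_lev i x : vgt vL (lev i) x = vge vL (lev i.+1) x.
Proof.
rewrite /vgt /vge; have [//|x0 /=] := eqVneq x 0.
have [m hm] := vL_pmul p_pr vKi vLv vLe L_deg pi0 v_pi x0.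
rewrite /lev ltr_pdivrMr // ler_pdivrMr // [v (j x) * _]mulrC hm.
by rewrite -[i%:R]/(i%:Z%:~R) -[i.+1%:R]/(i.+1%:Z%:~R) ltr_int ler_int -lez1D; congr (_ <= _); lia.
Qed.

Definition kernel_pred : {pred ecpoint EL} := fun P => in_kernel vL (ecval P).
Lemma kernel_closed : zmod_closed kernel_pred.
Proof. by split=> // P Q hP hQ; apply: (kernel_sub vLv hEL). Qed.
Local Notation M := (subgroup kernel_closed).
Definition zM (x : M) : L := zc (ecval (sgval x)).

Lemma zM_inj : injective zM.
Proof.
move=> x y e; apply: sgval_inj; apply/eqP; apply: contraT => ne.
have [a [b [_ _ ne2 _]]] := kernel_sub_exact vLv hEL (sgvalP x) (sgvalP y) ne.
by move: ne2; rewrite -[zc _]/(zM x) e eqxx.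
Qed.

Lemma zM0 : zM 0 = 0. Proof. by []. Qed.
Lemma zM_exists z : vgt vL 0 z -> exists x, zM x = z.
Proof.
move=> hz; have [P [hP ez]] := zc_exists vLv Lc hEL hz.
by exists (SubGroup kernel_closed (hP : P \in kernel_pred)).
Qed.

Lemma zM_gt0 x : vgt vL 0 (zM x).
Proof.
have := sgvalP x; rewrite /zM; case e: (ecval (sgval x)) => [[a b]|]; last by rewrite /vgt eqxx.
rewrite unfold_in /kernel_pred e /= => /andP[a0 va].
have hc : on_curve EL (Some (a, b)) by rewrite -e; apply: ecpP.
have [z0 vz] := zc_val vLv hEL hc a0 va.
rewrite vgt_nz //; move: vz => /=; lra.
Qed.

Definition FM (i : nat) (x : M) : Prop := vge vL (lev i) (zM x).
Lemma FM_level i x : (0 < i)%N -> FM i x <-> level_ge vL (lev i) (ecval (sgval x)).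
Proof. by move=> i0; rewrite /FM (level_zc vLv hEL) //; exact: (sgvalP x). Qed.

(** [kernel_sub_exact] makes congruences in M and in L equivalent; all properties of the filtration
    are then read off from L through z. *)
Lemma FM_subE i x y : FM i (x - y) <-> vge vL (lev i) (zM x - zM y).
Proof.
have [->|ne] := eqVneq x y; first by rewrite !subrr /FM zM0.
have ne' : sgval x != sgval y by rewrite (inj_eq (@sgval_inj _ _ _)).
have [a [b [e a0 ne2 va]]] := kernel_sub_exact vLv hEL (sgvalP x) (sgvalP y) ne'.
rewrite /FM -(level_zc vLv hEL); last exact: (sgvalP (x - y)).
rewrite sgvalB e /= a0 va /= vge_nz ?subr_eq0 // lerN2 ler_pM2l //.
Qed.

Lemma FM0 x : FM 0 x.
Proof. by rewrite /FM /lev mul0r; apply: vgtW; apply: zM_gt0. Qed.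
Lemma FM_dec i x : FM i.+1 x -> FM i x.
Proof. by apply: vge_le; apply: lev_le. Qed.
Lemma FM_sub i : sgrp (FM i).
Proof.
split=> [|x y hx hy]; first exact: vge0.
by apply/FM_subE; apply: (vgeB vLv).
Qed.
Lemma FM_1 x : FM 1 x.
Proof. by rewrite /FM -vgt_lev /lev mul0r; apply: zM_gt0. Qed.
Lemma FM_sep x : (forall i, FM i x) -> x = 0.
Proof.
move=> h; apply: zM_inj; rewrite zM0; apply: (vge_all (v := vL)) => k.
by have := h (p * k)%N; rewrite /FM lev_mulp.
Qed.
Lemma FM_ge i k x : (i <= k)%N -> FM k x -> FM i x.
Proof. by move=> h; apply: vge_le; apply: lev_le. Qed.

Lemma FM_complete (u : nat -> M) : (forall k, FM k (u k)) ->
  exists x, forall k, FM k (x - \sum_(i < k) u i).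
Proof.
move=> hu; pose S k := \sum_(i < k) u i.
have hS a b : (a <= b)%N -> FM a (S b - S a).
  elim: b => [|b IH]; first by rewrite leqn0 => /eqP ->; rewrite subrr; apply: vge0.
  rewrite leq_eqVlt => /orP[/eqP ->|]; first by rewrite subrr; apply: vge0.
  rewrite ltnS => ab; have -> : S b.+1 - S a = (S b - S a) - (0 - u b).
    by rewrite {1}/S big_ord_recr /= sub0r opprK addrAC.
  apply: (FM_sub a).2; first exact: IH.
  by apply: (FM_sub a).2; [exact: vge0 | apply: FM_ge (hu b)].
(* Levels are in units of 1/p, so the subsequence of indices p k converges at the rate required by
   completeness of L. *)
have [|l hl] := Lc (u := fun k => zM (S (p * k)%N)).
  by move=> k; rewrite -lev_mulp; apply/FM_subE/hS; rewrite leq_pmul2l.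
have l0 : vgt vL 0 l.
  rewrite -[l](subKr (zM (S (p * 1)%N))); apply: (vgtB vLv); first exact: zM_gt0.
  by apply: (vge_gt (r := 1%:R)); [rewrite ltr01 | apply: hl].
have [x ex] := zM_exists l0; exists x => k; apply/FM_subE; rewrite ex -/(S k).
have -> : l - zM (S k) = (zM (S (p * k)%N) - zM (S k)) - (zM (S (p * k)%N) - l) by ring.
apply: (vgeB vLv); first by apply/FM_subE/hS; rewrite leq_pmull.
by apply: vge_le (hl k); rewrite -lev_mulp; apply: lev_le; rewrite leq_pmull.
Qed.

Lemma vgeK r (a : K) : vge vL r (a%:A : L) = vge (@vK p K) r a.
Proof. by rewrite /vge (fmorph_eq0 (in_alg L)); have [//|a0] := eqVneq a 0; rewrite vLe. Qed.
Lemma vgtK r (a : K) : vgt vL r (a%:A : L) = vgt (@vK p K) r a.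
Proof. by rewrite /vgt (fmorph_eq0 (in_alg L)); have [//|a0] := eqVneq a 0; rewrite vLe. Qed.
Lemma res_lift (rho : lf_res K) : exists2 a : oring K, ored a = rho & True.
Proof. by have [a /ointP ha <-] := lf_red_surj rho; exists (ORing ha). Qed.
Definition lift (rho : lf_res K) : oring K := sval (cid2 (res_lift rho)).
Lemma liftE rho : ored (lift rho) = rho. Proof. by rewrite /lift; case: cid2. Qed.
Lemma vpiX i : v (j (pi ^+ i)) = lev i.
Proof. by rewrite (val_X vLv) // v_pi /lev mulrA mulr1. Qed.
Let piX0 i : pi ^+ i != 0. Proof. by rewrite expf_neq0. Qed.

Lemma FM_idx i : (0 < i)%N -> idx (FM i) (FM i.+1) #|lf_res K|.
Proof.
move=> i0; have hz (rho : lf_res K) : vge vL (lev i) ((oval (lift rho))%:A * pi ^+ i).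
  rewrite -[lev i]add0r; apply: (vgeM vLv); last by rewrite vge_nz // vpiX.
  by rewrite vgeK -oint_vge; exact: (oring_proof (lift rho)).
have ex rho : exists x, zM x = (oval (lift rho))%:A * pi ^+ i.
  by apply: zM_exists; apply: vge_gt (hz rho); apply: lev_gt0.
pose pt rho : M := sval (cid (ex rho)).
have ptE rho : zM (pt rho) = (oval (lift rho))%:A * pi ^+ i by exact: (svalP (cid (ex rho))).
have sep rho rho' : FM i.+1 (pt rho - pt rho') -> rho = rho'.
  move=> /FM_subE; rewrite !ptE -mulrBl -[_%:A - _%:A]/(in_alg L _ - in_alg L _) -rmorphB.
  rewrite -vgt_lev => h; have h0 : vgt (@vK p K) 0 (oval (lift rho - lift rho')).
    rewrite -vgtK; move: h; rewrite /vgt mulf_eq0 (negPf (piX0 i)) orbF.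
    have [//|nz /=] := eqVneq ((oval (lift rho - lift rho'))%:A : L) 0.
    by rewrite (val_M vLv) // vpiX ltrDr.
  by move: h0; rewrite -ored_eq0 rmorphB /= !liftE subr_eq0 => /eqP.
exists [seq pt rho | rho <- enum (lf_res K)]; split.
- by rewrite size_map -cardE.
- rewrite map_inj_uniq ?enum_uniq // => rho rho' e; apply: sep.
  by rewrite e subrr; apply: vge0.
- by move=> _ /mapP[rho _ ->]; rewrite /FM ptE.
- by move=> _ _ /mapP[rho _ ->] /mapP[rho' _ ->] h; congr pt; apply: sep.
move=> x hx; have hq : vge vL 0%:~R (zM x / pi ^+ i).
  rewrite mulr0z; have -> : 0 = lev i + - lev i by rewrite subrr.
  by apply: (vgeM vLv) => //; rewrite vge_nz ?invr_eq0 // (val_V vLv) // vpiX.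
have [a ha hxa] := approx_base p_pr vKi vLv vLe L_deg pi0 v_pi hq; rewrite mulr0z in ha hxa.
rewrite -oint_vge in ha; pose a' := ORing ha.
exists (pt (ored a')); first by apply/mapP; exists (ored a'); rewrite ?mem_enum.
apply/FM_subE; rewrite ptE -vgt_lev.
have -> : zM x - (oval (lift (ored a')))%:A * pi ^+ i =
   ((zM x / pi ^+ i - a%:A) + (oval (a' - lift (ored a')))%:A) * pi ^+ i.
  rewrite mulrDl mulrBl divfK // -[(oval (a' - _))%:A]/(in_alg L _) rmorphB mulrBl /=.
  by rewrite addrA subrK.
rewrite -[lev i]add0r; apply: (vgtM vLv); last by rewrite vge_nz // vpiX.
by apply: (vgtD vLv) => //; rewrite vgtK -ored_eq0 rmorphB /= liftE subrr.
Qed.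

Lemma s_curve : ecW EL = mapW s EL.
Proof. by rewrite /= mapW_comp; apply: eq_mapW => x /=; rewrite s_K. Qed.
Definition sP : ecpoint EL -> ecpoint EL := ecmap s_curve.

Lemma sP_kernel P : P \in kernel_pred -> sP P \in kernel_pred.
Proof.
rewrite !unfold_in /= /kernel_pred /=; case: (ecval P) => [[x y]|] //=.
by rewrite fmorph_eq0 vL_s.
Qed.
Definition sgM (x : M) : M := SubGroup kernel_closed (sP_kernel (sgvalP x)).

Lemma zM_sg x : zM (sgM x) = s (zM x).
Proof.
rewrite /zM /=; case: (ecval _) => [[a b]|] /=; last by rewrite rmorph0.
by rewrite rmorphM rmorphN fmorphV.
Qed.
Lemma sgMB x y : sgM (x - y) = sgM x - sgM y.
Proof. by apply: sgval_inj; rewrite /= -ecmapB. Qed.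
Lemma sgM_p x : iter p sgM x = x.
Proof.
have it m : zM (iter m sgM x) = iter m s (zM x) by elim: m => //= m IH; rewrite zM_sg IH.
by apply: zM_inj; rewrite it s_p.
Qed.
Lemma sgM_F i x : FM i x -> FM i (sgM x).
Proof. by rewrite /FM zM_sg /vge vL_s fmorph_eq0. Qed.
Lemma sgM_DF i x : (0 < i)%N -> FM i x -> FM (i + lam) (sgM x - x).
Proof.
move=> _ h; apply/FM_subE; rewrite zM_sg /lev natrD mulrDl.
exact: (D_vge p_pr (@vK_val p K) vKi vLv vLe L_deg pi0 v_pi pK s_K s_p s_fix vL_s v_u1 h).
Qed.
Lemma sgM_DF' i x : (0 < i)%N -> ~~ (p %| i)%N -> FM i x -> FM (i + lam).+1 (sgM x - x) -> FM i.+1 x.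
Proof.
move=> _ hi h /FM_subE; rewrite zM_sg -vgt_lev => h2; rewrite /FM -vgt_lev.
exact: (D_strict p_pr (@vK_val p K) vKi vLv vLe L_deg pi0 v_pi pK s_K s_p s_fix vL_s v_u1 hi h h2).
Qed.
Lemma sgM_fix i x : (0 < i)%N -> (p %| i)%N -> FM i x ->
  exists2 y, sgM y = y & FM i y /\ FM i.+1 (x - y).
Proof.
move=> i0 /dvdnP[l el] h; rewrite mulnC in el.
have l0 : (0 < l)%N by move: i0; rewrite el muln_gt0 => /andP[].
rewrite /FM el lev_mulp in h.
have [a ha hxa] := approx_base (l := l%:Z) p_pr vKi vLv vLe L_deg pi0 v_pi h.
have a0 : vgt vL 0 (a%:A : L) by rewrite vgtK; apply: vge_gt ha; rewrite ltr0n.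
have [y ey] := zM_exists a0; exists y; first by apply: zM_inj; rewrite zM_sg ey s_K.
split; first by rewrite /FM ey el lev_mulp vgeK.
by apply/FM_subE; rewrite ey -vgt_lev el lev_mulp.
Qed.

Lemma exact_level x : x != 0 -> exists m a b, [/\ (0 < m)%N, ecval (sgval x) = Some (a, b), a != 0,
  v (j a) = - (2 * lev m) & forall i, FM i x <-> (i <= m)%N].
Proof.
move=> x0; have z0 : zM x != 0 by rewrite -zM0 (inj_eq zM_inj).
have [m0 hm0] := vL_pmul p_pr vKi vLv vLe L_deg pi0 v_pi z0.
have vz : 0 < v (j (zM x)) by have := zM_gt0 x; rewrite vgt_nz.
have m0pos : 0 < m0 by rewrite -(ltr_int rat) -hm0 mulr_gt0.
have hm : v (j (zM x)) = lev `|m0|%N.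
  apply: (mulfI pR); rewrite hm0 /lev mulrCA mulfV // mulr1.
  by rewrite -[in LHS](gtz0_abs m0pos).
case e: (ecval (sgval x)) => [[a b]|]; last by move: z0; rewrite /zM e eqxx.
have := sgvalP x; rewrite unfold_in /kernel_pred e /= => /andP[a0 va].
have hc : on_curve EL (Some (a, b)) by rewrite -e; apply: ecpP.
have [_ vz2] := zc_val vLv hEL hc a0 va.
exists `|m0|%N, a, b; split=> //; first by rewrite absz_gt0 gt_eqF.
  by move: vz2; rewrite -[zc _]/(zc (Some (a, b))) -e -[zc _]/(zM x) hm; lra.
move=> i; rewrite /FM vge_nz // hm /lev ler_pM2r ?invr_gt0 // ler_nat //.
Qed.

Let tauE : tau v xT = n%:R / (p%:R * p.-1%:R).
Proof.
have PR : (p%:R - 1 : rat) = p.-1%:R by rewrite -subn1 natrB.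
have P0 : p.-1%:R != 0 :> rat by rewrite pnatr_eq0 -lt0n; lia.
by rewrite n_tau PR; field; rewrite pR P0.
Qed.

Let lev_tau m : [/\ (lev m < tau v xT) = (p.-1 * m < n)%N, (lev m == tau v xT) = (p.-1 * m == n)%N &
  (tau v xT < lev m) = (n < p.-1 * m)%N].
Proof.
have P0 : 0 < p.-1%:R :> rat by rewrite ltr0n; lia.
have hp : 0 < (p%:R * p.-1%:R)^-1 :> rat by rewrite invr_gt0 mulr_gt0.
have -> : lev m = (p.-1 * m)%N%:R / (p%:R * p.-1%:R).
  by rewrite natrM /lev; field; rewrite pR gt_eqF.
rewrite tauE !ltr_pM2r // !ltr_nat; split=> //.
by rewrite (inj_eq (mulIf (lt0r_neq0 hp))) eqr_nat.
Qed.

Lemma mulp_exact x m a b : ecval (sgval x) = Some (a, b) -> a != 0 -> v (j a) = - (2 * lev m) -> (0 < m)%N ->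
  [/\ (p.-1 * m < n)%N -> forall i, FM i (x *+ p) <-> (i <= p ^ 2 * m)%N,
   (p.-1 * m = n)%N -> FM (p ^ 2 * m) (x *+ p) &
   (n < p.-1 * m)%N -> forall i, FM i (x *+ p) <-> (i <= p * (m + n))%N].
Proof.
move=> e a0 va m0; have [l1 l2 l3] := lev_tau m.
have [h1 h2 h3] := mulp_levelF v_val v_ext W_int W_good W_ss tors_card eT T_tors (kF := in_alg L) j_ext e a0 va (lev_gt0 m0).
have fin k a' b' : (0 < k)%N -> ecval (sgval x *+ p) = Some (a', b') -> a' != 0 -> v (j a') = - (2 * lev k) ->
    forall i, FM i (x *+ p) <-> (i <= k)%N.
  move=> k0 e' a'0 va' i; have [->|i0] := posnP i; first by split=> // _; apply: FM0.
  rewrite (FM_level _ i0) sgvalMn e' /= a'0 va' /= lerN2 ler_pM2l // /lev ler_pM2r ?invr_gt0 //.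
  by rewrite ler_nat.
split.
- rewrite -l1 => /h1[a' [b' [e' a'0 va']]]; apply: (fin _ a' b') => //.
    by rewrite muln_gt0 expn_gt0 p_gt0.
  by rewrite va' lev_mul.
- move=> /eqP; rewrite -l2 => /eqP /h2 hl; apply/FM_level; first by rewrite muln_gt0 expn_gt0 p_gt0.
  by rewrite sgvalMn lev_mul.
rewrite -l3 => /h3[a' [b' [e' a'0 va']]]; apply: (fin _ a' b') => //.
  by rewrite muln_gt0 p_gt0 addn_gt0 m0.
by rewrite va' lev_mulp -n_tau natrD; congr (- (_ * (_ + _))); rewrite /lev mulrCA mulfV // mulr1.
Qed.

Lemma mulp1 i x : (p.-1 * i <= n)%N -> FM i x -> FM (p ^ 2 * i) (x *+ p).
Proof.
move=> hi hx; have [->|x0] := eqVneq x 0; first by rewrite mul0rn; apply: vge0.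
have [m [a [b [m0 e a0 va hF]]]] := exact_level x0; have im := (hF i).1 hx.
have [h1 h2 h3] := mulp_exact e a0 va m0; case: (ltngtP (p.-1 * m) n) => hm.
- by apply/(h1 hm); rewrite leq_mul2l im orbT.
- apply/(h3 hm); rewrite -mulnn -mulnA leq_mul2l; apply/orP; right.
  by move: hi im; have := prednK p_gt0; move: (p.-1) => P <-; rewrite mulSn; clear; lia.
by apply: FM_ge (h2 hm); rewrite leq_mul2l im orbT.
Qed.

Lemma mulp1' i x : (0 < i)%N -> (p.-1 * i < n)%N -> FM i x -> FM (p ^ 2 * i).+1 (x *+ p) -> FM i.+1 x.
Proof.
move=> i0 hi hx hpx; have [->|x0] := eqVneq x 0; first exact: vge0.
have [m [a [b [m0 e a0 va hF]]]] := exact_level x0; have im := (hF i).1 hx.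
have [h1 _ _] := mulp_exact e a0 va m0; apply/hF; move: im; rewrite leq_eqVlt => /orP[/eqP em|//].
by move: hpx => /(h1 _); rewrite -em ltnn => /(_ hi).
Qed.

Lemma mulp2 i x : (n <= p.-1 * i)%N -> FM i x -> FM (p * (i + n)) (x *+ p).
Proof.
move=> hi hx; have [->|x0] := eqVneq x 0; first by rewrite mul0rn; apply: vge0.
have [m [a [b [m0 e a0 va hF]]]] := exact_level x0; have im := (hF i).1 hx.
have [_ h2 h3] := mulp_exact e a0 va m0.
have : (n <= p.-1 * m)%N by apply: leq_trans hi _; rewrite leq_mul2l im orbT.
rewrite leq_eqVlt => /orP[/eqP em|hm]; last by apply/(h3 hm); rewrite leq_mul2l leq_add2r im orbT.
apply: FM_ge (h2 (esym em)); rewrite -mulnn -mulnA leq_mul2l; apply/orP; right.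
by move: em im; have := prednK p_gt0; move: (p.-1) => P <- ->; rewrite mulSn; clear; lia.
Qed.

Lemma mulp2' i x : (0 < i)%N -> (n < p.-1 * i)%N -> FM i x -> FM (p * (i + n)).+1 (x *+ p) -> FM i.+1 x.
Proof.
move=> i0 hi hx hpx; have [->|x0] := eqVneq x 0; first exact: vge0.
have [m [a [b [m0 e a0 va hF]]]] := exact_level x0; have im := (hF i).1 hx.
have [_ _ h3] := mulp_exact e a0 va m0; apply/hF; move: im; rewrite leq_eqVlt => /orP[/eqP em|//].
by move: hpx => /(h3 _); rewrite -em ltnn => /(_ hi).
Qed.

Section Tie.
Hypotheses (p2 : p = 2%N) (n1 : n = 1%N).
Let pr2 : p%:R = 2 :> rat. Proof. by rewrite [in LHS]p2. Qed.
Let tau2 : tau v xT = 1 / 2. Proof. by have := n_tau; rewrite n1 pr2; lra. Qed.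
Local Notation hh := (in_alg L).
Local Notation PsiL := (map_poly hh (divden W p)).
Let PsiE a : PsiL.[a] = (wa1 W)%:A ^+ 2 * a ^+ 2 + (wa3 W)%:A ^+ 2.
Proof.
have -> : divden W p = (wa1 W ^+ 2) *: 'X^2 + (wa3 W ^+ 2)%:P by apply: pchar2_omega.
have h (c : K) : (c ^+ 2)%:A = c%:A ^+ 2 :> L by rewrite -[LHS]/(in_alg L _) rmorphXn.
by rewrite rmorphD /= map_polyZ map_polyXn map_polyC hornerD hornerZ hornerXn hornerC /= !h.
Qed.

Let lead_val : wa1 W != 0 /\ v (iota (wa1 W)) = 1.
Proof.
have [hr x0 _] := torsion_abscissa v_val v_ext W_int W_good W_ss eT T_tors.
have hv := vPsi0 v_ext Wd W_int W_good W_ss; have h0 := Psi0 iota Wd W_int W_good W_ss.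
have eP : divden W p = (wa1 W ^+ 2) *: 'X^2 + (wa3 W ^+ 2)%:P by apply: pchar2_omega.
have c0 : (map_poly iota (divden W p))`_0 = iota (wa3 W) ^+ 2.
  by rewrite coef_map eP coefD coefZ coefXn mulr0 add0r coefC /= rmorphXn.
have e : iota (wa1 W) ^+ 2 * xT ^+ 2 = - iota (wa3 W) ^+ 2.
  apply/eqP; rewrite -addr_eq0; move/rootP: hr => <-; apply/eqP.
  by rewrite eP rmorphD /= map_polyZ map_polyXn map_polyC hornerD hornerZ hornerXn hornerC /= !rmorphXn.
rewrite c0 in hv h0.
have a10 : wa1 W != 0.
  apply: contraNneq h0 => a10; move: e; rewrite a10 rmorph0 expr0n mul0r => /eqP.
  by rewrite eq_sym oppr_eq0.
split=> //; have ia0 : iota (wa1 W) != 0 by rewrite fmorph_eq0.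
have := congr1 v e; rewrite (val_N v_val) hv (val_M v_val) ?expf_neq0 // !(val_X v_val) //.
by move: tau2; rewrite /tau; lra.
Qed.

(** A point of exact level 1 has v(x) = -1, and its double has generic level 4. A double of level at
    least 5 forces the denominator to have valuation at least 1. *)
Lemma tie_point x : ~ FM 2 x -> FM 5 (x *+ p) -> exists a,
  [/\ a != 0, v (j a) = -1, vge vL 1 PsiL.[a], zM x != 0 /\ v (j (zM x)) = 1 / 2 &
      vgt vL 0 (a * zM x ^+ 2 - 1)].
Proof.
move=> h2 h5; have x0 : x != 0 by apply: contra_not_neq h2 => ->; apply: vge0.
have [m [a [b [m0 e a0 va hF]]]] := exact_level x0.
have m1 : m = 1%N by apply/eqP; rewrite eqn_leq m0 andbT leqNgt; apply/negP => /hF.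
rewrite m1 /lev pr2 in va; have {}va : v (j a) = -1 by rewrite va; lra.
have hc : on_curve EL (Some (a, b)) by rewrite -e; apply: ecpP.
have va0 : v (j a) < 0 by lra.
have [z0 vz] := zc_val vLv hEL hc a0 va0.
have ez : zM x = zc (Some (a, b)) by rewrite /zM e.
have vz' : v (j (zM x)) = 1 / 2 by rewrite ez; move: vz => /=; lra.
have ja0 : j a != 0 by rewrite fmorph_eq0.
have hj q w : j (map_poly hh q).[w] = (map_poly iota q).[j w] by apply: horner_j => y; exact: j_ext.
have PM : map_poly iota (divnum W p) \is monic by exact: Phi_monic.
have PS : size (map_poly iota (divnum W p)) = (p ^ 2).+1 by exact: Phi_size.
have PI i : vge v 0 (map_poly iota (divnum W p))`_i by apply: Phi_int.
have [n0 vn] := num_val v_val PM PS PI ja0 va0.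
exists a; split=> //; last first.
- have b0 : b != 0 by apply: contraNneq z0 => b0; rewrite /zc b0 invr0 mulr0.
  have := kernel_cusp vLv hEL hc a0 b0 z0; rewrite ez.
  have -> : 0 < v (j (zc (Some (a, b)))) by rewrite -ez vz'.
  have -> : v (j a) = - (2%:R * v (j (zc (Some (a, b))))) by rewrite -ez vz' va; lra.
  by case/(_ isT erefl erefl)/and3P.
- by rewrite ez; split=> //; rewrite -ez.
have [s0 s0n [e1 e2]] : xrep (ecval (sgval x *+ p)) (map_poly hh (divnum W p)).[a] PsiL.[a].
  exact: multiple_abscissa_map e.
rewrite e2; move: h5 => /FM_level /=; rewrite sgvalMn.
case: (ecval _) e1 e2 => [[x' y']|] /= e1 e2; last by move=> _; rewrite mulr0; apply: vge0.
move=> /(_ isT)/andP[x'0]; rewrite /lev pr2 mulr1 => vx'; rewrite vge_nz //.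
have := vn; rewrite -hj e1 rmorphM (val_M v_val) ?fmorph_eq0 // va.
have -> : ((p ^ 2)%:R : rat) = 4 by rewrite natrX pr2; lra.
lra.
Qed.

(** The denominator is a1^2 X^2 + a3^2 with v(a1) = 1. Its values at the abscissas a and b differ by
    a1^2 (a - b)^2, so v(a - b) >= -1/2. Since a z^2 is congruent to 1 for each point, the squares
    of the two z differ by a valuation greater than 1, which in characteristic 2 halves to the next
    level. *)
Lemma kernel_tie x y : FM 5 (x *+ p) -> FM 5 (y *+ p) -> FM 2 x \/ FM 2 y \/ FM 2 (x - y).
Proof.
move=> hx hy; have [|h2x] := EM (FM 2 x); first by left.
have [|h2y] := EM (FM 2 y); first by right; left.
right; right; have [a [a0 va ha [z0 vz] ca]] := tie_point h2x hx.
have [b [b0 vb hb [w0 vw] cb]] := tie_point h2y hy.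
have [l0 lv] := lead_val.
have pL : 2%N \in [pchar L] by rewrite -p2 (fmorph_pchar (in_alg L)) lf_pchar.
have sq (u w : L) : (u - w) ^+ 2 = u ^+ 2 - w ^+ 2.
  by rewrite -!(pFrobenius_autE pL) rmorphB.
have hab : vge vL (- 1 / 2) (a - b).
  rewrite /vge; have [//|ab0 /=] := eqVneq (a - b) 0.
  have := vgeB vLv ha hb; rewrite !PsiE opprD addrACA subrr addr0 -mulrBr -sq.
  have la0 : (wa1 W)%:A != 0 :> L by rewrite (fmorph_eq0 (in_alg L)).
  have [la2 ab2] := (expf_neq0 2 la0, expf_neq0 2 ab0).
  rewrite (vge_nz _ _ (mulf_neq0 la2 ab2)) (val_M vLv la2 ab2) (val_X vLv 2 la0) (val_X vLv 2 ab0).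
  rewrite -[v (j (wa1 W)%:A)]/(v (j _)) j_ext lv; qlra.
apply/FM_subE; rewrite -vgt_lev /lev pr2.
have hd : vgt vL 1 (zM x ^+ 2 - zM y ^+ 2).
  have -> : zM x ^+ 2 - zM y ^+ 2 =
     ((a * zM x ^+ 2 - 1) * b - (b * zM y ^+ 2 - 1) * a - (a - b)) * (a^-1 * b^-1).
    by field; rewrite a0 b0.
  have -> : 1 = -1 + 2 :> rat by lra.
  apply: (vgtM vLv); last by rewrite vge_nz ?mulf_neq0 ?invr_eq0 // (val_M vLv) ?invr_eq0 // !(val_V vLv) // va vb; qlra.
  apply: (vgtB vLv); last by apply: vge_gt hab; qlra.
  apply: (vgtB vLv); have -> : -1 = 0 + -1 :> rat by lra.
    by apply: (vgtM vLv) => //; rewrite vge_nz // vb.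
  by apply: (vgtM vLv) => //; rewrite vge_nz // va.
move: hd; rewrite -sq /vgt expf_eq0 /=; have [//|zw0 /=] := eqVneq (zM x - zM y) 0.
rewrite (val_X vLv 2 zw0); qlra.
Qed.
End Tie.

Lemma good_disc_val : vK (discW W) = 0.
Proof.
have [[a1 a2 a3 a4 a6] e] := integralW_lift W_int.
pose b2 := a1 ^+ 2 + 4%:R * a2; pose b4 := 2%:R * a4 + a1 * a3; pose b6 := a3 ^+ 2 + 4%:R * a6.
pose b8 := a1 ^+ 2 * a6 + 4%:R * a2 * a6 - a1 * a3 * a4 + a2 * a3 ^+ 2 - a4 ^+ 2.
pose d := - (b2 ^+ 2 * b8) - 8%:R * b4 ^+ 3 - 27%:R * b6 ^+ 2 + 9%:R * b2 * b4 * b6.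
have dE (F : fieldType) (f : {rmorphism oring K -> F}) :
    discW (mapW f (Weierstrass a1 a2 a3 a4 a6)) = f d.
  by rewrite /d /b2 /b4 /b6 /b8 /discW /=; ring.
have := W_good; rewrite /elliptic -e mapW_comp dE [X in X != 0 -> _](_ : _ = ored d); last exact: (dE _ (@ored p K)).
rewrite ored_eq0 -[oval d]dE e => h; have D0 : discW W != 0 by exact: Wd.
have := oring_proof d; rewrite oint_vge -[oval d]dE e vge_nz // => h1.
by apply/eqP; rewrite -dE e eq_le h1 andbT leNgt; move: h; rewrite vgt_nz.
Qed.

Let approx x : vge vL 0 x -> exists a : oring K, vgt vL 0 (x - (oval a)%:A).
Proof.
rewrite -[0]/(0%:~R : rat) => hx.
have [a ha hxa] := approx_base p_pr vKi vLv vLe L_deg pi0 v_pi hx.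
by rewrite -oint_vge in ha; exists (ORing ha).
Qed.

Let approx_eq x x' (a a' : oring K) : ored a = ored a' -> vge vL 0 x -> vge vL 0 x' ->
  vgt vL 0 (x - (oval a)%:A) -> vgt vL 0 (x' - (oval a')%:A) -> cong vL x x'.
Proof.
move=> e hx hx' h h'; rewrite /cong hx hx' /=.
have -> : x - x' = (x - (oval a)%:A) - (x' - (oval a')%:A) + (oval (a - a'))%:A.
  by rewrite -[(oval (a - _))%:A]/(in_alg L _) rmorphB /=; ring.
apply: (vgtD vLv); first exact: (vgtB vLv).
have : vgt (@vK p K) 0 (oval (a - a')) by rewrite -ored_eq0 rmorphB /= e subrr.
by rewrite /vgt (fmorph_eq0 (in_alg L)); have [//|a0] := eqVneq (oval (a - a')) 0; rewrite vLe.
Qed.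

Let coords_int (P : ecpoint EL) x y : ecval P = Some (x, y) -> ~~ in_kernel vL (ecval P) ->
  vge vL 0 x /\ vge vL 0 y.
Proof.
move=> eP; rewrite eP /= negb_and negbK -leNgt => hx.
have hx' : vge vL 0 x by rewrite /vge.
split=> //; have := ecpP P; rewrite eP.
have [] := hEL; rewrite /on_curve /= => i1 i2 i3 i4 i6.
move: ((wa1 W)%:A) ((wa2 W)%:A) ((wa3 W)%:A) ((wa4 W)%:A) ((wa6 W)%:A) i1 i2 i3 i4 i6 => a1 a2 a3 a4 a6 i1 i2 i3 i4 i6 /= e.
pose d i := if i == 0%N then x ^+ 3 + a2 * x ^+ 2 + a4 * x + a6 else - (a1 * x + a3).
apply: (@integral_root _ vL vLv 1 y 1 d (oner_neq0 _) (val_1 vLv)).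
  move=> [|i] _; rewrite /d /=.
    by repeat first [assumption | apply: (vgeD vLv) | apply: (vgeM0 vLv) | apply: (vgeX vLv)].
  by rewrite (vgeN vLv); repeat first [assumption | apply: (vgeD vLv) | apply: (vgeM0 vLv)].
rewrite big_ord_recl big_ord1 /d /= expr0 expr1 mul1r mulr1 -e; ring.
Qed.

(** Points outside the kernel are sorted by the residues of their coordinates, which lie in the
    finite residue field of K as L is totally ramified; [None] stands for the kernel. *)
Lemma exists_class : exists cls : ecpoint EL -> option (lf_res K * lf_res K),
  forall P Q, cls P = cls Q -> P - Q \in kernel_pred.
Proof.
have ex (P : ecpoint EL) : exists c, if in_kernel vL (ecval P) then c = None
    else exists x y (a b : oring K), [/\ ecval P = Some (x, y), c = Some (ored a, ored b),
      vgt vL 0 (x - (oval a)%:A) & vgt vL 0 (y - (oval b)%:A)].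
  case: (boolP (in_kernel vL (ecval P))) => [_|nk]; first by exists None.
  case e: (ecval P) => [[x y]|]; last by move: nk; rewrite e.
  have [hx hy] := coords_int e nk; have [a ha] := approx hx; have [b hb] := approx hy.
  by exists (Some (ored a, ored b)), x, y, a, b.
exists (fun P => sval (cid (ex P))) => P Q; case: cid => c /= hP; case: cid => d /= hQ ecd.
move: hP hQ; rewrite -{d}ecd; case: ifPn => kP; case: ifPn => kQ.
- by move=> _ _; apply: (kernel_sub vLv hEL).
- by move=> -> [x [y [a [b []]]]].
- by move=> [x [y [a [b [_ -> _ _]]]]].
move=> [x [y [a [b [eP -> ha hb]]]]] [x' [y' [a' [b' [eQ [ea eb] ha' hb']]]]].
have [hx hy] := coords_int eP kP; have [hx' hy'] := coords_int eQ kQ.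
apply: (kernel_sub_cong vLv hEL eP eQ).
- have -> : discW EL = in_alg L (discW W) by exact: discW_map.
  by rewrite /= j_ext v_ext ?good_disc_val.
- exact: approx_eq ea hx hx' ha ha'.
exact: approx_eq eb hy hy' hb hb'.
Qed.

Section NormIndex.
Hypothesis lam_p : ~~ (p %| lam)%N.
Local Notation q := #|lf_res K|.
Local Notation rg := (index_iota 1 lam).
Let q_gt0 : (0 < q)%N. Proof. by apply/card_gt0P; exists 0. Qed.

Lemma kernel_covered l : (0 < l < lam)%N -> cov p lam n l -> covered FM sgM p l.
Proof.
move=> /andP[l0 ll]; rewrite /cov.
have C1 := covered1 p_pr lam_gt0 lam_p n_gt0 FM_sub FM_dec FM_idx sgMB sgM_p sgM_DF sgM_DF' sgM_fix mulp1 mulp2.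
have C2 := covered_mulp p_pr lam_gt0 lam_p n_gt0 FM_sub FM_dec FM_idx sgMB sgM_p sgM_DF sgM_DF' sgM_fix mulp1 mulp1' mulp2 mulp2'.
have [m em] : exists m, lam = (l + m)%N by exists (lam - l)%N; rewrite subnKC // ltnW.
rewrite [(lam - l)%N](_ : _ = m); last by rewrite em addKn.
have [P eP] : exists P, p = P.+1 by exists p.-1; rewrite prednK.
case/or3P => [/andP[h1 h2]|/and3P[/dvdnP[i ei] h1 h2]|/andP[h1 h2]].
- have [a1 a2 a3 a4] : [/\ 0 < l - p.-1 * m, l - p.-1 * m + p.-1 * lam = p * l, l < p * (l - p.-1 * m) & l < l - p.-1 * m + n]%N.
    by move: h1 h2; rewrite em eP /=; apply: covered_arith; move: p_gt1; rewrite eP.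
  by move=> y /(C1 _ _ l0 a1 a2 a3 a4)[x _ hx]; exists x.
- apply: (C2 l i) => //; first by move: l0; rewrite ei muln_gt0 => /andP[].
    by move: h1 h2; rewrite em ei eP /= => _; nia.
  by left; rewrite mulnC -ei; split=> //; move: h1; rewrite ei eP /=; nia.
have nl : (n < l)%N by move: h1; rewrite eP /=; nia.
apply: (C2 l (l - n)%N) => //; first by rewrite subn_gt0.
  by move: h2; rewrite em eP /=; nia.
by right; rewrite subnK ?(ltnW nl) //; split=> //; move: h1; rewrite eP /=; nia.
Qed.

Lemma kernel_norm_index : exists2 g, idx (kerN sgM p) (DM sgM) g &
  [/\ (q ^ count (low p lam n) rg <= g)%N,
      (g <= q ^ count (predC (cov p lam n)) rg)%N &
      p = 2%N -> n = 1%N -> (4 <= lam)%N -> (q * g <= 2 * q ^ count (predC (cov p lam n)) rg)%N].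
Proof.
have hlow l : (0 < l < lam)%N -> low p lam n l -> lower_level FM sgM p l.
  move=> _ /and3P[h1 h2 h3]; apply: (lower_levelP p_pr lam_gt0 lam_p n_gt0 FM_sub FM_dec FM_1 sgMB sgM_p sgM_DF sgM_DF' mulp1 mulp1' mulp2) => //.
have [g hg /andP[g1 g2]] := norm_index p_pr lam_gt0 lam_p n_gt0 FM_sub FM_dec FM_1 FM_sep FM_complete FM_idx sgMB sgM_p sgM_F sgM_DF sgM_DF' sgM_fix mulp1 mulp2 (leqnn lam) q_gt0 kernel_covered hlow.
exists g => //; split=> // p2 n1 l4.
apply: (norm_index_tie p_pr lam_gt0 lam_p n_gt0 FM_sub FM_dec FM_1 FM_sep FM_complete FM_idx sgMB sgM_p sgM_F sgM_DF sgM_DF' sgM_fix mulp1 mulp2 (low p lam n) (leqnn lam) q_gt0 kernel_covered p2 n1 l4) hg.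
  by case: (uncovered_le_tie p_pr lam_gt0 lam_p n_gt0 p2 n1 l4).
have mp (w : M) : w *+ 2 = w *+ p by congr (w *+ _); exact: esym p2.
by move=> x y; rewrite !mp; apply: kernel_tie.
Qed.
Theorem curve_index : exists2 g, idx (kerN sP p) (DM sP) g &
  [/\ (q ^ count (low p lam n) rg <= g)%N,
      (g <= q ^ count (predC (cov p lam n)) rg)%N &
      p = 2%N -> n = 1%N -> (4 <= lam)%N -> (q * g <= 2 * q ^ count (predC (cov p lam n)) rg)%N].
Proof.
have [g hg hb] := kernel_norm_index.
exists g => //; have [cls hcls] := exists_class.
pose C := (#|{: option (lf_res K * lf_res K)}|)`!.
have C0 : (0 < C)%N by apply: fact_gt0.
(* The multiplier p^C - 1 kills the classes modulo the kernel by [kill_quotient], and it is - 1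
   modulo p. *)
apply: (idx_subgroup (m := (p ^ C).-1) (t := (p ^ C.-1)%N) _ _ _ _ hg) => //.
- by move=> x y; rewrite /sP ecmapB.
- by rewrite prednK ?expn_gt0 ?prime_gt0 // -expnS prednK.
apply: kill_quotient hcls _ _; [exact: kernel_closed | | exact: prime_gt1].
move=> x; apply: (kernel_mulpF v_val v_ext W_int W_good W_ss) => a; exact: j_ext.
Qed.
End NormIndex.
End KernelFiltration.
End SupersingularReduction.

(** * Cohomology *)

Section CyclicCohomology.
Variables (p : nat) (K : localField p) (L : splittingFieldType K) (g : gal_of {:L}).
Hypotheses (g_gen : 'Gal({:L} / 1)%g = <[g]>%g) (g_ord : #[g]%g = p).
Variable s : {rmorphism L -> L}.
Hypotheses (sE : forall x, s x = g x) (s_K : forall a : K, s a%:A = a%:A).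

Variable A : weierstrass K.
Hypothesis Ad : elliptic A.
Local Notation V := (ecpoint (ec_map (in_alg L) Ad)).
Local Notation sV := (sP s_K (Wd := Ad)).
Local Notation AL := (mapW (in_alg L) A).

Let sB x y : sV (x - y) = sV x - sV y. Proof. exact: ecmapB. Qed.
Let sD x y : sV (x + y) = sV x + sV y. Proof. exact: ecmapD. Qed.
Let gG i : (g ^+ i)%g \in 'Gal({:L} / 1)%g. Proof. by rewrite g_gen mem_cycle. Qed.

Lemma gal_point i (P : V) : cmap (g ^+ i)%g (ecval P) = ecval (iter i sV P).
Proof.
have -> : ecval (iter i sV P) = iter i (cmap s) (ecval P) by elim: i => //= i <-.
case: (ecval P) => [[x y]|] /=; last by elim: i => //= i <-.
by elim: i => [|i IH] /=; rewrite ?expg0 ?gal_id // -IH /= expgSr !galM ?memvf // !sE.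
Qed.

(** The value at g^i of the cocycle whose value at g is P; it depends only on i modulo p exactly
    when the norm of P vanishes. *)
Definition psum (P : V) i : V := \sum_(k < i) iter k sV P.

Lemma psumD P a b : psum P (a + b) = psum P b + iter b sV (psum P a).
Proof.
have itD c x y : iter c sV (x + y) = iter c sV x + iter c sV y by elim: c => //= c ->; rewrite sD.
elim: a => [|a IH].
  rewrite add0n /psum big_ord0; suff -> : iter b sV 0 = 0 by rewrite addr0.
  by elim: b => //= b ->; rewrite -[X in sV X](subrr (0 : V)) sB subrr.
by rewrite addSn /psum big_ord_recr /= -/(psum P _) IH big_ord_recr /= itD addrA -iterD addnC.
Qed.

Lemma psum_mod P a b : kerN sV p P -> a = b %[mod p] -> psum P a = psum P b.
Proof.
move=> hP ab; have it0 d : iter d sV 0 = 0.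
  by elim: d => //= d ->; rewrite -[X in sV X](subrr (0 : V)) sB subrr.
have pp c d : psum P (c * p + d) = psum P d.
  elim: c => // c IH; rewrite mulSn -addnA psumD IH.
  have -> : psum P p = 0 by exact: hP.
  by rewrite it0 addr0.
by rewrite (divn_eq a p) (divn_eq b p) !pp ab.
Qed.

Lemma psum_D Q i : psum (sV Q - Q) i = iter i sV Q - Q.
Proof.
elim: i => [|i IH]; first by rewrite /psum big_ord0 subrr.
rewrite /psum big_ord_recr /= -/(psum _ i) IH.
have -> : iter i sV (sV Q - Q) = iter i.+1 sV Q - iter i sV Q.
  by rewrite iterSr; elim: {IH}i => //= i ->; rewrite sB.
by rewrite addrC addrA subrK.
Qed.

Definition exponent_of (x : gal_of {:L}) : nat := xget 0%N [set i | x = (g ^+ i)%g].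
Definition cocycle_of (P : V) (x : gal_of {:L}) : cpoint L := ecval (psum P (exponent_of x)).

Lemma cocycle_ofE P i : kerN sV p P -> cocycle_of P (g ^+ i)%g = ecval (psum P i).
Proof.
move=> hP; congr ecval; apply: psum_mod => //.
have : [set k | (g ^+ i)%g = (g ^+ k)%g] (exponent_of (g ^+ i)%g) by apply: xgetPex; exists i.
by move=> /= /eqP; rewrite eq_expg_mod_order g_ord => /eqP.
Qed.

Lemma cocycle_ofP P : kerN sV p P -> cocycle A (cocycle_of P).
Proof.
move=> hP; split=> [x _|x y]; first exact: ecpP.
rewrite g_gen => /cycleP[a ->] /cycleP[b ->].
by rewrite -expgD !cocycle_ofE // psumD gal_point.
Qed.

Lemma cocycle_gen f : cocycle A f -> exists2 P : V, kerN sV p P & forall i, f (g ^+ i)%g = ecval (psum P i).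
Proof.
move=> [hc hM]; have hg : on_curve (ec_map (in_alg L) Ad) (f g) by apply: hc; have := gG 1; rewrite expg1.
pose P : V := mkpt hg.
have f1 : f 1%g = ecval (0 : V).
  have h1 : on_curve (ec_map (in_alg L) Ad) (f 1%g) by apply: hc; exact: (gG 0).
  pose Q : V := mkpt h1; have e := hM 1%g 1%g (gG 0) (gG 0).
  rewrite mulg1 [cmap _ _](gal_point 0 Q) in e.
  have /eqP : Q = Q + Q by apply: ecval_inj; exact: e.
  by rewrite addrC -subr_eq subrr => /eqP e0; rewrite -[f 1%g]/(ecval Q) e0.
have h i : f (g ^+ i)%g = ecval (psum P i).
  elim: i => [|i IH]; first by rewrite expg0 f1 /psum big_ord0.
  rewrite expgS hM //; last by have := gG 1; rewrite expg1.
  rewrite IH /psum big_ord_recr /=; congr addP; exact: (gal_point i P).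
exists P => //; apply: ecval_inj; have := h p; rewrite /kerN -[psum P p]/(nrm sV p P) => <-.
have -> : (g ^+ p)%g = 1%g by apply/eqP; rewrite -order_dvdn g_ord.
by rewrite f1.
Qed.

Lemma cohomologousP f h (P Q : V) : (forall i, f (g ^+ i)%g = ecval (psum P i)) ->
  (forall i, h (g ^+ i)%g = ecval (psum Q i)) -> cohomologous A f h <-> DM sV (Q - P).
Proof.
have ps1 x : psum x 1 = x by rewrite /psum big_ord1.
move=> hf hh; split=> [[R [hR eR]]|[R eR]].
  pose R' : V := mkpt (hR : on_curve (ec_map (in_alg L) Ad) R).
  exists R'; have := eR (g ^+ 1)%g (gG 1); rewrite hf hh !ps1 (gal_point 1 R').
  move=> e; have -> : Q = P + (sV R' - R') by apply: ecval_inj; exact: e.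
  by rewrite addrAC subrr add0r.
exists (ecval R); split; first exact: ecpP.
move=> x; rewrite g_gen => /cycleP[i ->]; rewrite hf hh gal_point.
have -> : psum Q i = psum P i + (iter i sV R - R); last by [].
rewrite -psum_D eR /psum -big_split /=; apply: eq_bigr => k _.
have -> : iter k sV (Q - P) = iter k sV Q - iter k sV P by elim: {1 2 3}(k : nat) => //= m ->; rewrite sB.
by rewrite addrC subrK.
Qed.

(** Cocycles are determined on the cyclic group by their value at the generator, a point of norm
    zero, and coboundaries correspond to values of s - 1. Representatives of the quotient therefore
    list the cohomology classes. *)
Lemma H1_card c : idx (kerN sV p) (DM sV) c -> finite_set (H1 L A) /\ #|` fset_set (H1 L A)| = c.
Proof.
move=> [r [sz ur rK sep cov]]; have DS := DM_sub sB.
pose CL (P : V) := [set h | cocycle A h /\ cohomologous A (cocycle_of P) h].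
have c0 P : kerN sV p P -> forall i, cocycle_of P (g ^+ i)%g = ecval (psum P i) by move=> hP i; apply: cocycle_ofE.
have inj : {in r &, injective CL}.
  move=> x y hx hy e; apply: sep => //; have kx := rK _ hx; have ky := rK _ hy.
  have : CL x (cocycle_of y).
    rewrite e; split; first exact: cocycle_ofP.
    by apply/(cohomologousP (c0 _ ky) (c0 _ ky)); rewrite subrr; apply: DS.1.
  move=> [_ /(cohomologousP (c0 _ kx) (c0 _ ky)) h].
  by rewrite -opprB; apply: sgrpN DS h.
have -> : H1 L A = [set` [fset z in [seq CL y | y <- r]]%fset].
  apply/seteqP; split=> [z [f hf ->]|z].
    have [P kP hP] := cocycle_gen hf; have [y hy hd] := cov _ kP; have ky := rK _ hy.
    rewrite /= !inE; apply/mapP; exists y => //.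
    apply/seteqP; split=> h [hh hc]; split=> //; have [Q kQ hQ] := cocycle_gen hh.
      move/(cohomologousP hP hQ): hc => hc; apply/(cohomologousP (c0 _ ky) hQ).
      by rewrite -(subrK P Q) -addrA; apply: (sgrpD DS).
    move/(cohomologousP (c0 _ ky) hQ): hc => hc; apply/(cohomologousP hP hQ).
    by rewrite -(subrK y Q) -addrA; apply: (sgrpD DS) => //; rewrite -opprB; apply: (sgrpN DS).
  rewrite /= !inE => /mapP[y hy ->]; exists (cocycle_of y) => //; exact: cocycle_ofP (rK _ hy).
split; first exact: finite_fset.
by rewrite set_fsetK card_fseq undup_id ?size_map // map_inj_in_uniq.
Qed.
End CyclicCohomology.

Lemma idx_bij (V V' : zmodType) (f : V -> V) (f' : V' -> V') (phi : V' -> V) p c :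
  (forall x y, phi (x - y) = phi x - phi y) -> injective phi -> (forall y, exists x, phi x = y) ->
  (forall x, phi (f' x) = f (phi x)) ->
  idx (kerN f' p) (DM f') c -> idx (kerN f p) (DM f) c.
Proof.
move=> pB pI pS pf [s [sz us sK sep cov]].
have nE x : phi (nrm f' p x) = nrm f p (phi x).
  have p0 : phi 0 = 0 by rewrite -[X in phi X](subrr (0 : V')) pB subrr.
  have pD x' y : phi (x' + y) = phi x' + phi y.
    by rewrite -[y in LHS]opprK pB -[- y]sub0r pB p0 sub0r opprK.
  rewrite /nrm (big_morph phi pD p0); apply: eq_bigr => k _.
  by elim: {k}(k : nat) => //= k <-; rewrite pf.
have kE x : kerN f p (phi x) <-> kerN f' p x.
  rewrite /kerN -nE; split=> [h|->]; last by rewrite -[X in phi X](subrr (0 : V')) pB subrr.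
  by apply: pI; rewrite h -[X in phi X](subrr (0 : V')) pB subrr.
have dE x : DM f (phi x) <-> DM f' x.
  split=> [[y hy]|[y <-]]; last by exists (phi y); rewrite pB pf.
  have [z ez] := pS y; exists z; apply: pI; by rewrite pB pf ez.
exists [seq phi x | x <- s]; split; first by rewrite size_map.
- by rewrite map_inj_uniq.
- by move=> _ /mapP[x /sK hx ->]; apply/kE.
- by move=> _ _ /mapP[x hx ->] /mapP[y hy ->]; rewrite -pB => /dE h; congr phi; apply: sep.
move=> y; have [x <-] := pS y => /kE /cov[z hz hd]; exists (phi z); first by apply/mapP; exists z.
by rewrite -pB; apply/dE.
Qed.

Section IsomorphicCurves.
Variables (p : nat) (K : localField p) (L : fieldExtType K)
 (A W : weierstrass K) (Ad : elliptic A) (Wd : elliptic W) (u r t0 t : K).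
Hypotheses (u0 : u != 0) (A_eqs : iso_eqs u r t0 t A W).
Variable s : {rmorphism L -> L}.
Hypothesis s_K : forall a : K, s a%:A = a%:A.

Lemma idx_iso c : idx (kerN (sP s_K (Wd := Wd)) p) (DM (sP s_K (Wd := Wd))) c ->
  idx (kerN (sP s_K (Wd := Ad)) p) (DM (sP s_K (Wd := Ad))) c.
Proof.
have u0L : in_alg L u != 0 by rewrite fmorph_eq0.
have eqL := iso_eqs_morph (in_alg L) A_eqs.
pose ph := isoP (in_alg L u) (in_alg L r) (in_alg L t0) (in_alg L t).
have hc (P : ecpoint (ec_map (in_alg L) Wd)) : on_curve (ec_map (in_alg L) Ad) (ph (ecval P)).
  by apply/(isoP_on_curve u0L eqL); apply: ecpP.
pose phi (P : ecpoint (ec_map (in_alg L) Wd)) : ecpoint (ec_map (in_alg L) Ad) := mkpt (hc P).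
have phiD P Q : phi (P + Q) = phi P + phi Q.
  by apply: ecval_inj; apply: (isoP_add u0L eqL); apply: ecpP.
have phiN P : phi (- P) = - phi P.
  by apply/eqP; rewrite -addr_eq0 -phiD addNr; apply/eqP; apply: ecval_inj.
apply: (idx_bij (phi := phi)).
- by move=> P Q; rewrite phiD phiN.
- by move=> P Q /(congr1 (@ecval _ _)) /(isoP_inj u0L) /ecval_inj.
- move=> Q; have [P eP] := isoP_surj (in_alg L r) (in_alg L t0) (in_alg L t) u0L (ecval Q).
  have hP : on_curve (ec_map (in_alg L) Wd) P by apply/(isoP_on_curve u0L eqL); rewrite eP; apply: ecpP.
  by exists (mkpt hP); apply: ecval_inj.
move=> P; apply: ecval_inj; rewrite /= /ph; case: (ecval P) => [[x y]|] //=.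
by rewrite !(rmorphD, rmorphM, rmorphXn) /= !s_K.
Qed.
End IsomorphicCurves.

(** * From indices to logarithmic bounds *)

Lemma log_bounds (R : realType) (p d lo up e g : nat) : (1 < p)%N ->
  ((p ^ d) ^ lo <= g)%N -> (g <= p ^ e * (p ^ d) ^ up)%N ->
  logb (p%:R : R) g%:R <= d%:R * (up%:Z)%:~R + e%:R /\ d%:R * (lo%:Z)%:~R <= logb (p%:R : R) g%:R.
Proof.
move=> p1 h1 h2; have p0 : (0 < p)%N by apply: ltnW.
have lp : 0 < ln (p%:R : R) by rewrite ln_gt0 // ltr1n.
have g0 : (0 < g)%N by apply: leq_trans h1; rewrite !expn_gt0 p0.
have lnp k : ln ((p ^ k)%:R : R) = k%:R * ln p%:R by rewrite natrX lnXn ?ltr0n // mulr_natl.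
have mono a b : (0 < a)%N -> (a <= b)%N -> ln (a%:R : R) <= ln b%:R.
  move=> a0 ab; rewrite ler_ln ?posrE ?ltr0n ?ler_nat //; exact: leq_trans ab.
rewrite /logb ler_pdivrMr // ler_pdivlMr //; split.
  have := mono _ _ g0 h2; rewrite -expnM -expnD lnp natrD natrM.
  by rewrite [_%:R + _]addrC.
have := mono _ _ _ h1; rewrite !expn_gt0 p0 => /(_ isT).
by rewrite -expnM lnp natrM.
Qed.

Lemma card_residue p (K : localField p) : #|lf_res K| = (p ^ resdeg K)%N.
Proof.
rewrite /resdeg [X in (p ^ X)%N](pprimeChar_dimf (lf_res_pchar K)).
exact: (card_pprimeChar (lf_res_pchar K)).
Qed.
Lemma half_slope (x y : rat) : 2%:R * y = 3%:R * x -> x - y = - x / 2.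
Proof. lra. Qed.

Theorem theoremA (R : realType) (p : nat) (K : localField p)
  (* an algebraic closure of K, with the extension of ord_v *)
  (Om : closedFieldType) (iota : {rmorphism K -> Om})
  (Om_closure : alg_closure iota)
  (v : Om -> rat) (v_val : valuation v)
  (v_ext : forall x : K, x != 0 -> v (iota x) = (lf_ord x)%:~R)
  (* the elliptic curve A and a minimal equation W of it *)
  (A W : weierstrass K) (A_ell : elliptic A) (A_ord : ordinary p iota A)
  (A_ss : supersingular_reduction A) (W_min : minimal_equation A W)
  (* the ramified cyclic extension L = K'_{v'} of degree p *)
  (L : splittingFieldType K) (j : {rmorphism L -> Om})
  (j_ext : forall x : K, j x%:A = iota x)
  (L_gal : galois 1 {:L}) (L_cyc : cyclic 'Gal({:L} / 1)%g)
  (L_deg : \dim {:L} = p)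
  (L_ram : (1 < ram_index v (range j) (range iota))%N)
  (* a non-zero point of A_p over the algebraic closure *)
  (a b : Om) (P_tors : torsion (mapW iota W) p (Some (a, b))) :
  let Kv := range iota in
  let kw := twist_torsion_field p iota A in
  let k'w := subfield_gen (kw `|` range j) in
  let e_w := ram_index v kw Kv in
  let lambda_v : rat := ord_disc v (range j) Kv / (p%:R - 1) - 1 in
  let lambda_w : rat := ord_disc v k'w kw / (p%:R - 1) - 1 in
  let n_v : rat := p%:R * (p%:R - 1) * v (a / b) in
  let n_w : rat := e_w%:R * n_v in
  let nat_w : nat := Num.truncn (p%:R * n_w / (p%:R - 1)) in
  let flat_w := flat p nat_w lambda_w in
  let sharp_w := sharp p nat_w lambda_w in
  let c : nat := Num.truncn (n_w / (p%:R - 1)) in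
  let F m : int := (phi p e_w m + diamond p e_w c m)%N in
  let eps : nat :=
    if `[< p%:R * nat_w%:R <= lambda_w /\ kw = Kv >] then 1%N else 0%N in
  let b_low : int := F nat_w - F flat_w in
  let b_up : int := F sharp_w - F flat_w in
  let h : R := logb p%:R #|` fset_set (H1 L A) |%:R in
  [/\ finite_set (H1 L A),
      h <= (resdeg K)%:R * b_up%:~R + eps%:R /\ (resdeg K)%:R * b_low%:~R <= h,
      b_low%:~R <= n_v /\ 0 <= b_low &
      [/\ (flat_w = 1%N -> b_low%:~R = n_v),
          (lambda_v = 1 <-> b_up = 0) &
          (p%:R * nat_w%:R <= lambda_w -> b_up%:~R = p%:R * n_v)]].
Proof.
have p_pr : prime p := localField_prime K.
have p_gt1 := prime_gt1 p_pr; have p_gt0 := prime_gt0 p_pr.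
have pR : p%:R != 0 :> rat by rewrite pnatr_eq0 -lt0n.
have P0 : (0 < p.-1)%N by rewrite -subn1 subn_gt0.
have PR : (p%:R - 1 : rat) = p.-1%:R by rewrite -subn1 natrB.
have P0R : p.-1%:R != 0 :> rat by rewrite pnatr_eq0 -lt0n.
have v_ext' (x : K) : x != 0 -> v (iota x) = vK x by exact: v_ext.
have [W_int Wd W_good W_ss] := minimal_good A_ell A_ss W_min.
have [u [r [t0 [t [u0 A_eqs]]]]] := (isoWP A W).1 (let: And3 h _ _ := W_min in h).
have tors_card : (torsion (ec_map iota Wd) p #= `I_p)%card.
  have iu0 : iota u != 0 by rewrite fmorph_eq0.
  exact: (iso_torsion_card iu0 (iso_eqs_morph iota A_eqs) A_ord).
pose T : ecpoint (ec_map iota Wd) := mkpt (P_tors.1 : on_curve (ec_map iota Wd) (Some (a, b))).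
have eT : ecval T = Some (a, b) by [].
have T_tors : T *+ p = 0 by apply: ecval_inj; rewrite ecvalMn; exact: P_tors.2.
have [n n_gt0 n_tau] := exists_level v_val v_ext' W_int W_good W_ss tors_card eT T_tors.
have vab : v (a / b) = tau v a.
  have hE : integral_curve v (ec_map iota Wd).
    by apply: integral_curve_map (integralW_oint W_int) => x x0; rewrite v_ext'.
  have [_ a0 va] := torsion_abscissa v_val v_ext' W_int W_good W_ss eT T_tors.
  have [b0 vb] := kernel_y v_val hE P_tors.1 a0 va.
  by rewrite (val_div v_val) //; apply: half_slope.
have [g [g_gen g_ord g_K g_p g_fix]] := cyclic_generator L_gal L_cyc L_deg.
have [pi pi0 v_pi] := ramified_uniformizer v_val v_ext' j_ext L_deg L_ram.
have vg x : v (j (g x)) = v (j x) by apply: (galois_val v_val v_ext' j_ext).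
have [lam [lam_gt0 lam_p v_u1]] := ramified_break v_val v_ext' j_ext L_deg pi0 v_pi g_K g_p g_fix vg.
have disc := ramified_discriminant v_val v_ext' j_ext L_deg pi0 v_pi g_K g_p g_fix vg lam_gt0 v_u1.
have [N [jN [Xn [Yn N_coord]]]] := coordinate_field_exists Om_closure v_val v_ext' W_int W_good W_ss tors_card eT T_tors.
have jNE (x : K) : jN x%:A = iota x by case: N_coord.
have kwE := twist_torsion_fieldE tors_card eT T_tors u0 A_eqs N_coord.
have [e [c [e_gt0 e_dvd c_def [y y0 vy] vN]]] := twist_ramification v_val v_ext' W_int W_good W_ss tors_card eT T_tors u0 N_coord n_tau.
have [i hi [g_low g_up g_tie]] := curve_index v_val v_ext' W_int W_good W_ss tors_card eT T_tors
  j_ext L_deg pi0 v_pi g_K g_p g_fix vg lam_gt0 v_u1 n_gt0 n_tau lam_p.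
have [H1_fin H1_i] := H1_card g_gen g_ord (fun _ => erefl) (idx_iso A_ell u0 A_eqs hi).
have [tu tu0 vtu] := vK_unif K.
move=> Kv kw k'w e_w lambda_v lambda_w n_v n_w nat_w flat_w sharp_w c' F eps b_low b_up h.
have n_vE : n_v = n%:R by rewrite /n_v vab n_tau.
have e_wE : e_w = e.
  rewrite /e_w /kw kwE /Kv; apply: (@ram_index_val _ v (range jN) (range iota) 1 e (iota tu) (jN y)) => //.
  - by rewrite fmorph_eq0.
  - by rewrite v_ext' // vtu divr1.
  - exact: (range_iota_int v_ext').
  - by rewrite fmorph_eq0.
  - by rewrite mul1n.
  by move=> _ [x _ <-]; rewrite fmorph_eq0 mul1n; apply: vN.
(* The discriminant formula over the base K itself, with ramification index 1. *)
have lambda_vE : lambda_v = lam%:R.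
  have rE : range j = subfield_gen (range iota `|` range j).
    apply/seteqP; split; last first.
      apply: subfield_gen_min; first exact: range_subfield.
      by move=> _ [[x _ <-]|//]; exists x%:A; rewrite ?j_ext.
    by move=> x hx; apply: subfield_gen_sub; right.
  rewrite /lambda_v rE /Kv (disc K iota idfun 1%N) //.
  - by rewrite PR mul1n mulrAC mulfV // mul1r addrK.
  - by rewrite coprimen1.
  - by move=> m m0; have [x hx] := vK_int m0; exists x; rewrite v_ext' // hx divr1.
  by exists tu; rewrite // v_ext' // vtu divr1.
(* The same formula over k_w; its ramification index e divides p - 1 and is therefore prime to p. *)
have lambda_wE : lambda_w = (e * lam)%N%:R.
  rewrite /lambda_w /k'w /kw kwE (disc N jN (in_alg N) e) //.
  - by rewrite PR mulrAC mulfV // mul1r addrK.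
  - exact: coprime_dvdr e_dvd (coprimenP p_gt0).
  by exists y.
have n_wE : n_w = (c * p.-1)%N%:R by rewrite /n_w n_vE e_wE c_def natrM.
have cE : c' = c by rewrite /c' n_wE PR natrM mulfK // natrK.
have nat_wE : nat_w = (p * c)%N.
  by rewrite /nat_w n_wE PR natrM mulrA mulfK // -natrM natrK.
have b_lowC : b_low = (count (low p lam n) (index_iota 1 lam))%:Z.
  rewrite -(b_lowE p_pr e_dvd lam_gt0 lam_p n_gt0 c_def) /b_low /flat_w lambda_wE nat_wE /F e_wE cE.
  by [].
have b_upC : b_up = (count (low p lam n) (index_iota 1 lam) + count (mid p lam n) (index_iota 1 lam))%:Z.
  rewrite -(b_upE p_pr e_dvd lam_gt0 lam_p n_gt0 c_def) /b_up /flat_w /sharp_w lambda_wE nat_wE /F e_wE cE.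
  by [].
have big : (p%:R * nat_w%:R <= lambda_w) = (p * (p * c) <= e * lam)%N.
  by rewrite lambda_wE nat_wE -natrM ler_nat.
split=> //.
- rewrite b_lowC b_upC /h H1_i; apply: log_bounds => //; rewrite -card_residue //.
  set B := (count _ _ + _)%N; have q0 : (0 < #|lf_res K|)%N by apply/card_gt0P; exists 0.
  (* In the exceptional case e = c = 1 and p times the natural sign is 4 <= lam, while k_w = K_v, so
     epsilon is 1. There is one more uncovered level than the count allows, but [g_tie] replaces its
     factor q by 2. *)
  have [/and3P[/eqP p2 /eqP n1 l4]|hexc] := boolP [&& p == 2%N, n == 1%N & (4 <= lam)%N].
    have [unc _] := uncovered_le_tie p_pr lam_gt0 lam_p n_gt0 p2 n1 l4.
    have p1 : p.-1 = 1%N by rewrite p2.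
    have e1 : e = 1%N by move: e_dvd; rewrite p1 dvdn1 => /eqP.
    have c1 : c = 1%N by move: c_def; rewrite p1 e1 n1 !muln1.
    have -> : eps = 1%N.
      rewrite /eps; case: asboolP => // -[]; split.
        by rewrite big c1 e1 mul1n muln1 (leq_trans _ l4) // p2.
      by rewrite /kw kwE; apply: (twist_field2 N_coord).
    rewrite expn1 -(leq_pmul2l q0) (leq_trans (g_tie p2 n1 l4)) //.
    by rewrite mulnCA leq_mul ?p_gt1 // -expnS leq_pexp2l.
  apply: (leq_trans g_up); apply: leq_trans (_ : #|lf_res K| ^ B <= _)%N.
    by rewrite leq_pexp2l // uncovered_le.
  by rewrite leq_pmull // expn_gt0 p_gt0.
- by rewrite b_lowC n_vE ler_nat count_low_le.
split.
- rewrite /flat_w lambda_wE nat_wE b_lowC n_vE => /(flat1 p_pr e_dvd lam_gt0 lam_p n_gt0 c_def) ->; by [].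
- rewrite lambda_vE b_upC; have := count_low_mid_eq0 p_pr lam_gt0 lam_p n_gt0.
  move: (_ + _)%N => B hB; split=> [/eqP|[/eqP]].
    by rewrite pnatr_eq1 -hB => /eqP ->.
  by rewrite hB => /eqP ->.
rewrite big b_upC n_vE => /(big_lam p_pr e_dvd lam_gt0 lam_p n_gt0 c_def) ->.
by rewrite -natrM.
Qed.
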